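(* A composition structure $(\mathcal C_n)$ is self-similar Markov if and only if its associated random closed set $Z\subset[0,1]$ can be presented as $Z=\exp(-W)$, where $W$ is a regenerative set with stationary delay.
   Context: A composition of $n$ is a sequence $\lambda=(\lambda_1,\dots,\lambda_\ell)$ of positive integers (parts) with sum $n$. In balls-in-boxes form it is a row of $n$ identical balls in $\ell$ consecutive boxes, the $i$th box from the left containing $\lambda_i$ balls; in binary form it is the string of $n$ binary digits whose $j$th digit is $1$ iff the $j$th ball is the leftmost ball of its box. A composition structure is a sequence $(\mathcal C_n)_{n\ge1}$ of random compositions, $\mathcal C_n$ of $n$, which is uniform-consistent: for every $n\ge2$, deleting from $\mathcal C_n$ a ball chosen uniformly at random among its $n$ balls, independently of $\mathcal C_n$ (a box which becomes empty disappears), gives a composition of $n-1$ with the same distribution as $\mathcal C_{n-1}$. Only the marginal distributions of the $\mathcal C_n$ matter. Associated set: every composition structure is derived by uniform sampling from some random closed set $Z\subset[0,1]$ (its associated set, unique in distribution under the convention that $1$ is included in $Z$ only if $1$ is not an isolated point of $Z$; the point $0$ may be taken to belong to $Z$). That is, with $U_1,U_2,\dots$ independent uniform $[0,1]$ variables independent of $Z$, and $U_i\sim U_j$ for $i\neq j$ iff $U_i,U_j$ fall in the same interval component of $[0,1]\setminus Z$, $\mathcal C_n$ is distributed as the sequence of sizes of the equivalence classes among $U_1,\dots,U_n$, listed from left to right. When $(\mathcal C_n)$ is moreover right-consistent (deleting the last ball of $\mathcal C_n$ gives a composition distributed as $\mathcal C_{n-1}$), $Z$ is the restriction to $[0,1]$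 of a self-similar random closed set $S\subset[0,\infty[$ (i.e. $cS$ has the same distribution as $S$ for all $c>0$). Self-similar Markov: let $Q^\uparrow=(Q^\uparrow_t,t=0,1,\dots)$ be a time-homogeneous (strictly) increasing Markov chain with state space $\{1,2,\dots\}$ and $Q^\uparrow_0=1$, and let $\xi_j=1$ if $Q^\uparrow_t=j$ for some $t$ and $\xi_j=0$ otherwise. The compositions $\mathcal C_n$ with binary form $\xi_1\cdots\xi_n$ form a right-consistent sequence. A composition structure whose marginal distributions arise in this way from some such chain is called self-similar Markov. Regenerative set with stationary delay (stationary regenerative set on $[0,\infty[$): the closed range of a process $(X+Y_t,t\ge0)$, where $(Y_t)$, $Y_0=0$, is a subordinator with drift $\mathtt d\ge0$ and Lévy measure $\nu$ satisfying $\mathtt m=\int_0^\infty y\,\nu(dy)<\infty$, $\mathtt d+\mathtt m>0$, and $X$ is independent of $(Y_t)$ with distribution $$\mathbb P(X\in dy)=\frac{\nu[y,\infty]}{\mathtt d+\mathtt m}\,dy+\frac{\mathtt d}{\mathtt d+\mathtt m}\,\delta_0(dy),\qquad y\ge 0.$$ The set $\exp(-W)$ is understood to include $0=e^{-\infty}$. *)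

(* Defs.v *)
From HB Require Import structures.
From mathcomp Require Import all_boot all_order all_algebra.
From mathcomp Require Import all_classical all_reals all_analysis.

Set Implicit Arguments.
Unset Strict Implicit.
Unset Printing Implicit Defensive.
Import Order.TTheory GRing.Theory Num.Theory.
Import numFieldNormedType.Exports.

Local Open Scope classical_set_scope.
Local Open Scope ring_scope.

Definition compositions (n : nat) : set (seq nat) :=
  [set s | all (fun k => (0 < k)%N) s /\ sumn s = n].

(* The leftmost ball of a box is coded by [true]; on [compositions n] this map
   is injective. *)
Definition binary_form (s : seq nat) : seq bool :=
  flatten [seq true :: nseq k.-1 false | k <- s].

(* Balls are numbered from 0, left to right; an emptied box disappears. *)
Fixpoint delete_ball (s : seq nat) (j : nat) : seq nat :=
  if s is k :: s' then
    if (j < k)%N then (if k == 1%N then s' else k.-1 :: s')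
    else k :: delete_ball s' (j - k)
  else [::].

Definition composition_law (R : realType) (n : nat) (p : seq nat -> R) : Prop :=
  [/\ forall s, 0 <= p s,
      forall s, ~ compositions n s -> p s = 0 &
      \sum_(s \in compositions n) p s = 1].

(* Only the marginal laws of the random compositions matter: [C n s] is the
   probability that the random composition of [n] equals [s]. The value of
   [C] at [n = 0] is irrelevant. *)
Definition composition_structure (R : realType) (C : nat -> seq nat -> R) : Prop :=
  (forall n, (0 < n)%N -> composition_law n (C n)) /\
  (forall n mu, (0 < n)%N -> compositions n mu ->
    C n mu = \sum_(s \in compositions n.+1)
      C n.+1 s * (\sum_(j < n.+1) (delete_ball s j == mu)%:R / n.+1%:R)).

(* Transition matrix of a strictly increasing chain on {1, 2, ...}; row and
   column 0 are not part of the state space. *)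
Definition increasing_transition (R : realType) (q : nat -> nat -> R) : Prop :=
  forall i, (0 < i)%N ->
    [/\ forall j, 0 <= q i j,
        forall j, (j <= i)%N -> q i j = 0 &
        (\sum_(j <oo) (q i j)%:E = 1)%E].

Definition increasing_markov_chain (R : realType) (d : measure_display)
    (Om : measurableType d) (P : probability Om R)
    (Q : nat -> {RV P >-> nat}) : Prop :=
  [/\ forall w, Q 0%N w = 1%N,
      forall t w, (Q t w < Q t.+1 w)%N &
      exists2 q : nat -> nat -> R, increasing_transition q &
        forall (t : nat) (x : nat -> nat),
          (P [set w | forall i, (i <= t.+1)%N -> Q i w = x i] =
           P [set w | forall i, (i <= t)%N -> Q i w = x i]
             * (q (x t) (x t.+1))%:E)%E].

(* Positions in a binary string start at 1, hence [j.+1]. *)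
Definition xi_bits (Om : Type) (Q : nat -> Om -> nat) (w : Om) (n : nat) :
    seq bool :=
  mkseq (fun j => `[< exists t, Q t w = j.+1 >]) n.

Definition self_similar_markov (R : realType) (C : nat -> seq nat -> R) : Prop :=
  exists (d : measure_display) (Om : measurableType d) (P : probability Om R)
         (Q : nat -> {RV P >-> nat}),
    increasing_markov_chain Q /\
    forall n s, (0 < n)%N -> compositions n s ->
      (C n s)%:E = P [set w | xi_bits (fun t => Q t) w n = binary_form s].

Definition independent_classes (R : realType) (d : measure_display)
    (Om : measurableType d) (P : probability Om R)
    (F G : set (set Om)) : Prop :=
  forall A B, F A -> G B -> (P (A `&` B) = P A * P B)%E.

Definition mutually_independent (R : realType) (d : measure_display)
    (Om : measurableType d) (P : probability Om R)
    (I : eqType) (F : I -> set (set Om)) : Prop :=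
  forall (s : seq I) (E : I -> set Om), uniq s ->
    (forall i, i \in s -> F i (E i)) ->
    (P (\bigcap_(i in [set` s]) E i) = \prod_(i <- s) P (E i))%E.

Definition sigma_RV (R : realType) (Om : Type) (X : Om -> R) : set (set Om) :=
  preimage_set_system setT X measurable.

Definition sigma_process (R : realType) (Om : Type) (D : set R)
    (Y : R -> Om -> R) : set (set Om) :=
  <<s \bigcup_(t in D) sigma_RV (Y t) >>.

Definition hits (R : realType) (Om : Type) (Z : Om -> set R) (G : set R) :
    set Om :=
  [set w | Z w `&` G !=set0].

Definition random_closed_set (R : realType) (d : measure_display)
    (Om : measurableType d) (Z : Om -> set R) : Prop :=
  (forall w, closed (Z w)) /\ (forall G, open G -> measurable (hits Z G)).

Definition sigma_set (R : realType) (Om : Type) (Z : Om -> set R) :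
    set (set Om) :=
  <<s [set hits Z G | G in [set G | open G]] >>.

(* [x] and [y] lie in the same interval component of [0,1] \ Z. The library's
   [connected_component A x] is empty when [x] is not in [A]. *)
Definition same_interval (R : realType) (Z : set R) (x y : R) : Prop :=
  connected_component (`[0, 1]%classic `\` Z) x y.

(* [c] sends a sample point to the rank of its class: [s] is the list, from
   left to right, of the sizes of the classes of [u 0, ..., u (n - 1)]. A
   sample point lying in [Z] is alone in its class. *)
Definition sampled_composition (R : realType) (Z : set R) (n : nat)
    (u : nat -> R) (s : seq nat) : Prop :=
  exists c : 'I_n -> 'I_(size s),
    [/\ forall i j, c i = c j <-> i = j \/ same_interval Z (u i) (u j),
        forall i j : 'I_n, u i < u j -> (c i <= c j)%N &
        forall k : 'I_(size s), nth 0%N s k = #|[pred i | c i == k]|].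

Definition derived_by_uniform_sampling (R : realType) (d : measure_display)
    (Om : measurableType d) (P : probability Om R)
    (C : nat -> seq nat -> R) (Z : Om -> set R) : Prop :=
  exists U : nat -> {RV P >-> R},
    [/\ forall i A, measurable A ->
          distribution P (U i) A = uniform_prob (@ltr01 R) A,
        mutually_independent P
          (fun o : option nat =>
             if o is Some i then sigma_RV (U i) else sigma_set Z) &
        forall n s, (0 < n)%N -> compositions n s ->
          (C n s)%:E =
          P [set w | sampled_composition (Z w) n (fun i => U i w) s]].

(* Sampling determines the law of Z up to the points 0 and 1: 0 is always put
   in Z, while 1 is discarded when it would be isolated. *)
Definition associated_set (R : realType) (d : measure_display)
    (Om : measurableType d) (P : probability Om R)
    (C : nat -> seq nat -> R) (Z : Om -> set R) : Prop :=
  [/\ random_closed_set Z,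
      forall w, Z w `<=` `[0, 1]%classic,
      forall w, Z w 0,
      {ae P, forall w, ~ isolated (Z w) (1 : R)} &
      derived_by_uniform_sampling P C Z].

Definition levy_measure (R : realType)
    (nu : {measure set (measurableTypeR R) -> \bar R}) : Prop :=
  nu `]-oo, 0]%classic = 0%E /\
  (\int[nu]_(y in `]0%R, +oo[%classic) (Num.min 1%R y)%:E < +oo)%E.

Definition levy_mean (R : realType)
    (nu : {measure set (measurableTypeR R) -> \bar R}) : \bar R :=
  (\int[nu]_(y in `]0%R, +oo[%classic) y%:E)%E.

Definition laplace_exponent (R : realType) (dr : R)
    (nu : {measure set (measurableTypeR R) -> \bar R}) (l : R) : R :=
  dr * l + \int[nu]_(y in `]0, +oo[%classic) (1 - expR (- (l * y))).

(* Only the values [Y t] with [0 <= t] are meaningful. Drift and Levy measure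
   are identified by the Levy-Khintchine formula; there is no killing. *)
Record subordinator (R : realType) (d : measure_display)
    (Om : measurableType d) (P : probability Om R) (dr : R)
    (nu : {measure set (measurableTypeR R) -> \bar R})
    (Y : R -> {RV P >-> R}) : Prop := {
  sub_drift_ge0 : 0 <= dr ;
  sub_levy : levy_measure nu ;
  sub_start : forall w, Y 0 w = 0 ;
  sub_nondecreasing : forall w (s t : R), 0 <= s -> s <= t -> Y s w <= Y t w ;
  sub_right_continuous : forall w (t : R), 0 <= t ->
    Y s w @[s --> at_right t] --> Y t w ;
  sub_independent : forall s t : R, 0 <= s -> 0 <= t ->
    independent_classes P
      (sigma_process `[0, s]%classic (fun r => Y r))
      (sigma_RV (fun w => Y (s + t) w - Y s w)) ;
  sub_stationary : forall (s t : R) (A : set R), 0 <= s -> 0 <= t -> measurable A ->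
    P [set w | A (Y (s + t) w - Y s w)] = P [set w | A (Y t w)] ;
  sub_laplace : forall t l : R, 0 <= t -> 0 <= l ->
    'E_P[fun w => expR (- (l * Y t w))]%E =
    (expR (- (t * laplace_exponent dr nu l)))%:E
}.

(* [nu] charges only finite jumps, so [nu `[y, +oo[] is nu[y, infinity]; a
   charge at infinity would in any case make the mean infinite. *)
Definition regenerative_stationary_delay (R : realType) (d : measure_display)
    (Om : measurableType d) (P : probability Om R) (W : Om -> set R) : Prop :=
  exists (dr : R) (nu : {measure set (measurableTypeR R) -> \bar R})
         (X : {RV P >-> R}) (Y : R -> {RV P >-> R}),
    let m := fine (levy_mean nu) in
    [/\ subordinator dr nu Y,
        (levy_mean nu < +oo)%E /\ 0 < dr + m,
        independent_classes P (sigma_RV X)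
          (sigma_process `[0, +oo[%classic (fun t => Y t)),
        (forall w, 0 <= X w) /\
        (forall A, measurable A ->
          (distribution P X A =
           ((dr + m)^-1)%:E *
             (\int[lebesgue_measure]_(y in A `&` `[0%R, +oo[%classic)
                nu `[y, +oo[%classic) +
           (dr / (dr + m))%:E * \d_(0%R : R) A)%E) &
        forall w, W w = closure [set X w + Y t w | t in `[0, +oo[%classic]].

(* The image of a subset of [0, +oo[ under w |-> exp(-w), with exp(-oo) = 0. *)
Definition exp_neg (R : realType) (W : set R) : set R :=
  0 |` [set expR (- x) | x in W].

(* Main.v *)
Require Import Defs.
From HB Require Import structures.
From mathcomp Require Import all_boot all_order all_algebra.
From mathcomp Require Import all_classical all_reals all_analysis.
From mathcomp Require Import measurable_realfun.
From mathcomp Require Import zify ring lra.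

Set Implicit Arguments.
Unset Strict Implicit.
Unset Printing Implicit Defensive.
Import Order.TTheory GRing.Theory Num.Theory.
Import numFieldNormedType.Exports.

Local Open Scope classical_set_scope.
Local Open Scope ring_scope.

(* Both conditions amount to the same formula for the law of C_n: with
   a_k = E exp(- k X), the last box holds m of the n balls with probability
   binom(n-1, m-1) (Delta^(m-1) a)_(n-m), and the boxes further left follow the
   decrement matrix of the exponent Phi(k) = k a_k.
   If Z = exp(- W) with W stationary regenerative, the formula is found by
   sampling from the points X + Y_t at times t in 2^-r N, conditioning on the
   cells from right to left and letting r tend to infinity; the resulting bits
   form a renewal process, whence the chain.
   Conversely, sampling consistency determines the chain from a_k = P(a box
   starts at k + 1), and forces the differences of Phi to alternate in sign.
   By Hausdorff's moment problem Phi is then a Laplace exponent; that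
   the first increment of the chain is finite says precisely that d + m = 1. The
   stationary regenerative set, together with the uniform sample, is
   constructed from a moment problem in countably many variables. *)

(** * Finite differences and moment tables *)

(** A linear time change of Y keeps its range, so d + m is only a normalization: the converse takes
    d + m = 1, where Phi(k) = k a_k exactly, and in the direct part the constant d + m cancels as
    the mesh tends to 0. Restricting Y to dyadic times avoids any description of its jumps: only the
    integer moments of exp(- (Y_(s+t) - Y_s)) and the independence of increments enter. As exp(- W)
    reverses the order, cells are numbered from the right and boxes are peeled off from the right.
    For the converse, Phi(n+1) - Phi(n) is a_1 E M^n for some M in [0, 1]. A jump is - ln M, an atom
    of M at 1 is the drift, an atom at 0 would be killing. The first row of the chain is the series
    of a_1 E (1 - M)^m / (m+1), whose sum a_1 E (- ln M) / (1 - M) is d + m; its convergence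
    excludes killing. The process is prescribed by the mixed moments of exp(- (Y_q - Y_p)) for
    rational p < q. The obstacle is their positivity: it comes from expanding exp(- Psi) for Psi
    with alternating differences. *)

Section real_sequences.
Variable R : realType.
Implicit Types (u v : nat -> R) (l c : R).

Lemma seq_cvg_unique u l l' : u @ \oo --> l -> u @ \oo --> l' -> l = l'.
Proof. by move=> /(cvg_lim (@Rhausdorff R)) <- /(cvg_lim (@Rhausdorff R)) <-. Qed.

Lemma seq_cvg_ge u l c : u @ \oo --> l -> (forall n, c <= u n) -> c <= l.
Proof.
move=> ul cu; rewrite -(cvg_lim (@Rhausdorff R) ul); apply: limr_ge.
  by apply/cvg_ex; exists l.
exact: nearW.
Qed.

Lemma seq_cvg_le u l c : u @ \oo --> l -> (forall n, u n <= c) -> l <= c.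
Proof.
move=> ul cu; rewrite -(cvg_lim (@Rhausdorff R) ul); apply: limr_le.
  by apply/cvg_ex; exists l.
exact: nearW.
Qed.

Lemma eseq_cvg_unique (u : nat -> \bar R) (l l' : \bar R) :
  u @ \oo --> l -> u @ \oo --> l' -> l = l'.
Proof.
by move=> /(cvg_lim (@ereal_hausdorff R)) <- /(cvg_lim (@ereal_hausdorff R)) <-.
Qed.

Lemma EFin_cvg u l : u @ \oo --> l -> (u n)%:E @[n --> \oo] --> l%:E.
Proof. by move=> ul; apply/fine_cvgP; split; [exact: nearW|exact: ul]. Qed.

End real_sequences.

Section differences.
Variable R : realType.
Implicit Types (a f : nat -> R) (rs s : seq nat).

(** When [a] is the moment sequence of a variable x in [0, 1], this is E x^n (1 - x)^m; hence the
    sign convention. *)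
Fixpoint diff (m : nat) (a : nat -> R) (n : nat) : R :=
  if m is m'.+1 then diff m' a n - diff m' a n.+1 else a n.

(** Leibniz rule: the second differences of k vanish, so only two terms survive. *)
Lemma diff_leibniz a m j :
  diff m.+1 (fun k => k%:R * a k) j
    = j%:R * diff m.+1 a j - m.+1%:R * diff m a j.+1.
Proof.
elim: m j => [|m IH] j; first by rewrite /= -(natr1 j); ring.
rewrite [LHS]/= -/(diff m.+1 _ j) -/(diff m.+1 _ j.+1) !IH /=.
by rewrite -(natr1 j) -(natr1 m.+1) -(natr1 m); ring.
Qed.

Lemma eq_diff a f m j : a =1 f -> diff m a j = diff m f j.
Proof. by move=> af; elim: m j => [|m IH] j //=; rewrite !IH. Qed.

Lemma diffZ c a m j : diff m (fun k => c * a k) j = c * diff m a j.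
Proof. by elim: m j => [|m IH] j //=; rewrite !IH mulrBr. Qed.

(* The weight of a jump over [m] of the [j + m] remaining balls, for the
   Laplace exponent [k |-> k * a k]. *)
Definition jump_weight a j m : R := - diff m (fun k => k%:R * a k) j.

Lemma jump_weightE a j m : jump_weight a j m.+1 =
  m.+1%:R * diff m a j.+1 - j%:R * diff m.+1 a j.
Proof. by rewrite /jump_weight diff_leibniz opprB. Qed.

Lemma delay_weightE a j m : (j + m.+1)%:R * diff m.+1 a j + jump_weight a j m.+1 =
  m.+1%:R * diff m a j.
Proof. by rewrite jump_weightE natrD /=; ring. Qed.

(* Compositions are listed from right to left in what follows. *)
Fixpoint regen_law a rs : R :=
  if rs is m :: rs' then
    let j := sumn rs' in
    'C(j + m, m)%:R * jump_weight a j m / ((j + m)%:R * a (j + m)%N)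
      * regen_law a rs'
  else 1.

Definition delayed_law a rs : R :=
  if rs is m :: rs' then
    let j := sumn rs' in
    'C(j + m.-1, j)%:R * diff m.-1 a j * regen_law a rs'
  else 1.

Lemma delayed_law1 a rs : delayed_law a (1%N :: rs) = a (sumn rs) * regen_law a rs.
Proof. by rewrite /delayed_law /= addn0 binn mul1r. Qed.

(** Right consistency: a ball added at the right end either enlarges the last box or opens a new
    one. After division by the common factors it is Pascal's rule. *)
Lemma delayed_law_step a m rs : (0 < m)%N -> (forall k, 0 < a k) ->
  delayed_law a (m :: rs) - delayed_law a (m.+1 :: rs)
    = delayed_law a [:: 1%N, m & rs].
Proof.
case: m => // m _ a0; rewrite delayed_law1 /delayed_law /=.
set j := sumn rs; rewrite jump_weightE.
have an0 : a (j + m.+1)%N != 0 by rewrite gt_eqF.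
have jm0 : (j + m.+1)%:R != 0 :> R by rewrite pnatr_eq0 addnS.
rewrite [(m.+1 + j)%N]addnC.
have sym p q : 'C(p + q, p) = 'C(p + q, q).
  by rewrite -(bin_sub (leq_addr q p)) addKn.
have E1 : 'C(j + m.+1, m.+1)%:R * m.+1%:R = (j + m.+1)%:R * 'C(j + m, j)%:R :> R.
  by rewrite -!natrM mulnC -mul_bin_diag addnS sym.
have E2 : 'C(j + m.+1, m.+1)%:R * j%:R = (j + m.+1)%:R * 'C(j + m, m.+1)%:R :> R.
  by rewrite -!natrM mulnC -{1}(addnK m.+1 j) -mul_bin_down addnS.
have E3 : 'C(j + m.+1, j)%:R = 'C(j + m, j)%:R + 'C(j + m, m.+1)%:R :> R.
  by rewrite -natrD sym addnS binS addnC sym.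
rewrite E3.
move: (_%:R) jm0 E1 E2 => d d0 E1 E2.
move: (a (j + m.+1)%N) an0 => A A0.
move: ('C(_, m.+1)%:R) E1 E2 => c E1 E2.
have -> : A * (c * (m.+1%:R * diff m a j.+1
   - j%:R * (diff m a j - diff m a j.+1)) / (d * A) * regen_law a rs)
  = (c * m.+1%:R * diff m a j.+1
   - c * j%:R * (diff m a j - diff m a j.+1)) / d
   * regen_law a rs by field; rewrite A0 d0.
by rewrite E1 E2; field.
Qed.

Fixpoint multinom rs : nat :=
  if rs is m :: rs' then ('C(sumn rs' + m, m) * multinom rs')%N else 1%N.

Lemma multinom_fact rs : (multinom rs * \prod_(m <- rs) m`!)%N = (sumn rs)`!.
Proof.
elim: rs => [|m rs IH] /=; first by rewrite big_nil.
rewrite big_cons mulnACA IH addnC -[RHS](bin_fact (leq_addr (sumn rs) m)).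
by rewrite addKn mulnA.
Qed.

Fixpoint jump_product a rs : R :=
  if rs is m :: rs' then
    let j := sumn rs' in
    jump_weight a j m / ((j + m)%:R * a (j + m)%N) * jump_product a rs'
  else 1.

Lemma regen_lawE a rs : regen_law a rs = (multinom rs)%:R * jump_product a rs.
Proof.
elim: rs => [|m rs IH] /=; first by rewrite mulr1.
by rewrite IH natrM; ring.
Qed.

(* The weight of a composition of the remaining balls, read from left to right,
   when [j] balls have been used up. *)
Fixpoint left_weight a j s : R :=
  if s is m :: s' then
    if s' is [::] then diff m a j + jump_weight a j m / (j + m)%:R
    else jump_weight a j m / ((j + m)%:R * a (j + m)%N) * left_weight a (j + m)%N s'
  else 0.

(** Reconciles the two reading directions: sampling along the cells produces the boxes from left to
    right, the decrement matrix from right to left. [rs] collects, reversed, the boxes already read;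
    all but the last one carry the same factor in both. *)
Lemma delayed_lawE a rs s : s <> [::] -> all (leq 1) s ->
  (multinom (catrev s rs))%:R * (jump_product a rs * left_weight a (sumn rs) s) =
  delayed_law a (catrev s rs).
Proof.
elim: s rs => // m [_ rs _ /=|m' s IH rs _].
  rewrite andbT; case: m => // m _; rewrite /= regen_lawE natrM.
  set j := sumn rs.
  have jm0 : (j + m.+1)%:R != 0 :> R by rewrite pnatr_eq0 addnS.
  (* The last box is the gap next to 1, due to the delay, or a jump of Y; the two weights merge into
     one difference. *)
  have -> : diff m a j - diff m a j.+1 + jump_weight a j m.+1 / (j + m.+1)%:R =
    m.+1%:R * diff m a j / (j + m.+1)%:R.
    by rewrite -delay_weightE /= mulrDl mulrAC mulfV// mul1r.
  have E1 : 'C(j + m.+1, m.+1)%:R * m.+1%:R = (j + m.+1)%:R * 'C(j + m, j)%:R :> R.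
    rewrite -!natrM mulnC -mul_bin_diag addnS.
    by rewrite -(bin_sub (leq_addl j m)) addnK.
  transitivity ('C(j + m.+1, m.+1)%:R * m.+1%:R * diff m a j / (j + m.+1)%:R *
     ((multinom rs)%:R * jump_product a rs)); first by ring.
  by rewrite E1; move: ((j + _)%:R) jm0 => d d0; field.
move=> /= /andP[m0 ms]; rewrite -(IH (m :: rs))//=.
by rewrite [(m + _)%N]addnC; ring.
Qed.

Lemma delayed_law_rev a s : s <> [::] -> all (leq 1) s ->
  (multinom (rev s))%:R * left_weight a 0 s = delayed_law a (rev s).
Proof. by move=> s0 ps; rewrite -(@delayed_lawE a [::])//= mul1r. Qed.

End differences.

Section tables.
Variables (R : realType) (I : eqType).
Implicit Types (a b Psi : seq I -> R) (A B : seq I) (V : seq I -> Prop).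

(* [iter_diff B a A] is the mixed moment of [x_i], [i] in [A], and [1 - x_i],
   [i] in [B], when [a] gives the mixed moments of the [x_i]. *)
Fixpoint iter_diff B a A : R :=
  if B is i :: B' then iter_diff B' (fun s => a s - a (i :: s)) A else a A.

Definition symmetric_table a := forall s s', perm_eq s s' -> a s = a s'.

Lemma eq_iter_diff B a b A : a =1 b -> iter_diff B a A = iter_diff B b A.
Proof. by elim: B a b => //= i B IH a b ab; apply: IH => s; rewrite !ab. Qed.

Lemma iter_diffD B a b A :
  iter_diff B (fun s => a s + b s) A = iter_diff B a A + iter_diff B b A.
Proof.
elim: B a b => //= i B IH a b.
by rewrite -IH; apply: eq_iter_diff => s; ring.
Qed.

Lemma iter_diffZ B c a A : iter_diff B (fun s => c * a s) A = c * iter_diff B a A.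
Proof.
elim: B a => //= i B IH a.
by rewrite -IH; apply: eq_iter_diff => s; ring.
Qed.

Lemma iter_diffN B a A : iter_diff B (fun s => - a s) A = - iter_diff B a A.
Proof. by rewrite -mulN1r -iter_diffZ; apply: eq_iter_diff => s; ring. Qed.

Lemma iter_diff_cst i B c A : iter_diff (i :: B) (fun=> c) A = 0.
Proof.
rewrite /= -[RHS](mul0r (iter_diff B (fun=> 1) A)) -iter_diffZ.
by apply: eq_iter_diff => s; ring.
Qed.

Lemma iter_diff_consr B a i A : symmetric_table a ->
  iter_diff B a (i :: A) = iter_diff B (fun s => a (i :: s)) A.
Proof.
elim: B a => //= k B IH a sa; rewrite IH; last first.
  by move=> s s' ss'; congr (_ - _); apply: sa; rewrite ?perm_cons.
apply: eq_iter_diff => s; congr (_ - _); apply: sa.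
exact: permEl (perm_catCA [:: _] [:: _] s).
Qed.

Lemma iter_diff_cons B a i A : symmetric_table a ->
  iter_diff (i :: B) a A = iter_diff B a A - iter_diff B a (i :: A).
Proof.
by move=> sa; rewrite iter_diff_consr// -iter_diffN -iter_diffD.
Qed.

Lemma symmetric_diff a i : symmetric_table a ->
  symmetric_table (fun s => a s - a (i :: s)).
Proof. by move=> sa s s' ss'; congr (_ - _); apply: sa; rewrite ?perm_cons. Qed.

Lemma symmetric_cons a i : symmetric_table a -> symmetric_table (fun s => a (i :: s)).
Proof. by move=> sa s s' ss'; apply: sa; rewrite perm_cons. Qed.

Lemma iter_diff_perm B a A A' : symmetric_table a -> perm_eq A A' ->
  iter_diff B a A = iter_diff B a A'.
Proof.
move=> + AA'; elim: B a => /= [a|i B IH a sa]; first exact.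
by apply: IH; exact: symmetric_diff.
Qed.

(* Positivity is only asked for multisets in [V]; down-closed [V] make products
   of such tables positive. *)
Definition down_closed V := [/\ (forall i s, V (i :: s) -> V s) &
  (forall s s', perm_eq s s' -> V s -> V s')].

Definition positive_on V a := symmetric_table a /\ forall B A, V (B ++ A) -> 0 <= iter_diff B a A.

Definition positive_table a := positive_on (fun=> True) a.

Lemma down_closed_cons V i : down_closed V -> down_closed (fun s => V (i :: s)).
Proof.
move=> [V1 V2]; split=> [k s|s s' ss']; last by apply: V2; rewrite perm_cons.
move=> h; apply: (V1 k); apply: V2 h.
exact: permEl (perm_catCA [:: _] [:: _] s).
Qed.

Lemma positive_on_diff V a i : positive_on V a ->
  positive_on (fun s => V (i :: s)) (fun s => a s - a (i :: s)).
Proof.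
by move=> [sa pa]; split=> [|B A h]; [exact: symmetric_diff | exact: (pa (i :: B))].
Qed.

Lemma positive_on_cons V a i : down_closed V -> positive_on V a ->
  positive_on (fun s => V (i :: s)) (fun s => a (i :: s)).
Proof.
move=> [_ V2] [sa pa]; split=> [|B A h]; first exact: symmetric_cons.
rewrite -iter_diff_consr//; apply: pa; apply: V2 h.
exact: permEl (perm_catCA [:: _] _ _).
Qed.

Lemma positive_onS V V' a : (forall s, V' s -> V s) -> positive_on V a ->
  positive_on V' a.
Proof. by move=> VV [sa pa]; split=> // B A /VV; exact: pa. Qed.

(** Induction on B: peeling off i by the Leibniz rule leaves two products of positive tables, which
    are positive on the multisets that stay in V after i has been added. *)
Lemma positive_onM V a b : down_closed V -> positive_on V a -> positive_on V b ->
  positive_on V (fun s => a s * b s).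
Proof.
move=> dV pa pb; split.
  by move=> s s' ss'; rewrite (pa.1 _ _ ss') (pb.1 _ _ ss').
move=> B; elim: B V a b dV pa pb => [|i B IH] V a b dV pa pb A VA /=.
  by apply: mulr_ge0; [apply: (pa.2 [::])|apply: (pb.2 [::])].
have VS s : V (i :: s) -> V s by case: dV => + _; apply.
rewrite (eq_iter_diff _ _ (b := fun s => (a s - a (i :: s)) * b s +
    a (i :: s) * (b s - b (i :: s)))); last by move=> s; ring.
rewrite iter_diffD addr_ge0//.
  apply: (IH (fun s => V (i :: s))) => //; first exact: down_closed_cons.
    exact: positive_on_diff.
  exact: positive_onS pb.
apply: (IH (fun s => V (i :: s))) => //; first exact: down_closed_cons.
  exact: positive_on_cons.
exact: positive_on_diff.
Qed.

Lemma positive_on1 V : positive_on V (fun=> 1).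
Proof. by split=> // -[|i B] A _; [exact: ler01 | rewrite iter_diff_cst]. Qed.

Lemma positive_onD V a b : positive_on V a -> positive_on V b ->
  positive_on V (fun s => a s + b s).
Proof.
move=> [sa pa] [sb pb]; split=> [s s' ss'|B A h].
  by rewrite (sa _ _ ss') (sb _ _ ss').
by rewrite iter_diffD addr_ge0 ?pa ?pb.
Qed.

Lemma positive_onZ V c a : 0 <= c -> positive_on V a ->
  positive_on V (fun s => c * a s).
Proof.
move=> c0 [sa pa]; split=> [s s' ss'|B A h]; first by rewrite (sa _ _ ss').
by rewrite iter_diffZ mulr_ge0 ?pa.
Qed.

Lemma positive_onX V a n : down_closed V -> positive_on V a ->
  positive_on V (fun s => a s ^+ n).
Proof.
move=> dV pa; elim: n => [|n IH]; first exact: positive_on1.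
have [sM pM] := positive_onM dV pa IH.
split=> [s s' ss'|B A h]; first by rewrite (pa.1 _ _ ss').
rewrite (eq_iter_diff _ _ (b := fun s => a s * a s ^+ n)) ?pM// => s.
by rewrite exprS.
Qed.

Lemma cvg_iter_diff B (a_ : nat -> seq I -> R) a A :
  (forall s, a_ n s @[n --> \oo] --> a s) ->
  iter_diff B (a_ n) A @[n --> \oo] --> iter_diff B a A.
Proof.
elim: B a_ a => [|i B IH] a_ a h; first exact: h.
by apply: (IH (fun n s => a_ n s - a_ n (i :: s))) => s; exact: cvgB.
Qed.

Lemma positive_on_cvg V (a_ : nat -> seq I -> R) a :
  (forall n, positive_on V (a_ n)) -> (forall s, a_ n s @[n --> \oo] --> a s) ->
  positive_on V a.
Proof.
move=> pa ha; split=> [s s' ss'|B A h].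
  apply: (seq_cvg_unique (ha s)); apply: cvg_trans (ha s'); apply: near_eq_cvg.
  by apply: nearW => n; rewrite ((pa n).1 _ _ ss').
have /seq_cvg_ge := @cvg_iter_diff B _ _ A ha.
by apply => n; exact: (pa n).2.
Qed.

(* The Poisson principle: expand exp(- Psi) = exp(- K) exp(K - Psi) in powers of
   K - Psi, which is positive on the multisets where Psi is at most K. *)
Lemma positive_table_exp Psi : symmetric_table Psi ->
  (forall i B A, iter_diff (i :: B) Psi A <= 0) ->
  positive_table (fun s => expR (- Psi s)).
Proof.
move=> sP dP; split=> [s s' ss'|B A _]; first by rewrite (sP _ _ ss').
have mono i s : Psi s <= Psi (i :: s).
  by have := dP i [::] s; rewrite /= subr_le0.
pose K := Psi (B ++ A); pose V s := Psi s <= K.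
have dV : down_closed V.
  split=> [i s|s s' ss']; first exact: le_trans.
  by rewrite /V (sP _ _ ss').
pose b s := K - Psi s.
have pb : positive_on V b.
  split=> [s s' ss'|[|i B'] A']; first by rewrite /b (sP _ _ ss').
    by rewrite /V /b /= subr_ge0.
  move=> _; rewrite /b iter_diffD iter_diff_cst add0r iter_diffN oppr_ge0.
  exact: dP.
pose E n s := \sum_(k < n) (k`!%:R)^-1 * b s ^+ k.
have pE n : positive_on V (E n).
  elim: n => [|n [sE pE]].
    split=> [s s' _|B' A' _]; rewrite /E ?big_ord0//.
    rewrite (eq_iter_diff _ _ (b := fun s => 0 * b s)).
      by rewrite iter_diffZ mul0r.
    by move=> s; rewrite big_ord0 mul0r.
  have n0 : 0 <= (n`!%:R)^-1 :> R by rewrite invr_ge0.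
  have [sD pD] := positive_onD (conj sE pE)
    (positive_onZ n0 (positive_onX n dV pb)).
  split=> [s s' ss'|B' A' h].
    by rewrite /E !big_ord_recr /=; apply: sD.
  rewrite (eq_iter_diff _ _ (b := fun s => E n s + (n`!%:R)^-1 * b s ^+ n)).
    exact: pD.
  by move=> s; rewrite /E big_ord_recr.
have cE s : E n s @[n --> \oo] --> expR (b s).
  have := @is_cvg_series_exp_coeff R (b s); rewrite /expR => h.
  apply: cvg_trans h; apply: near_eq_cvg; apply: nearW => n.
  rewrite /E /series /= big_mkord; apply: eq_bigr => k _.
  by rewrite /exp_coeff /= mulrC.
have [_ /(_ B A (lexx _))] := positive_on_cvg pE cE.
rewrite (eq_iter_diff _ _ (b := fun s => expR K * expR (- Psi s))).
  by rewrite iter_diffZ pmulr_rge0 ?expR_gt0.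
by move=> s; rewrite /b expRD.
Qed.

End tables.

(** * Integration and independence *)

Section bounded_measurable.
Context d (T : measurableType d) (R : realType).
Implicit Types (f g : T -> R).

Definition bounded_measurable f :=
  measurable_fun setT f /\ exists M, forall w, `|f w| <= M.

Lemma bmf_cst c : bounded_measurable (fun=> c).
Proof. by split; [exact: measurable_cst | exists `|c|]. Qed.

Lemma bmfD f g : bounded_measurable f -> bounded_measurable g ->
  bounded_measurable (fun w => f w + g w).
Proof.
move=> [mf [M fM]] [mg [N gN]]; split; first exact: measurable_funD.
by exists (M + N) => w; rewrite (le_trans (ler_normD _ _))// lerD.
Qed.

Lemma bmfM f g : bounded_measurable f -> bounded_measurable g ->
  bounded_measurable (fun w => f w * g w).
Proof.
move=> [mf [M fM]] [mg [N gN]]; split; first exact: measurable_funM.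
by exists (M * N) => w; rewrite normrM ler_pM.
Qed.

Lemma bmfN f : bounded_measurable f -> bounded_measurable (fun w => - f w).
Proof.
move=> [mf [M fM]]; split; first exact: measurable_funN.
by exists M => w; rewrite normrN.
Qed.

Lemma bmfB f g : bounded_measurable f -> bounded_measurable g ->
  bounded_measurable (fun w => f w - g w).
Proof. by move=> bf bg; apply: bmfD => //; exact: bmfN. Qed.

Lemma bmfZ c f : bounded_measurable f -> bounded_measurable (fun w => c * f w).
Proof. by move=> bf; apply: bmfM => //; exact: bmf_cst. Qed.

Lemma bmfX f n : bounded_measurable f -> bounded_measurable (fun w => f w ^+ n).
Proof.
move=> bf; elim: n => [|n IH]; first exact: bmf_cst.
by under eq_fun do rewrite exprS; exact: bmfM.
Qed.

Lemma bmf_sum I (s : seq I) (P : pred I) (F : I -> T -> R) :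
  (forall i, bounded_measurable (F i)) ->
  bounded_measurable (fun w => \sum_(i <- s | P i) F i w).
Proof.
move=> bF; elim: s => [|i s IH].
  by under eq_fun do rewrite big_nil; exact: bmf_cst.
under eq_fun do rewrite big_cons.
by case: (P i) => //; exact: bmfD.
Qed.

Lemma bmf_prod I (s : seq I) (P : pred I) (F : I -> T -> R) :
  (forall i, bounded_measurable (F i)) ->
  bounded_measurable (fun w => \prod_(i <- s | P i) F i w).
Proof.
move=> bF; elim: s => [|i s IH].
  by under eq_fun do rewrite big_nil; exact: bmf_cst.
under eq_fun do rewrite big_cons.
by case: (P i) => //; exact: bmfM.
Qed.

Lemma bmf_indic (A : set T) : measurable A -> bounded_measurable (\1_A : T -> R).
Proof.
move=> mA; split; first exact: measurable_indic.
by exists 1 => w; rewrite indicE; case: (_ \in _); rewrite ?normr1 ?normr0.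
Qed.

Lemma bmf01 f : measurable_fun setT f -> (forall w, 0 <= f w <= 1) ->
  bounded_measurable f.
Proof.
move=> mf f01; split => //; exists 1 => w.
by have /andP[f0 f1] := f01 w; rewrite ger0_norm.
Qed.

Section finite_measure_integral.
Variable mu : {finite_measure set T -> \bar R}.

Lemma bmf_integrable f : bounded_measurable f -> mu.-integrable setT (EFin \o f).
Proof.
move=> [mf [M fM]]; apply: measurable_bounded_integrable => //.
  by rewrite ltey_eq fin_num_measure.
exists M; split; first by rewrite num_real.
by move=> N MN w _; exact: le_trans (fM w) (ltW MN).
Qed.

Lemma bmf_integralE f : bounded_measurable f ->
  (\int[mu]_w (f w)%:E = (\int[mu]_w f w)%:E)%E.
Proof.
by move=> bf; rewrite fineK//; apply: integrable_fin_num => //; exact: bmf_integrable.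
Qed.

Lemma bmf_intD f g : bounded_measurable f -> bounded_measurable g ->
  \int[mu]_w (f w + g w) = \int[mu]_w f w + \int[mu]_w g w.
Proof. by move=> bf bg; rewrite RintegralD//; exact: bmf_integrable. Qed.

Lemma bmf_intB f g : bounded_measurable f -> bounded_measurable g ->
  \int[mu]_w (f w - g w) = \int[mu]_w f w - \int[mu]_w g w.
Proof. by move=> bf bg; rewrite RintegralB//; exact: bmf_integrable. Qed.

Lemma bmf_intZ c f : bounded_measurable f ->
  \int[mu]_w (c * f w) = c * \int[mu]_w f w.
Proof. by move=> bf; rewrite RintegralZl//; exact: bmf_integrable. Qed.

Lemma bmf_int_sum I (s : seq I) (F : I -> T -> R) :
  (forall i, bounded_measurable (F i)) ->
  \int[mu]_w (\sum_(i <- s) F i w) = \sum_(i <- s) \int[mu]_w F i w.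
Proof.
move=> bF; elim: s => [|i s IH].
  under eq_Rintegral do rewrite big_nil.
  by rewrite Rintegral_cst// mul0r big_nil.
under eq_Rintegral do rewrite big_cons.
by rewrite bmf_intD// ?IH ?big_cons//; exact: bmf_sum.
Qed.

Lemma bmf_int_le f g : bounded_measurable f -> bounded_measurable g ->
  (forall w, f w <= g w) -> \int[mu]_w f w <= \int[mu]_w g w.
Proof. by move=> bf bg fg; apply: le_Rintegral => //; exact: bmf_integrable. Qed.

Lemma bmf_int_indic (A : set T) : measurable A ->
  \int[mu]_w (\1_A w : R) = fine (mu A).
Proof. by move=> mA; rewrite /Rintegral integral_indic// setIT. Qed.

Lemma bmf_int_ae f g : bounded_measurable f -> bounded_measurable g ->
  {ae mu, forall w, f w = g w} -> \int[mu]_w f w = \int[mu]_w g w.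
Proof.
move=> [mf _] [mg _] fg; congr fine; apply: ae_eq_integral => //.
- exact/measurable_EFinP.
- exact/measurable_EFinP.
- by apply: filterS fg => w + _ => ->.
Qed.

Lemma bmf_int_cvg (f_ : nat -> T -> R) f M :
  (forall n, measurable_fun setT (f_ n)) -> measurable_fun setT f ->
  (forall n w, `|f_ n w| <= M) ->
  {ae mu, forall w, f_ n w @[n --> \oo] --> f w} ->
  \int[mu]_w f_ n w @[n --> \oo] --> \int[mu]_w f w.
Proof.
move=> mf_ mf fM cf.
have bM : bounded_measurable (fun=> M) by exact: bmf_cst.
have [//|//|||//|intf _ cE] := @dominated_convergence _ _ _ mu _ measurableT
    (fun n => EFin \o f_ n) (EFin \o f) (EFin \o (fun=> M)).
- by move=> n; apply/measurable_EFinP.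
- exact/measurable_EFinP.
- apply: filterS cf => w cw _ /=.
  exact: EFin_cvg.
- exact: bmf_integrable.
- by apply: aeW => w n _ /=; rewrite lee_fin.
apply: fine_cvg; rewrite fineK//; exact: integrable_fin_num.
Qed.

End finite_measure_integral.
End bounded_measurable.

Section independence.
Context (R : realType) d (T : measurableType d) (P : probability T R).
Implicit Types F G : set (set T).

Lemma sigma_generated_measurable F : F `<=` measurable -> <<s F>> `<=` @measurable d T.
Proof. by move=> Fm; apply: smallest_sub => //; exact: sigma_algebra_measurable. Qed.

Lemma independent_classes_generated F G : F `<=` measurable -> G `<=` measurable ->
  setI_closed F -> independent_classes P F G -> independent_classes P <<s F>> G.
Proof.
move=> Fm Gm IF FG A B + GB; move: A.
have mB := Gm _ GB.
have Pfin X : measurable X -> P X \is a fin_num by move=> ?; rewrite fin_num_measure.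
suff h : <<s F>> `<=` [set A | measurable A /\ P (A `&` B) = (P A * P B)%E].
  by move=> A /h[].
apply: lambda_system_subset => //.
- split => //.
  + by split => //; rewrite setTI probability_setT mul1e.
  + move=> A C CA [mA PA] [mC PC]; split; first exact: measurableD.
    have -> : (A `\` C) `&` B = (A `&` B) `\` (C `&` B).
      apply/seteqP; split=> [w [[Aw nCw] Bw]|w [[Aw Bw] nCB]].
        by split => // -[].
      by split=> //; split => // Cw; apply: nCB.
    have fty X : measurable X -> (P X < +oo)%E.
      by move=> mX; rewrite ltey_eq Pfin.
    have mAB : measurable (A `&` B) by exact: measurableI.
    have mCB : measurable (C `&` B) by exact: measurableI.
    have e1 : (P (A `\` C) = P A - P C)%E.
      by rewrite measureD ?fty// (setIidr CA).
    have e2 : (P ((A `&` B) `\` (C `&` B)) = P (A `&` B) - P (C `&` B))%E.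
      by rewrite measureD ?fty// setIACA setIid (setIidr CA).
    by rewrite e1 e2 PA PC muleBl// ?Pfin// fin_num_adde_defr// Pfin.
  + move=> A_ ndA hA; split; first by apply: bigcup_measurable => k _; exact: (hA k).1.
    rewrite setI_bigcupl.
    have c1 : P (A_ n `&` B) @[n --> \oo] --> P (\bigcup_n (A_ n `&` B)).
      apply: nondecreasing_cvg_mu.
      - by move=> i; apply: measurableI => //; exact: (hA i).1.
      - by apply: bigcup_measurable => k _; apply: measurableI => //; exact: (hA k).1.
      - by move=> m n mn; apply/subsetPset; apply: setSI; apply/subsetPset; exact: ndA.
    have c2 : P (A_ n) @[n --> \oo] --> P (\bigcup_n A_ n).
      apply: nondecreasing_cvg_mu => //; first by move=> i; exact: (hA i).1.
      by apply: bigcup_measurable => k _; exact: (hA k).1.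
    have c3 : (P (A_ n) * P B @[n --> \oo] --> P (\bigcup_n A_ n) * P B)%E.
      by apply: cvgeZr; rewrite ?Pfin.
    apply: (eseq_cvg_unique c1); apply: cvg_trans c3; apply: near_eq_cvg.
    by apply: nearW => n; rewrite (hA n).2.
- by move=> A FA; split; [exact: Fm|exact: FG].
Qed.

Lemma ge0_independent_integral (f g : T -> R) :
  measurable_fun setT f -> measurable_fun setT g ->
  (forall w, 0 <= f w) -> (forall w, 0 <= g w) ->
  independent_classes P (sigma_RV f) (sigma_RV g) ->
  (\int[P]_w (f w * g w)%:E = \int[P]_w (f w)%:E * \int[P]_w (g w)%:E)%E.
Proof.
move=> mf mg f0 g0 FG.
pose F : {mfun T >-> R} := HB.pack f (isMeasurableFun.Build _ _ _ _ f mf).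
pose G : {mfun T >-> R} := HB.pack g (isMeasurableFun.Build _ _ _ _ g mg).
have mFG : measurable_fun setT (fun w => (f w, g w)) by exact: measurable_fun_pair.
pose FG' : {mfun T >-> (R * R)%type} :=
  HB.pack (fun w => (f w, g w)) (isMeasurableFun.Build _ _ _ _ (fun w => (f w, g w)) mFG).
(* The truncation makes the integrand nonnegative on all of R, so that Tonelli's theorem applies,
   and changes nothing on the values of [f] and [g]. *)
pose h (z : R) : \bar R := (Num.max 0 z)%:E.
have mh : measurable_fun setT h.
  by apply/measurable_EFinP; apply: measurable_maxr => //; exact: measurable_cst.
have h0 z : (0 <= h z)%E by rewrite lee_fin le_max lexx.
pose k (z : R * R) : \bar R := (h z.1 * h z.2)%E.
have mk : measurable_fun setT k.
  apply: emeasurable_funM.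
  - exact: measurableT_comp mh measurable_fst.
  - exact: measurableT_comp mh measurable_snd.
have k0 z : (0 <= k z)%E by rewrite mule_ge0.
have e1 : (\int[P]_w (f w * g w)%:E = \int[distribution P FG']_z k z)%E.
  rewrite ge0_integral_distribution//; apply: eq_integral => w _.
  by rewrite /k /h /= !max_r// EFinM.
have e2 : (\int[P]_w (f w)%:E = \int[distribution P F]_z h z)%E.
  rewrite ge0_integral_distribution//; apply: eq_integral => w _.
  by rewrite /h /= max_r.
have e3 : (\int[P]_w (g w)%:E = \int[distribution P G]_z h z)%E.
  rewrite ge0_integral_distribution//; apply: eq_integral => w _.
  by rewrite /h /= max_r.
rewrite e1 e2 e3.
rewrite (eq_measure_integral (distribution P F \x distribution P G)%E); last first.
  move=> A mA _; apply/esym; apply: product_measure_unique => // A1 A2 mA1 mA2.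
  have : P ((f @^-1` A1) `&` (g @^-1` A2)) = (P (f @^-1` A1) * P (g @^-1` A2))%E.
    by apply: FG; [exists A1 | exists A2] => //; rewrite setTI.
  exact.
rewrite fubini_tonelli1//.
under eq_integral.
  move=> x _; rewrite /fubini_F /k /=.
  rewrite ge0_integralZl//; first over.
rewrite ge0_integralZr//.
by apply: integral_ge0.
Qed.

Lemma independent_Rintegral (f g : T -> R) :
  bounded_measurable f -> bounded_measurable g ->
  (forall w, 0 <= f w) -> (forall w, 0 <= g w) ->
  independent_classes P (sigma_RV f) (sigma_RV g) ->
  \int[P]_w (f w * g w) = \int[P]_w f w * \int[P]_w g w.
Proof.
move=> bf bg f0 g0 FG; apply: EFin_inj.
rewrite EFinM -!bmf_integralE//; last exact: bmfM.
by apply: ge0_independent_integral => //; [case: bf | case: bg].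
Qed.

End independence.

(** * Measures given by a density *)

Section density.
Context d (T : measurableType d) (R : realType).
Variables (mu : {measure set T -> \bar R}) (f : T -> R).
Hypotheses (mf : measurable_fun setT f) (f0 : forall x, 0 <= f x).

(** The two proofs are arguments so that the measure structure declared below can be recovered from
    the term. *)
Definition density_measure (mf : measurable_fun setT f) (f0 : forall x, 0 <= f x)
  (A : set T) : \bar R := (\int[mu]_(x in A) (f x)%:E)%E.

Let dens := density_measure mf f0.

Let dens0 : dens set0 = 0%E. Proof. exact: integral_set0. Qed.

Let dens_ge0 A : (0 <= dens A)%E. Proof. by apply: integral_ge0 => x _; rewrite lee_fin. Qed.

Let dens_sigma_additive : semi_sigma_additive dens.
Proof.
move=> /= F mF tF mUF; rewrite /dens /density_measure; apply: cvg_toP.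
  apply: ereal_nondecreasing_is_cvgn => m n mn.
  apply: lee_sum_nneg_natr => // k _ _.
  by apply: integral_ge0 => x _; rewrite lee_fin.
rewrite ge0_integral_bigcup//.
- exact/measurable_EFinP/measurable_funTS.
- by move=> x _; rewrite lee_fin.
Qed.

HB.instance Definition _ := isMeasure.Build _ _ _ (density_measure mf f0)
  dens0 dens_ge0 dens_sigma_additive.

Import HBNNSimple.

Let integral_density_nnsfun (h : {nnsfun T >-> R}) :
  (\int[dens]_x (h x)%:E = \int[mu]_x ((h x)%:E * (f x)%:E))%E.
Proof.
under [LHS]eq_integral do rewrite fimfunE -fsumEFin//.
rewrite [LHS]ge0_integral_fsum//; last 2 first.
  - by move=> r; exact/measurable_EFinP/measurableT_comp.
  - by move=> n x _; rewrite EFinM nnfun_muleindic_ge0.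
under [RHS]eq_integral.
  move=> x xD; rewrite fimfunE -fsumEFin// ge0_mule_fsuml; last first.
    by move=> r; rewrite EFinM nnfun_muleindic_ge0.
  over.
rewrite [RHS]ge0_integral_fsum//; last 2 first.
  - move=> r; apply: emeasurable_funM; last exact/measurable_EFinP.
    by apply/measurable_EFinP; do 2 apply/measurableT_comp => //.
  - move=> n x _; apply: mule_ge0; last by rewrite lee_fin.
    by rewrite EFinM nnfun_muleindic_ge0.
apply: eq_fsbigr => r _.
have mr : measurable (h @^-1` [set r]) by exact: measurable_sfunP.
under [RHS]eq_integral do rewrite EFinM -muleA.
have [r0|r0] := ltP r 0.
  rewrite preimage_nnfun0//.
  under eq_integral do rewrite indic0 mulr0.
  under [RHS]eq_integral do rewrite indic0 mul0e mule0.
  by rewrite !integral0.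
rewrite [RHS]ge0_integralZl//; last 2 first.
  - by apply: emeasurable_funM; exact/measurable_EFinP.
  - by move=> x _; rewrite mule_ge0// lee_fin.
under [LHS]eq_integral do rewrite EFinM.
rewrite [LHS]ge0_integralZl//; last exact/measurable_EFinP/measurable_indic.
congr (_ * _)%E.
rewrite integral_indic// setIT.
transitivity (\int[mu]_(x in h @^-1` [set r]) (f x)%:E)%E; first by [].
rewrite integral_mkcond; apply: eq_integral => x _; rewrite patchE indicE.
by case: ifPn => xr; rewrite ?mul1e ?mul0e.
Qed.

Lemma ge0_integral_density (h : T -> \bar R) : measurable_fun setT h ->
  (forall x, 0 <= h x)%E -> (\int[dens]_x h x = \int[mu]_x (h x * (f x)%:E))%E.
Proof.
move=> mh h0; pose h_ := nnsfun_approx measurableT mh.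
transitivity (lim (\int[dens]_x (h_ n x)%:E @[n --> \oo])%E).
  rewrite -monotone_convergence//=.
  - apply: eq_integral => ? /[!inE] xD; apply/esym/cvg_lim => //=.
    exact: cvg_nnsfun_approx.
  - by move=> n; exact/measurable_EFinP/measurable_funTS.
  - by move=> n ? _; rewrite lee_fin.
  - by move=> ? _ ? ? mn; rewrite lee_fin; exact/lefP/nd_nnsfun_approx.
transitivity (lim (\int[mu]_x ((h_ n x)%:E * (f x)%:E) @[n --> \oo])%E).
  by congr (lim _); apply/funext => A; under eq_fun do rewrite integral_density_nnsfun.
rewrite -monotone_convergence//=.
- apply: eq_integral => x _; apply/cvg_lim => //=.
  have cx := cvg_nnsfun_approx measurableT mh (fun x _ => h0 x) (I : setT x).
  exact: cvgeZr.
- by move=> n; apply: emeasurable_funM; exact/measurable_EFinP.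
- by move=> n x _; rewrite mule_ge0// lee_fin.
- move=> x _ m n mn; apply: lee_wpmul2r; first by rewrite lee_fin.
  by rewrite lee_fin; exact/lefP/nd_nnsfun_approx.
Qed.

End density.

Section sigma_algebras.
Variables (R : realType) (T : Type).
Implicit Types (S G : set (set T)) (f : T -> R).

Lemma sigma_algebra_setT S : sigma_algebra setT S -> S setT.
Proof. by move=> [S0 SC _]; rewrite -(setD0 setT); exact: SC. Qed.

Lemma sigma_algebra_setC S A : sigma_algebra setT S -> S A -> S (~` A).
Proof. by move=> [_ SC _] SA; rewrite -setTD; exact: SC. Qed.

Lemma sigma_algebra_bigcap S (A : nat -> set T) : sigma_algebra setT S ->
  (forall n, S (A n)) -> S (\bigcap_n A n).
Proof.
move=> sS SA; rewrite -(setCK (\bigcap_n A n)) setC_bigcap.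
apply: sigma_algebra_setC => //; case: (sS) => _ _; apply => n.
exact: sigma_algebra_setC.
Qed.

Lemma sigma_algebra_setI S A B : sigma_algebra setT S -> S A -> S B -> S (A `&` B).
Proof.
move=> sS SA SB; rewrite -bigcap2E; apply: sigma_algebra_bigcap => // -[|[|n]] //=.
exact: sigma_algebra_setT.
Qed.

Lemma preimage_sigma_algebra S f : sigma_algebra setT S ->
  (forall x, S [set w | x < f w]) -> forall B, measurable B -> S (f @^-1` B).
Proof.
move=> sS Sf B; have [S0 SC SU] := sS.
suff h : @measurable _ (measurableTypeR R) `<=` [set B | S (f @^-1` B)] by exact: h.
rewrite [X in X `<=` _](RGenOInfty.measurableE R).
apply: smallest_sub; last first.
  move=> _ [x ->] /=; suff -> : f @^-1` `]x, +oo[ = [set w | x < f w] by exact: Sf.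
  by apply/seteqP; split=> w /=; rewrite in_itv/= andbT.
split => /=.
- by rewrite preimage_set0.
- by move=> A SA; exact: SC.
- by move=> F SF; rewrite preimage_bigcup; exact: SU.
Qed.

End sigma_algebras.

Section indicator_approximation.
Variable R : realType.
Implicit Types (x c : R) (k : nat).

(* 1 - (1 - x^n)^K tends to the indicator of [c < x] when K grows like c^-n,
   up to a factor making x = c converge to 0. *)
Definition step_exponent c k := Num.truncn ((c ^+ (k * k))^-1 / k.+1%:R).

Definition step_poly c k x := 1 - (1 - x ^+ (k * k)) ^+ step_exponent c k.

Lemma bernoulli_ineq (h : R) n : -1 <= h -> 1 + n%:R * h <= (1 + h) ^+ n.
Proof.
move=> h1; elim: n => [|n IH]; first by rewrite mul0r addr0 expr0.
rewrite exprS; have h0 : 0 <= 1 + h by lra.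
apply: le_trans (ler_wpM2l h0 IH); rewrite -natr1.
have : 0 <= n%:R * (h * h) by rewrite mulr_ge0 // -expr2 sqr_ge0.
by lra.
Qed.

Lemma step_poly_bound c k x : 0 <= x <= 1 -> 0 <= step_poly c k x <= 1.
Proof.
move=> /andP[x0 x1].
have y0 : 0 <= 1 - x ^+ (k * k) <= 1.
  by rewrite subr_ge0 exprn_ile1//= gerBl exprn_ge0.
by rewrite /step_poly subr_ge0 gerBl exprn_ge0 ?exprn_ile1//; case/andP: y0.
Qed.

Lemma cvg_step_poly c x : 0 < c -> 0 <= x <= 1 ->
  step_poly c k x @[k --> \oo] --> ((c < x)%R%:R : R).
Proof.
move=> c0 /andP[x0 x1].
have y01 k : 0 <= x ^+ (k * k) <= 1 by rewrite exprn_ge0 ?exprn_ile1.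
have cn0 k : 0 < c ^+ (k * k) by exact: exprn_gt0.
have tr k : 0 <= (c ^+ (k * k))^-1 / k.+1%:R.
  by rewrite divr_ge0// invr_ge0 ltW.
have [cx|xc] := ltP c x.
(* [C] is chosen so that (k + 1)^2 <= 2 + 2 k^2 <= C (1 + k^2 h). *)
- pose h := x / c - 1; pose C := 2 + 2 / h.
  have h0 : 0 < h by rewrite subr_gt0 ltr_pdivlMr// mul1r.
  have C0 : 0 < C by rewrite addr_gt0// divr_gt0.
  have key k : 1 - C * k.+1%:R^-1 <= step_poly c k x <= 1.
    have /andP[_ ->] := step_poly_bound c k (introT andP (conj x0 x1)).
    rewrite andbT /step_poly lerD2l lerN2.
    set y := x ^+ (k * k); set K := step_exponent c k.
    have /andP[y0 y1] : 0 <= y <= 1 by exact: y01.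
    have p0 : 0 <= (1 - y) ^+ K by rewrite exprn_ge0// subr_ge0.
    have e1 : (1 - y) ^+ K * (1 + K%:R * y) <= 1.
      apply: (@le_trans _ _ ((1 - y) ^+ K * (1 + y) ^+ K)).
        by rewrite ler_wpM2l// bernoulli_ineq//; lra.
      rewrite -exprMn exprn_ile1//; first by nra.
      by have := sqr_ge0 y; rewrite expr2; lra.
    (* Bernoulli's inequality gives (x / c)^(k^2) a growth of order k^2, which beats the divisor k +
       1: this is why the exponent is a square. *)
    have e2 : (1 + (k * k)%:R * h) / k.+1%:R <= 1 + K%:R * y.
      have : (c ^+ (k * k))^-1 / k.+1%:R < K.+1%:R by exact: truncnS_gt.
      have e3 : 1 + (k * k)%:R * h <= y / c ^+ (k * k).
        rewrite -expr_div_n (_ : x / c = 1 + h); last by rewrite /h; lra.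
        by apply: bernoulli_ineq; lra.
      move=> e4; apply: (@le_trans _ _ (y / c ^+ (k * k) / k.+1%:R)).
        by rewrite ler_wpM2r// invr_ge0.
      apply: (@le_trans _ _ (y * K.+1%:R)).
        by rewrite -mulrA ler_wpM2l// ltW.
      by rewrite -natr1 mulrDr mulr1; lra.
    have e5 : (1 - y) ^+ K * (1 + (k * k)%:R * h) <= k.+1%:R.
      have := le_trans (ler_wpM2l p0 e2) e1.
      by rewrite mulrA ler_pdivrMr// mul1r.
    rewrite ler_pdivlMr//.
    have k1 : 0 < k.+1%:R :> R by [].
    have e6 : k.+1%:R * k.+1%:R <= C * (1 + (k * k)%:R * h).
      have -> : C * (1 + (k * k)%:R * h) =
          2 + 2 * (k * k)%:R + (2 / h + 2 * ((k * k)%:R * h)).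
        by rewrite /C; field; rewrite gt_eqF.
      have : 0 <= 2 / h + 2 * ((k * k)%:R * h).
        by rewrite addr_ge0 ?divr_ge0 ?mulr_ge0 ?(ltW h0).
      have := sqr_ge0 (k%:R - 1 : R).
      by rewrite -natr1 natrM expr2; nra.
    rewrite -(ler_pM2r k1) -mulrA; apply: (le_trans (ler_wpM2l p0 e6)).
    by rewrite mulrCA ler_wpM2l// ltW.
  have cC : 1 - C * k.+1%:R^-1 @[k --> \oo] --> (1 : R).
    rewrite -[X in _ --> X]subr0 -(mulr0 C); apply: cvgB; first exact: cvg_cst.
    by apply: cvgMr; exact: cvg_harmonic.
  apply: (squeeze_cvgr _ cC); last exact: cvg_cst.
  by apply: nearW => k; rewrite key.
- have key k : 0 <= step_poly c k x <= k.+1%:R^-1.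
    have /andP[-> _] := step_poly_bound c k (introT andP (conj x0 x1)).
    rewrite /= /step_poly; set y := x ^+ (k * k); set K := step_exponent c k.
    have /andP[y0 y1] : 0 <= y <= 1 by exact: y01.
    have e1 : 1 - K%:R * y <= (1 - y) ^+ K.
      have := @bernoulli_ineq (- y) K; rewrite mulrN; apply; lra.
    have e2 : K%:R <= (c ^+ (k * k))^-1 / k.+1%:R by rewrite truncn_le.
    have e3 : K%:R * y <= k.+1%:R^-1.
      apply: (le_trans (ler_wpM2r y0 e2)); rewrite mulrAC ler_piMl ?invr_ge0//.
      by rewrite mulrC ler_pdivrMr// mul1r lerXn2r// ?nnegrE// ltW.
    by apply: le_trans e3; rewrite lerBlDr addrC -lerBlDr.
  apply: (squeeze_cvgr (f := fun=> 0) (h := fun k => k.+1%:R^-1)).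
  + by apply: nearW => k; exact: key.
  + exact: cvg_cst.
  + exact: cvg_harmonic.
Qed.

End indicator_approximation.

(** * Mixed moments determine laws and independence *)

Section moment_uniqueness.
Context d (T : measurableType d) (R : realType) (I : Type).
Variables (m1 m2 : {finite_measure set T -> \bar R}) (f1 f2 : T -> R) (V : I -> T -> R).
Hypotheses (bf1 : bounded_measurable f1) (bf2 : bounded_measurable f2).
Hypotheses (mV : forall i, measurable_fun setT (V i)) (V01 : forall i w, 0 <= V i w <= 1).

Let same (h : T -> R) := \int[m1]_w (f1 w * h w) = \int[m2]_w (f2 w * h w).

Let sameB g h : bounded_measurable g -> bounded_measurable h -> same g -> same h ->
  same (fun w => g w - h w).
Proof.
move=> bg bh sg sh; rewrite /same.
under eq_Rintegral do rewrite mulrBr.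
under [RHS]eq_Rintegral do rewrite mulrBr.
by rewrite !bmf_intB ?sg ?sh//; exact: bmfM.
Qed.

Let same_cvg (h_ : nat -> T -> R) (h : T -> R) (M : R) :
  (forall n, measurable_fun setT (h_ n)) -> measurable_fun setT h ->
  (forall n w, `|h_ n w| <= M) -> (forall w, h_ n w @[n --> \oo] --> h w) ->
  (forall n, same (h_ n)) -> same h.
Proof.
move=> mh_ mh hM ch sh.
have c (m : {finite_measure set T -> \bar R}) f : bounded_measurable f ->
    \int[m]_w (f w * h_ n w) @[n --> \oo] --> \int[m]_w (f w * h w).
  move=> [mf [N fN]].
  apply: (@bmf_int_cvg _ _ _ m _ _ (N * M)).
  - by move=> n; exact: measurable_funM.
  - exact: measurable_funM.
  - by move=> n w; rewrite normrM ler_pM.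
  - by apply: aeW => w; apply: cvgMr; exact: ch.
apply: (seq_cvg_unique (c m1 f1 bf1)).
apply: cvg_trans (c m2 f2 bf2); apply: near_eq_cvg.
by apply: nearW => n; rewrite sh.
Qed.

Let mono (s : seq I) w := \prod_(i <- s) V i w.
Let ind (L : seq (I * R)) w : R := \prod_(p <- L) ((p.2 < V p.1 w)%R%:R : R).

Let bV i : bounded_measurable (V i). Proof. exact: bmf01. Qed.

Let bind1 (p : I * R) : bounded_measurable (fun w => ((p.2 < V p.1 w)%R%:R : R)).
Proof.
have -> : (fun w => ((p.2 < V p.1 w)%R%:R : R)) = \1_[set w | p.2 < V p.1 w].
  by apply/funext => w; rewrite indicE mem_setE.
apply: bmf_indic; rewrite -[X in measurable X]setTI.
by apply: (measurable_fun_ltr (measurable_cst _) (mV _)) => //.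
Qed.

Hypothesis same_mono : forall s, same (mono s).

(** Induction on [L]: for one more pair (i, c), the step polynomials in V_i have matching integrals,
    being polynomials, and converge boundedly to the indicator of c < V_i. *)
Let same_ind L s : all (fun p => 0 < p.2) L -> same (fun w => ind L w * mono s w).
Proof.
elim: L s => [|[i c] L IH] s /=.
  move=> _; have := same_mono s; congr same; apply/funext => w.
  by rewrite /ind big_nil mul1r.
move=> /andP[c0 L0].
have bI : bounded_measurable (ind L) by apply: bmf_prod => p; exact: bind1.
have bm t : bounded_measurable (mono t) by apply: bmf_prod => j; exact: bV.
have bp n K : bounded_measurable (fun w => (1 - V i w ^+ n) ^+ K).
  by apply: bmfX; apply: bmfB; [exact: bmf_cst|exact: bmfX].
have pw n K t : same (fun w => ind L w * ((1 - V i w ^+ n) ^+ K * mono t w)).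
  elim: K t => [|K IHK] t.
    by have := IH t L0; congr same; apply/funext => w; rewrite expr0 mul1r.
  rewrite [X in same X](_ : _ = (fun w =>
      ind L w * ((1 - V i w ^+ n) ^+ K * mono t w) -
      ind L w * ((1 - V i w ^+ n) ^+ K * mono (nseq n i ++ t) w))); last first.
    apply/funext => w; rewrite exprS /mono big_cat/= big_nseq iter_mulr_1.
    by ring.
  by apply: sameB => //; apply: bmfM => //; exact: bmfM.
apply: (same_cvg (h_ := fun k w => ind L w * (step_poly c k (V i w) * mono s w)) (M := 1)).
- move=> n; apply: (bmfM bI _).1; apply: bmfM => //.
  by apply: bmfB => //; exact: bmf_cst.
- by apply: (bmfM _ (bm s)).1; apply: bmf_prod => p; exact: bind1.
- move=> n w; rewrite !normrM.
  have i1 : `|ind L w| <= 1.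
    rewrite /ind; elim/big_ind : _ => //; rewrite ?normr1//.
      by move=> x y x1 y1; rewrite normrM mulr_ile1.
    by move=> p _; case: (_ < _); rewrite ?normr1 ?normr0.
  have i2 : `|mono s w| <= 1.
    rewrite /mono; elim/big_ind : _ => //; rewrite ?normr1//.
      by move=> x y x1 y1; rewrite normrM mulr_ile1.
    by move=> j _; have /andP[a b] := V01 j w; rewrite ger0_norm.
  have i3 : `|step_poly c n (V i w)| <= 1.
    by have /andP[a b] := step_poly_bound c n (V01 i w); rewrite ger0_norm.
  by rewrite !mulr_ile1 ?mulr_ge0.
- move=> w; have -> : ind ((i, c) :: L) w * mono s w =
      ind L w * ((c < V i w)%R%:R * mono s w) by rewrite /ind big_cons /=; ring.
  apply: cvgMr; apply: cvgMl.
  exact: cvg_step_poly.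
- move=> n.
  rewrite [X in same X](_ : _ = (fun w => ind L w * mono s w -
      ind L w * ((1 - V i w ^+ (n * n)) ^+ step_exponent c n * mono s w))).
    by apply: sameB => //; [exact: bmfM|apply: bmfM => //; exact: bmfM|exact: IH].
  by apply/funext => w; rewrite /step_poly; ring.
Qed.

(** Thresholds are positive because [cvg_step_poly] asks for 0 < c; these sets still generate, the
    threshold 0 being a countable union of them. *)
Let G : set (set T) := [set A | exists2 L : seq (I * R), all (fun p => 0 < p.2) L &
  A = [set w | all (fun p => p.2 < V p.1 w) L]].

Let indE L : ind L = \1_[set w | all (fun p => p.2 < V p.1 w) L].
Proof.
apply/funext => w; rewrite indicE mem_setE /ind.
elim: L => [|p L IH]; rewrite ?big_nil// big_cons IH /=.
by rewrite -natrM mulnb.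
Qed.

Let Gm : G `<=` measurable.
Proof.
move=> A [L _ ->]; have : measurable_fun setT (ind L) by exact: (bmf_prod _ _ bind1).1.
by rewrite indE => /measurable_indicP.
Qed.

Lemma sigma_family_sub : <<s \bigcup_i sigma_RV (V i) >> `<=` <<s G >>.
Proof.
have sG : sigma_algebra setT <<s G >> by exact: smallest_sigma_algebra.
apply: smallest_sub => // _ [i _ [B mB <-]]; rewrite setTI.
have pos x : 0 < x -> <<s G >> [set w | x < V i w].
  move=> x0; apply: sub_sigma_algebra; exists [:: (i, x)] => /=; first by rewrite x0.
  by apply/seteqP; split=> w /=; rewrite andbT.
apply: preimage_sigma_algebra => // x.
have [x0|x0|->] := ltgtP x 0.
- rewrite (_ : [set _ | _] = setT); first exact: sigma_algebra_setT.
  by apply/seteqP; split=> w //= _; have /andP[+ _] := V01 i w; exact: lt_le_trans.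
- exact: pos.
- rewrite (_ : [set _ | _] = \bigcup_n [set w | n.+1%:R^-1 < V i w]).
    by case: sG => _ _; apply => n; apply: pos; rewrite invr_gt0.
  apply/seteqP; split=> w /= => [Vw|[n _]]; last exact: lt_trans.
  have [n _ /(_ n (leqnn _))] : \forall n \near \oo, n.+1%:R^-1 < V i w.
    by have := @cvg_harmonic R => /cvgr_lt; apply.
  by exists n.
Qed.

(** Dynkin's lemma. The weights [f1] and [f2] serve the proof of independence, where the first one
    involves the other family of variables and the second one is a constant. *)
Lemma moment_uniqueness A : <<s \bigcup_i sigma_RV (V i) >> A ->
  \int[m1]_w (f1 w * \1_A w) = \int[m2]_w (f2 w * \1_A w).
Proof.
move=> /sigma_family_sub; move: A.
suff : <<s G >> `<=` [set A | measurable A /\ same \1_A] by move=> h A /h[].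
apply: lambda_system_subset => //.
- move=> A B [L L0 ->] [L' L'0 ->]; exists (L ++ L'); first by rewrite all_cat L0.
  by apply/seteqP; split=> w /=; rewrite all_cat => /andP.
- split => //.
  + split => //; have := same_mono [::]; congr same; apply/funext => w.
    by rewrite /mono big_nil indicT.
  + move=> A B BA [mA sA] [mB sB]; split; first exact: measurableD.
    rewrite (_ : \1_(A `\` B) = fun w => \1_A w - \1_B w).
      by apply: sameB => //; exact: bmf_indic.
    apply/funext => w; rewrite !indicE in_setD.
    have [wB|wB] := boolP (w \in B); last by rewrite andbT subr0.
    by rewrite (mem_set (BA _ (set_mem wB))) subrr.
  + move=> A_ ndA hA; have mU : measurable (\bigcup_n A_ n).
      by apply: bigcup_measurable => k _; exact: (hA k).1.
    split => //; apply: (same_cvg (h_ := fun n => \1_(A_ n)) (M := 1)).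
    * by move=> n; apply: measurable_indic; exact: (hA n).1.
    * exact: measurable_indic.
    * by move=> n w; rewrite indicE; case: (_ \in _); rewrite ?normr1 ?normr0.
    * move=> w; have [[n _ Anw]|nw] := pselect ((\bigcup_n A_ n) w).
        apply: cvg_near_cst; exists n => // m /= nm.
        rewrite !indicE !mem_set//; first by exists n.
        by move: w Anw; exact/subsetPset/ndA.
      apply: cvg_near_cst; apply: nearW => n.
      by rewrite !indicE !memNset//; contra: nw => ?; exists n.
    * by move=> n; exact: (hA n).2.
- move=> A GA; split; first exact: Gm.
  case: GA => L L0 ->; have := same_ind [::] L0; congr same; apply/funext => w.
  by rewrite /mono big_nil mulr1 indE.
Qed.

End moment_uniqueness.

Section moments_independence.
Context (R : realType) d (T : measurableType d) (P : probability T R) (I J : Type).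
Variables (V : I -> T -> R) (W : J -> T -> R).
Hypotheses (mV : forall i, measurable_fun setT (V i)) (V01 : forall i w, 0 <= V i w <= 1).
Hypotheses (mW : forall i, measurable_fun setT (W i)) (W01 : forall i w, 0 <= W i w <= 1).

Lemma sigma_family_measurable (K : Type) (F : K -> T -> R) :
  (forall i, measurable_fun setT (F i)) ->
  <<s \bigcup_i sigma_RV (F i) >> `<=` @measurable d T.
Proof.
move=> mF; apply: sigma_generated_measurable => _ [i _ [B mB <-]].
exact: mF.
Qed.

(** Uniqueness is applied twice: monomials in V are replaced by A with a monomial in W as weight,
    then monomials in W by B with the indicator of A as weight. *)
Lemma moments_independence : (forall s t,
    \int[P]_w (\prod_(i <- s) V i w * \prod_(j <- t) W j w) =
    \int[P]_w (\prod_(i <- s) V i w) * \int[P]_w (\prod_(j <- t) W j w)) ->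
  independent_classes P <<s \bigcup_i sigma_RV (V i) >> <<s \bigcup_j sigma_RV (W j) >>.
Proof.
move=> h A B FA GB.
have bV s : bounded_measurable (fun w => \prod_(i <- s) V i w).
  by apply: bmf_prod => i; exact: bmf01.
have bW t : bounded_measurable (fun w => \prod_(j <- t) W j w).
  by apply: bmf_prod => j; exact: bmf01.
have mA := sigma_family_measurable mV FA; have mB := sigma_family_measurable mW GB.
have e1 t : \int[P]_w (\prod_(j <- t) W j w * \1_A w) =
    \int[P]_w (\int[P]_w (\prod_(j <- t) W j w) * \1_A w).
  refine (@moment_uniqueness _ _ _ _ P P (fun w => \prod_(j <- t) W j w)
    (fun=> \int[P]_w (\prod_(j <- t) W j w)) V (bW t) (bmf_cst _ _) mV V01 _ A FA) => s.
  rewrite bmf_intZ// mulrC -h; apply: eq_Rintegral => w _.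
  by rewrite mulrC.
have e2 : \int[P]_w (\1_A w * \1_B w : R) = \int[P]_w (fine (P A) * \1_B w).
  refine (@moment_uniqueness _ _ _ _ P P \1_A (fun=> fine (P A)) W
    (bmf_indic _ mA) (bmf_cst _ _) mW W01 _ B GB) => t.
  rewrite bmf_intZ// -bmf_int_indic// [RHS]mulrC -bmf_intZ; last exact: bmf_indic.
  by rewrite -e1; apply: eq_Rintegral => w _; rewrite mulrC.
have fP X : measurable X -> P X \is a fin_num by move=> ?; rewrite fin_num_measure.
rewrite -[LHS]fineK ?fP//; last exact: measurableI.
rewrite -(fineK (fP _ mA)) -(fineK (fP _ mB)) -EFinM; congr (_%:E).
rewrite -bmf_int_indic; last exact: measurableI.
rewrite -[fine (P B)]bmf_int_indic// -bmf_intZ; last exact: bmf_indic.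
rewrite -e2; apply: eq_Rintegral => w _.
by rewrite indicI.
Qed.

End moments_independence.

Lemma moments_distribution (R : realType) d1 (T1 : measurableType d1)
    d2 (T2 : measurableType d2) (P1 : probability T1 R) (P2 : probability T2 R)
    (X1 : T1 -> R) (X2 : T2 -> R) :
  measurable_fun setT X1 -> measurable_fun setT X2 ->
  (forall w, 0 <= X1 w <= 1) -> (forall w, 0 <= X2 w <= 1) ->
  (forall k, \int[P1]_w (X1 w ^+ k) = \int[P2]_w (X2 w ^+ k)) ->
  forall B, measurable B -> P1 (X1 @^-1` B) = P2 (X2 @^-1` B).
Proof.
move=> mX1 mX2 X101 X201 h B mB.
pose F1 : {mfun T1 >-> R} := HB.pack X1 (isMeasurableFun.Build _ _ _ _ X1 mX1).
pose F2 : {mfun T2 >-> R} := HB.pack X2 (isMeasurableFun.Build _ _ _ _ X2 mX2).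
(* The laws live on R, whereas uniqueness is stated for variables with values in [0, 1]; clipping is
   the identity on the ranges of [X1] and [X2]. *)
pose clip (x : R) := Num.max 0 (Num.min 1 x).
have mclip : measurable_fun setT clip.
  apply: measurable_maxr; first exact: measurable_cst.
  by apply: measurable_minr => //; exact: measurable_cst.
have clip01 x : 0 <= clip x <= 1.
  by rewrite /clip le_max lexx /= ge_max ler01 ge_min lexx.
have clip_id x : 0 <= x <= 1 -> clip x = x.
  by move=> /andP[x0 x1]; rewrite /clip min_r// max_r.
have e d (T : measurableType d) (P : probability T R) (F : {mfun T >-> R}) k :
    (forall w, 0 <= F w <= 1) ->
    \int[distribution P F]_x (clip x ^+ k) = \int[P]_w (F w ^+ k).
  move=> F01; rewrite /Rintegral ge0_integral_distribution//=.
  - by congr fine; apply: eq_integral => w _ /=; rewrite clip_id.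
  - by apply/measurable_EFinP; exact: measurable_funX.
  - by move=> x; rewrite lee_fin exprn_ge0//; case/andP: (clip01 x).
have mcB : measurable (clip @^-1` B).
  by rewrite -[X in measurable X]setTI; exact: mclip.
have : \int[distribution P1 F1]_x (1 * \1_(clip @^-1` B) x : R) =
       \int[distribution P2 F2]_x (1 * \1_(clip @^-1` B) x).
  apply: (@moment_uniqueness _ _ _ unit (distribution P1 F1) (distribution P2 F2)
      (fun=> 1) (fun=> 1) (fun=> clip)) => //.
  - exact: bmf_cst.
  - exact: bmf_cst.
  - move=> s; under eq_Rintegral do rewrite mul1r big_const_seq count_predT iter_mulr_1.
    under [RHS]eq_Rintegral do rewrite mul1r big_const_seq count_predT iter_mulr_1.
    by rewrite !e// h.
  - by apply: sub_sigma_algebra; exists tt => //; exists B => //; rewrite setTI.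
under eq_Rintegral do rewrite mul1r.
under [X in _ = X -> _]eq_Rintegral do rewrite mul1r.
rewrite !bmf_int_indic//.
have fP d (T : measurableType d) (P : probability T R) X : measurable X -> P X \is a fin_num.
  by move=> ?; rewrite fin_num_measure.
move=> eq12; have := congr1 EFin eq12; rewrite !fineK ?fP//.
have pE d (T : measurableType d) (X : T -> R) : (forall w, 0 <= X w <= 1) ->
    X @^-1` (clip @^-1` B) = X @^-1` B.
  by move=> X01; apply/seteqP; split=> w /=; rewrite clip_id.
by rewrite -[in X in _ -> X](pE _ _ X1)// -[in X in _ -> X](pE _ _ X2).
Qed.

(** * The moment problem *)

Section random_bits.
Variables (R : realType) (p : seq bool -> R).
Hypotheses (p_ge0 : forall b, 0 <= p b) (p_nil : p [::] = 1).
Hypothesis p_cons : forall b, p (true :: b) + p (false :: b) = p b.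

(* Histories are listed backwards. The history [b] occupies an interval of
   length [p b] of [0, 1[, the bit [false] to the left of the bit [true]. *)
Let left_end := fix F (b : seq bool) : R :=
  if b is c :: b' then (if c then F b' + p (false :: b') else F b') else 0.

Let hist := fix F n (x : R) : seq bool :=
  if n is n'.+1 then let b := F n' x in (left_end b + p (false :: b) <= x) :: b
  else [::].

Let size_hist n x : size (hist n x) = n.
Proof. by elim: n => //= n ->. Qed.

Let hist_itv n x b : 0 <= x < 1 -> size b = n ->
  (hist n x = b) <-> (left_end b <= x < left_end b + p b).
Proof.
move=> x01; elim: n b => [|n IH] [|c b]//=; first by move=> _; rewrite p_nil add0r.
move=> [sb]; split.
  move=> [<- hb]; have := (IH _ sb).1 hb; rewrite hb => /andP[h1 h2].
  case: (leP (left_end b + p (false :: b)) x) => h3; rewrite ?h3 ?h1//=.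
  by rewrite -addrA [p _ + _]addrC p_cons.
move=> h; have hb : hist n x = b.
  apply/(IH _ sb); case: c h => /andP[h1 h2]; last first.
    by rewrite h1/= (lt_le_trans h2)// lerD2l -(p_cons b) lerDr.
  rewrite (le_trans _ h1) ?lerDl//=.
  by rewrite (lt_le_trans h2)// -addrA lerD2l addrC p_cons.
rewrite hb; congr cons; case: c h => /andP[h1 h2]; first by rewrite h1.
by apply/negbTE; rewrite -ltNge.
Qed.

Let left_end_bounds b : 0 <= left_end b /\ left_end b + p b <= 1.
Proof.
elim: b => [|c b [h1 h2]]; first by rewrite /= p_nil add0r.
case: c => /=.
  by rewrite addr_ge0// -addrA [p _ + _]addrC p_cons.
by split=> //; apply: le_trans h2; rewrite lerD2l -(p_cons b) lerDr.
Qed.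

Local Notation U := (uniform_prob (@ltr01 R) : probability (measurableTypeR R) R).

Let measurable_hist n b : measurable [set x | hist n x = b].
Proof.
elim: n b => [|n IH] b /=.
  have [->|b0] := eqVneq b [::].
    by rewrite (_ : [set _ | _] = setT)//; apply/seteqP; split.
  rewrite (_ : [set _ | _] = set0)//; apply/seteqP; split => // x /= h.
  by rewrite -h eqxx in b0.
case: b => [|c b]; first by rewrite (_ : [set _ | _] = set0)//; apply/seteqP; split.
rewrite (_ : [set _ | _] = [set x | hist n x = b] `&`
    [set x | (left_end b + p (false :: b) <= x) = c]).
  apply: measurableI => //.
  have [->|->] : ([set x | (left_end b + p (false :: b) <= x) = c] =
      `[left_end b + p (false :: b), +oo[%classic) \/
      ([set x | (left_end b + p (false :: b) <= x) = c] =
      `]-oo, left_end b + p (false :: b)[%classic).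
  - case: c; [left|right]; apply/seteqP; split=> x /=; rewrite in_itv /= ?andbT//.
      by move=> /negbT; rewrite -ltNge.
    by move=> h; apply/negbTE; rewrite -ltNge.
  - exact: measurable_itv.
  - exact: measurable_itv.
by apply/seteqP; split=> x /= => [[<- hb]|[-> ->]//]; rewrite hb.
Qed.

Let prob_hist n b : size b = n -> U [set x | hist n x = b] = (p b)%:E.
Proof.
move=> sb; have mH := @measurable_hist n b.
transitivity (\int[U]_x (\1_[set x | hist n x = b] x)%:E)%E.
  by rewrite integral_indic// setIT.
rewrite integral_uniform//; last exact/measurable_EFinP/measurable_indic.
(* [hist_itv] is only available on [0, 1[, so the null point 1 is removed. *)
rewrite subr0 invr1 mul1e -integral_itv_bndo_bndc; last first.
  by apply/measurable_EFinP/measurable_funTS; exact: measurable_indic.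
rewrite integral_indic//.
have [h1 h2] := left_end_bounds b.
rewrite (_ : _ `&` _ = `[left_end b, left_end b + p b[%classic).
  apply: (etrans (lebesgue_measure_itv `[left_end b, left_end b + p b[)).
  rewrite /= lte_fin.
  case: ltP => h3; first by rewrite -EFinD addrAC subrr add0r.
  by congr (_%:E); have := p_ge0 b; lra.
apply/seteqP; split=> x /=; rewrite !in_itv/=.
  by move=> [h x01]; apply/(hist_itv x01 sb).
move=> h; have x01 : 0 <= x < 1.
  by case/andP: h => h3 h4; rewrite (le_trans h1 h3) (lt_le_trans h4 h2).
by split=> //; apply/(hist_itv x01 sb).
Qed.

(** A single uniform point carries the whole sequence: its bits are the address of the nested
    intervals that contain it. *)
Lemma random_bits : exists B : nat -> measurableTypeR R -> bool,
  (forall n, measurable [set x | B n x]) /\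
  (forall b, measurable [set x | mkseq (B^~ x) (size b) = rev b] /\
    U [set x | mkseq (B^~ x) (size b) = rev b] = (p b)%:E).
Proof.
exists (fun n x => head false (hist n.+1 x)).
have mk n x : mkseq (fun k => head false (hist k.+1 x)) n = rev (hist n x).
  elim: n => // n IH.
  by rewrite [RHS]/= rev_cons -IH /mkseq -cats1 -[in LHS]addn1 iotaD map_cat.
have inj n b : [set x | rev (hist n x) = rev b] = [set x | hist n x = b].
  by apply/seteqP; split=> x /= => [/(can_inj revK)|->].
split=> [n|b].
  have -> : [set x | head false (hist n.+1 x)] =
      \bigcup_(b : seq bool) (if head false b then [set x | hist n.+1 x = b] else set0).
    apply/seteqP; split=> x => [h|[b _ /=]]; first by exists (hist n.+1 x) => //; rewrite h.
    by case: ifP => // hb /= h; rewrite -h in hb.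
  apply: countable_bigcupT_measurable => [|b]; first exact: countableP.
  by case: ifP => // _; exact: measurable_hist.
under eq_set do rewrite mk.
by rewrite inj; split; [exact: measurable_hist|exact: prob_hist].
Qed.

End random_bits.

Section almost_sure_convergence.
Context d (T : measurableType d) (R : realType) (P : probability T R).

(* |f_k| <= 2^-k + 2^k f_k^2, and the right-hand side is summable almost surely. *)
Lemma ae_cvg_of_square (S : nat -> T -> R) :
  (forall n, bounded_measurable (S n)) ->
  (forall k, \int[P]_w ((S k.+1 w - S k w) ^+ 2) <= (8 ^+ k)^-1) ->
  {ae P, forall w, cvg (S n w @[n --> \oo])}.
Proof.
move=> bS ES.
pose f k w := S k.+1 w - S k w.
have bf k : bounded_measurable (f k) by exact: bmfB.
pose g k w := 2 ^+ k * f k w ^+ 2.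
have bg k : bounded_measurable (g k) by apply: bmfZ; exact: bmfX.
have g0 k w : 0 <= g k w by rewrite mulr_ge0 ?sqr_ge0 ?exprn_ge0.
pose G w := (\sum_(k <oo) (g k w)%:E)%E.
have mg k : measurable_fun setT (fun w => (g k w)%:E).
  by apply/measurable_EFinP; case: (bg k).
have mG : measurable_fun setT G.
  apply: (@ge0_emeasurable_sum _ _ _ setT (fun k w => (g k w)%:E) xpredT) => [k w _ _|k _].
    by rewrite lee_fin.
  exact: mg.
have G0 w : (0 <= G w)%E by apply: nneseries_ge0 => k _ _; rewrite lee_fin.
have half n : \sum_(0 <= k < n) 2^-1 ^+ k <= 2 :> R.
  have -> : \sum_(0 <= k < n) 2^-1 ^+ k = 2 - 2 * 2^-1 ^+ n :> R.
    elim: n => [|n IH]; first by rewrite big_geq// expr0; lra.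
    by rewrite big_nat_recr//= IH exprS; lra.
  by have : 0 <= 2^-1 ^+ n :> R by []; lra.
have iG : P.-integrable setT G.
  apply/integrableP; split => //.
  under eq_integral do rewrite gee0_abs//.
  rewrite /G integral_nneseries//; last by move=> k w _; rewrite lee_fin.
  apply: (@le_lt_trans _ _ (2 : R)%:E); last exact: ltry.
  apply: lime_le; first by apply: is_cvg_nneseries => k _ _; apply: integral_ge0 => w _; rewrite lee_fin.
  apply: nearW => n; apply: (@le_trans _ _ (\sum_(0 <= k < n) 2^-1 ^+ k)%:E); last first.
    by rewrite lee_fin.
  rewrite -sumEFin; apply: lee_sum => k _.
  rewrite bmf_integralE// lee_fin bmf_intZ; last exact: bmfX.
  apply: (le_trans (ler_wpM2l _ (ES k))); first by rewrite exprn_ge0.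
  rewrite -!exprVn -exprMn lerXn2r ?nnegrE ?mulr_ge0 ?invr_ge0//.
  by lra.
have := integrable_ae measurableT iG; apply: filterS => w /(_ I) Gw.
have hf k : `|f k w| <= 2^-1 ^+ k + g k w.
  rewrite /g; have e : 2^-1 ^+ k * 2 ^+ k = 1 :> R by rewrite -exprMn mulVf// expr1n.
  have a0 : 0 < 2 ^+ k :> R by rewrite exprn_gt0.
  have b0 : 0 < 2^-1 ^+ k :> R by rewrite exprn_gt0// invr_gt0.
  set A := 2 ^+ k in e a0 *; set B := 2^-1 ^+ k in e b0 *.
  have h : 0 <= (A * `|f k w| - 1) ^+ 2 by exact: sqr_ge0.
  have h2 : `|f k w| ^+ 2 = f k w ^+ 2 by rewrite real_normK// num_real.
  have n0 : 0 <= `|f k w| by [].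
  rewrite -h2 -(ler_pM2l a0) mulrDr [A * B]mulrC e.
  by rewrite expr2 in h *; nra.
have cs : cvgn (series (fun k => f k w)).
  apply: normed_cvg.
  apply: nondecreasing_is_cvgn.
    by apply: nondecreasing_series => k _ _ /=.
  exists (2 + fine (G w)) => _ [n _ <-].
  rewrite /series /=; apply: (le_trans (ler_sum _ (fun k _ => hf k))).
  rewrite big_split/=; apply: lerD.
    exact: half.
  rewrite -lee_fin fineK//.
  by rewrite -sumEFin; apply: nneseries_lim_ge => k _ _; rewrite lee_fin.
have -> : (fun n => S n w) = (fun n => S 0%N w + series (fun k => f k w) n).
  apply/funext => n; rewrite /series /= /f.
  by rewrite telescope_sumr// addrC subrK.
by apply: is_cvgD => //; exact: is_cvg_cst.
Qed.

End almost_sure_convergence.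

(** * Variables with prescribed mixed moments, as biases of coins *)

Section moment_problem.
Variables (R : realType) (I : countType) (a : seq I -> R).
Hypotheses (pa : positive_table a) (a_nil : a [::] = 1).

Let sa : symmetric_table a. Proof. by case: pa. Qed.

(* The bit of index [pickle (i, j)] is the [j]-th toss of the coin [i]; the bits
   whose index is not a code are always [true]. *)
Let coord (k : nat) : option I := omap fst (unpickle k : option (I * nat)).

Let ones := fix F (b : seq bool) : seq I :=
  if b is c :: b' then
    if coord (size b') is Some i then if c then i :: F b' else F b' else F b'
  else [::].

Let zeros := fix F (b : seq bool) : seq I :=
  if b is c :: b' then
    if coord (size b') is Some i then if c then F b' else i :: F b' else F b'
  else [::].

Let valid := fix F (b : seq bool) : bool :=
  if b is c :: b' then (if coord (size b') is Some _ then true else c) && F b' else true.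

(** The probability of the history [b] together with heads in one fresh toss of each coin of [E]; a
    history with [false] at an index that is not a code has probability 0. *)
Let pE E b := if valid b then iter_diff (zeros b) a (ones b ++ E) else 0.

Let pE_cons E b : pE E (true :: b) + pE E (false :: b) = pE E b.
Proof.
rewrite /pE /=; case: (coord (size b)) => [i|] /=; last by case: ifP; rewrite addr0.
case: ifP => _; rewrite ?addr0//.
by have := iter_diff_cons (zeros b) i (ones b ++ E) sa; rewrite /= => ->; rewrite addrC subrK.
Qed.

Let pE_ge0 b : 0 <= pE [::] b.
Proof. by rewrite /pE; case: ifP => // _; exact: pa.2. Qed.

Let allb := fix F n : seq (seq bool) :=
  if n is n'.+1 then [seq true :: b | b <- F n'] ++ [seq false :: b | b <- F n']
  else [:: [::]].

Let mem_allb n b : (b \in allb n) = (size b == n).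
Proof.
elim: n b => [|n IH] [|c b]; rewrite ?inE//= mem_cat.
  by apply/negP => /orP[] /mapP[].
have e c' : (c :: b \in [seq c' :: b0 | b0 <- allb n]) = (c == c') && (size b == n).
  apply/mapP/andP => [[b0 h [-> ->]]|[/eqP -> h]]; first by rewrite eqxx -IH.
  by exists b => //; rewrite IH.
by rewrite !e -andb_orl eqSS; case: c {e}.
Qed.

Let uniq_allb n : uniq (allb n).
Proof.
elim: n => //= n IH; rewrite cat_uniq !map_inj_uniq ?IH ?andbT/= => [|? ? []|? ? []]//.
by apply/hasPn => _ /mapP[b _ ->]; apply/negP => /mapP[].
Qed.

Let okK (K : seq nat) := fix F (b : seq bool) : bool :=
  if b is c :: b' then (if size b' \in K then c else true) && F b' else true.

Let cK (K : seq nat) := fix F n : seq I :=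
  if n is n'.+1 then
    if n' \in K then (if coord n' is Some i then i :: F n' else F n') else F n'
  else [::].

(** The tosses are summed out from the latest to the earliest: a toss required to be heads moves its
    coin into [E], a free one disappears by [pE_cons]. *)
Let sum_okK K n E : (forall k, k \in K -> coord k != None) ->
  \sum_(b <- allb n | okK K b) pE E b = a (cK K n ++ E).
Proof.
move=> KP; elim: n E => [|n IH] E /=; first by rewrite big_cons big_nil /= addr0.
rewrite big_cat !big_map /= big_mkcond [X in _ + X]big_mkcond -big_split /=.
pose E' := if n \in K then (if coord n is Some i then i :: E else E) else E.
transitivity (\sum_(b <- allb n | okK K b) pE E' b).
  rewrite [RHS]big_mkcond; apply: eq_big_seq => b; rewrite mem_allb => /eqP sb.
  rewrite sb /E'; have [nK|nK] /= := boolP (n \in K); last first.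
    by case: ifP => _; rewrite ?pE_cons ?addr0.
  rewrite addr0; case: ifP => // _; have := KP _ nK.
  rewrite /pE /= sb; case: (coord n) => [i _|//] /=.
  case: ifP => // _; apply: iter_diff_perm => //.
  exact: permEl (perm_catCA [:: i] (ones b) E).
rewrite IH /E'; case: ifP => // nK; case: (coord n) => // i.
by apply: sa; exact: permEl (perm_catCA (cK K n) [:: i] E).
Qed.

Let okKE K n f : okK K (rev (mkseq f n)) = all (fun k => (k < n)%N ==> f k) K.
Proof.
have mkS m : rev (mkseq f m.+1) = f m :: rev (mkseq f m).
  by rewrite /mkseq -addn1 iotaD map_cat rev_cat.
elim: n => [|n IH]; first by apply/esym/allP.
rewrite mkS /= size_rev size_mkseq IH; apply/andP/allP => [[h1 /allP h2] k kK|h].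
  apply/implyP; rewrite ltnS leq_eqVlt => /orP[/eqP e|]; last exact/implyP/h2.
  by move: h1; rewrite -e kK.
split; first by case: ifP => // /h; rewrite ltnSn.
by apply/allP => k kK; apply/implyP => kn; have := h _ kK; rewrite ltnS ltnW.
Qed.

Let cKE K n : cK K n = pmap coord [seq k <- rev (iota 0 n) | k \in K].
Proof.
elim: n => // n IH; rewrite -{2}addn1 iotaD rev_cat /= add0n IH.
by case: ifP => // nK /=; case: (coord n).
Qed.

Let perm_coord K n : uniq K -> (forall k, k \in K -> (k < n)%N) ->
  perm_eq (cK K n) (pmap coord K).
Proof.
move=> uK Kn; rewrite cKE; apply: perm_pmap; apply: uniq_perm => //.
  by rewrite filter_uniq// rev_uniq iota_uniq.
move=> k; rewrite mem_filter mem_rev mem_iota /= add0n.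
by apply: andb_idr => /Kn.
Qed.

Local Notation U := (uniform_prob (@ltr01 R) : probability (measurableTypeR R) R).

(** The wanted variables will be the random biases of the coins. Conditionally on them distinct
    tosses should be independent, so the joint law of the tosses is dictated by [a], and it is a law
    because [a] is positive. *)
Lemma exchangeable_tosses : exists X : I * nat -> measurableTypeR R -> R,
  (forall t, measurable_fun setT (X t)) /\
  (forall t w, 0 <= X t w <= 1 /\ X t w * X t w = X t w) /\
  (forall T : seq (I * nat), uniq T ->
    \int[U]_w (\prod_(t <- T) X t w) = a (map fst T)).
Proof.
have p_nil : pE [::] [::] = 1 by rewrite /pE /= a_nil.
have [B [mB hB]] := random_bits pE_ge0 p_nil (pE_cons [::]).
exists (fun t w => (B (pickle t) w)%:R); split; [|split].
- move=> t; rewrite (_ : (fun w => _) = \1_[set w | B (pickle t) w]).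
    by apply: measurable_indic; exact: mB.
  by apply/funext => w; rewrite indicE mem_setE.
- by move=> t w; case: (B _ _); rewrite ler01 lexx ?mulr1 ?mulr0.
move=> T uT; pose K := map pickle T; pose n := (\max_(k <- K) k)%N.+1.
have Kn k : k \in K -> (k < n)%N 
  by move=> kK; rewrite ltnS; exact: (@leq_bigmax_seq nat K xpredT (fun k => k) k kK isT).
have cT (t : I * nat) : coord (pickle t) = Some t.1 by rewrite /coord pickleK.
have KP k : k \in K -> coord k != None by case/mapP => t _ ->; rewrite cT.
pose A b := [set w | mkseq (B^~ w) n = rev b].
have mA b : size b = n -> measurable (A b) /\ U (A b) = (pE [::] b)%:E.
  by rewrite /A => sb; have := hB b; rewrite sb.
(* The product of the tosses in [T] is the indicator of the disjoint union of these histories. *)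
pose s := [seq b <- allb n | okK K b].
have sP b : b \in s -> size b = n by rewrite mem_filter mem_allb => /andP[_ /eqP].
transitivity (\int[U]_w (\sum_(b <- s) \1_(A b) w : R)).
  apply: eq_Rintegral => w _.
  pose b0 := rev (mkseq (B^~ w) n).
  have b0n : b0 \in allb n by rewrite mem_allb size_rev size_mkseq.
  have e0 : \prod_(t <- T) (B (pickle t) w)%:R = (okK K b0)%:R :> R.
    rewrite okKE (_ : all _ K = all (fun k => B k w) K); last first.
      by apply: eq_in_all => k /Kn ->.
    rewrite /K all_map; elim: (T) => [|t T' IH]; rewrite ?big_nil// big_cons IH /=.
    by rewrite -natrM mulnb.
  rewrite e0 /s big_filter big_mkcond (bigD1_seq b0 b0n (uniq_allb n))/= big1 ?addr0.
    by case: ifP => //; rewrite indicE mem_set// /A /b0 /= revK.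
  move=> b bb0; case: ifP => // _; rewrite indicE memNset// /A /= => e.
  by move: bb0; rewrite /b0 e revK eqxx.
have bA b : size b = n -> bounded_measurable (\1_(A b) : R -> R).
  by move=> /mA[? _]; exact: bmf_indic.
transitivity (\sum_(b <- s) pE [::] b).
  elim: s sP => [|b s' IH] sP.
    by under eq_Rintegral do rewrite big_nil; rewrite Rintegral_cst// mul0r big_nil.
  have sb : size b = n by apply: sP; rewrite inE eqxx.
  have sP' b' : b' \in s' -> size b' = n by move=> h; apply: sP; rewrite inE h orbT.
  under eq_Rintegral do rewrite big_cons.
  rewrite big_cons bmf_intD; [|exact: bA|].
    have [mAb eAb] := mA _ sb; rewrite IH// bmf_int_indic//.
    by congr (_ + _); exact: (congr1 fine eAb).
  rewrite (_ : (fun w => _) = fun w => \sum_(b <- s') (if size b == n then \1_(A b) w else 0)).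
    by apply: bmf_sum => b'; case: eqP => [/bA//|_]; exact: bmf_cst.
  by apply/funext => w; apply: eq_big_seq => b' /sP' ->; rewrite eqxx.
rewrite /s big_filter sum_okK// cats0.
have -> : map fst T = pmap coord K.
  by rewrite /K; elim: (T) => //= t T' ->; rewrite cT.
apply: sa; apply: perm_coord => //.
by rewrite map_inj_uniq//; exact: (pcan_inj pickleK).
Qed.

(** De Finetti's argument: the frequency of heads of each coin converges almost surely, and its
    limit is the bias. *)
Lemma exchangeable_limit d (T0 : measurableType d) (P : probability T0 R)
    (X : I * nat -> T0 -> R) :
  (forall t, measurable_fun setT (X t)) ->
  (forall t w, 0 <= X t w <= 1 /\ X t w * X t w = X t w) ->
  (forall T : seq (I * nat), uniq T ->
    \int[P]_w (\prod_(t <- T) X t w) = a (map fst T)) ->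
  exists M : I -> T0 -> R,
  (forall i, measurable_fun setT (M i)) /\ (forall i w, 0 <= M i w <= 1) /\
  (forall s, \int[P]_w (\prod_(i <- s) M i w) = a s).
Proof.
move=> mX X01' EX.
have X01 t w : 0 <= X t w <= 1 by case: (X01' t w).
have bX t : bounded_measurable (X t) by exact: bmf01.
pose S i n w := n%:R^-1 * \sum_(j < n) X (i, val j) w.
have bS i n : bounded_measurable (S i n) by apply: bmfZ; apply: bmf_sum.
have S01 i n w : 0 <= S i n w <= 1.
  rewrite /S; apply/andP; split.
    by rewrite mulr_ge0 ?invr_ge0// sumr_ge0// => j _; case/andP: (X01 (i, val j) w).
  case: n => [|n]; first by rewrite invr0 mul0r.
  rewrite mulrC ler_pdivrMr// mul1r.
  apply: (@le_trans _ _ (\sum_(j < n.+1) 1)); last by rewrite sumr_const card_ord.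
  by apply: ler_sum => j _; case/andP: (X01 (i, val j) w).
have EXX i j k : \int[P]_w (X (i, j) w * X (i, k) w) =
    a [:: i; i] + (j == k)%:R * (a [:: i] - a [:: i; i]).
  have [<-|jk] := eqVneq j k.
    have /= <- := EX [:: (i, j)] isT.
    rewrite mul1r addrC subrK; apply: eq_Rintegral => w _.
    by rewrite big_cons big_nil mulr1; case: (X01' (i, j) w).
  have := EX [:: (i, j); (i, k)]; rewrite /= inE xpair_eqE eqxx /= jk => /(_ isT) <-.
  rewrite mul0r addr0; apply: eq_Rintegral => w _.
  by rewrite !big_cons big_nil mulr1.
have ESS i n m : (0 < n <= m)%N -> \int[P]_w (S i n w * S i m w) =
    a [:: i; i] + m%:R^-1 * (a [:: i] - a [:: i; i]).
  move=> /andP[n0 nm].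
  transitivity (\int[P]_w (n%:R^-1 * m%:R^-1 *
      \sum_(j < n) \sum_(k < m) X (i, val j) w * X (i, val k) w)).
    by apply: eq_Rintegral => w _; rewrite /S mulrACA big_distrlr.
  have b2 j k : bounded_measurable (fun w => X (i, j) w * X (i, k) w) by exact: bmfM.
  rewrite bmf_intZ; last by do 2!apply: bmf_sum => ?; exact: b2.
  rewrite bmf_int_sum; last by move=> j; apply: bmf_sum => k; exact: b2.
  set c := a [:: i] - _.
  have inner (j : 'I_n) : \int[P]_w (\sum_(k < m) X (i, val j) w * X (i, val k) w) =
      a [:: i; i] *+ m + c.
    rewrite bmf_int_sum => [|k]; last exact: b2.
    under eq_bigr do rewrite EXX -/c.
    rewrite big_split/= sumr_const card_ord (bigD1 (widen_ord nm j))//= eqxx mul1r.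
    rewrite big1 ?addr0// => k; rewrite -val_eqE /= eq_sym => /negbTE ->.
    exact: mul0r.
  rewrite (eq_bigr (fun=> a [:: i; i] *+ m + c)) => [|j _]; last exact: inner.
  rewrite sumr_const card_ord -[a _ *+ m]mulr_natl -[(_ + c) *+ n]mulr_natl.
  have n0' : n%:R != 0 :> R by rewrite pnatr_eq0 -lt0n.
  have m0' : m%:R != 0 :> R by rewrite pnatr_eq0 -lt0n (leq_trans n0).
  move: (n%:R) (m%:R) n0' m0' => N M N0 M0; field.
  by rewrite N0 M0.
have a_ge0 t : 0 <= a t by exact: (pa.2 [::]).
have a_le1 t : a t <= 1.
  elim: t => [|i t IH]; first by rewrite a_nil.
  by apply: le_trans IH; have := pa.2 [:: i] t Logic.I; rewrite /= subr_ge0.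
have ES i n m : (0 < n <= m)%N -> \int[P]_w ((S i m w - S i n w) ^+ 2) <= n%:R^-1.
  move=> nm; have /andP[n0 nm'] := nm.
  have bSS n' m' : bounded_measurable (fun w => S i n' w * S i m' w) by exact: bmfM.
  have -> : \int[P]_w ((S i m w - S i n w) ^+ 2) =
      \int[P]_w (S i m w * S i m w - 2 * (S i n w * S i m w) + S i n w * S i n w).
    by apply: eq_Rintegral => w _; ring.
  rewrite bmf_intD; [|by apply: bmfB; [exact: bSS|apply: bmfZ; exact: bSS]|exact: bSS].
  rewrite bmf_intB; [|exact: bSS|by apply: bmfZ; exact: bSS].
  rewrite bmf_intZ; last exact: bSS.
  rewrite !ESS ?n0 ?leqnn ?(leq_trans n0)//.
  have h1 : 0 <= a [:: i; i] by [].
  have h2 : a [:: i] <= 1 by [].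
  have h3 : 0 <= m%:R^-1 :> R by rewrite invr_ge0.
  have h4 : m%:R^-1 <= n%:R^-1 :> R.
    by rewrite lef_pV2 ?posrE ?ltr0n ?ler_nat// (leq_trans n0).
  by nra.
(* The clipped limsup is measurable and in [0, 1] everywhere; almost surely it is the limit. *)
pose M i w := Num.max 0 (Num.min 1 (limn_sup (fun k => S i (8 ^ k)%N w))).
have mM i : measurable_fun setT (M i).
  apply: measurable_maxr; first exact: measurable_cst.
  apply: measurable_minr; first exact: measurable_cst.
  apply: measurable_fun_limn_sup => [w _|w _|k].
  - by exists 1 => _ [k _ <-]; case/andP: (S01 i (8 ^ k)%N w).
  - by exists 0 => _ [k _ <-]; case/andP: (S01 i (8 ^ k)%N w).
  - by case: (bS i (8 ^ k)%N).
have M01 i w : 0 <= M i w <= 1.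
  by rewrite /M le_max lexx /= ge_max ler01 ge_min lexx.
have bM i : bounded_measurable (M i) by exact: bmf01.
(* Along the sizes 8^k the bound 1 / n of [ES] is exactly the rate asked by [ae_cvg_of_square]. *)
have cM i : {ae P, forall w, S i (8 ^ k)%N w @[k --> \oo] --> M i w}.
  have : {ae P, forall w, cvg (S i (8 ^ k)%N w @[k --> \oo])}.
    apply: (@ae_cvg_of_square _ _ _ P (fun k => S i (8 ^ k)%N)) => [k|k].
      exact: bS.
    rewrite -natrX; apply: ES; rewrite expn_gt0/=.
    by rewrite leq_exp2l.
  apply: filterS => w cw.
  have /cvg_ex[l cl] := cw.
  have l0 : 0 <= l by apply: (seq_cvg_ge cl) => k; case/andP: (S01 i (8 ^ k)%N w).
  have l1 : l <= 1 by apply: (seq_cvg_le cl) => k; case/andP: (S01 i (8 ^ k)%N w).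
  rewrite /M (cvg_limn_supE cw) (cvg_lim (@Rhausdorff R) cl).
  by rewrite min_r// max_r.
exists M; split => //; split => // s.
(* The statement mixes biases and tosses so that biases can be introduced one at a time: M_i is the
   limit of averages of tosses of the coin i, and all but at most [size T] of them are absent from
   [T], hence contribute [al]. *)
suff h T : uniq T -> \int[P]_w (\prod_(i <- s) M i w * \prod_(t <- T) X t w) =
    a (s ++ map fst T).
  have := h [::] isT; rewrite cats0 => <-; apply: eq_Rintegral => w _.
  by rewrite big_nil mulr1.
elim: s T => [|i s IH] T uT.
  rewrite -EX//; apply: eq_Rintegral => w _; by rewrite big_nil mul1r.
pose F w := \prod_(i <- s) M i w * \prod_(t <- T) X t w.
have bF : bounded_measurable F by apply: bmfM; apply: bmf_prod.
have F01 w : 0 <= F w <= 1.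
  have p1 : 0 <= \prod_(i <- s) M i w <= 1.
    by elim/big_ind : _ => [|x y /andP[? ?] /andP[? ?]|j _]; rewrite ?ler01 ?lexx ?mulr_ge0 ?mulr_ile1.
  have p2 : 0 <= \prod_(t <- T) X t w <= 1.
    by elim/big_ind : _ => [|x y /andP[? ?] /andP[? ?]|j _]; rewrite ?ler01 ?lexx ?mulr_ge0 ?mulr_ile1.
  by case/andP: p1 => ? ?; case/andP: p2 => ? ?; rewrite mulr_ge0 ?mulr_ile1.
have c1 : \int[P]_w (S i (8 ^ k)%N w * F w) @[k --> \oo] --> \int[P]_w (M i w * F w).
  apply: (@bmf_int_cvg _ _ _ P _ _ 1).
  - by move=> k; case: (bmfM (bS i (8 ^ k)%N) bF).
  - by case: (bmfM (bM i) bF).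
  - move=> k w; have /andP[? ?] := S01 i (8 ^ k)%N w; have /andP[? ?] := F01 w.
    by rewrite ger0_norm; [exact: mulr_ile1|exact: mulr_ge0].
  - by have := cM i; apply: filterS => w; exact: cvgMl.
pose al := a (i :: s ++ map fst T).
have e1 j : (i, j) \notin T -> \int[P]_w (X (i, j) w * F w) = al.
  move=> ijT; have := IH ((i, j) :: T); rewrite /= ijT uT => /(_ isT) => h.
  rewrite /al (sa (s' := s ++ i :: map fst T)); last first.
    by rewrite perm_sym; exact: permEl (perm_catCA s [:: i] _).
  rewrite -h; apply: eq_Rintegral => w _; rewrite big_cons /F; ring.
have e2 n : (0 < n)%N -> `|\int[P]_w (S i n w * F w) - al| <= (size T)%:R * n%:R^-1.
  move=> n0; have bXF j : bounded_measurable (fun w => X (i, j) w * F w) by exact: bmfM.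
  have n0' : n%:R != 0 :> R by rewrite pnatr_eq0 -lt0n.
  have -> : \int[P]_w (S i n w * F w) = n%:R^-1 * \sum_(j < n) \int[P]_w (X (i, val j) w * F w).
    rewrite -bmf_int_sum => [|j]; last exact: bXF.
    rewrite -bmf_intZ; last by apply: bmf_sum => j; exact: bXF.
    by apply: eq_Rintegral => w _; rewrite /S -mulrA mulr_suml.
  have -> : al = n%:R^-1 * \sum_(j < n) al.
    by rewrite sumr_const card_ord -[al *+ n]mulr_natl mulKf.
  rewrite -mulrBr -sumrB normrM ger0_norm ?invr_ge0// mulrC ler_wpM2r ?invr_ge0//.
  apply: (le_trans (ler_norm_sum _ _ _)).
  apply: (@le_trans _ _ (\sum_(j < n) ((i, val j) \in T)%:R)).
    apply: ler_sum => j _; have [ijT|/e1 ->] := boolP (_ \in T); last by rewrite subrr normr0.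
    have h0 : 0 <= al <= 1 by rewrite /al a_ge0 a_le1.
    have h1 : 0 <= \int[P]_w (X (i, val j) w * F w) <= 1.
      apply/andP; split.
        by apply: Rintegral_ge0 => w _; have /andP[? _] := X01 (i, val j) w;
           have /andP[? _] := F01 w; rewrite mulr_ge0.
      apply: (@le_trans _ _ (\int[P]_w 1)); last first.
        by rewrite Rintegral_cst//= probability_setT mulr1.
      apply: bmf_int_le => //; first exact: bmf_cst.
      by move=> w; have /andP[? ?] := X01 (i, val j) w;
         have /andP[? ?] := F01 w; rewrite mulr_ile1.
    by rewrite (_ : true%:R = 1 :> R)// ler_norml; lra.
  rewrite -natr_sum ler_nat.
  rewrite (_ : (\sum_(j < n) _)%N = size [seq (i, j) | j <- iota 0 n & (i, j) \in T]).
    apply: uniq_leq_size.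
      by rewrite map_inj_uniq ?filter_uniq ?iota_uniq// => x y [].
    by move=> _ /mapP[j + ->]; rewrite mem_filter => /andP[].
  rewrite size_map size_filter -sum1_count [RHS]big_mkcond /=.
  rewrite -(big_mkord xpredT (fun j => nat_of_bool ((i, j) \in T))).
  by rewrite /index_iota subn0; apply: eq_bigr => j _; case: (_ \in _).
transitivity (\int[P]_w (M i w * F w)).
  by apply: eq_Rintegral => w _; rewrite big_cons mulrA.
rewrite -/al; apply: (seq_cvg_unique c1).
have c0 : (size T)%:R * ((8 : R)^-1 ^+ k) @[k --> \oo] --> (0 : R).
  rewrite -(mulr0 (size T)%:R); apply: cvgMr.
  by apply: cvg_expr; rewrite ger0_norm ?invr_ge0// invf_lt1// ltr1n.
apply: (squeeze_cvgr (f := fun k => al - (size T)%:R * ((8 : R)^-1 ^+ k))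
    (h := fun k => al + (size T)%:R * ((8 : R)^-1 ^+ k))).
- apply: nearW => k; have := @e2 (8 ^ k)%N; rewrite expn_gt0 => /(_ isT).
  by rewrite natrX -exprVn ler_norml; lra.
- by rewrite -[X in _ --> X]subr0; apply: cvgB => //; exact: cvg_cst.
- by rewrite -[X in _ --> X]addr0; apply: cvgD => //; exact: cvg_cst.
Qed.

Lemma moment_problem : exists M : I -> measurableTypeR R -> R,
  (forall i, measurable_fun setT (M i)) /\ (forall i w, 0 <= M i w <= 1) /\
  (forall s, \int[U]_w (\prod_(i <- s) M i w) = a s).
Proof.
by have [X [mX [X01 EX]]] := exchangeable_tosses; exact: (exchangeable_limit mX X01 EX).
Qed.

End moment_problem.

(** * Cell sums *)

Section cell_sums.
Variable R : realType.

(** The monomial quasisymmetric polynomial of the cell lengths. Up to the factor [multinom s] it is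
    the probability that uniform points occupy cells with the counts [s], read from left to right,
    the cells being numbered from right to left. *)
Fixpoint cell_sum (len : nat -> R) (s : seq nat) (K : nat) : R :=
  if s is m :: s' then \sum_(k < K) len k ^+ m * cell_sum len s' k else 1.

Lemma cell_sumS len m s K :
  cell_sum len (m :: s) K.+1 = cell_sum len (m :: s) K + len K ^+ m * cell_sum len s K.
Proof. by rewrite /= big_ord_recr. Qed.

Lemma cell_sum_ge0 len s K : (forall k, 0 <= len k) -> 0 <= cell_sum len s K.
Proof.
move=> len0; elim: s K => //= m s IH K.
by apply: sumr_ge0 => k _; rewrite mulr_ge0// exprn_ge0.
Qed.

Lemma cell_sum_nd len s : (forall k, 0 <= len k) ->
  {homo cell_sum len s : m n / (m <= n)%N >-> m <= n}.
Proof.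
move=> len0; case: s => [|m s] //; apply: homo_leq => [//|? ? ?|K].
  exact: le_trans.
by rewrite cell_sumS lerDl mulr_ge0 ?exprn_ge0 ?cell_sum_ge0.
Qed.

(** [u] is nondecreasing and bounded by l / (1 - e), and its limit is a fixed point of the
    recursion. *)
Lemma linear_recursion_cvg (e l : R) (u v : nat -> R) : 0 <= e < 1 ->
  (forall n, 0 <= v n) -> {homo v : m n / (m <= n)%N >-> m <= n} ->
  v n @[n --> \oo] --> l ->
  u 0%N = 0 -> (forall n, u n.+1 = e * u n + v n) ->
  u n @[n --> \oo] --> l / (1 - e).
Proof.
move=> /andP[e0 e1] v0 vnd vl u0 uS.
have e1' : 0 < 1 - e by rewrite subr_gt0.
have vle n : v n <= l.
  rewrite -(cvg_lim (@Rhausdorff R) vl); apply: nondecreasing_cvgn_le => //.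
  by apply/cvg_ex; exists l.
have u_le n : u n <= l / (1 - e).
  elim: n => [|n IH].
    by rewrite u0 divr_ge0 ?(ltW e1')// (le_trans (v0 0%N)).
  rewrite uS; apply: (le_trans (lerD (ler_wpM2l e0 IH) (vle n))).
  by rewrite le_eqVlt; apply/orP; left; apply/eqP; field; rewrite gt_eqF.
have u_nd : {homo u : m n / (m <= n)%N >-> m <= n}.
  apply: homo_leq => [//|? ? ?|n]; first exact: le_trans.
  elim: n => [|n IH]; first by rewrite uS u0 mulr0 add0r.
  by rewrite uS [X in _ <= X]uS lerD ?ler_wpM2l// vnd.
have cu : cvgn u by apply: nondecreasing_is_cvgn => //; exists (l / (1 - e)) => _ [n _ <-].
have /cvg_ex[L uL] := cu.
have uL1 : u n.+1 @[n --> \oo] --> L by rewrite -cvg_shiftS in uL.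
have uL2 : u n.+1 @[n --> \oo] --> e * L + l.
  under eq_fun do rewrite uS.
  by apply: cvgD => //; exact: cvgMr.
have e2 := seq_cvg_unique uL1 uL2.
suff -> : l / (1 - e) = L by [].
apply: (mulIf (lt0r_neq0 e1')); rewrite mulfVK ?lt0r_neq0//.
by rewrite mulrBr mulr1 [in LHS](_ : l = L - e * L); lra.
Qed.

Section recursion.
Variables (a e : nat -> R) (E : nat -> nat -> seq nat -> R).
Hypotheses (E_ge0 : forall K j s, 0 <= E K j s).
Hypotheses (E0_nil : forall j, E 0 j [::] = a j)
  (E0_cons : forall j m s, (0 < m)%N ->
     E 0 j (m :: s) = if s is [::] then diff m a j else 0).
Hypotheses (ES_nil : forall K j, E K.+1 j [::] = e j * E K j [::])
  (ES_cons : forall K j m s, (0 < m)%N ->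
     E K.+1 j (m :: s) = e j * E K j (m :: s) + diff m e j * E K (j + m)%N s).
Hypotheses (e0 : e 0%N = 1) (e01 : forall j, (0 < j)%N -> 0 <= e j < 1).
Hypothesis de_ge0 : forall m j, (0 < m)%N -> 0 <= diff m e j.

(** The Green function, that is the sum over K of [E K j s]: a step that separates no ball
    multiplies by [e j], whence the divisor. *)
Fixpoint green_sum j s : R :=
  if s is m :: s' then
    ((if s' is [::] then diff m a j else 0) + diff m e j * green_sum (j + m) s')
      / (1 - e j)
  else a j / (1 - e j).

Lemma cvg_green_sum j s : (0 < j)%N -> all (leq 1) s ->
  \sum_(k < K) E k j s @[K --> \oo] --> green_sum j s.
Proof.
elim: s j => [|m s IH] j j0 /=.
  move=> _; apply: (@linear_recursion_cvg (e j) _ _ (fun=> a j)).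
  - exact: e01.
  - by move=> _; rewrite -E0_nil.
  - by [].
  - exact: cvg_cst.
  - by rewrite big_ord0.
  - elim=> [|n IH]; first by rewrite big_ord_recr !big_ord0/= E0_nil mulr0.
    by rewrite big_ord_recr/= [in LHS]IH [in RHS]big_ord_recr/= ES_nil; ring.
move=> /andP[m0 s0]; apply: (@linear_recursion_cvg (e j) _ _
    (fun K => E 0 j (m :: s) + diff m e j * \sum_(k < K) E k (j + m)%N s)).
- exact: e01.
- by move=> n; rewrite addr_ge0// mulr_ge0 ?de_ge0 ?sumr_ge0.
- apply: homo_leq => [//|? ? ?|n]; first exact: le_trans.
  by rewrite lerD2l ler_wpM2l ?de_ge0// big_ord_recr/= lerDl.
- rewrite E0_cons//; apply: cvgD; first exact: cvg_cst.
  by apply: cvgMr; apply: IH => //; rewrite addn_gt0 j0.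
- by rewrite big_ord0.
- elim=> [|n IHn]; first by rewrite big_ord_recr !big_ord0/= !mulr0 addr0 add0r.
  rewrite big_ord_recr/= [in LHS]IHn ES_cons//.
  by rewrite !big_ord_recr/=; ring.
Qed.

(** For j = 0 the recursion telescopes since [e 0 = 1]: the limit is the initial value plus the sum
    of all increments, which is a Green function. *)
Lemma cvg_cell_recursion m s : (0 < m)%N -> all (leq 1) s ->
  E K 0 (m :: s) @[K --> \oo] -->
  (if s is [::] then diff m a 0 else 0) + diff m e 0 * green_sum m s.
Proof.
move=> m0 s0.
have -> : (fun K => E K 0 (m :: s)) = (fun K => E 0 0 (m :: s) +
    diff m e 0 * \sum_(k < K) E k m s).
  apply/funext; elim=> [|K IH]; first by rewrite big_ord0 mulr0 addr0.
  by rewrite ES_cons// e0 IH big_ord_recr/= add0n; ring.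
rewrite E0_cons//; apply: cvgD; first exact: cvg_cst.
by apply: cvgMr; exact: cvg_green_sum.
Qed.

End recursion.

Lemma cvg_diff (f_ : nat -> nat -> R) f m j :
  (forall k, f_ n k @[n --> \oo] --> f k) ->
  diff m (f_ n) j @[n --> \oo] --> diff m f j.
Proof. by move=> cf; elim: m j => [|m IH] j //=; exact: cvgB. Qed.

Lemma diff_const_sub c (f : nat -> R) m j :
  diff m.+1 (fun k => c - f k) j = - diff m.+1 f j.
Proof.
have -> : diff m.+1 (fun k => c - f k) j = diff m.+1 (fun k => -1 * f k) j.
  elim: m j => [|m IH] j; first by rewrite /=; ring.
  by rewrite [LHS]/= -!/(diff m.+1 _ _) !IH.
by rewrite diffZ mulN1r.
Qed.

(** * The limit of a small mesh *)

Section small_mesh.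
Variables (a Phi : nat -> R) (c : R).
Hypotheses (a_gt0 : forall k, 0 < a k) (c_gt0 : 0 < c).
Hypothesis PhiE : forall k, Phi k = c * (k%:R * a k).

Let mesh r : R := 2^-1 ^+ r.
Let e r k := expR (- (mesh r * Phi k)).

Let mesh_gt0 r : 0 < mesh r. Proof. by rewrite exprn_gt0// invr_gt0. Qed.

Let Phi_ge0 k : 0 <= Phi k.
Proof. by rewrite PhiE mulr_ge0 ?mulr_ge0// ltW. Qed.

(** Squeeze between y - y^2 <= 1 - exp(- y) <= y for y = mesh times Phi(k). *)
Let cvg_slope k : (1 - e r k) / mesh r @[r --> \oo] --> Phi k.
Proof.
have m0 : Phi k - mesh r * (Phi k * Phi k) @[r --> \oo] --> Phi k.
  rewrite -[X in _ --> X]subr0 -(mul0r (Phi k * Phi k)); apply: cvgB; first exact: cvg_cst.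
  by apply: cvgMl; apply: cvg_expr; rewrite ger0_norm ?invr_ge0// invf_lt1// ltr1n.
apply: (squeeze_cvgr _ m0); last exact: cvg_cst.
apply: nearW => r; have d0 := mesh_gt0 r; have f0 := Phi_ge0 k.
set d := mesh r in d0 *; set f := Phi k in f0 *.
have h1 : 1 - d * f <= expR (- (d * f)) by have := expR_ge1Dx (- (d * f)).
have h2 : expR (- (d * f)) * (1 + d * f) <= 1.
  rewrite expRN mulrC ler_pdivrMr ?expR_gt0// mul1r; exact: expR_ge1Dx.
rewrite ler_pdivlMr// ler_pdivrMr//.
have df0 : 0 <= d * f by rewrite mulr_ge0// ltW.
have E0 := expR_gt0 (- (d * f)).
rewrite /e -/d -/f; set x := expR _ in h1 h2 E0 *; apply/andP; split; last lra.
have -> : (f - d * (f * f)) * d = d * f - (d * f) * (d * f) by ring.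
set y := d * f in h1 h2 df0 *.
have : x * (1 + y) * (1 - y) <= 1 - y \/ 1 <= y.
  by case: (leP 1 y) => ?; [right|left; rewrite -[leRHS]mul1r ler_pM2r//; lra].
by case=> ?; nra.
Qed.

Let cvg_jump m j : (0 < m)%N ->
  diff m (e r) j / mesh r @[r --> \oo] --> c * jump_weight a j m.
Proof.
case: m => // m _.
have -> : (fun r => diff m.+1 (e r) j / mesh r) =
    (fun r => - diff m.+1 (fun k => (1 - e r k) / mesh r) j).
  apply/funext => r.
  have -> : diff m.+1 (fun k => (1 - e r k) / mesh r) j = (mesh r)^-1 * - diff m.+1 (e r) j.
    by rewrite -(diff_const_sub 1) -diffZ; apply: eq_diff => k; rewrite mulrC.
  by rewrite mulrN opprK mulrC.
rewrite /jump_weight mulrN -diffZ; apply: cvgN.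
have -> : diff m.+1 (fun k => c * (k%:R * a k)) j = diff m.+1 Phi j.
  by apply: eq_diff => k; rewrite PhiE.
by apply: cvg_diff => k; exact: cvg_slope.
Qed.

(** Gives [left_weight] the shape of [green_sum]; when no box is left, the last factor is a_(j+m) /
    Phi(j+m). *)
Let left_weight_green j m s : (0 < j + m)%N ->
  left_weight a j (m :: s) = (if s is [::] then diff m a j else 0) +
   (c * jump_weight a j m) * (if s is [::] then (c * (j + m)%:R)^-1 else
      left_weight a (j + m) s / Phi (j + m)%N).
Proof.
move=> jm0; have d0 : (j + m)%:R != 0 :> R by rewrite pnatr_eq0 -lt0n.
have a0 := lt0r_neq0 (a_gt0 (j + m)); have c0 := lt0r_neq0 c_gt0.
case: s => [|m' s'] /=.
  by congr (_ + _); move: (_%:R) d0 => D D0; field; rewrite D0 c0.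
rewrite add0r PhiE; move: (_%:R) d0 => D D0.
move: (if s' is [::] then _ else _) => x; move: (a _) a0 => A A0.
by field; rewrite A0 D0 c0.
Qed.

Let cvg_green s j : (0 < j)%N -> all (leq 1) s ->
  mesh r * green_sum a (e r) j s @[r --> \oo] -->
  (if s is [::] then (c * j%:R)^-1 else left_weight a j s / Phi j).
Proof.
have slope0 r k : (0 < k)%N -> (1 - e r k) != 0.
  move=> k0; rewrite subr_eq0 eq_sym lt_eqF// /e expR_lt1 oppr_lt0.
  by rewrite mulr_gt0// PhiE !mulr_gt0// ltr0n.
have PhiN0 k : (0 < k)%N -> Phi k != 0.
  by move=> k0; rewrite gt_eqF// PhiE !mulr_gt0// ltr0n.
elim: s j => [|m s IH] j j0.
  move=> _; have -> : (fun r => mesh r * green_sum a (e r) j [::]) =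
      (fun r => a j * ((1 - e r j) / mesh r)^-1).
    by apply/funext => r; rewrite /= invf_div; ring.
  have -> : (c * j%:R)^-1 = a j * (Phi j)^-1.
    by rewrite PhiE; field; rewrite !gt_eqF// ltr0n.
  by apply: cvgMr; apply: cvgV; [exact: PhiN0|exact: cvg_slope].
move=> /andP[m0 s0].
have -> : (fun r => mesh r * green_sum a (e r) j (m :: s)) =
    (fun r => ((if s is [::] then diff m a j else 0) +
       (diff m (e r) j / mesh r) * (mesh r * green_sum a (e r) (j + m) s))
       * ((1 - e r j) / mesh r)^-1).
  apply/funext => r; rewrite /= invf_div; field.
  by rewrite slope0//= gt_eqF.
have jm0 : (0 < j + m)%N by rewrite addn_gt0 j0.
rewrite left_weight_green//.
apply: cvgM; last by apply: cvgV; [exact: PhiN0|exact: cvg_slope].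
apply: cvgD; first exact: cvg_cst.
by apply: cvgM; [exact: cvg_jump|exact: IH].
Qed.

(** The mesh cancels: [diff m] of [e] is of the order of the mesh and the Green sum of the order of
    its inverse. The constant [c] cancels in the same way. *)
Lemma cvg_small_mesh m s : (0 < m)%N -> all (leq 1) s ->
  (if s is [::] then diff m a 0 else 0) + diff m (e r) 0 * green_sum a (e r) m s
    @[r --> \oo] --> left_weight a 0 (m :: s).
Proof.
move=> m0 s0.
have -> : (fun r => (if s is [::] then diff m a 0 else 0) +
      diff m (e r) 0 * green_sum a (e r) m s) =
    (fun r => (if s is [::] then diff m a 0 else 0) +
      (diff m (e r) 0 / mesh r) * (mesh r * green_sum a (e r) m s)).
  by apply/funext => r; rewrite mulrA mulfVK// gt_eqF.
rewrite left_weight_green// add0n.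
apply: cvgD; first exact: cvg_cst.
by apply: cvgM; [exact: cvg_jump|exact: cvg_green].
Qed.

End small_mesh.
End cell_sums.

Section counting.
Variable l : nat.

Lemma big_tuple_cons (V : nmodType) n (F : n.+1.-tuple 'I_l -> V) :
  \sum_(t : n.+1.-tuple 'I_l) F t =
  \sum_(x : 'I_l) \sum_(t : n.-tuple 'I_l) F (cons_tuple x t).
Proof.
rewrite pair_bigA /=.
rewrite (reindex (fun p : 'I_l * n.-tuple 'I_l => cons_tuple p.1 p.2))//.
exists (fun t => (thead t, behead_tuple t)) => [[x t] _|t _] /=.
  by congr pair; apply: val_inj.
by rewrite [RHS]tuple_eta; apply: val_inj.
Qed.

(** Induction on the first letter x, whose count drops by one; the resulting weights [s x] add up to
    n. *)
Lemma count_words n (s : 'I_l -> nat) : (\sum_k s k = n)%N ->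
  ((\sum_(t : n.-tuple 'I_l) [forall k, count_mem k t == s k]) * \prod_k (s k)`! = n`!)%N.
Proof.
elim: n s => [|n IH] s sn.
  have s0 k : s k = 0%N by move/eqP: sn; rewrite sum_nat_eq0 => /forallP/(_ k)/eqP.
  rewrite [X in (_ * X)%N]big1 ?muln1 => [|k _]; last by rewrite s0.
  rewrite (bigD1 [tuple])//= big1 ?addn0.
    by rewrite (_ : [forall k, _] = true)//; apply/forallP => k; rewrite s0.
  by move=> t /eqP tn; case: tn; exact: tuple0.
rewrite (big_tuple_cons (V := nat)) big_distrl /=.
pose s' x k := (s k - (x == k))%N.
rewrite (eq_bigr (fun x => s x * n`!)%N) => [|x _].
  by rewrite -big_distrl /= sn factS.
have [sx0|sx] := posnP (s x).
  rewrite sx0 mul0n big1// => t _; rewrite (_ : [forall k, _] = false)//.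
  by apply/negbTE/forallPn; exists x; rewrite /= eqxx sx0.
rewrite -(IH (s' x)); last first.
  apply: succn_inj; rewrite -sn (bigD1 x)//= [in RHS](bigD1 x)//= /s' eqxx.
  rewrite -addSn -[(_ - _).+1]addn1 subnK//.
  congr addn; apply: eq_bigr => k /negbTE kx.
  by rewrite eq_sym kx subn0.
rewrite mulnCA; congr muln.
  apply: eq_bigr => t _; congr nat_of_bool; apply: eq_forallb => k /=.
  rewrite /s'; have [<-|_] := eqVneq x k; last by rewrite add0n subn0.
  by rewrite -{1}(subnK sx) addnC eqn_add2r.
rewrite (bigD1 x)//= [in RHS](bigD1 x)//= mulnA /s' eqxx subn1.
rewrite -{1}(prednK sx) factS prednK//; congr muln.
by apply: eq_bigr => k /negbTE kx; rewrite eq_sym kx subn0.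
Qed.

End counting.

(** * Measurability of events written as countable formulas *)

Section sigma_predicates.
Variables (T : Type) (S : set (set T)).
Hypothesis sS : sigma_algebra setT S.
Implicit Types p q : T -> Prop.

Lemma sigma_and p q : S [set z | p z] -> S [set z | q z] -> S [set z | p z /\ q z].
Proof. exact: sigma_algebra_setI. Qed.

Lemma sigma_not p : S [set z | p z] -> S [set z | ~ p z].
Proof. exact: sigma_algebra_setC. Qed.

Lemma sigma_const (P : Prop) : S [set _ | P].
Proof.
have [h|h] := pselect P.
  by rewrite (_ : [set _ | _] = setT); [exact: sigma_algebra_setT|apply/seteqP; split].
by rewrite (_ : [set _ | _] = set0); [case: sS|apply/seteqP; split].
Qed.

Lemma sigma_imply p q : S [set z | p z] -> S [set z | q z] -> S [set z | p z -> q z].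
Proof.
move=> Sp Sq; have := sigma_not (sigma_and Sp (sigma_not Sq)).
congr S; apply/seteqP; split=> z /= h; last by move=> [/h].
by move=> pz; apply: contrapT => nq; apply: h.
Qed.

Lemma sigma_iff p q : S [set z | p z] -> S [set z | q z] -> S [set z | p z <-> q z].
Proof. by move=> Sp Sq; apply: sigma_and; exact: sigma_imply. Qed.

Lemma sigma_exists (I : countType) (p : I -> T -> Prop) :
  (forall i, S [set z | p i z]) -> S [set z | exists i, p i z].
Proof.
move=> Sp.
have -> : [set z | exists i, p i z] = \bigcup_n
    (if unpickle n is Some i then [set z | p i z] else set0).
  apply/seteqP; split=> [z [i pz]|z [n _]].
    by exists (pickle i) => //; rewrite pickleK.
  by case: (unpickle n) => // i pz; exists i.
case: (sS) => S0 _; apply => n; case: (unpickle n) => [i|//]; exact: Sp.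
Qed.

Lemma sigma_or p q : S [set z | p z] -> S [set z | q z] -> S [set z | p z \/ q z].
Proof.
move=> Sp Sq; have := @sigma_exists bool (fun b => if b then p else q).
move=> /(_ ltac:(by case)); congr S; apply/seteqP; split=> z /=.
  by move=> [[] h]; [left|right].
by move=> [h|h]; [exists true|exists false].
Qed.

Lemma sigma_forall (I : countType) (p : I -> T -> Prop) :
  (forall i, S [set z | p i z]) -> S [set z | forall i, p i z].
Proof.
move=> Sp; have := sigma_not (sigma_exists (fun i => sigma_not (Sp i))).
congr S; apply/seteqP; split=> z /= h.
  by move=> i; apply: contrapT => np; apply: h; exists i.
by move=> [i]; apply.
Qed.

End sigma_predicates.

(** * Sampling from a closed set *)

Section intervals.
Variable R : realType.
Implicit Types (Z : set R) (x y z u v : R).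

Lemma same_intervalP Z x y :
  same_interval Z x y <->
  [/\ 0 <= x <= 1, 0 <= y <= 1 &
      forall z, Num.min x y <= z <= Num.max x y -> ~ Z z].
Proof.
split=> [[C [Cx CZ Ccon] Cy]|[x01 y01 h]].
  have [/= x01 _] := CZ _ Cx; have [/= y01 _] := CZ _ Cy.
  rewrite !in_itv/= in x01 y01; split => // z xzy.
  suff /CZ[] : C z by [].
  move/connected_intervalP : Ccon => iC.
  by case: (leP x y) xzy => xy xzy; [apply: (iC x y)|apply: (iC y x)].
pose C := `[Num.min x y, Num.max x y]%classic : set R.
have Cx : C x by rewrite /C /= in_itv/= ge_min lexx le_max lexx.
have Cy : C y by rewrite /C /= in_itv/= ge_min lexx orbT le_max lexx orbT.
apply: (@connected_component_max _ _ C) => //.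
- move=> z Cz; have zC : Num.min x y <= z <= Num.max x y by move: Cz; rewrite /C /= in_itv.
  split; last exact: h.
  case/andP: zC => z1 z2; case/andP: x01 => ? ?; case/andP: y01 => ? ?.
  suff : z \in `[0, 1] by [].
  rewrite in_itv/= (le_trans _ z1) ?(le_trans z2)//; first by rewrite ge_max; exact/andP.
  by rewrite le_min; exact/andP.
- exact: segment_connected.
Qed.

(** For measurability: the gap event becomes a countable combination of hitting events of open
    intervals. *)
Lemma closed_gapP Z x y : closed Z -> x <= y ->
  (forall z, x <= z <= y -> ~ Z z) <->
  (exists p q : rat, [/\ ratr p < x, y < ratr q & ~ (Z `&` `]ratr p, ratr q[ !=set0)]).
Proof.
move=> cZ xy; split=> [h|[p [q [px yq h]]] z /andP[xz zy] Zz]; last first.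
  apply: h; exists z; split => //=.
  by rewrite in_itv/= (lt_le_trans px xz) (le_lt_trans zy yq).
have oZ : open (~` Z) by rewrite openC.
have near_gap v : x <= v <= y -> exists2 e, 0 < e & forall z, `|v - z| < e -> ~ Z z.
  move=> xvy; have : nbhs v (~` Z) by apply: open_nbhs_nbhs; split => //; exact: h.
  by move=> /nbhs_ballP[e e0 ballZ]; exists e => // z vz; apply: ballZ.
have [|e1 e10 h1] := near_gap x; first by rewrite lexx.
have [|e2 e20 h2] := near_gap y; first by rewrite lexx xy.
have /rat_in_itvoo[p /=] : x - e1 < x by rewrite ltrBlDr ltrDl.
rewrite in_itv/= => /andP[p1 p2].
have /rat_in_itvoo[q /=] : y < y + e2 by rewrite ltrDl.
rewrite in_itv/= => /andP[q1 q2].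
exists p, q; split => // -[z [Zz /=]]; rewrite in_itv/= => /andP[pz zq].
have [zx|xz] := ltP z x.
  by apply: (h1 z) Zz; rewrite ltr_norml; apply/andP; split; lra.
have [yz|zy] := ltP y z.
  by apply: (h2 z) Zz; rewrite ltr_norml; apply/andP; split; lra.
by apply: (h z) Zz; rewrite xz.
Qed.

Definition right_isolated Z z := Z z /\ exists2 e, 0 < e & forall v, z < v < z + e -> ~ Z v.

Definition left_isolated Z z := Z z /\ exists2 e, 0 < e & forall v, z - e < v < z -> ~ Z v.

(** A rational number in the gap to its right determines such a point. Hence almost surely no sample
    point is one. *)
Lemma countable_right_isolated Z : countable [set z | right_isolated Z z].
Proof.
have f_ex z : exists q : rat, right_isolated Z z ->
    z < ratr q /\ forall v, z < v <= ratr q -> ~ Z v.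
  have [[Zz [e e0 h]]|n] := pselect (right_isolated Z z); last by exists 0.
  have /rat_in_itvoo[q /=] : z < z + e by rewrite ltrDl.
  rewrite in_itv/= => /andP[q1 q2]; exists q => _; split => // v /andP[zv vq].
  by apply: h; rewrite zv (le_lt_trans vq q2).
have [f fP] := choice f_ex.
apply/countable_injP; exists (pickle \o f) => z z'; rewrite !inE => iz iz' /=.
move=> /(pcan_inj pickleK) fz.
have [z1 z2] := fP _ iz; have [z3 z4] := fP _ iz'.
have [zz'|zz'|//] := ltgtP z z'.
  by exfalso; apply: (z2 z') iz'.1; rewrite zz' fz ltW.
by exfalso; apply: (z4 z) iz.1; rewrite zz' -fz ltW.
Qed.

Lemma countable_left_isolated Z : countable [set z | left_isolated Z z].
Proof.
have f_ex z : exists q : rat, left_isolated Z z ->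
    ratr q < z /\ forall v, ratr q <= v < z -> ~ Z v.
  have [[Zz [e e0 h]]|n] := pselect (left_isolated Z z); last by exists 0.
  have /rat_in_itvoo[q /=] : z - e < z by rewrite ltrBlDr ltrDl.
  rewrite in_itv/= => /andP[q1 q2]; exists q => _; split => // v /andP[qv vz].
  by apply: h; rewrite (lt_le_trans q1 qv).
have [f fP] := choice f_ex.
apply/countable_injP; exists (pickle \o f) => z z'; rewrite !inE => iz iz' /=.
move=> /(pcan_inj pickleK) fz.
have [z1 z2] := fP _ iz; have [z3 z4] := fP _ iz'.
have [zz'|zz'|//] := ltgtP z z'.
  by exfalso; apply: (z4 z) iz.1; rewrite zz' -fz ltW.
by exfalso; apply: (z2 z') iz'.1; rewrite zz' fz ltW.
Qed.

End intervals.

(** * Dyadic points of the range separate the gaps *)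

Section range_gaps.
Variables (R : realType) (y : R -> R).
Hypotheses (y_nd : forall s t, 0 <= s -> s <= t -> y s <= y t)
  (y_rc : forall t, 0 <= t -> y s @[s --> at_right t] --> y t)
  (y_ge0 : forall t, 0 <= t -> 0 <= y t).

Let W := closure [set y t | t in `[0, +oo[%classic].
Let Z := exp_neg W.
Definition grid r k := expR (- y (k%:R * 2^-1 ^+ r)).

Lemma grid_in_Z r k : Z (grid r k).
Proof.
right; exists (y (k%:R * 2^-1 ^+ r)) => //.
apply: subset_closure; exists (k%:R * 2^-1 ^+ r) => //=.
by rewrite in_itv/= andbT mulr_ge0// exprn_ge0.
Qed.

Lemma grid_nonincreasing r k : grid r k.+1 <= grid r k.
Proof.
rewrite /grid ler_expR lerN2; apply: y_nd; first by rewrite mulr_ge0// exprn_ge0.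
by rewrite ler_wpM2r ?exprn_ge0// ler_nat.
Qed.

Lemma grid_refine r k : grid r.+1 (2 * k) = grid r k.
Proof.
by rewrite /grid; congr (expR (- y _)); rewrite exprS natrM mulrACA mulfV ?mul1r.
Qed.

Lemma grid_le1 r k : 0 < grid r k <= 1.
Proof.
rewrite /grid expR_gt0 /= -expR0 ler_expR oppr_le0; apply: y_ge0.
by rewrite mulr_ge0// exprn_ge0.
Qed.

(** A point of the closure is approached by values of y, and each of these, by right continuity, by
    values at later dyadic times. *)
Lemma open_gap_grid u v : 0 <= u < v -> (exists2 z, Z z & u < z < v) ->
  exists r k, u < grid r k < v.
Proof.
move=> /andP[u0 uv] [z Zz /andP[uz zv]].
case: Zz => [z0|[w Ww wz]].
  by rewrite z0 ltNge u0 in uz.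
have z0 : 0 < z by exact: le_lt_trans uz.
pose O := [set w' : R | u < expR (- w') < v].
have cE : continuous (fun w : R => expR (- w)).
  move=> w'; apply: (@continuous_comp _ _ _ -%R expR); first exact: opp_continuous.
  exact: continuous_expR.
have oO : open O.
  rewrite (_ : O = (fun w => expR (- w)) @^-1` `]u, v[%classic).
    apply: open_comp => [w' _|]; first exact: cE.
    exact: interval_open.
  by apply/seteqP; split=> w' /=; rewrite in_itv.
have Ow : O w by rewrite /O /= wz uz zv.
have [_ [[t t0 <-] Oyt]] : [set y t | t in `[0, +oo[%classic] `&` O !=set0.
  by apply: Ww; exact: open_nbhs_nbhs.
rewrite /= in_itv/= andbT in t0.
have : \forall s \near at_right t, O (y s).
  have /(_ O) := y_rc t0; apply.
  exact: (open_nbhs_nbhs (conj oO Oyt)).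
move=> [e /= e0 he].
have [r hr] : exists r, 2^-1 ^+ r < e.
  have : (2^-1 : R) ^+ r @[r --> \oo] --> 0.
    by apply: cvg_expr; rewrite ger0_norm ?invr_ge0// invf_lt1// ltr1n.
  move=> /cvgr_lt/(_ _ e0)[r _ /(_ r (leqnn r))] h.
  by exists r.
have d0 : 0 < 2^-1 ^+ r :> R by rewrite exprn_gt0// invr_gt0.
pose k := (Num.truncn (t / 2^-1 ^+ r)).+1.
have k1 : t < k%:R * 2^-1 ^+ r by rewrite -ltr_pdivrMr//; exact: truncnS_gt.
have k2 : k%:R * 2^-1 ^+ r <= t + 2^-1 ^+ r.
  rewrite /k -natr1 mulrDl mul1r lerD2r -ler_pdivlMr//.
  by rewrite truncn_le divr_ge0// ltW.
exists r, k; apply: (he (k%:R * 2^-1 ^+ r)) => //=.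
by rewrite distrC ger0_norm ?subr_ge0 ?(ltW k1)//; lra.
Qed.

Definition same_cell r (u v : R) := forall k, (u < grid r k) = (v < grid r k).

Lemma same_cell_refine r u v : same_cell r.+1 u v -> same_cell r u v.
Proof. by move=> h k; rewrite -grid_refine; exact: h. Qed.

Lemma same_cell_mono r r' u v : (r <= r')%N -> same_cell r' u v -> same_cell r u v.
Proof.
move=> /subnK <-; elim: (r' - r)%N => // m IH; rewrite addSn => /same_cell_refine.
exact: IH.
Qed.

(** The grid separates u from v as soon as Z meets the open interval between them; the isolation
    hypotheses rule out that Z meets the closed interval only at its endpoints. *)
Lemma same_cell_interval u v : 0 < u < 1 -> 0 < v < 1 -> u != v ->
  ~ right_isolated Z u -> ~ left_isolated Z u ->
  ~ right_isolated Z v -> ~ left_isolated Z v ->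
  same_interval Z u v <-> forall r, same_cell r u v.
Proof.
move=> u01 v01 uv.
wlog : u v u01 v01 uv / u < v.
  move=> h r1 l1 r2 l2; have [uv'|vu'|e] := ltgtP u v; first exact: h.
    have sym : same_interval Z u v <-> same_interval Z v u.
      by split; exact: connected_component_sym.
    rewrite sym (h v u)//; last by rewrite eq_sym.
    by split=> h' r k; rewrite h'.
  by rewrite e eqxx in uv.
move=> {}uv r1 l1 r2 l2; rewrite same_intervalP min_l ?(ltW uv)// max_r ?(ltW uv)//.
have /andP[u0 u1] := u01; have /andP[v0 v1] := v01.
split=> [[_ _ h] r k|h].
  apply/idP/idP => [ux|vx]; last exact: lt_trans vx.
  rewrite ltNge; apply/negP => xv; apply: (h (grid r k)) (grid_in_Z r k).
  by rewrite (ltW ux).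
split; rewrite ?(ltW u0) ?(ltW u1) ?(ltW v0) ?(ltW v1)// => z /andP[uz zv] Zz.
suff [z' Zz' uz'v] : exists2 z', Z z' & u < z' < v.
  have [|r [k]] := @open_gap_grid u v _ (ex_intro2 _ _ z' Zz' uz'v); first by rewrite ltW.
  by move=> /andP[ux xv]; have := h r k; rewrite ux ltNge (ltW xv).
move: uz; rewrite le_eqVlt => /orP[/eqP e|uz].
  apply: contrapT => nz; apply: r1; split; first by rewrite e.
  exists (v - u); first by rewrite subr_gt0.
  move=> v'; rewrite addrC subrK => /andP[uv' v'v] Zv'.
  by apply: nz; exists v' => //; rewrite uv'.
move: zv; rewrite le_eqVlt => /orP[/eqP e|zv]; last by exists z => //; rewrite uz.
apply: contrapT => nz; apply: l2; split; first by rewrite -e.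
exists (v - u); first by rewrite subr_gt0.
move=> v'; rewrite opprB addrC subrK => /andP[uv' v'v] Zv'.
by apply: nz; exists v' => //; rewrite uv'.
Qed.

End range_gaps.

(** * Freezing one of two independent sources *)

Section diagonal.
Context d (Om : measurableType d) (R : realType) (P : probability Om R).
Variables F G : set (set Om).
Hypotheses (Fm : F `<=` measurable) (Gm : G `<=` measurable)
  (FI : setI_closed F) (GI : setI_closed G) (FT : F setT) (GT : G setT)
  (FG : independent_classes P F G).

Lemma rectangles_measurable :
  <<s [set A `*` B | A in F & B in G] >> `<=` @measurable _ (Om * Om)%type.
Proof.
apply: sigma_generated_measurable => _ [A /Fm mA [B /Gm mB <-]].
exact: measurableX.
Qed.

(** Independence means that the diagonal map has the product law on the sigma-algebra generated by
    rectangles; then Fubini's theorem applies. *)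
Lemma independent_diagonal (D : set (Om * Om)) :
  <<s [set A `*` B | A in F & B in G] >> D ->
  (P [set w | D (w, w)] = \int[P]_w P [set w' | D (w, w')])%E.
Proof.
move=> hD.
have mdiag : measurable_fun [set: Om] (fun w : Om => (w, w)).
  by apply: measurable_fun_pair; exact: measurable_id.
pose diag : {mfun Om >-> (Om * Om)%type} := mfun_Sub (mem_set mdiag).
transitivity ((P \x P)%E D); last first.
  rewrite /product_measure1 /=; apply: eq_integral => w _; congr (P _).
  by apply/seteqP; split=> w' /=; rewrite /xsection /= inE.
apply: (g_sigma_algebra_measure_unique [set A `*` B | A in F & B in G] _
  (fun=> setT) _ _ (distribution P diag) (P \x P)%E) => //.
- by move=> X hX; apply: rectangles_measurable; exact: sub_sigma_algebra.
- by move=> _; exists setT => //; exists setT => //; rewrite setXTT.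
- by rewrite bigcup_const//; exists 0%N.
- move=> _ _ [A FA [B GB <-]] [A' FA' [B' GB' <-]].
  by exists (A `&` A'); [exact: FI|exists (B `&` B'); [exact: GI|rewrite setXI]].
- move=> _ [A FA [B GB <-]]; rewrite [RHS]product_measure1E; [|exact: Fm|exact: Gm].
  by rewrite -FG.
- by move=> _; apply: (@le_lt_trans _ _ 1%E); [exact: probability_le1|exact: ltry].
Qed.

End diagonal.

Section sampling_event.
Context d (Om : measurableType d) (R : realType) (P : probability Om R).
Variables (Z : Om -> set R) (U : nat -> {RV P >-> R}) (n : nat).
Hypothesis cZ : random_closed_set Z.
Hypothesis UZ_indep : mutually_independent P
  (fun o : option nat => if o is Some i then sigma_RV (U i) else sigma_set Z).

Definition sample_rectangles : set (set Om) :=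
  [set B | exists A : nat -> set R, (forall i, measurable (A i)) /\
    B = [set w | forall i, (i < n)%N -> A i (U i w)]].

Lemma sample_rectangleE (A : nat -> set R) :
  [set w | forall i, (i < n)%N -> A i (U i w)] =
  \bigcap_(i in [set` iota 0 n]) (U i @^-1` A i).
Proof.
apply/seteqP; split=> w h i /= ni; apply: h; first by move: ni; rewrite mem_iota.
by rewrite /= mem_iota.
Qed.

Lemma sample_rectangle_measurable (A : nat -> set R) : (forall i, measurable (A i)) ->
  measurable [set w | forall i, (i < n)%N -> A i (U i w)].
Proof.
move=> mA; rewrite sample_rectangleE; apply: bigcap_measurableType => i _.
by rewrite -[X in measurable X]setTI; exact: measurable_funPT.
Qed.

Lemma probability_sample_rectangle (H : set Om) (A : nat -> set R) :
  sigma_set Z H -> (forall i, measurable (A i)) ->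
  (P (H `&` [set w | forall i, (i < n)%N -> A i (U i w)]) =
   P H * \prod_(i <- iota 0 n) P (U i @^-1` A i))%E.
Proof.
move=> ZH mA.
pose E (o : option nat) := if o is Some i then U i @^-1` A i else H.
have := UZ_indep (s := None :: map Some (iota 0 n)) (E := E).
rewrite big_cons big_map => <-.
- congr (P _); rewrite sample_rectangleE; apply/seteqP; split=> [w [Hw h] [i|]|w h].
  + rewrite /= inE => /orP[//|]; rewrite mem_map; last by move=> ? ? [].
    exact: h.
  + by [].
  + split=> [|i /= ni]; first by apply: (h None); rewrite /= inE eqxx.
    by apply: (h (Some i)); rewrite /= inE mem_map// => ? ? [].
- rewrite /= map_inj_uniq ?iota_uniq ?andbT; last by move=> ? ? [].
  by apply/mapP => -[].
- move=> [i _|//]; exists (A i) => //; by rewrite setTI.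
Qed.

Lemma sigma_set_measurable : sigma_set Z `<=` measurable.
Proof. by apply: sigma_generated_measurable => _ [G oG <-]; exact: cZ.2. Qed.

Let sigmaZ : sigma_algebra setT (sigma_set Z).
Proof. exact: smallest_sigma_algebra. Qed.

Lemma sample_rectangles_independent : independent_classes P (sigma_set Z) sample_rectangles.
Proof.
move=> H _ ZH [A [mA ->]]; rewrite probability_sample_rectangle//; congr (_ * _)%E.
have := probability_sample_rectangle (sigma_algebra_setT sigmaZ) mA.
by rewrite setTI probability_setT mul1e.
Qed.

Let events := <<s [set A `*` B | A in sigma_set Z & B in sample_rectangles] >>.

Let sigma_events : sigma_algebra setT events.
Proof. exact: smallest_sigma_algebra. Qed.

Let setT_rectangle : sample_rectangles setT.
Proof. by exists (fun=> setT); split=> //; apply/seteqP; split. Qed.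

Let event_hits (G : set R) : open G -> events [set z | Z z.1 `&` G !=set0].
Proof.
move=> oG; apply: sub_sigma_algebra; exists (hits Z G).
  by apply: sub_sigma_algebra; exists G.
by exists setT => //; apply/seteqP; split=> z //= [].
Qed.

Let event_sample (i : 'I_n) (A : set R) : measurable A -> events [set z | A (U i z.2)].
Proof.
move=> mA; apply: sub_sigma_algebra; exists setT; first exact: sigma_algebra_setT.
exists [set w | A (U i w)]; last by apply/seteqP; split=> z //= [].
exists (fun j => if j == i :> nat then A else setT); split=> [j|]; first by case: ifP.
apply/seteqP; split=> w /= h; first by move=> j _; case: eqP => // ->.
by have := h i (ltn_ord i); rewrite eqxx.
Qed.

Let event_lt (i : 'I_n) (q : R) : events [set z | U i z.2 < q].
Proof.
have := @event_sample i `]-oo, q[%classic; rewrite (_ : [set z | _] = [set z | U i z.2 < q]).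
  by apply; exact: measurable_itv.
by apply/seteqP; split=> z /=; rewrite in_itv.
Qed.

Let event_gt (i : 'I_n) (q : R) : events [set z | q < U i z.2].
Proof.
have := @event_sample i `]q, +oo[%classic; rewrite (_ : [set z | _] = [set z | q < U i z.2]).
  by apply; exact: measurable_itv.
by apply/seteqP; split=> z /=; rewrite in_itv/= andbT.
Qed.

Let event_01 (i : 'I_n) : events [set z | 0 <= U i z.2 <= 1].
Proof.
have := @event_sample i `[0, 1]%classic.
rewrite (_ : [set z | _] = [set z | 0 <= U i z.2 <= 1]).
  by apply; exact: measurable_itv.
by apply/seteqP; split=> z /=; rewrite in_itv.
Qed.

Let event_lt2 (i j : 'I_n) : events [set z | U i z.2 < U j z.2].
Proof.
rewrite (_ : [set z | _] =
    [set z | exists q : rat, U i z.2 < ratr q /\ ratr q < U j z.2]).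
  by apply: (sigma_exists sigma_events) => q; exact: (sigma_and sigma_events).
apply/seteqP; split=> z /=; last by move=> [q [? ?]]; apply: (@lt_trans _ _ (ratr q)).
by move=> /rat_in_itvoo[q /=]; rewrite in_itv/= => /andP[? ?]; exists q.
Qed.

Let event_same_interval (i j : 'I_n) :
  events [set z | same_interval (Z z.1) (U i z.2) (U j z.2)].
Proof.
rewrite (_ : [set z | _] = [set z | 0 <= U i z.2 <= 1 /\ (0 <= U j z.2 <= 1 /\
  exists p q : rat, ((ratr p < U i z.2 /\ ratr p < U j z.2) /\
    ((U i z.2 < ratr q /\ U j z.2 < ratr q) /\
    ~ (Z z.1 `&` `]ratr p, ratr q[ !=set0))))]).
  apply: (sigma_and sigma_events) => //; apply: (sigma_and sigma_events) => //.
  apply: (sigma_exists sigma_events) => p; apply: (sigma_exists sigma_events) => q.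
  apply: (sigma_and sigma_events); first exact: (sigma_and sigma_events).
  apply: (sigma_and sigma_events); first exact: (sigma_and sigma_events).
  by apply: (sigma_not sigma_events); apply: event_hits; exact: interval_open.
have minmax (x y : R) : Num.min x y <= Num.max x y.
  by case: (leP x y) => [//|/ltW].
apply/seteqP; split=> z /=.
  rewrite same_intervalP => -[? ? /(closed_gapP (cZ.1 z.1) (minmax _ _))].
  move=> [p [q []]]; rewrite lt_min gt_max => /andP[? ?] /andP[? ?] ?; do 2 split=> //.
  by exists p, q.
move=> [? [? [p [q [[? ?] [[? ?] ?]]]]]]; rewrite same_intervalP; split=> //.
apply/(closed_gapP (cZ.1 z.1) (minmax _ _)); exists p, q.
by rewrite lt_min gt_max; split=> //; exact/andP.
Qed.

Lemma sampling_event s :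
  events [set z | sampled_composition (Z z.1) n (fun i => U i z.2) s].
Proof.
(* Written as finite functions, the ranking maps range over a countable type, so the existential is
   a countable union. *)
rewrite (_ : [set z | _] = [set z | exists c : {ffun 'I_n -> 'I_(size s)},
  (forall i j : 'I_n, c i = c j <-> i = j \/ same_interval (Z z.1) (U i z.2) (U j z.2)) /\
  ((forall i j : 'I_n, U i z.2 < U j z.2 -> (c i <= c j)%N) /\
   (forall k : 'I_(size s), nth 0%N s k = #|[pred i | c i == k]|))]).
  apply: (sigma_exists sigma_events) => c; apply: (sigma_and sigma_events).
    apply: (sigma_forall sigma_events) => i; apply: (sigma_forall sigma_events) => j.
    apply: (sigma_iff sigma_events); first exact: (sigma_const sigma_events).
    apply: (sigma_or sigma_events); first exact: (sigma_const sigma_events).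
    exact: event_same_interval.
  apply: (sigma_and sigma_events); last exact: (sigma_const sigma_events).
  apply: (sigma_forall sigma_events) => i; apply: (sigma_forall sigma_events) => j.
  apply: (sigma_imply sigma_events); first exact: event_lt2.
  exact: (sigma_const sigma_events).
apply/seteqP; split=> z /= [c].
  move=> [h1 h2 h3]; exists (finfun c); split; [|split].
  + by move=> i j; rewrite !ffunE.
  + by move=> i j; rewrite !ffunE; exact: h2.
  + by move=> k; rewrite h3; apply: eq_card => i; rewrite !inE ffunE.
by move=> [h1 [h2 h3]]; exists c.
Qed.

(** Conditioning on Z: the sample is independent of it, so Z may be frozen while the points vary. *)
Lemma probability_sampling s :
  (P [set w | sampled_composition (Z w) n (fun i => U i w) s] =
   \int[P]_w P [set w' | sampled_composition (Z w) n (fun i => U i w') s])%E.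
Proof.
apply: (@independent_diagonal _ _ _ _ _ _ _ _ _ _ _ _ _ _ (sampling_event s)).
- exact: sigma_set_measurable.
- by move=> _ [A [mA ->]]; exact: (sample_rectangle_measurable mA).
- by move=> A B ZA ZB; exact: (sigma_algebra_setI sigmaZ).
- move=> _ _ [A [mA ->]] [B [mB ->]]; exists (fun i => A i `&` B i); split.
    by move=> i; exact: measurableI.
  apply/seteqP; split=> w /=; first by move=> [a b] i ni; split; [exact: a|exact: b].
  by move=> h; split=> i ni; have [] := h i ni.
- exact: (sigma_algebra_setT sigmaZ).
- by [].
- exact: sample_rectangles_independent.
Qed.

Lemma measurable_sampling_section s w :
  measurable [set w' | sampled_composition (Z w) n (fun i => U i w') s].
Proof.
have mD := @rectangles_measurable _ Om (sigma_set Z) sample_rectangles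
  sigma_set_measurable _ _ (sampling_event s).
have /(measurable_xsection w) := mD ltac:(by move=> _ [A [mA ->]]; exact: sample_rectangle_measurable).
by congr measurable; apply/seteqP; split=> w' /=; rewrite /xsection /= inE.
Qed.

End sampling_event.

Section cell_counts.
Variable R : realType.

Definition nonzero (v : seq nat) := [seq m <- v | (0 < m)%N].

(** Induction on K, splitting off the leftmost cell: either it is empty or it holds the first box.
    The entry p of a count vector belongs to the cell K - p - 1. *)
Lemma sum_cell_counts (len : nat -> R) n K s : all (fun m => 0 < m <= n)%N s ->
  \sum_(v : K.-tuple 'I_n.+1 | nonzero (map val v) == s)
    \prod_(p < K) len (K - p.+1)%N ^+ tnth v p = cell_sum len s K.
Proof.
elim: K s => [|K IH] s sn.
  case: s sn => [|m s] _.
    rewrite (bigD1 [tuple])//= big_ord0 big1 ?addr0// => v /andP[_ /eqP vn].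
    by case: vn; exact: tuple0.
  by rewrite /= big_ord0 big_pred0// => v; rewrite tuple0.
have wE (m : 'I_n.+1) (v : K.-tuple 'I_n.+1) :
    \prod_(p < K.+1) len (K.+1 - p.+1)%N ^+ tnth (cons_tuple m v) p =
    len K ^+ m * \prod_(p < K) len (K - p.+1)%N ^+ tnth v p.
  rewrite big_ord_recl subSS subn0; congr (_ * _).
  by apply: eq_bigr => p _; rewrite lift0 subSS tnthS.
pose S s' := \sum_(v : K.-tuple 'I_n.+1 | nonzero (map val v) == s')
  \prod_(p < K) len (K - p.+1)%N ^+ tnth v p.
pose G s0 m := if m is m'.+1 then
  if s0 is m0 :: s' then if m0 == m'.+1 then len K ^+ m0 * S s' else 0 else 0 else S s0.
rewrite big_mkcond big_tuple_cons (eq_bigr (fun m : 'I_n.+1 => G s m)) => [|m _]; last first.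
  rewrite /G /S; case: m => [[|m] mn] /=.
    rewrite [RHS]big_mkcond/=; apply: eq_bigr => v _.
    by rewrite wE expr0 mul1r.
  case: s sn => [|m0 s] sn; first by apply: big1 => v _; rewrite /nonzero/=.
  rewrite (eq_bigr (fun v : K.-tuple 'I_n.+1 => if (m.+1 == m0) && (nonzero (map val v) == s)
    then len K ^+ m.+1 * \prod_(p < K) len (K - p.+1)%N ^+ tnth v p else 0)).
    have [->|mm0] := eqVneq m0 m.+1; last by rewrite big1.
    by rewrite -big_mkcond /= big_distrr.
  by move=> v _; rewrite wE.
rewrite big_ord_recl [G _ _]IH//.
case: s sn => [|m s] sn; first by rewrite big1// addr0; case: (K).
have /andP[/andP[m0 mn] {}sn] := sn.
rewrite cell_sumS; congr (_ + _); case: m m0 mn => // m _ mn.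
rewrite (eq_bigr (fun k => if k == Ordinal mn then len K ^+ m.+1 * S s else 0)).
  by rewrite -big_mkcond big_pred1_eq [S s]IH.
by move=> k _; rewrite /G lift0 eqSS eq_sym.
Qed.

Lemma prod_count_mem (I : finType) (t : seq I) (f : I -> R) :
  \prod_(i <- t) f i = \prod_i f i ^+ count_mem i t.
Proof.
elim: t => [|x t IH]; first by rewrite big_nil big1.
rewrite big_cons IH (bigD1 x)//= [in RHS](bigD1 x)//= eqxx mulrA add1n exprS; congr (_ * _).
by apply: eq_bigr => k /negbTE kx; rewrite eq_sym kx.
Qed.

Definition cell_counts K (t : seq 'I_K) := [seq count_mem p t | p <- enum 'I_K].

(** Words are grouped by their letter counts: a group has n! / prod m! = [multinom s] elements, all
    of the same weight. *)
Lemma sum_cell_words (len : nat -> R) n K s : all (leq 1) s -> sumn s = n ->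
  \sum_(t : n.-tuple 'I_K | nonzero (cell_counts t) == s) \prod_(p <- t) len (K - p.+1)%N =
  (multinom s)%:R * cell_sum len s K.
Proof.
move=> s0 sn.
have sn' : all (fun m => 0 < m <= n)%N s.
  apply/allP => m ms; rewrite (allP s0)//= -sn sumnE.
  by rewrite (big_rem m)//= leq_addr.
rewrite -(sum_cell_counts len K sn') big_distrr/=.
pose cnt (t : n.-tuple 'I_K) : K.-tuple 'I_n.+1 := [tuple inord (count_mem p t) | p < K].
have tnth_cnt t p : tnth (cnt t) p = count_mem p t :> nat.
  by rewrite tnth_mktuple inordK// ltnS (leq_trans (count_size _ _))// size_tuple.
have cntE t : map val (cnt t) = cell_counts t.
  rewrite /cell_counts /= -map_comp; apply: eq_map => p /=.
  by have := tnth_cnt t p; rewrite tnth_mktuple.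
rewrite (partition_big cnt (fun v => nonzero (map val v) == s))/=; last first.
  by move=> t; rewrite -cntE.
apply: eq_bigr => v /eqP vs.
transitivity (\sum_(t : n.-tuple 'I_K) [forall k, count_mem k t == tnth v k]%:R *
    \prod_(p < K) len (K - p.+1)%N ^+ tnth v p).
  rewrite big_mkcond; apply: eq_bigr => t _.
  have -> : (nonzero (cell_counts t) == s) && (cnt t == v) =
      [forall k, count_mem k t == tnth v k].
    apply/andP/forallP => [[_ /eqP <-] k|h]; first by rewrite tnth_cnt.
    have tv : cnt t = v by apply: eq_from_tnth => k; apply: ord_inj; rewrite tnth_cnt; exact/eqP.
    by rewrite -cntE tv vs !eqxx.
  case: ifP => [/forallP h|_]; last by rewrite mul0r.
  rewrite mul1r prod_count_mem; apply: eq_bigr => k _; congr (_ ^+ _); exact/eqP.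
rewrite -mulr_suml; congr (_ * _).
have nz0 (w : seq nat) : sumn (nonzero w) = sumn w.
  by elim: w => //= -[|m] w /= ->.
have nz1 (w : seq nat) : (\prod_(m <- nonzero w) m`! = \prod_(m <- w) m`!)%N.
  elim: w => //= -[|m] w /= IH; first by rewrite big_cons mul1n.
  by rewrite !big_cons IH.
have vE (T : Type) (idx : T) (op : Monoid.law idx) (F : nat -> T) :
    \big[op/idx]_(k < K) F (tnth v k) = \big[op/idx]_(m <- map val v) F m.
  by rewrite big_map big_tuple.
have sumv : (\sum_(k < K) tnth v k = n)%N.
  apply: (etrans (vE _ _ _ id)); rewrite -[LHS]/(\sum_(m <- map val v) m)%N -sumnE.
  by apply: (etrans (esym (nz0 _))); rewrite vs.
have prodv : (\prod_(k < K) (tnth v k)`! = \prod_(m <- s) m`!)%N.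
  apply: (etrans (vE _ _ _ factorial)).
  by apply: (etrans (esym (nz1 _))); rewrite vs.
have := count_words sumv; rewrite prodv => h.
have fact_s : (0 < \prod_(m <- s) m`!)%N by apply: prodn_gt0 => m; exact: fact_gt0.
have := multinom_fact s; rewrite sn -h => /eqP.
by rewrite eqn_pmul2r// => /eqP ->; rewrite natr_sum.
Qed.

End cell_counts.

(** The class of rank l can only be the l-th occupied cell, since both families are listed in
    increasing order. *)
Lemma rank_compositionP n K (k : 'I_n -> 'I_K) (s : seq nat) :
  all (leq 1) s ->
  (exists c : 'I_n -> 'I_(size s),
     (forall i j, (c i < c j)%N = (k i < k j)%N) /\
     (forall l : 'I_(size s), nth 0%N s l = #|[pred i | c i == l]|)) <->
  nonzero [seq #|[pred i | k i == p]| | p <- enum 'I_K] = s.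
Proof.
move=> s0; set cnt := fun p : 'I_K => #|[pred i | k i == p]|.
pose ks := [seq p <- enum 'I_K | (0 < cnt p)%N].
have -> : nonzero [seq cnt p | p <- enum 'I_K] = map cnt ks.
  by rewrite /nonzero filter_map.
have mem_ks p : (p \in ks) = (0 < cnt p)%N by rewrite mem_filter mem_enum andbT.
have k_ks i : k i \in ks by rewrite mem_ks; apply/card_gt0P; exists i; rewrite !inE.
pose lt (p q : 'I_K) := (p < q)%N.
have lt_tr : transitive lt by move=> p q r; exact: ltn_trans.
have s_ks : sorted lt ks.
  apply: (sorted_filter lt_tr).
  have := iota_ltn_sorted 0 K; rewrite -val_enum_ord sorted_map.
  by move=> h; exact: h.
split=> [[c [cE cs]]|<-].
  have surj (l : 'I_(size s)) : exists i, c i == l.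
    have /card_gt0P[i] : (0 < #|[pred i | c i == l]|)%N.
      by rewrite -cs; apply: (allP s0); exact: mem_nth.
    by rewrite inE; exists i.
  pose f l := k (xchoose (surj l)).
  have cf l : c (xchoose (surj l)) = l by apply/eqP/(xchooseP (surj l)).
  have fk i l : (k i == f l) = (c i == l).
    have eqk i' j : (k i' == k j) = (c i' == c j).
      rewrite -(inj_eq (@ord_inj _) (k i')) -(inj_eq (@ord_inj _) (c i')).
      by rewrite [LHS]eqn_leq [RHS]eqn_leq; congr (_ && _); rewrite leqNgt [RHS]leqNgt cE.
    by rewrite /f eqk cf.
  have ks_f : ks = map f (enum 'I_(size s)).
    apply: (@irr_sorted_eq _ lt).
    - exact: lt_tr.
    - by move=> p; rewrite /lt ltnn.
    - exact: s_ks.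
    - rewrite sorted_map; have := iota_ltn_sorted 0 (size s).
      rewrite -val_enum_ord sorted_map; apply: sub_sorted => l l' /=.
      by rewrite /lt /f -cE !cf.
    - move=> p; rewrite mem_ks; apply/card_gt0P/mapP => [[i]|[l _ ->]].
        rewrite inE => /eqP <-; exists (c i); first by rewrite mem_enum.
        by apply/eqP; rewrite fk.
      by exists (xchoose (surj l)); rewrite inE.
  have sz : size (map cnt ks) = size s by rewrite ks_f 2!size_map size_enum_ord.
  apply: (@eq_from_nth _ 0%N) => // l; rewrite sz => ls; rewrite ks_f.
  rewrite (nth_map (f (Ordinal ls))); last by rewrite size_map size_enum_ord.
  rewrite (nth_map (Ordinal ls)); last by rewrite size_enum_ord.
  rewrite (cs (Ordinal ls)) /cnt.
  apply: eq_card => i; rewrite !inE fk; congr (_ == _); apply: val_inj.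
  by rewrite /= nth_enum_ord.
have ltc i : (index (k i) ks < size (map cnt ks))%N by rewrite size_map index_mem.
pose c0 i : 'I_(size (map cnt ks)) := Ordinal (ltc i).
exists c0; split=> [i j|l] /=.
  have u_ks : uniq ks by apply: filter_uniq; exact: enum_uniq.
  have lt_ks : {in ks &, forall p q : 'I_K, (index p ks < index q ks)%N = (p < q)%N}.
    move=> p q pk qk; apply/idP/idP.
      exact: (sorted_ltn_index lt_tr s_ks).
    move=> pq; rewrite ltnNge leq_eqVlt; apply/negP => /orP[/eqP e|h].
      by have := congr1 (nth p ks) e; rewrite !nth_index// => e'; rewrite e' ltnn in pq.
    have := ltn_trans pq (sorted_ltn_index lt_tr s_ks _ _ qk pk h).
    by rewrite ltnn.
  exact: lt_ks.
have ls : (l < size ks)%N by rewrite -(size_map cnt) ltn_ord.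
pose x0 : 'I_K := tnth (in_tuple ks) (Ordinal ls).
rewrite (nth_map x0)// /cnt; apply: eq_card => i; rewrite !inE.
have idx : index (nth x0 ks l) ks = l by apply: index_uniq => //; apply: filter_uniq; exact: enum_uniq.
apply/eqP/eqP => [e|/(congr1 (@nat_of_ord _)) /= <-]; last by rewrite nth_index.
by apply: ord_inj; rewrite /= e idx.
Qed.

(** * Uniform points in the cells of a nonincreasing sequence *)

Section uniform_sample.
Context d (Om : measurableType d) (R : realType) (P : probability Om R).

Lemma finite_exists_measurable (I : finType) (p : pred I) (E : I -> set Om) :
  (forall i, measurable (E i)) -> measurable [set w | exists2 i, p i & E i w].
Proof.
move=> mE; rewrite (_ : [set w | _] = \bigcup_(i in [set i | p i]) E i).
  by apply: fin_bigcup_measurable => //; exact: finite_finset.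
by apply/seteqP; split=> w /= [i pi Ei]; exists i.
Qed.

Lemma finite_disjoint_probability (I : finType) (p : pred I) (E : I -> set Om) :
  (forall i, measurable (E i)) -> (forall i j w, E i w -> E j w -> i = j) ->
  fine (P [set w | exists2 i, p i & E i w]) = \sum_(i | p i) fine (P (E i)).
Proof.
move=> mE dE; have mU := finite_exists_measurable p mE.
rewrite -bmf_int_indic// big_mkcond/=.
transitivity (\int[P]_w (\sum_i (p i)%:R * \1_(E i) w : R)).
  congr (Rintegral _ _ _); apply/funext => w; rewrite indicE.
  have [[i pi Ei]|nE] := pselect ([set w | exists2 i, p i & E i w] w).
    rewrite mem_set; last by exists i.
    rewrite (bigD1 i)//= pi mul1r indicE mem_set// big1 ?addr0// => j ji.
    rewrite indicE memNset ?mulr0// => Ej; move: ji; rewrite (dE _ _ _ Ej Ei) eqxx//.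
  rewrite memNset// big1// => i _; have [pi|] := boolP (p i); last by rewrite mul0r.
  by rewrite indicE memNset ?mulr0// => Ei; apply: nE; exists i.
rewrite bmf_int_sum => [|i]; last by apply: bmfZ; exact: bmf_indic.
apply: eq_bigr => i _; rewrite bmf_intZ; last exact: bmf_indic.
by rewrite bmf_int_indic//; case: ifP; rewrite ?mul1r// mul0r.
Qed.

Lemma uniform_probE (A : set R) : measurable A ->
  uniform_prob (@ltr01 R) A = lebesgue_measure (A `&` `[0, 1]%classic).
Proof.
move=> mA; rewrite /uniform_prob integral_uniform_pdf.
rewrite (eq_integral (fun=> 1%:E)) => [|x].
  by rewrite integral_cst ?mul1e//; exact: measurableI.
rewrite inE => -[_ /=]; rewrite in_itv/= /uniform_pdf => ->.
by rewrite subr0 invr1.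
Qed.

(** The cells go from right to left. The cell 0 is unbounded, so that every point above some [x k]
    has a cell; its length is that of its trace on [0, 1]. *)
Definition cell (x : nat -> R) k : set R :=
  if k is k'.+1 then `[x k, x k'[%classic else `[x 0%N, +oo[%classic.

Definition cell_length (x : nat -> R) k : R :=
  if k is k'.+1 then x k' - x k else 1 - x 0%N.

Lemma measurable_cell x k : measurable (cell x k).
Proof. by case: k => [|k]; exact: measurable_itv. Qed.

Section cells.
Variable x : nat -> R.
Hypotheses (x01 : forall k, 0 < x k <= 1) (x_ni : forall k, x k.+1 <= x k).

Lemma cell_length_ge0 k : 0 <= cell_length x k.
Proof. by case: k => [|k]; rewrite /= subr_ge0//; case/andP: (x01 0%N). Qed.

Lemma x_nonincreasing m k : (m <= k)%N -> x k <= x m.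
Proof.
move=> /subnK <-; elim: (k - m)%N => // j IH; rewrite addSn.
exact: le_trans (x_ni _) IH.
Qed.

Lemma uniform_cell k : uniform_prob (@ltr01 R) (cell x k) = (cell_length x k)%:E.
Proof.
rewrite uniform_probE; last exact: measurable_cell.
case: k => [|k] /=.
  rewrite (_ : _ `&` _ = `[x 0%N, 1]%classic).
    rewrite lebesgue_measure_itv/= lte_fin; case: ltP => h; first by rewrite -EFinD.
    by congr EFin; have /andP[_ h'] := x01 0%N; lra.
  have /andP[h _] := x01 0%N.
  apply/seteqP; split=> z /=; rewrite !in_itv/= ?andbT; first by move=> [-> /andP[]].
  by move=> /andP[h1 ->]; rewrite h1 (le_trans (ltW h) h1).
rewrite (_ : _ `&` _ = `[x k.+1, x k[%classic).
  rewrite lebesgue_measure_itv/= lte_fin; case: ltP => h; first by rewrite -EFinD.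
  by congr EFin; have := x_ni k; lra.
have /andP[_ h1] := x01 k; have /andP[h0 _] := x01 k.+1.
apply/seteqP; split=> z /=; rewrite !in_itv/=; first by move=> [].
by move=> /andP[h2 h3]; rewrite h2 h3 (le_trans (ltW h0) h2) (ltW (lt_le_trans h3 h1)).
Qed.

Lemma cell_lt k u m : cell x k u -> (u < x m) = (m < k)%N.
Proof.
case: k => [|k] /=; rewrite in_itv/= ?andbT => h.
  by rewrite ltn0; apply/negbTE; rewrite -leNgt (le_trans (x_nonincreasing (leq0n m)) h).
case/andP: h => h1 h2; have [mk|km] := ltnP m k.+1.
  by rewrite (lt_le_trans h2)// x_nonincreasing.
by apply/negbTE; rewrite -leNgt (le_trans (x_nonincreasing km)).
Qed.

Lemma cell_inj k l u : cell x k u -> cell x l u -> k = l.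
Proof.
move=> hk hl; have h m : (m < k)%N = (m < l)%N by rewrite -(cell_lt m hk) (cell_lt m hl).
have [kl|lk|//] := ltngtP k l.
  by rewrite -h ltnn in kl.
by rewrite h ltnn in lk.
Qed.

Lemma cell_order k l u v : cell x k u -> cell x l v -> (k < l)%N -> v < u.
Proof.
move=> hk hl kl; have := cell_lt k hl; have := cell_lt k hk; rewrite kl ltnn => h h'.
by apply: (lt_le_trans h'); rewrite leNgt h.
Qed.

Lemma cell_exists u : (exists k, x k <= u) -> exists k, cell x k u.
Proof.
move=> h; case: (ex_minnP h) => -[|k] hk min.
  by exists 0%N; rewrite /= in_itv/= hk.
exists k.+1; rewrite /= in_itv/= hk ltNge; apply/negP => hk'.
by have := min _ hk'; rewrite ltnn.
Qed.

End cells.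

Variable U : nat -> {RV P >-> R}.
Hypothesis U_unif : forall i A, measurable A ->
  distribution P (U i) A = uniform_prob (@ltr01 R) A.
Hypothesis U_indep : mutually_independent P (fun i : nat => sigma_RV (U i)).

Lemma measurable_sample i (A : set R) : measurable A -> measurable [set w | A (U i w)].
Proof. by move=> mA; rewrite -[X in measurable X]setTI; exact: measurable_funPT. Qed.

Lemma sample_null i (A : set R) : measurable A -> lebesgue_measure A = 0%E ->
  {ae P, forall w, ~ A (U i w)}.
Proof.
move=> mA A0; exists [set w | A (U i w)]; split.
- exact: measurable_sample.
- have := U_unif i mA; rewrite /distribution /pushforward /= uniform_probE// => ->.
  apply/eqP; rewrite eq_le measure_ge0 andbT -A0 le_measure// ?inE//.
  exact: measurableI.
- by move=> w /= /contrapT.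
Qed.

Lemma sample_interior i : {ae P, forall w, 0 < U i w < 1}.
Proof.
have h0 : {ae P, forall w, U i w != 0}.
  have := @sample_null i [set 0] (measurable_set1 _) (lebesgue_measure_set1 _).
  by apply: filterS => w /= h; apply/eqP.
have h1 : {ae P, forall w, U i w != 1}.
  have := @sample_null i [set 1] (measurable_set1 _) (lebesgue_measure_set1 _).
  by apply: filterS => w /= h; apply/eqP.
have h2 : {ae P, forall w, 0 <= U i w <= 1}.
  have m01 : measurable (`[0, 1]%classic : set R) by exact: measurable_itv.
  exists [set w | (~` `[0, 1]%classic) (U i w)]; split.
  - by apply: measurable_sample; exact: measurableC.
  - have := @U_unif i (~` `[0, 1]%classic) (measurableC m01).
    rewrite /distribution /pushforward /= uniform_probE; last exact: measurableC.
    by rewrite setICl measure0.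
  - by move=> w /= h; rewrite in_itv.
apply: filterS3 h0 h1 h2 => w h0 h1 /andP[h2 h3].
by rewrite !lt_neqAle h2 h3 h1 eq_sym h0.
Qed.

Lemma sample_avoids i (A : set R) : countable A -> {ae P, forall w, ~ A (U i w)}.
Proof.
move=> cA; apply: sample_null; last exact: countable_lebesgue_measure0.
exact: countable_measurable.
Qed.

(** Once the value of [U i] is frozen, [U j] avoids this single point almost surely. Rational
    separation puts the event in the sigma-algebra of rectangles. *)
Lemma sample_distinct i j : i != j -> {ae P, forall w, U i w != U j w}.
Proof.
move=> ij.
have sig k : sigma_algebra setT (sigma_RV (U k)).
  by apply: sigma_algebra_preimage; exact: sigma_algebra_measurable.
have sRVm k : sigma_RV (U k) `<=` measurable.
  by move=> _ [A mA <-]; exact: measurable_funPT.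
have sRV k (A : set R) : measurable A -> sigma_RV (U k) [set w | A (U k w)].
  by move=> mA; exists A => //; rewrite setTI.
have mlt (q : R) : measurable [set x : R | x < q].
  by rewrite -set_itvNyo; exact: measurable_itv.
have mgt (q : R) : measurable [set x : R | q < x].
  by rewrite -set_itvoy; exact: measurable_itv.
pose D := [set z : Om * Om | U i z.1 != U j z.2].
have Devent : <<s [set A `*` B | A in sigma_RV (U i) & B in sigma_RV (U j)] >> D.
  have sD := smallest_sigma_algebra setT [set A `*` B | A in sigma_RV (U i) & B in sigma_RV (U j)].
  rewrite (_ : D = [set z | exists q : rat, (U i z.1 < ratr q /\ ratr q < U j z.2) \/
      (ratr q < U i z.1 /\ U j z.2 < ratr q)]).
    have e1 A : measurable A ->
        <<s [set A `*` B | A in sigma_RV (U i) & B in sigma_RV (U j)] >> [set z | A (U i z.1)].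
      move=> mA; apply: sub_sigma_algebra; exists [set w | A (U i w)]; first exact: sRV.
      by exists setT; [exact: (sigma_algebra_setT (sig j))|apply/seteqP; split=> z //= []].
    have e2 A : measurable A ->
        <<s [set A `*` B | A in sigma_RV (U i) & B in sigma_RV (U j)] >> [set z | A (U j z.2)].
      move=> mA; apply: sub_sigma_algebra; exists setT; first exact: (sigma_algebra_setT (sig i)).
      by exists [set w | A (U j w)]; [exact: sRV|apply/seteqP; split=> z //= []].
    apply: (sigma_exists sD) => q; apply: (sigma_or sD); apply: (sigma_and sD).
    + exact: (e1 [set x | x < ratr q]).
    + exact: (e2 [set x | ratr q < x]).
    + exact: (e1 [set x | ratr q < x]).
    + exact: (e2 [set x | x < ratr q]).
  apply/seteqP; split=> [[z z'] /=|[z z'] /= [q [[h1 h2]|[h1 h2]]]].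
  + rewrite /D /= neq_lt => /orP[] /rat_in_itvoo[q /=]; rewrite in_itv/= => /andP[h1 h2].
      by exists q; left.
    by exists q; right.
  + by rewrite /D /= lt_eqF// (lt_trans h1 h2).
  + by rewrite /D /= gt_eqF// (lt_trans h2 h1).
have PD : P [set w | U i w != U j w] = 1%E.
  rewrite (@independent_diagonal _ _ _ _ _ _ _ _ _ _ _ _ _ _ Devent).
  - transitivity (\int[P]_w (cst 1%E) w)%E.
      apply: eq_integral => w _ /=.
      have := sample_null j (measurable_set1 (U i w)) (lebesgue_measure_set1 (U i w)).
      move=> h; have m1 : measurable [set w' | U j w' = U i w].
        exact: (measurable_sample j (measurable_set1 (U i w))).
      have [N [mN PN hN]] := h.
      have P0 : P [set w' | U j w' = U i w] = 0%E.
        by apply: (subset_measure0 m1 mN _ PN) => w' /= e; apply: hN => /=; apply.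
      have := probability_setC P m1; rewrite P0 sube0 => <-; congr (P _).
      by apply/seteqP; split=> w' /=; rewrite /D /= eq_sym => /eqP.
    by rewrite integral_cst//= mul1e probability_setT.
  - exact: sRVm.
  - exact: sRVm.
  - by move=> A B; exact: (sigma_algebra_setI (sig i)).
  - by move=> A B; exact: (sigma_algebra_setI (sig j)).
  - exact: (sigma_algebra_setT (sig i)).
  - exact: (sigma_algebra_setT (sig j)).
  - move=> A B sA sB; pose E k := if k == i then A else B.
    have Ej : E j = B by rewrite /E eq_sym (negbTE ij).
    have Ei : E i = A by rewrite /E eqxx.
    have := U_indep (s := [:: i; j]) (E := E).
    rewrite /= inE ij big_cons big_seq1 Ei Ej => <- //.
      congr (P _); apply/seteqP; split=> [w [Aw Bw] k|w h].
        by rewrite /= !inE => /orP[] /eqP ->; rewrite ?Ei ?Ej.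
      by split; rewrite -1?Ei -1?Ej; apply: h; rewrite /= !inE eqxx ?orbT.
    by move=> k; rewrite !inE => /orP[] /eqP ->; rewrite ?Ei ?Ej.
have mD : measurable [set w | U i w == U j w].
  rewrite (_ : [set w | _] = (fun w => U i w - U j w) @^-1` [set 0]).
    have mf : measurable_fun setT (fun w => U i w - U j w) by exact: measurable_funB.
    rewrite -[X in measurable X]setTI.
    exact: (mf measurableT [set 0] (measurable_set1 0)).
  apply/seteqP; split=> w /= => [/eqP ->|/eqP]; first by rewrite subrr.
  by rewrite subr_eq0.
exists [set w | U i w == U j w]; split => //.
  have := probability_setC P mD; rewrite (_ : ~` _ = [set w | U i w != U j w]); last first.
    by apply/seteqP; split=> w /= /negP.
  rewrite PD => e; have := fin_num_measure P _ mD.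
  case: (P [set w | U i w == U j w]) e => // r /eqP; rewrite -EFinB eqe => /eqP e _.
  by congr EFin; lra.
by move=> w /= /negP; rewrite negbK.
Qed.

Lemma cell_word_probability n K (x : nat -> R) (t : n.-tuple 'I_K) :
  (forall k, 0 < x k <= 1) -> (forall k, x k.+1 <= x k) ->
  fine (P [set w | forall i : 'I_n, cell x (K - (tnth t i).+1) (U i w)]) =
  \prod_(p <- t) cell_length x (K - p.+1).
Proof.
move=> x01 xni; pose A i := cell x (K - (nth 0 (map val t) i).+1).
have mA i : measurable (A i) by exact: measurable_cell.
have -> : [set w | forall i : 'I_n, cell x (K - (tnth t i).+1) (U i w)] =
    \bigcap_(i in [set` iota 0 n]) (U i @^-1` A i).
  apply/seteqP; split=> w h i.
    rewrite /= mem_iota add0n => /andP[_ ni].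
    by have := h (Ordinal ni); rewrite /A (tnth_nth (tnth t (Ordinal ni))) (nth_map (tnth t (Ordinal ni))) ?size_tuple.
  have := h i; rewrite /= mem_iota add0n ltn_ord => /(_ isT); rewrite /A /preimage /=.
  by rewrite (tnth_nth (tnth t i)) (nth_map (tnth t i)) ?size_tuple ?ltn_ord.
rewrite (U_indep (iota_uniq 0 n)); last by move=> i _; exists (A i) => //; rewrite setTI.
transitivity (fine (\prod_(i <- iota 0 n) (cell_length x (K - (nth 0 (map val t) i).+1)%N)%:E)).
  congr fine; apply: eq_bigr => i _.
  by rewrite -[LHS]/(distribution P (U i) (A i)) U_unif// uniform_cell.
rewrite prodEFin /=.
rewrite (_ : iota 0 n = index_iota 0 (size (map val t))); last first.
  by rewrite /index_iota subn0 size_map size_tuple.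
by rewrite -(big_nth 0 xpredT (fun p => cell_length x (K - p.+1))) big_map.
Qed.

Definition cell_event n s x K := [set w | exists2 t : n.-tuple 'I_K,
  nonzero (cell_counts t) == s & forall i : 'I_n, cell x (K - (tnth t i).+1) (U i w)].

Lemma measurable_cell_word n K x (t : n.-tuple 'I_K) :
  measurable [set w | forall i : 'I_n, cell x (K - (tnth t i).+1) (U i w)].
Proof.
rewrite (_ : [set w | _] = \bigcap_(i in [set: 'I_n])
    [set w | cell x (K - (tnth t i).+1) (U i w)]).
  by apply: fin_bigcap_measurable => // i _; apply: measurable_sample; exact: measurable_cell.
by apply/seteqP; split=> w h i; [move=> _|]; exact: h.
Qed.

Lemma measurable_cell_event n s x K : measurable (cell_event n s x K).
Proof. by apply: finite_exists_measurable => t; exact: measurable_cell_word. Qed.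

Lemma cell_event_probability n s x K : all (leq 1) s -> sumn s = n ->
  (forall k, 0 < x k <= 1) -> (forall k, x k.+1 <= x k) ->
  fine (P (cell_event n s x K)) = (multinom s)%:R * cell_sum (cell_length x) s K.
Proof.
move=> s0 sn x01 xni; rewrite -(sum_cell_words _ _ s0 sn) finite_disjoint_probability.
- by apply: eq_bigr => t _; exact: cell_word_probability.
- by move=> t; exact: measurable_cell_word.
move=> t t' w h h'; apply: eq_from_tnth => i; apply: ord_inj.
have := cell_inj xni (h i) (h' i).
move: (ltn_ord (tnth t i)) (ltn_ord (tnth t' i)).
move: (nat_of_ord (tnth t i)) (nat_of_ord (tnth t' i)) => a b; lia.
Qed.

End uniform_sample.

Section ranked_cells.
Variable R : realType.

(** The order is reversed: cells are numbered from right to left, boxes from left to right. *)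
Definition ranked n s (k : 'I_n -> nat) := exists c : 'I_n -> 'I_(size s),
  (forall i j, (c i < c j)%N = (k j < k i)%N) /\
  (forall l : 'I_(size s), nth 0%N s l = #|[pred i | c i == l]|).

Lemma count_mem_tuple n K (k : 'I_n -> 'I_K) p :
  count_mem p [tuple k i | i < n] = #|[pred i | k i == p]|.
Proof.
rewrite /= count_map cardE -size_filter; congr size.
by rewrite enumT; apply: eq_filter => i; rewrite !inE.
Qed.

Lemma cell_words_ranked (x : nat -> R) n s K (u k : 'I_n -> _) :
  (forall m, x m.+1 <= x m) -> all (leq 1) s ->
  (forall i, (k i < K)%N) -> (forall i, cell x (k i) (u i)) ->
  (exists2 t : n.-tuple 'I_K, nonzero (cell_counts t) == s &
     forall i, cell x (K - (tnth t i).+1) (u i)) <-> ranked s k.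
Proof.
move=> xni s0 kK ku.
have pK i : (K - (k i).+1 < K)%N by have := kK i; lia.
pose p i : 'I_K := Ordinal (pK i).
have rankE : ranked s k <-> exists c : 'I_n -> 'I_(size s),
    (forall i j, (c i < c j)%N = (p i < p j)%N) /\
    (forall l : 'I_(size s), nth 0%N s l = #|[pred i | c i == l]|).
  have e i j : (p i < p j)%N = (k j < k i)%N.
    by rewrite /=; have := kK i; have := kK j; lia.
  by split=> -[c [c1 c2]]; exists c; split=> // i j; rewrite c1 e.
rewrite rankE (rank_compositionP p s0).
have cE : cell_counts [tuple p i | i < n] = [seq #|[pred i | p i == q]| | q <- enum 'I_K].
  by apply: eq_map => q; exact: count_mem_tuple.
split=> [[t /eqP <- tu]|h].
  have -> : t = [tuple p i | i < n].
    apply: eq_from_tnth => i; apply: ord_inj; rewrite tnth_mktuple.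
    have := cell_inj xni (tu i) (ku i); rewrite /=.
    move: (ltn_ord (tnth t i)) (kK i).
    by move: (nat_of_ord (tnth t i)) => a; lia.
  by rewrite cE.
exists [tuple p i | i < n]; first by rewrite cE h.
move=> i; rewrite tnth_mktuple /= subnSK// subKn; first exact: ku.
exact: ltnW.
Qed.

Lemma sampled_ranked (Z : set R) (x : nat -> R) n s (u : nat -> R) (k : 'I_n -> nat) :
  (forall m, x m.+1 <= x m) -> (forall i, cell x (k i) (u i)) ->
  (forall i j : 'I_n, (forall m, (u i < x m) = (u j < x m)) <->
     i = j \/ same_interval Z (u i) (u j)) ->
  sampled_composition Z n u s <-> ranked s k.
Proof.
move=> xni ku same.
have kE (i j : 'I_n) : k i = k j <-> i = j \/ same_interval Z (u i) (u j).
  rewrite -same; split=> [e m|h]; first by rewrite (cell_lt xni m (ku i)) (cell_lt xni m (ku j)) e.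
  have h' m : (m < k i)%N = (m < k j)%N.
    by rewrite -(cell_lt xni m (ku i)) -(cell_lt xni m (ku j)) h.
  have [lt|lt|//] := ltngtP (k i) (k j).
    by rewrite -h' ltnn in lt.
  by rewrite h' ltnn in lt.
split=> [[c [c1 c2 c3]]|[c [c1 c2]]]; exists c; split=> //.
- have lt_c i j : (k j < k i)%N -> (c i < c j)%N.
    move=> kji; rewrite ltn_neqAle c2 ?andbT; last exact: (cell_order xni (ku j) (ku i) kji).
    apply/negP => /eqP/ord_inj/c1/kE e; by rewrite e ltnn in kji.
  move=> i j; apply/idP/idP => [cij|]; last exact: lt_c.
  have [//|kij|/kE/c1 e] := ltngtP (k j) (k i).
    by have := ltn_trans cij (lt_c _ _ kij); rewrite ltnn.
  by rewrite e ltnn in cij.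
- move=> i j; rewrite -kE; split=> [e|e].
    have := c1 i j; have := c1 j i; rewrite e !ltnn.
    by case: ltngtP.
  apply: ord_inj; have := c1 i j; have := c1 j i; rewrite e !ltnn.
  by case: ltngtP.
- move=> i j uij; rewrite leqNgt c1; apply/negP => kij.
  by have := cell_order xni (ku i) (ku j) kij; rewrite ltNge (ltW uij).
Qed.

End ranked_cells.

Section fixed_set.
Context d (Om : measurableType d) (R : realType) (P : probability Om R).
Variable U : nat -> {RV P >-> R}.
Hypothesis U_unif : forall i A, measurable A ->
  distribution P (U i) A = uniform_prob (@ltr01 R) A.
Hypothesis U_indep : mutually_independent P (fun i : nat => sigma_RV (U i)).
Variable y : R -> R.
Hypotheses (y_nd : forall s t, 0 <= s -> s <= t -> y s <= y t)
  (y_rc : forall t, 0 <= t -> y s @[s --> at_right t] --> y t)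
  (y_ge0 : forall t, 0 <= t -> 0 <= y t)
  (y_pinfty : forall M, exists2 k : nat, True & M <= y k%:R).

Let Z := exp_neg (closure [set y t | t in `[0, +oo[%classic]).

Lemma grid_small r u : 0 < u -> exists k, grid y r k <= u.
Proof.
move=> u0; have [k _ hk] := y_pinfty (- ln u).
exists (k * 2 ^ r)%N; rewrite /grid natrM natrX -mulrA -exprMn.
rewrite mulfV ?pnatr_eq0// expr1n mulr1.
by rewrite -[leRHS](lnK u0) ler_expR; lra.
Qed.

(** Outside the null events of coincident points and of points isolated on one side in Z, each of
    the finitely many pairs of points is settled by all fine enough grids. *)
Lemma sampling_cells n s : all (leq 1) s ->
  {ae P, forall w, (forall r, exists k : 'I_n -> nat, forall i, cell (grid y r) (k i) (U i w)) /\
    \forall r \near \oo, forall k : 'I_n -> nat, (forall i, cell (grid y r) (k i) (U i w)) ->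
      sampled_composition Z n (U ^~ w) s <-> ranked s k}.
Proof.
move=> s0.
have g01 r k : 0 < grid y r k <= 1 by exact: grid_le1.
have gni r k : grid y r k.+1 <= grid y r k by exact: grid_nonincreasing.
have a1 : {ae P, forall w, forall i : nat, 0 < U i w < 1}.
  by apply: ae_foralln => i; exact: sample_interior.
have a2 : {ae P, forall w, forall i j : nat, i != j -> U i w != U j w}.
  apply: ae_foralln => i; apply: ae_foralln => j.
  have [->|ij] := eqVneq i j; first by apply: aeW => w /eqP.
  by have := sample_distinct U_unif U_indep ij; apply: filterS.
have a3 : {ae P, forall w, forall i : nat, ~ right_isolated Z (U i w)}.
  by apply: ae_foralln => i; exact: (sample_avoids U_unif i (countable_right_isolated Z)).
have a4 : {ae P, forall w, forall i : nat, ~ left_isolated Z (U i w)}.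
  by apply: ae_foralln => i; exact: (sample_avoids U_unif i (countable_left_isolated Z)).
apply: filterS2 (filterI a1 a2) (filterI a3 a4) => w [h1 h2] [h3 h4]; split.
  move=> r; have /choice[k hk] : forall i : 'I_n, exists k, cell (grid y r) k (U i w).
    by move=> i; apply: cell_exists => //; apply: grid_small; case/andP: (h1 i).
  by exists k.
have : \forall r \near \oo, forall i j : 'I_n,
    (forall m, (U i w < grid y r m) = (U j w < grid y r m)) <->
    i = j \/ same_interval Z (U i w) (U j w).
  apply: filter_forall => i; apply: filter_forall => j.
  have [->|ij] := eqVneq i j; first by apply: nearW => r; split=> _; [left|].
  have ij' : nat_of_ord i != j by [].
  have sI := same_cell_interval y_rc (h1 i) (h1 j) (h2 _ _ ij') (h3 i) (h4 i) (h3 j) (h4 j).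
  have [si|nsi] := pselect (same_interval Z (U i w) (U j w)).
    apply: nearW => r; split=> _; first by right.
    by move/sI : si; apply.
  have [r0 hr0] : exists r0, ~ same_cell y r0 (U i w) (U j w).
    by apply/existsNP => h; apply: nsi; exact/sI.
  exists r0 => // r /= rr0; split=> [h|[/eqP|//]]; last by rewrite (negbTE ij).
  by exfalso; apply: hr0; exact: (same_cell_mono rr0 h).
apply: filterS => r hr k hk.
exact: sampled_ranked.
Qed.

(** Two dominated limits. For fixed r the cell event is constant as soon as K exceeds the cell
    numbers of the sample points; then the grid is refined. *)
Lemma sampling_limit n s : all (leq 1) s -> sumn s = n ->
  measurable [set w | sampled_composition Z n (U ^~ w) s] ->
  exists p : nat -> R,
    (forall r, (multinom s)%:R * cell_sum (cell_length (grid y r)) s K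
       @[K --> \oo] --> p r) /\
    p r @[r --> \oo] --> fine (P [set w | sampled_composition Z n (U ^~ w) s]).
Proof.
move=> s0 sn mS; set S := [set w | _].
have g01 r k : 0 < grid y r k <= 1 by exact: grid_le1.
have gni r k : grid y r k.+1 <= grid y r k by exact: grid_nonincreasing.
pose E r K := cell_event U n s (grid y r) K.
have mE r K : measurable (E r K) by exact: measurable_cell_event.
(* The lim inf in K is measurable by construction and agrees almost surely with the ranked event. *)
pose S_ r := \bigcup_K0 \bigcap_(K in [set K | (K0 <= K)%N]) E r K.
have mS_ r : measurable (S_ r).
  by apply: bigcup_measurable => K0 _; apply: bigcap_measurableType => K _; exact: mE.
have ind1 A w : `|(\1_A w : R)| <= 1.
  by rewrite indicE; case: (_ \in _); rewrite ?normr1// normr0.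
have event_ranked r (k : 'I_n -> nat) w K : (forall i, cell (grid y r) (k i) (U i w)) ->
    (\sum_i (k i).+1 <= K)%N -> E r K w <-> ranked s k.
  move=> hk kK; have kK' i : (k i < K)%N.
    by apply: leq_trans kK; rewrite (bigD1 i)//= leq_addr.
  exact: (cell_words_ranked (gni r) s0 kK' hk).
have S_ranked r (k : 'I_n -> nat) w : (forall i, cell (grid y r) (k i) (U i w)) ->
    S_ r w <-> ranked s k.
  move=> hk; split=> [[K0 _ hK0]|rk].
    apply/(event_ranked r k w (maxn K0 (\sum_i (k i).+1)) hk); first exact: leq_maxr.
    by apply: hK0; exact: leq_maxl.
  by exists (\sum_i (k i).+1)%N => // K /= kK; apply/(event_ranked r k).
have ae_good := @sampling_cells n s s0.
have indic_eq (A B : set Om) w : (A w <-> B w) -> \1_A w = \1_B w :> R.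
  move=> AB; rewrite !indicE; congr (_ %:R); congr nat_of_bool.
  by apply/idP/idP; rewrite !inE => /AB.
exists (fun r => fine (P (S_ r))); split=> [r|].
  rewrite (_ : (fun K => _) = (fun K => \int[P]_w (\1_(E r K) w : R))); last first.
    by apply/funext => K; rewrite bmf_int_indic// cell_event_probability.
  rewrite -(bmf_int_indic P (mS_ r)).
  apply: (@bmf_int_cvg _ _ _ P _ _ 1).
  - by move=> K; exact: measurable_indic.
  - exact: measurable_indic.
  - by move=> K w; exact: ind1.
  apply: filterS ae_good => w [/(_ r)[k hk] _].
  apply: cvg_near_cst; exists (\sum_i (k i).+1)%N => // K /= kK.
  by apply: indic_eq; rewrite (event_ranked r k) // (S_ranked r k).
rewrite -(bmf_int_indic P mS).
rewrite (_ : (fun r => _) = (fun r => \int[P]_w (\1_(S_ r) w : R))); last first.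
  by apply/funext => r; rewrite bmf_int_indic.
apply: (@bmf_int_cvg _ _ _ P _ _ 1).
- by move=> r; exact: measurable_indic.
- exact: measurable_indic.
- by move=> r w; exact: ind1.
apply: filterS ae_good => w [hk hr].
apply: cvg_near_cst; apply: filterS hr => r h.
by have [k hk'] := hk r; apply: indic_eq; rewrite (S_ranked r k)// -(h k hk').
Qed.

End fixed_set.

(** * Sampling from a stationary regenerative set *)

Section delay_law.
Variables (R : realType) (dr : R) (nu : {measure set (measurableTypeR R) -> \bar R}).
Hypotheses (dr_ge0 : 0 <= dr) (nu_levy : levy_measure nu)
  (mean_fin : (levy_mean nu < +oo)%E) (c_gt0 : 0 < dr + fine (levy_mean nu)).

Local Notation leb := (@lebesgue_measure R).
Let D : set R := `]0, +oo[%classic.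
Let mD : measurable D. Proof. exact: measurable_itv. Qed.
Let c := dr + fine (levy_mean nu).
Let m1D : measurable_fun setT (\1_D : R -> R). Proof. exact: measurable_indic. Qed.
Let ind_ge0 (x : R) : 0 <= (\1_D x : R). Proof. by rewrite indicE. Qed.

(** [nu] cut to ]0, +oo[, as a name that can carry the sigma-finite structure required by Tonelli's
    theorem; the finite tails provide it. *)
Definition levy_restriction (h : levy_measure nu) : set (measurableTypeR R) -> \bar R :=
  density_measure nu m1D ind_ge0.

Let nuD := levy_restriction nu_levy.

HB.instance Definition _ := Measure.on nuD.

Let DP (y : R) : D y = (0 < y). Proof. by rewrite /D /= in_itv/= andbT. Qed.

Let nuDE A : measurable A -> nuD A = nu (A `&` D).
Proof. by move=> mA; rewrite [LHS]integral_indic// setIC. Qed.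

Let integral_nuD (h : R -> \bar R) : measurable_fun setT h -> (forall x, 0 <= h x)%E ->
  (\int[nuD]_y h y = \int[nu]_(y in D) h y)%E.
Proof.
move=> mh h0; rewrite ge0_integral_density// [RHS]integral_mkcond.
apply: eq_integral => y _; rewrite patchE indicE.
by case: ifP => _; rewrite ?mule1 ?mule0.
Qed.

(** Markov's inequality for the function min(1, z). *)
Lemma levy_tail_fin y : 0 < y -> (nu `[y, +oo[%classic < +oo)%E.
Proof.
move=> y0; have my : measurable (`[y, +oo[%classic : set R) by exact: measurable_itv.
have min0 : 0 < Num.min 1 y by rewrite lt_min ltr01 y0.
have mmin : measurable_fun setT (fun z : R => (Num.min 1 z)%:E).
  by apply/measurable_EFinP; apply: measurable_minr => //; exact: measurable_cst.
have h : ((Num.min 1 y)%:E * nu `[y, +oo[%classic <=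
    \int[nu]_(z in D) (Num.min 1%R z)%:E)%E.
  rewrite -integral_cst//.
  apply: (@le_trans _ _ (\int[nu]_(z in `[y, +oo[%classic) (Num.min 1%R z)%:E)%E).
    apply: ge0_le_integral => //.
    - by move=> z _; rewrite lee_fin ltW.
    - exact: measurable_funTS.
    - move=> z /=; rewrite in_itv/= andbT => yz.
      by rewrite lee_fin le_min !ge_min lexx/= yz orbT.
  apply: ge0_subset_integral => //.
  - exact: measurable_funTS.
  - by move=> z; rewrite DP => z0; rewrite lee_fin le_min ler01 ltW.
  - by move=> z /=; rewrite DP in_itv/= andbT; exact: lt_le_trans.
rewrite ltey; apply/eqP => e; have := le_lt_trans h nu_levy.2.
by rewrite e mulry gtr0_sg// mul1e ltxx.
Qed.

Let nuD_sigma_finite : sigma_finite setT nuD.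
Proof.
exists (fun n => `]-oo, 0]%classic `|` `[n.+1%:R^-1, +oo[%classic).
  apply/esym; apply/seteqP; split=> // y _; have [y0|y0] := leP y 0.
    by exists 0%N => //; left; rewrite /= in_itv.
  have [n hn] : exists n, n.+1%:R^-1 <= y.
    exists (Num.truncn y^-1); rewrite invf_ple ?posrE//.
    exact/ltW/truncnS_gt.
  by exists n => //; right; rewrite /= in_itv/= hn.
move=> n; have n0 : 0 < n.+1%:R^-1 :> R by rewrite invr_gt0.
have mF : measurable (`]-oo, 0] `|` `[n.+1%:R^-1, +oo[ : set R)%classic.
  by apply: measurableU; exact: measurable_itv.
split=> //; rewrite nuDE//; apply: le_lt_trans (levy_tail_fin n0).
apply: le_measure; rewrite ?inE; [exact: measurableI|exact: measurable_itv|].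
by move=> y [[|//]]; rewrite DP /= in_itv/= leNgt => /negP.
Qed.

HB.instance Definition _ := Measure_isSigmaFinite.Build _ _ _ nuD nuD_sigma_finite.

(** The true tail may be infinite at 0; a real value there makes it a density for Lebesgue measure.
    The delay does not charge the negative numbers. *)
Definition levy_tail (y : R) : R := if 0 < y then fine (nu `[y, +oo[%classic) else 0.

Lemma levy_tail_ge0 y : 0 <= levy_tail y.
Proof. by rewrite /levy_tail; case: ifP => // _; rewrite fine_ge0. Qed.

Let tailE y : 0 <= y -> nu `[y, +oo[%classic = nuD `[y, +oo[%classic.
Proof.
move=> y0; rewrite nuDE; last exact: measurable_itv.
have [y_gt0|] := ltP 0 y.
  congr (nu _); apply/seteqP; split=> z /=; last by case.
  by rewrite DP in_itv/= andbT => yz; split=> //; exact: lt_le_trans yz.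
move=> yle; have -> : y = 0 by apply/eqP; rewrite eq_le y0 yle.
rewrite (_ : `[0, +oo[%classic `&` D = D); last first.
  by apply/setIidr => z; rewrite DP /= in_itv/= andbT; exact: ltW.
rewrite -(@setU1itv _ _ _ 0 false) // measureU//; last first.
  by apply/seteqP; split=> z //= [->]; rewrite in_itv/= ltxx.
rewrite [X in (X + _)%E](_ : _ = 0%E) ?add0e//.
apply/eqP; rewrite eq_le measure_ge0 andbT -nu_levy.1 le_measure// ?inE//.
by move=> z /= ->; rewrite in_itv/= lexx.
Qed.

Let E := [set z : R * R | 0 < z.1 <= z.2].

Let mE : measurable E.
Proof.
have mb : measurable_fun setT (fun z : R * R => (0 < z.1) && (z.1 <= z.2)).
  by apply: measurable_and; [exact: measurable_fun_ltr|exact: measurable_fun_ler].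
rewrite (_ : E = (fun z : R * R => (0 < z.1) && (z.1 <= z.2)) @^-1` [set true]).
  by rewrite -[X in measurable X]setTI; exact: (mb measurableT).
by apply/seteqP; split=> z.
Qed.

Let tail_section x : nuD (xsection E x) = (levy_tail x)%:E.
Proof.
rewrite /levy_tail; case: ltP => x0.
  rewrite fineK; last by rewrite ge0_fin_numE// levy_tail_fin.
  rewrite tailE ?ltW//; congr (nuD _).
  by apply/seteqP; split=> y; rewrite /xsection /= inE /E /= x0 in_itv/= andbT.
rewrite (_ : xsection _ _ = set0) ?measure0//.
apply/seteqP; split=> // y; rewrite /xsection /= inE /E /= ltNge x0//.
Qed.

Lemma measurable_levy_tail : measurable_fun setT levy_tail.
Proof.
have := measurable_fun_xsection (nuD : {sigma_finite_measure set _ -> \bar R}) mE.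
rewrite (_ : _ \o _ = EFin \o levy_tail); first by move/measurable_EFinP.
by apply/funext => x /=; rewrite tail_section.
Qed.

(** Both sides integrate g over the region 0 < x <= y, in the two orders. *)
Lemma levy_tail_tonelli (g : R -> R) : measurable_fun setT g -> (forall x, 0 <= g x) ->
  (\int[leb]_x ((g x)%:E * (levy_tail x)%:E) =
   \int[nu]_(y in D) \int[leb]_(x in `[0%R, y]%classic) (g x)%:E)%E.
Proof.
move=> mg g0; pose f (z : R * R) := ((g z.1)%:E * (\1_E z)%:E)%E.
have mf : measurable_fun setT f.
  apply: emeasurable_funM.
    by apply/measurable_EFinP; apply: measurableT_comp => //; exact: measurable_fst.
  by apply/measurable_EFinP; exact: measurable_indic.
have f0 z : (0 <= f z)%E by rewrite mule_ge0// lee_fin// indicE.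
transitivity (\int[leb]_x \int[nuD]_y f (x, y))%E.
  apply: eq_integral => x _; apply/esym; rewrite /f /= ge0_integralZl//=.
  - rewrite -tail_section -[in RHS](setIT (xsection E x)) -integral_indic//; last exact: measurable_xsection.
    congr (_ * _)%E; apply: eq_integral => y _.
    by rewrite !indicE mem_xsection.
  - rewrite (_ : (fun y => _) = (fun y => (\1_(xsection E x) y)%:E)).
      by apply/measurable_EFinP; apply: measurable_indic; exact: measurable_xsection.
    by apply/funext => y; rewrite !indicE mem_xsection.
  - by rewrite lee_fin.
rewrite (@fubini_tonelli _ _ _ _ R leb nuD f mf f0) integral_nuD.
- apply: eq_integral => y; rewrite inE DP => y0.
  rewrite -integral_itv_obnd_cbnd; last exact/measurable_funTS/measurable_EFinP.
  rewrite [RHS]integral_mkcond; apply: eq_integral => x _.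
  rewrite /f /= patchE indicE.
  have -> : ((x, y) \in E) = (x \in `]0, y]%classic).
    by apply/idP/idP; rewrite !inE /E /= ?in_itv.
  by case: ifP => _; rewrite ?mule1 ?mule0.
- exact: measurable_fun_fubini_tonelli_G.
- by move=> y; apply: integral_ge0.
Qed.

Let mulcV : c^-1 * c = 1. Proof. by rewrite mulVf// gt_eqF. Qed.

Let mtail : measurable_fun setT (fun y => c^-1 * levy_tail y).
Proof. by apply: measurable_funM => //; exact: measurable_levy_tail. Qed.

Let tail_ge0 y : 0 <= c^-1 * levy_tail y.
Proof. by rewrite mulr_ge0 ?levy_tail_ge0// invr_ge0 ltW. Qed.

Let drc_ge0 : 0 <= dr / c. Proof. by rewrite divr_ge0// ltW. Qed.

Definition delay_measure := measure_add (density_measure leb mtail tail_ge0)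
  (mscale (NngNum drc_ge0)
    (\d_(0 : measurableTypeR R) : {measure set (measurableTypeR R) -> \bar R})).

HB.instance Definition _ := Measure.on delay_measure.

Lemma integral_delay_measure (h : R -> R) : measurable_fun setT h -> (forall x, 0 <= h x) ->
  (\int[delay_measure]_x (h x)%:E =
   c^-1%:E * \int[leb]_x ((h x)%:E * (levy_tail x)%:E) + (dr / c * h 0)%:E)%E.
Proof.
move=> mh h0; have mh' : measurable_fun setT (EFin \o h) by exact/measurable_EFinP.
have h0' x : (0 <= (h x)%:E)%E by rewrite lee_fin.
rewrite ge0_integral_measure_add//.
transitivity (\int[leb]_x ((h x)%:E * (c^-1 * levy_tail x)%:E) + (dr / c * h 0)%:E)%E.
  congr (_ + _)%E; first exact: (@ge0_integral_density _ _ R leb _ mtail tail_ge0 _ mh' h0').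
  by rewrite ge0_integral_mscale// integral_dirac// diracT mul1e.
congr (_ + _)%E.
rewrite -ge0_integralZl//; last 3 first.
- by apply: emeasurable_funM => //; apply/measurable_EFinP; exact: measurable_levy_tail.
- by move=> x _; rewrite mule_ge0// lee_fin// levy_tail_ge0.
- by rewrite lee_fin invr_ge0 ltW.
by apply: eq_integral => x _; rewrite EFinM muleCA.
Qed.

Lemma delay_measureE A : measurable A ->
  delay_measure A = (c^-1%:E * (\int[leb]_(y in A `&` `[0%R, +oo[%classic)
                nu `[y, +oo[%classic) + (dr / c)%:E * \d_(0%R : R) A)%E.
Proof.
move=> mA; have m0 : measurable (`[0%R, +oo[%classic : set R) by exact: measurable_itv.
have mtE : measurable_fun setT (EFin \o levy_tail).
  by apply/measurable_EFinP; exact: measurable_levy_tail.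
have tail_pos y : `]0, +oo[%classic y -> nu `[y, +oo[%classic = (levy_tail y)%:E.
  rewrite /= in_itv/= andbT => y0; rewrite /levy_tail y0 fineK// ge0_fin_numE//.
  exact: levy_tail_fin.
have eqI : A `&` `[0%R, +oo[%classic `\` [set 0] = A `&` `]0%R, +oo[%classic.
  apply/seteqP; split=> x /=; rewrite !in_itv/= !andbT.
    by move=> [[Ax x0] /eqP n0]; rewrite lt_neqAle eq_sym n0 x0.
  by move=> [Ax x0]; rewrite ltW//; split=> // e; rewrite e ltxx in x0.
have mI' : measurable (A `&` `]0%R, +oo[%classic).
  by apply: measurableI => //; exact: measurable_itv.
rewrite /delay_measure measure_addE; congr (_ + _)%E.
transitivity (c^-1%:E * \int[leb]_(x in A) (levy_tail x)%:E)%E.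
  rewrite -ge0_integralZl//.
  - exact: measurable_funTS.
  - by move=> x _; rewrite lee_fin levy_tail_ge0.
  - by rewrite lee_fin invr_ge0 ltW.
congr (_ * _)%E.
(* The point 0 is removed, where the tail of [nu] and [levy_tail] may differ. *)
rewrite -[in RHS](@integral_setD1 _ _ 0) eqI//.
  rewrite integral_mkcond [RHS]integral_mkcond; apply: eq_integral => x _.
  rewrite !patchE in_setI; case: (x \in A) => //=.
  case: ifPn => [|nx]; first by rewrite inE => /tail_pos ->.
  rewrite /levy_tail ifN//; apply: contra nx => x0.
  by rewrite inE /= in_itv/= x0.
apply: (eq_measurable_fun (EFin \o levy_tail)); last exact: measurable_funTS.
by move=> x; rewrite inE => -[_ /tail_pos ->].
Qed.

Lemma delay_laplace l : 0 < l ->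
  (\int[delay_measure]_x (expR (- (l * x)))%:E = (laplace_exponent dr nu l / (c * l))%:E)%E.
Proof.
move=> l0; have ml : measurable_fun setT (fun x : R => expR (- (l * x))).
  by apply: measurableT_comp => //; apply: measurableT_comp.
rewrite integral_delay_measure// levy_tail_tonelli//.
have inner y : D y -> (\int[leb]_(x in `[0%R, y]%classic) (expR (- (l * x)))%:E =
    (l^-1 * (1 - expR (- (l * y))))%:E)%E.
  rewrite DP => y0.
  (* Up to the factor 1 / l the integrand is the exponential density of rate l, whose distribution
     function is known. *)
  transitivity (\int[leb]_(x in `[0%R, y]%classic) ((l^-1)%:E * (exponential_pdf l x)%:E))%E.
    apply: eq_integral => x; rewrite inE /= in_itv/= => /andP[x0 _].
    rewrite /exponential_pdf patchE ifT; last by rewrite inE /= in_itv/= x0.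
    by rewrite -EFinM mulKf ?gt_eqF// mulNr.
  rewrite ge0_integralZl//.
  - rewrite -[X in (_ * X)%E]/(exponential_prob l `[0, y]%classic).
    by rewrite exponential_prob_itv0c// -EFinB -EFinM mulNr.
  - by apply/measurable_EFinP; apply: measurable_funTS; exact: measurable_exponential_pdf.
  - by move=> x _; rewrite lee_fin exponential_pdf_ge0// ltW.
  - by rewrite lee_fin invr_ge0 ltW.
rewrite [X in (_ * X)%E](_ : _ =
    (\int[nu]_(y in D) ((l^-1)%:E * (1 - expR (- (l * y)))%:E))%E); last first.
  by apply: eq_integral => y; rewrite inE => /inner ->.
have exp_le1 y : D y -> 0 <= 1 - expR (- (l * y)).
  by rewrite DP => y0; rewrite subr_ge0 -expR0 ler_expR oppr_le0 mulr_ge0// ltW.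
have m1 : measurable_fun D (fun y => (1 - expR (- (l * y)))%:E).
  by apply/measurable_EFinP; apply: measurable_funTS; apply: measurable_funB.
have lin : (0 <= l^-1%:E)%E by rewrite lee_fin invr_ge0 ltW.
rewrite ge0_integralZl//.
set I := (\int[nu]_(y in D) _)%E.
(* By 1 - exp(- l y) <= l y and the finite mean. *)
have Ifin : I \is a fin_num.
  rewrite ge0_fin_numE; last by apply: integral_ge0 => y /exp_le1.
  apply: (@le_lt_trans _ _ (l%:E * levy_mean nu)%E); last first.
    by rewrite lte_mul_pinfty// lee_fin ltW.
  rewrite -ge0_integralZl//; last 2 first.
  - by move=> y; rewrite /= in_itv/= andbT lee_fin => /ltW.
  - by rewrite lee_fin ltW.
  apply: ge0_le_integral => //.
  - by apply/measurable_EFinP; apply: measurable_funTS; apply: measurable_funM; [exact: measurable_cst|exact: measurable_id].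
  - move=> y _; rewrite -EFinM lee_fin; have := expR_ge1Dx (- (l * y)); lra.
rewrite -(fineK Ifin) -!EFinM -EFinD; congr EFin.
rewrite /laplace_exponent -[Rintegral _ _ _]/(fine I) mulr0 oppr0 expR0 -/c.
by field; rewrite !gt_eqF.
Qed.

Lemma delay_law_laplace (rho : {measure set (measurableTypeR R) -> \bar R}) l : 0 < l ->
  (forall A, measurable A -> (rho A =
     c^-1%:E * (\int[leb]_(y in A `&` `[0%R, +oo[%classic) nu `[y, +oo[%classic) +
     (dr / c)%:E * \d_(0%R : R) A)%E) ->
  (\int[rho]_x (expR (- (l * x)))%:E = (laplace_exponent dr nu l / (c * l))%:E)%E.
Proof.
move=> l0 rhoE; rewrite -(delay_laplace l0).
by apply: eq_measure_integral => A mA _; rewrite rhoE//; exact/esym/delay_measureE.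
Qed.

Lemma delay_measure_setT : delay_measure setT = 1%E.
Proof.
have -> : delay_measure setT = (\int[delay_measure]_x (cst 1 x)%:E)%E.
  by rewrite -[RHS]/(\int[delay_measure]_x cst 1%E x)%E integral_cst// mul1e.
rewrite integral_delay_measure// levy_tail_tonelli//.
rewrite [X in (_ * X)%E](_ : _ = levy_mean nu); last first.
  apply: eq_integral => y; rewrite inE DP => y0; rewrite -[LHS]/(\int[leb]_(x in `[0%R, y]%classic) cst 1%E x)%E.
  rewrite integral_cst// mul1e; apply: (etrans (lebesgue_measure_itv _)).
  by rewrite /= lte_fin y0 -EFinB subr0.
rewrite -(@fineK _ (levy_mean nu)); last first.
  rewrite ge0_fin_numE//; apply: integral_ge0 => y /=.
  by rewrite in_itv/= andbT lee_fin => /ltW.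
by rewrite -EFinM -EFinD mulr1 -[X in _ + X]mulrC -mulrDr addrC mulcV.
Qed.

End delay_law.

Section moments.
Context d (T : measurableType d) (R : realType) (P : probability T R).

Lemma bmf_int_gt0 (f : T -> R) : bounded_measurable f -> (forall w, 0 < f w) ->
  0 < \int[P]_w f w.
Proof.
move=> bf f0; rewrite lt_neqAle; apply/andP; split; last first.
  by apply: Rintegral_ge0 => w _; exact: ltW.
apply/negP => /eqP e.
have /ae_eq_integral_abs h : measurable_fun setT (EFin \o f) by apply/measurable_EFinP; case: bf.
have : (\int[P]_(x in setT) `|(EFin \o f) x| = 0)%E.
  rewrite (eq_integral (EFin \o f)) => [|w _]; last by rewrite /= gtr0_norm.
  by have := bmf_integralE P bf; rewrite -e.
move=> /(h P measurableT)[N [mN N0 sub]].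
have : (P setT <= P N)%E.
  apply: le_measure; rewrite ?inE// => w _; apply: sub => /= /(_ I) [] fw.
  by have := f0 w; rewrite fw ltxx.
by rewrite probability_setT N0 lee_fin ler10.
Qed.

Lemma moment_diff (f : T -> R) j m : bounded_measurable f ->
  \int[P]_w (f w ^+ j * (1 - f w) ^+ m) = diff m (fun k => \int[P]_w f w ^+ k) j.
Proof.
move=> bf; elim: m j => [|m IH] j.
  by congr Rintegral; apply/funext => w; rewrite expr0 mulr1.
rewrite /= -!IH -bmf_intB.
- by congr Rintegral; apply/funext => w; rewrite !exprS; ring.
- by apply: bmfM; [exact: bmfX|apply: bmfX; apply: bmfB => //; exact: bmf_cst].
- by apply: bmfM; [exact: bmfX|apply: bmfX; apply: bmfB => //; exact: bmf_cst].
Qed.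

Lemma Rintegral_distribution (X1 X2 : {RV P >-> R}) (g : R -> R) :
  measurable_fun setT g -> (forall x, 0 <= g x) ->
  (forall A, measurable A -> P (X1 @^-1` A) = P (X2 @^-1` A)) ->
  \int[P]_w g (X1 w) = \int[P]_w g (X2 w).
Proof.
move=> mg g0 e; rewrite /Rintegral; congr fine.
rewrite -(@ge0_integral_distribution _ _ _ _ _ P X1 (EFin \o g))//; last exact/measurable_EFinP.
rewrite -(@ge0_integral_distribution _ _ _ _ _ P X2 (EFin \o g))//; last exact/measurable_EFinP.
by apply: eq_measure_integral => A mA _; exact: e.
Qed.

Lemma bmf_cell_function (x : nat -> T -> R) s K j :
  (forall k, (k <= K)%N -> bounded_measurable (x k)) ->
  bounded_measurable (fun w => x K w ^+ j * cell_sum (cell_length (x ^~ w)) s K.+1).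
Proof.
move=> bx; apply: bmfM; first exact/bmfX/bx.
have blen k : (k <= K)%N -> bounded_measurable (fun w => cell_length (x ^~ w) k).
  case: k => [|k] kK /=; first by apply: bmfB; [exact: bmf_cst|exact: bx].
  by apply: bmfB; apply: bx => //; exact: ltnW.
have : (K.+1 <= K.+1)%N by [].
move: {-2}K.+1; elim: s => [|m s IH] K' K'K; first exact: bmf_cst.
have -> : (fun w => cell_sum (cell_length (x^~ w)) (m :: s) K') =
  (fun w => \sum_(k < K') (if (k <= K)%N then
     cell_length (x^~ w) k ^+ m * cell_sum (cell_length (x^~ w)) s k else 0)).
  apply/funext => w /=; apply: eq_bigr => k _; rewrite ifT//.
  by rewrite -ltnS (leq_trans (ltn_ord k)).
apply: bmf_sum => k; have [kK|kK] := boolP (nat_of_ord k <= K)%N; last exact: bmf_cst.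
apply: bmfM; [exact/bmfX/blen|apply: IH].
by rewrite ltnW.
Qed.

End moments.

(** * The cell recursion of a delayed subordinator *)

Section regenerative.
Context d (Om : measurableType d) (R : realType) (P : probability Om R).
Variables (dr : R) (nu : {measure set (measurableTypeR R) -> \bar R})
  (X : {RV P >-> R}) (Y : R -> {RV P >-> R}).
Let c := dr + fine (levy_mean nu).
Let Phi := laplace_exponent dr nu.
Hypotheses (Ysub : subordinator dr nu Y) (mean_fin : (levy_mean nu < +oo)%E) (c_gt0 : 0 < c).
Hypothesis XY_indep : independent_classes P (sigma_RV X)
  (sigma_process `[0, +oo[%classic (fun t => Y t)).
Hypothesis X_ge0 : forall w, 0 <= X w.
Hypothesis X_law : forall A, measurable A ->
  (distribution P X A =
   c^-1%:E * (\int[lebesgue_measure]_(y in A `&` `[0%R, +oo[%classic) nu `[y, +oo[%classic) +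
   (dr / c)%:E * \d_(0%R : R) A)%E.

Let a k := \int[P]_w expR (- X w) ^+ k.

Let expR01 (x : R) : 0 <= x -> 0 <= expR (- x) <= 1.
Proof. by move=> x0; rewrite expR_ge0 -expR0 ler_expR oppr_le0. Qed.

Let Y_ge0 t w : 0 <= t -> 0 <= Y t w.
Proof.
move=> t0; rewrite -(sub_start Ysub w).
exact: (sub_nondecreasing Ysub).
Qed.

Let bmf_expN (V : {RV P >-> R}) : (forall w, 0 <= V w) ->
  bounded_measurable (fun w => expR (- V w)).
Proof.
move=> V0; apply: bmf01 => [|w]; last exact: expR01.
by apply: measurableT_comp => //; apply: measurableT_comp.
Qed.

Lemma delay_moment_gt0 k : 0 < a k.
Proof. by apply: bmf_int_gt0 => [|w]; [exact/bmfX/bmf_expN|rewrite exprn_gt0// expR_gt0]. Qed.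

Lemma delay_momentE k : Phi k%:R = c * (k%:R * a k).
Proof.
case: k => [|k].
  rewrite mul0r mulr0 /Phi /laplace_exponent mulr0 add0r.
  under eq_Rintegral do rewrite mul0r oppr0 expR0 subrr.
  by rewrite /Rintegral integral0_eq.
have k0 : 0 < k.+1%:R :> R by [].
have c0 := c_gt0.
have mX : @measurable_fun _ _ Om (measurableTypeR R) setT X by exact: (@measurable_funPT _ _ _ _ X).
pose X' : {RV P >-> measurableTypeR R} := @mfun_Sub _ _ Om (measurableTypeR R) X (mem_set mX).
have := @delay_law_laplace R dr nu (sub_drift_ge0 Ysub) (sub_levy Ysub) mean_fin c_gt0
  (distribution P X') _ k0 X_law.
have mg : measurable_fun setT (fun x : R => expR (- (k.+1%:R * x))).
  by apply: measurableT_comp => //; apply: measurableT_comp.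
rewrite (@ge0_integral_distribution _ _ _ _ _ P X' (fun x => (expR (- (k.+1%:R * x)))%:E))//; last exact/measurable_EFinP.
move=> e; suff -> : a k.+1 = Phi k.+1%:R / (c * k.+1%:R).
  by field; rewrite !gt_eqF.
apply: EFin_inj; rewrite -e -bmf_integralE; last exact/bmfX/bmf_expN.
apply: eq_integral => w _ /=; congr EFin; rewrite -expRM_natl; congr expR; ring.
Qed.

Lemma increment_moment s t j : 0 <= s -> 0 <= t ->
  \int[P]_w expR (- (Y (s + t) w - Y s w)) ^+ j = expR (- (t * Phi j%:R)).
Proof.
move=> s0 t0.
have mZ : measurable_fun setT (fun w => Y (s + t) w - Y s w) by exact: measurable_funB.
pose V : {RV P >-> R} := mfun_Sub (mem_set mZ).
pose g (x : R) := expR (- x) ^+ j.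
have mg : measurable_fun setT g.
  by apply: (measurableT_comp (f := fun x : R => x ^+ j)) => //; apply: measurableT_comp.
have -> : \int[P]_w expR (- (Y (s + t) w - Y s w)) ^+ j = \int[P]_w g (Y t w).
  apply: (@Rintegral_distribution _ _ _ _ V (Y t) g) => //.
    by move=> x; rewrite exprn_ge0// expR_ge0.
  by move=> A mA; have := sub_stationary Ysub s0 t0 mA.
have := sub_laplace Ysub t0 (ler0n R j); rewrite unlock => e.
apply: EFin_inj; rewrite -e -bmf_integralE; last by apply: bmfX; apply: bmf_expN => w; exact: Y_ge0.
by apply: eq_integral => w _; congr EFin; rewrite /g -expRM_natl; congr expR; ring.
Qed.

(** Generated by intersections, which form a pi-system on which independence can be checked. *)
Definition past t : set (set Om) :=
  <<s [set A `&` B | A in sigma_RV X & B in sigma_process `[0, t]%classic (fun t => Y t)] >>.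

Let sigma_algebra_RV (V : Om -> R) : sigma_algebra setT (sigma_RV V).
Proof. by apply: sigma_algebra_preimage; exact: sigma_algebra_measurable. Qed.

Let sigma_algebra_process D : sigma_algebra setT (sigma_process D (fun t => Y t)).
Proof. exact: smallest_sigma_algebra. Qed.

Let sigma_RV_measurable (V : Om -> R) : measurable_fun setT V -> sigma_RV V `<=` measurable.
Proof. by move=> mV _ [A mA <-]; exact: mV. Qed.

Let process_sub D D' : D `<=` D' ->
  sigma_process D (fun t => Y t) `<=` sigma_process D' (fun t => Y t).
Proof.
move=> DD'; apply: sub_sigma_algebra2 => A [t Dt At]; exists t => //; exact: DD'.
Qed.

Let process_measurable D : sigma_process D (fun t => Y t) `<=` measurable.
Proof.
apply: sigma_generated_measurable => A [t Dt]; apply: sigma_RV_measurable.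
exact: measurable_funPT.
Qed.

Let process_lt D t q : D t -> sigma_process D (fun t => Y t) [set w | Y t w < q].
Proof.
move=> Dt; apply: sub_sigma_algebra; exists t => //; exists `]-oo, q[%classic.
  exact: measurable_itv.
by rewrite setTI; apply/seteqP; split=> w; rewrite /= in_itv.
Qed.

Let process_gt D t q : D t -> sigma_process D (fun t => Y t) [set w | q < Y t w].
Proof.
move=> Dt; apply: sub_sigma_algebra; exists t => //; exists `]q, +oo[%classic.
  exact: measurable_itv.
by rewrite setTI; apply/seteqP; split=> w; rewrite /= in_itv/= andbT.
Qed.

(** X is independent of the whole process, which determines both the past event and the increment;
    these two are then separated by the independence of increments. *)
Lemma past_independent s t : 0 <= s -> 0 <= t ->
  independent_classes P (past s) (sigma_RV (fun w => Y (s + t) w - Y s w)).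
Proof.
move=> s0 t0; have st0 : 0 <= s + t by exact: addr_ge0.
have mV : measurable_fun setT (fun w => Y (s + t) w - Y s w) by exact: measurable_funB.
apply: independent_classes_generated.
- move=> _ [A sA [B sB <-]]; apply: measurableI; last exact: process_measurable sB.
  by apply: sigma_RV_measurable sA; exact: measurable_funPT.
- exact: sigma_RV_measurable.
- move=> _ _ [A sA [B sB <-]] [A' sA' [B' sB' <-]].
  exists (A `&` A'); first exact: (sigma_algebra_setI (sigma_algebra_RV _)).
  exists (B `&` B'); first exact: (sigma_algebra_setI (sigma_algebra_process _)).
  by rewrite setIACA.
move=> _ C [A sA [B sB <-]] sC.
have sB' : sigma_process `[0, +oo[%classic (fun t => Y t) B.
  by apply: process_sub sB => x /=; rewrite !in_itv/= andbT => /andP[].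
have sC' : sigma_process `[0, +oo[%classic (fun t => Y t) C.
  case: sC => E mE <-; rewrite setTI.
  apply: preimage_sigma_algebra => // q.
  rewrite (_ : [set w | _] = [set w | exists r : rat, ratr r < Y (s + t) w /\ Y s w < ratr r - q]).
    apply: (sigma_exists (sigma_algebra_process _)) => r.
    apply: (sigma_and (sigma_algebra_process _)).
      by apply: process_gt; rewrite /= in_itv/= andbT.
    by apply: process_lt; rewrite /= in_itv/= andbT.
  apply/seteqP; split=> w /=; last by move=> [r []]; lra.
  move=> h; have /rat_in_itvoo[r /=] : q + Y s w < Y (s + t) w by lra.
  by rewrite in_itv/= => /andP[h1 h2]; exists r; lra.
rewrite -setIA XY_indep//; last exact: (sigma_algebra_setI (sigma_algebra_process _)).
rewrite (sub_independent Ysub s0 t0 sB sC) muleA; congr (_ * _)%E.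
by rewrite XY_indep.
Qed.

Lemma past_function s (f : Om -> R) :
  bounded_measurable (f : g_sigma_algebraType
     [set A `&` B | A in sigma_RV X & B in sigma_process `[0, s]%classic (fun t => Y t)] -> R) ->
  sigma_RV f `<=` past s.
Proof. by move=> [mf _] _ [A mA <-]; exact: mf. Qed.

Let y w t := X w + Y t w.
Let x r k w := grid (y w) r k.

Lemma grid_function_past r K k : (k <= K)%N ->
  bounded_measurable (x r k : g_sigma_algebraType
     [set A `&` B | A in sigma_RV X &
        B in sigma_process `[0, K%:R * 2^-1 ^+ r]%classic (fun t => Y t)] -> R).
Proof.
move=> kK; set G := [set _ | _ in _ & _ in _].
have t0 : 0 <= k%:R * 2^-1 ^+ r :> R by rewrite mulr_ge0// exprn_ge0.
apply: bmf01 => [|w]; last first.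
  by apply: expR01; rewrite addr_ge0// Y_ge0.
have mX : measurable_fun setT (X : g_sigma_algebraType G -> R).
  move=> _ B mB; rewrite setTI; apply: sub_sigma_algebra.
  exists (X @^-1` B); first by exists B => //; rewrite setTI.
  by exists setT; [exact: (sigma_algebra_setT (sigma_algebra_process _))|rewrite setIT].
have mY : measurable_fun setT (Y (k%:R * 2^-1 ^+ r) : g_sigma_algebraType G -> R).
  move=> _ B mB; rewrite setTI; apply: sub_sigma_algebra.
  exists setT; first exact: (sigma_algebra_setT (sigma_algebra_RV _)).
  exists (Y (k%:R * 2^-1 ^+ r) @^-1` B); last by rewrite setTI.
  apply: sub_sigma_algebra; exists (k%:R * 2^-1 ^+ r).
    by rewrite /= in_itv/= t0 ler_wpM2r ?exprn_ge0// ler_nat.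
  by exists B => //; rewrite setTI.
apply: measurableT_comp => //; apply: measurableT_comp => //.
exact: measurable_funD.
Qed.

Lemma grid_function r k : bounded_measurable (x r k).
Proof.
apply: bmf01 => [|w]; last by apply: expR01; rewrite addr_ge0// Y_ge0// mulr_ge0// exprn_ge0.
apply: measurableT_comp => //; apply: measurableT_comp => //; exact: measurable_funD.
Qed.

Let e r k := expR (- (2^-1 ^+ r * Phi k%:R)).
Let E r K j s := \int[P]_w (x r K w ^+ j * cell_sum (cell_length (fun k => x r k w)) s K.+1).

Let x01 r w k : 0 < x r k w <= 1.
Proof. by apply: grid_le1 => t t0; rewrite addr_ge0// Y_ge0. Qed.

Let x_ni r w k : x r k.+1 w <= x r k w.
Proof.
apply: grid_nonincreasing => s t s0 st; rewrite lerD2l; exact: (sub_nondecreasing Ysub).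
Qed.

Let len_ge0 r w k : 0 <= cell_length (fun k => x r k w) k.
Proof. by apply: cell_length_ge0; [exact: x01|exact: x_ni]. Qed.

Let dt_ge0 r : 0 <= 2^-1 ^+ r :> R. Proof. exact: exprn_ge0. Qed.

Lemma increment_function1 r K : bounded_measurable (fun w =>
  expR (- (Y (K%:R * 2^-1 ^+ r + 2^-1 ^+ r) w - Y (K%:R * 2^-1 ^+ r) w))).
Proof.
have t0 : 0 <= K%:R * 2^-1 ^+ r :> R by rewrite mulr_ge0.
apply: bmf01 => [|w].
  by apply: measurableT_comp => //; apply: measurableT_comp => //; exact: measurable_funB.
by apply: expR01; rewrite subr_ge0 (sub_nondecreasing Ysub)// lerDl.
Qed.

Lemma increment_function r K i m : bounded_measurable (fun w =>
  expR (- (Y (K%:R * 2^-1 ^+ r + 2^-1 ^+ r) w - Y (K%:R * 2^-1 ^+ r) w)) ^+ i *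
  (1 - expR (- (Y (K%:R * 2^-1 ^+ r + 2^-1 ^+ r) w - Y (K%:R * 2^-1 ^+ r) w))) ^+ m).
Proof.
apply: bmfM; apply: bmfX; first exact: increment_function1.
by apply: bmfB; [exact: bmf_cst|exact: increment_function1].
Qed.

(** The cells up to K are functions of the past at time K 2^-r, the other factor is a function of
    the next increment, whose moments are [e r]. *)
Lemma cell_recursion r K j i m s : 
  \int[P]_w (x r K w ^+ (j + m) * cell_sum (cell_length (fun k => x r k w)) s K.+1 *
    (expR (- (Y (K%:R * 2^-1 ^+ r + 2^-1 ^+ r) w - Y (K%:R * 2^-1 ^+ r) w)) ^+ i *
    (1 - expR (- (Y (K%:R * 2^-1 ^+ r + 2^-1 ^+ r) w - Y (K%:R * 2^-1 ^+ r) w))) ^+ m)) =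
  E r K (j + m) s * diff m (e r) i.
Proof.
have t0 : 0 <= K%:R * 2^-1 ^+ r :> R by rewrite mulr_ge0.
have mV : measurable_fun setT (fun w =>
    Y (K%:R * 2^-1 ^+ r + 2^-1 ^+ r) w - Y (K%:R * 2^-1 ^+ r) w).
  exact: measurable_funB.
pose V : {RV P >-> R} := mfun_Sub (mem_set mV).
have V0 w : 0 <= V w.
  by rewrite /V /= subr_ge0 (sub_nondecreasing Ysub)// lerDl.
have bV : bounded_measurable (fun w => expR (- V w)) by exact: bmf_expN.
have e1 w := expR01 (V0 w).
rewrite (@independent_Rintegral _ _ _ P _
  (fun w => expR (- V w) ^+ i * (1 - expR (- V w)) ^+ m)).
- congr (_ * _); rewrite moment_diff//; apply: eq_diff => k.
  exact: increment_moment.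
- by apply: bmf_cell_function => k _; exact: grid_function.
- by apply: bmfM; apply: bmfX => //; apply: bmfB => //; exact: bmf_cst.
- by move=> w; rewrite mulr_ge0 ?exprn_ge0 ?cell_sum_ge0//; case/andP: (x01 r w K) => /ltW.
- by move=> w; rewrite mulr_ge0 ?exprn_ge0 ?subr_ge0//; case/andP: (e1 w).
move=> A B sA sB.
have sA' : past (K%:R * 2^-1 ^+ r) A.
  apply: past_function sA; apply: bmf_cell_function => k kK; exact: grid_function_past.
apply: (past_independent t0 (dt_ge0 r) sA').
case: sB => B' mB' <-; rewrite setTI.
exists ((fun v : R => expR (- v) ^+ i * (1 - expR (- v)) ^+ m) @^-1` B'); last by rewrite setTI.
rewrite -[X in measurable X]setTI.
have mexp : measurable_fun setT (fun v : R => expR (- v)) by apply: measurableT_comp.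
suff mf : measurable_fun setT (fun v : R => expR (- v) ^+ i * (1 - expR (- v)) ^+ m) by exact: mf.
apply: measurable_funM; first exact: measurable_funX.
by apply: measurable_funX; apply: measurable_funB.
Qed.

Let x_succ r K w : x r K.+1 w = x r K w *
  expR (- (Y (K%:R * 2^-1 ^+ r + 2^-1 ^+ r) w - Y (K%:R * 2^-1 ^+ r) w)).
Proof.
rewrite /x /grid /y -expRD; congr expR.
rewrite -natr1 mulrDl mul1r; ring.
Qed.

Lemma delay_cell_recursion r m s : (0 < m)%N -> all (leq 1) s ->
  E r K 0 (m :: s) @[K --> \oo] -->
  (if s is [::] then diff m a 0 else 0) + diff m (e r) 0 * green_sum a (e r) m s.
Proof.
have x0E w : x r 0 w = expR (- X w).
  by rewrite /x /grid /y mul0r (sub_start Ysub) addr0.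
have bX : bounded_measurable (fun w => expR (- X w)) by exact: bmf_expN.
have dtgt0 : 0 < 2^-1 ^+ r :> R by rewrite exprn_gt0.
apply: cvg_cell_recursion => //.
- move=> K j s'; apply: Rintegral_ge0 => w _.
  by rewrite mulr_ge0 ?cell_sum_ge0// exprn_ge0//; case/andP: (x01 r w K) => /ltW.
- by move=> j; rewrite /E /a; congr Rintegral; apply/funext => w; rewrite /= mulr1 x0E.
- move=> j m' s' _; case: s' => [|n s'].
    rewrite -(moment_diff P j m' bX) /E; congr Rintegral; apply/funext => w.
    by rewrite /= big_ord1 /= mulr1 !x0E.
  rewrite /E (_ : (fun w => _) = (fun=> 0)) ?Rintegral_cst ?mul0r//.
  by apply/funext => w; rewrite /= big_ord1 big_ord0 mulr0 mulr0.
- move=> K j; transitivity (E r K (j + 0) [::] * diff 0 (e r) j).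
    2: by rewrite addn0 mulrC.
  rewrite -cell_recursion; congr Rintegral; apply/funext => w.
  by rewrite x_succ /= addn0 exprMn expr0 !mulr1.
- move=> K j m' s' _.
  transitivity (E r K (j + 0) (m' :: s') * diff 0 (e r) j +
      E r K (j + m') s' * diff m' (e r) j).
    2: by rewrite addn0 [X in X + _]mulrC [X in _ + X]mulrC.
  rewrite -!cell_recursion -bmf_intD.
  (* With D the exponential of minus the next increment, the new cell has length x_K (1 - D) and the
     balls to its left contribute (x_K D)^j. *)
  + congr Rintegral; apply/funext => w; rewrite addn0 cell_sumS x_succ.
    rewrite [cell_length _ K.+1]/= x_succ expr0 exprMn exprD.
    set D := expR _; rewrite -[in X in X ^+ m'](mulr1 (x r K w)) -mulrA mul1r -mulrBr exprMn.
    ring.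
  + apply: bmfM; last exact: increment_function.
    by apply: bmf_cell_function => k _; exact: grid_function.
  + apply: bmfM; last exact: increment_function.
    by apply: bmf_cell_function => k _; exact: grid_function.
- by rewrite /e delay_momentE mul0r mulr0 mulr0 oppr0 expR0.
- move=> j j0; rewrite /e expR_ge0 /= -[ltRHS]expR0 ltr_expR oppr_lt0 mulr_gt0// delay_momentE.
  by rewrite !mulr_gt0 ?ltr0n ?delay_moment_gt0.
- move=> m' j _; have := moment_diff P j m' (increment_function1 r 0).
  rewrite (@eq_diff _ _ (e r)) => [<-|k]; last exact: increment_moment.
  apply: Rintegral_ge0 => w _.
  have t0 : 0 <= 0%:R * 2^-1 ^+ r :> R by rewrite mulr_ge0.
  have V0 : 0 <= Y (0%:R * 2^-1 ^+ r + 2^-1 ^+ r) w - Y (0%:R * 2^-1 ^+ r) w.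
    by rewrite subr_ge0 (sub_nondecreasing Ysub)// lerDl.
  by have /andP[? ?] := expR01 V0; rewrite mulr_ge0 ?exprn_ge0 ?subr_ge0.
Qed.

(** Chernoff bound: P(Y_k < m) is at most exp(m) exp(- k Phi(1)), which tends to 0. *)
Lemma delay_unbounded :
  {ae P, forall w, forall M, exists2 k : nat, True & M <= X w + Y k%:R w}.
Proof.
pose N (m : nat) := \bigcap_k [set w | Y k%:R w < m%:R].
have mN m : measurable (N m).
  apply: bigcap_measurableType => k _.
  exact: (process_measurable (@process_lt setT k%:R m%:R I)).
have Phi1 : 0 < Phi 1.
  by have := delay_momentE 1; rewrite mul1r => ->; rewrite mulr_gt0 ?delay_moment_gt0.
have PN m : P (N m) = 0%E.
  have h k : fine (P (N m)) <= expR m%:R * expR (- Phi 1) ^+ k.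
    have <- : \int[P]_w expR (- Y k%:R w) = expR (- Phi 1) ^+ k.
      have := @increment_moment 0 k%:R 1 (lexx 0) (ler0n R k).
      rewrite -expRM_natl mulrN => <-; congr Rintegral; apply/funext => w.
      by rewrite add0r (sub_start Ysub) subr0 expr1.
    have bY : bounded_measurable (fun w => expR (- Y k%:R w)).
      by apply: bmf_expN => w; apply: Y_ge0.
    rewrite -bmf_int_indic// -bmf_intZ//.
    apply: bmf_int_le; [exact: bmf_indic|exact: bmfZ|] => w.
    rewrite -expRD indicE; have [/set_mem Nw|_] := boolP (w \in N m); last by rewrite expR_ge0.
    apply: (@le_trans _ _ (expR 0)); first by rewrite expR0.
    by rewrite ler_expR subr_ge0; exact/ltW/(Nw k I).
  have : fine (P (N m)) <= 0.
    apply: (@seq_cvg_ge _ (fun k => expR m%:R * expR (- Phi 1) ^+ k)) => //.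
    rewrite -(mulr0 (expR m%:R)); apply: cvgMr; apply: cvg_expr.
    by rewrite ger0_norm ?expR_ge0// -[ltRHS]expR0 ltr_expR oppr_lt0.
  have PNfin : P (N m) \is a fin_num by rewrite fin_num_measure.
  rewrite -(fineK PNfin) => h0; congr EFin; apply/eqP; rewrite eq_le h0/=.
  exact: fine_ge0.
have : {ae P, forall w, forall m, ~ N m w}.
  by apply: ae_foralln => m; exists (N m); split; [exact: mN|exact: PN|move=> w /= /contrapT].
apply: filterS => w h M; have /existsNP[k /not_implyP[_ /negP hk]] := h (Num.truncn M).+1.
exists k => //; rewrite -leNgt in hk; apply: (le_trans (ltW (truncnS_gt M))).
by rewrite (le_trans hk)// lerDr.
Qed.

Section sampling.
Variables (Z W : Om -> set R) (U : nat -> {RV P >-> R}).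
Hypotheses (W_E : forall w, W w = closure [set X w + Y t w | t in `[0, +oo[%classic])
  (Z_E : forall w, Z w = exp_neg (W w)).
Hypotheses (cZ : random_closed_set Z)
  (U_unif : forall i A, measurable A ->
     distribution P (U i) A = uniform_prob (@ltr01 R) A)
  (UZ_indep : mutually_independent P
     (fun o : option nat => if o is Some i then sigma_RV (U i) else sigma_set Z)).

Let U_indep : mutually_independent P (fun i : nat => sigma_RV (U i)).
Proof.
move=> s A us sA.
pose F (o : option nat) := if o is Some i then A i else setT.
have := UZ_indep (s := map Some s) (E := F); rewrite big_map => <-.
- congr (P _); apply/seteqP; split=> w h.
    by move=> [i|//] /= /mapP[j js [->]]; exact: h.
  by move=> i /= si; apply: (h (Some i)); rewrite /= mem_map// => ? ? [].
- by rewrite map_inj_uniq// => ? ? [].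
- by move=> _ /mapP[i si ->]; exact: sA.
Qed.

Lemma sampling_law n s : (0 < n)%N -> compositions n s ->
  P [set w | sampled_composition (Z w) n (fun i => U i w) s] = (delayed_law a (rev s))%:E.
Proof.
move=> n0 [s0 sn]; have s_nil : s <> [::] by move=> sE; rewrite -sn sE in n0.
rewrite (probability_sampling n cZ UZ_indep).
have msec := measurable_sampling_section U n cZ s.
pose sec w := [set w' | sampled_composition (Z w) n (fun i => U i w') s].
pose h w := fine (P (sec w)).
have mh : measurable_fun setT h.
  have mD := @rectangles_measurable _ Om (sigma_set Z) (sample_rectangles U n)
    (sigma_set_measurable cZ) _ _ (sampling_event cZ s).
  have /mD mD' : sample_rectangles U n `<=` measurable.
    by move=> _ [A [mA ->]]; apply: sample_rectangle_measurable.
  have := measurable_fun_xsection (P : {sigma_finite_measure set _ -> \bar R}) mD'.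
  rewrite (_ : _ \o _ = EFin \o h); first by move/measurable_EFinP.
  apply/funext => w /=; rewrite fineK; last by rewrite fin_num_measure//; exact: msec.
  by congr (P _); apply/seteqP; split=> w' /=; rewrite /xsection /= inE.
have h01 w : 0 <= h w <= 1.
  rewrite fine_ge0//= -lee_fin fineK ?probability_le1//; first exact: msec.
  by rewrite fin_num_measure//; exact: msec.
have bh : bounded_measurable h by exact: bmf01.
rewrite (eq_integral (EFin \o h)) => [|w _]; last first.
  by rewrite /= fineK// fin_num_measure//; exact: msec.
rewrite bmf_integralE//; congr EFin.
(* The probability, given the path, that the sample has the counts [s] in the first K cells of the
   grid of mesh 2^-r. *)
pose G r K w := (multinom s)%:R * cell_sum (cell_length (grid (y w) r)) s K.
have g01 r w k : 0 < grid (y w) r k <= 1 by exact: x01.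
have gni r w k : grid (y w) r k.+1 <= grid (y w) r k by exact: x_ni.
have G01 r K w : 0 <= G r K w <= 1.
  rewrite /G -(cell_event_probability U_unif U_indep K s0 sn (g01 r w) (gni r w)).
  have mE : measurable (cell_event U n s (grid (y w) r) K) by exact: measurable_cell_event.
  by rewrite fine_ge0//= -lee_fin fineK ?probability_le1// fin_num_measure.
have bG r K : bounded_measurable (G r K.+1).
  have := bmfZ (multinom s)%:R (@bmf_cell_function _ _ _ (x r) s K 0 (fun k _ => grid_function r k)).
  by congr bounded_measurable; apply/funext => w; rewrite expr0 mul1r.
have Gnd r w : {homo (fun K => G r K w) : m k / (m <= k)%N >-> m <= k}.
  by move=> m k mk; rewrite ler_wpM2l// cell_sum_nd// => i; exact: len_ge0.
pose p r w := limn (fun K => G r K w).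
have Gp r w : G r K w @[K --> \oo] --> p r w.
  apply: nondecreasing_is_cvgn; first exact: Gnd.
  by exists 1 => _ [K _ <-]; case/andP: (G01 r K w).
have GpS r w : G r K.+1 w @[K --> \oo] --> p r w by rewrite (cvg_shiftS (fun K => G r K w)); exact: Gp.
have mp r : measurable_fun setT (p r).
  apply: (@measurable_fun_cvg _ _ _ _ (fun K => G r K.+1)) => [K|w _]; last exact: GpS.
  by case: (bG r K).
have p01 r w : 0 <= p r w <= 1.
  apply/andP; split; first by apply: (seq_cvg_ge (Gp r w)) => K; case/andP: (G01 r K w).
  by apply: (seq_cvg_le (Gp r w)) => K; case/andP: (G01 r K w).
case: s s_nil s0 sn @sec @h mh h01 bh @G G01 bG Gnd @p Gp GpS mp p01 msec => // m s' _ s0 sn.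
move=> sec h mh h01 bh G G01 bG Gnd p Gp GpS mp p01 msec.
have /andP[m0 s'0] : (0 < m)%N && all (leq 1) s' by [].
pose L r := (multinom (m :: s'))%:R * ((if s' is [::] then diff m a 0 else 0) +
  diff m (e r) 0 * green_sum a (e r) m s').
have intp r : \int[P]_w p r w = L r.
  apply: (@seq_cvg_unique _ (fun K => \int[P]_w G r K.+1 w)).
    apply: (@bmf_int_cvg _ _ _ P _ _ 1) => //.
    - by move=> K; case: (bG r K).
    - by move=> K w; have /andP[h1 h2] := G01 r K.+1 w; rewrite ger0_norm.
    - by apply: aeW => w; exact: GpS.
  have -> : (fun K => \int[P]_w G r K.+1 w) = (fun K => (multinom (m :: s'))%:R * E r K 0 (m :: s')).
    apply/funext => K; rewrite /E -bmf_intZ; last first.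
      by apply: bmf_cell_function => k _; exact: grid_function.
    by congr Rintegral; apply/funext => w; rewrite expr0 mul1r.
  by apply: cvgMr; exact: delay_cell_recursion.
have -> : delayed_law a (rev (m :: s')) = (multinom (m :: s'))%:R * left_weight a 0 (m :: s').
  rewrite -delayed_law_rev//; congr (_%:R * _).
  (* Both multinomial coefficients are n! over the same product of factorials. *)
  have fact_gt0' : (0 < \prod_(i <- m :: s') i`!)%N by apply: prodn_gt0 => i; exact: fact_gt0.
  apply/eqP; rewrite -(eqn_pmul2r fact_gt0') multinom_fact.
  rewrite [X in (_ * X)%N](_ : _ = (\prod_(i <- rev (m :: s')) i`!)%N); last first.
    by apply: perm_big; rewrite perm_sym perm_rev.
  by rewrite multinom_fact sumn_rev.
(* The same integrals have two limits in r: pathwise the conditional probability [h], and through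
   the recursion the expression with [left_weight]. *)
apply: (@seq_cvg_unique _ (fun r => \int[P]_w p r w)).
  apply: (@bmf_int_cvg _ _ _ P _ _ 1) => //.
  - by move=> r w; have /andP[h1 h2] := p01 r w; rewrite ger0_norm.
  apply: filterS delay_unbounded => w uw.
  have y_nd t t' : 0 <= t -> t <= t' -> y w t <= y w t'.
    by move=> t0 tt'; rewrite lerD2l; exact: (sub_nondecreasing Ysub).
  have y_rc t : 0 <= t -> y w t' @[t' --> at_right t] --> y w t.
    by move=> t0; apply: cvgD; [exact: cvg_cst|exact: (sub_right_continuous Ysub)].
  have y_ge0 t : 0 <= t -> 0 <= y w t by move=> t0; rewrite addr_ge0// Y_ge0.
  have ZE : Z w = exp_neg (closure [set y w t | t in `[0, +oo[%classic]).
    by rewrite Z_E W_E.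
  have [|p' [p'1 p'2]] := sampling_limit U_unif U_indep y_nd y_rc y_ge0 uw s0 sn.
    by have := msec w; rewrite ZE.
  have -> : (fun r => p r w) = p'.
    by apply/funext => r; exact: (seq_cvg_unique (Gp r w) (p'1 r)).
  by rewrite /h /sec ZE.
have -> : (fun r => \int[P]_w p r w) = L by apply/funext.
by apply: cvgMr; apply: (cvg_small_mesh delay_moment_gt0 c_gt0 delay_momentE).
Qed.

End sampling.

End regenerative.

(** * The chain of a regenerative set *)

Section renewal_chain.
Context d (Om : measurableType d) (R : realType) (P : probability Om R).
Variable xi : nat -> Om -> bool.
Hypothesis xi1 : forall w, xi 1 w.
Hypothesis mxi : forall j, measurable [set w | xi j w].

(** The default [q.+1] keeps the renewal times strictly increasing even when no further 1 occurs,
    which will be a null event. *)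
Definition next_one w q : nat :=
  if pselect (exists j, (q < j)%N && xi j w) is left e then ex_minn e else q.+1.

Definition renewal t w := iter t (next_one w) 1%N.

Definition infinitely_many_ones w := forall q, exists j, (q < j)%N && xi j w.

Lemma next_one_gt w q : (q < next_one w q)%N.
Proof. by rewrite /next_one; case: pselect => // e; case: ex_minnP => j /andP[]. Qed.

Lemma next_oneP w q k : infinitely_many_ones w ->
  next_one w q = k <-> [/\ (q < k)%N, xi k w & forall j, (q < j < k)%N -> ~~ xi j w].
Proof.
move=> inf; rewrite /next_one; case: pselect => [e|/(_ (inf q))//].
case: ex_minnP => k' /andP[qk' xk'] min; split=> [<-|[qk xk hk]].
  split=> // j /andP[qj jk']; apply/negP => xj.
  by have := min j; rewrite qj xj leqNgt jk' => /(_ isT).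
apply/eqP; rewrite eqn_leq min ?qk ?xk//= leqNgt; apply/negP => k'k.
by have := hk k'; rewrite qk' k'k xk' => /(_ isT).
Qed.

Lemma renewal_one w t : infinitely_many_ones w -> xi (renewal t w) w.
Proof.
move=> inf; case: t => [|t]; first exact: xi1.
by have /(next_oneP _ _ inf)[] := erefl (next_one w (renewal t w)).
Qed.

Lemma renewal_lt t w : (renewal t w < renewal t.+1 w)%N.
Proof. exact: next_one_gt. Qed.

Lemma renewal_hits w j : infinitely_many_ones w -> (0 < j)%N ->
  (exists t, renewal t w = j) <-> xi j w.
Proof.
move=> inf j0; split=> [[t <-]|xj]; first exact: renewal_one.
have tQ t : (t < renewal t w)%N.
  by elim: t => // t IH; apply: leq_ltn_trans IH (renewal_lt t w).
have [t tj] : exists t, (renewal t w <= j < renewal t.+1 w)%N.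
  have ex : exists t, (j < renewal t w)%N by exists j.
  case: (ex_minnP ex) => -[|t] jt min.
    by rewrite /= ltnS leqNgt j0 in jt.
  exists t; rewrite jt andbT leqNgt; apply/negP => /min; by rewrite ltnn.
exists t; apply/eqP; case/andP: tj; rewrite leq_eqVlt => /orP[//|tj jt].
have /(next_oneP _ _ inf)[_ _ h] := erefl (next_one w (renewal t w)).
by have := h j; rewrite tj jt xj => /(_ isT).
Qed.

Lemma next_one_measurable q k : measurable [set w | next_one w q = k].
Proof.
have sm : sigma_algebra setT (@measurable _ Om) by exact: sigma_algebra_measurable.
rewrite (_ : [set w | _] = [set w |
   ((exists j : nat, (q < j)%N /\ xi j w) /\ ((q < k)%N /\ (xi k w /\ forall j : nat, (q < j < k)%N -> ~ xi j w)))
   \/ (~ (exists j : nat, (q < j)%N /\ xi j w) /\ k = q.+1)]).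
  have mex : measurable [set w | exists j : nat, (q < j)%N /\ xi j w].
    apply: (sigma_exists sm) => j; apply: (sigma_and sm); first exact: (sigma_const sm).
    exact: mxi.
  apply: (sigma_or sm); apply: (sigma_and sm) => //.
  - apply: (sigma_and sm); first exact: (sigma_const sm).
    apply: (sigma_and sm); first exact: mxi.
    apply: (sigma_forall sm) => j; apply: (sigma_imply sm); first exact: (sigma_const sm).
    by apply: (sigma_not sm); exact: mxi.
  - by apply: (sigma_not sm).
  - exact: (sigma_const sm).
apply/seteqP; split=> w /=; rewrite /next_one; case: pselect => [e|ne].
- case: ex_minnP => k' /andP[qk' xk'] min <-; left.
  split; first by exists k'.
  split=> //; split=> // j /andP[qj jk'] xj.
  by have := min j; rewrite qj xj leqNgt jk' => /(_ isT).
- move=> <-; right; split=> // -[j [qj xj]]; by apply: ne; exists j; rewrite qj xj.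
- case: ex_minnP => k' /andP[qk' xk'] min [[_ [qk [xk hk]]]|[nex _]]; last first.
    by exfalso; apply: nex; exists k'.
  apply/eqP; rewrite eqn_leq min ?qk ?xk//= leqNgt; apply/negP => k'k.
  by apply: (hk k'); rewrite ?qk'.
- by move=> [[[j [qj xj]]]|[_ ->//]]; exfalso; apply: ne; exists j; rewrite qj xj.
Qed.

Lemma renewal_measurable t k : measurable [set w | renewal t w = k].
Proof.
elim: t k => [|t IH] k.
  have sm : sigma_algebra setT (@measurable _ Om) by exact: sigma_algebra_measurable.
  exact: (sigma_const sm (1%N = k)).
rewrite (_ : [set w | _] = \bigcup_q ([set w | renewal t w = q] `&` [set w | next_one w q = k])).
  by apply: bigcup_measurable => q _; apply: measurableI => //; exact: next_one_measurable.
apply/seteqP; split=> [w <-|w [q _ [/= <- <-]]] //.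
by exists (renewal t w).
Qed.

(** Latest gap first: these are the boxes from right to left, without the box that opens at
    [x t]. *)
Fixpoint gaps (x : nat -> nat) t : seq nat :=
  if t is t'.+1 then (x t'.+1 - x t')%N :: gaps x t' else [::].

Lemma gaps_pos x t : (forall i, (i < t)%N -> (x i < x i.+1)%N) -> all (leq 1) (gaps x t).
Proof.
elim: t => //= t IH h; rewrite subn_gt0 h// IH// => i it.
by apply: h; exact: ltnW.
Qed.

Lemma sumn_gaps x t : x 0%N = 1%N -> (forall i, (i < t)%N -> (x i < x i.+1)%N) ->
  (sumn (gaps x t)).+1 = x t.
Proof.
move=> x0; elim: t => [//|t IH] h /=.
rewrite -addnS IH; last by move=> i it; apply: h; exact: ltnW.
by rewrite subnK// ltnW// h.
Qed.

Lemma gaps_path rs : all (leq 1) rs -> exists x,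
  [/\ x 0%N = 1%N, forall i, (i < size rs)%N -> (x i < x i.+1)%N,
      gaps x (size rs) = rs & x (size rs) = (sumn rs).+1].
Proof.
move=> rs0; pose x k := (sumn (drop (size rs - k) rs)).+1.
have dropE k : (k < size rs)%N ->
    (size rs - k)%N = (size rs - k.+1).+1 /\ (size rs - k.+1 < size rs)%N.
  move=> krs; split; first by lia.
  by move: krs; case: (size rs) => // n _; rewrite subSS ltnS leq_subr.
exists x; split; last by rewrite /x subnn drop0.
- by rewrite /x subn0 drop_size.
- move=> k /dropE[e szk]; rewrite /x ltnS.
  rewrite e [X in (_ < sumn X)%N](drop_nth 0%N szk) /=.
  by rewrite -[ltnLHS]add0n ltn_add2r; exact: (allP rs0 _ (mem_nth 0%N szk)).
suff h k : (k <= size rs)%N -> gaps x k = drop (size rs - k) rs.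
  by rewrite h// subnn drop0.
elim: k => [|k IH] krs /=; first by rewrite subn0 drop_size.
have [e szk] := dropE _ krs.
rewrite IH ?(ltnW krs)// /x e [in RHS](drop_nth 0%N szk) [X in (sumn X).+1](drop_nth 0%N szk) /=.
by congr (_ :: _); lia.
Qed.

Lemma binary_form_rcons s m : (0 < m)%N ->
  binary_form (rcons (rcons s m) 1) =
  binary_form (rcons s 1) ++ rcons (nseq m.-1 false) true.
Proof.
move=> m0; rewrite /binary_form !map_rcons !flatten_rcons /= -!catA; congr (_ ++ _).
by rewrite cats1.
Qed.

Lemma size_binary_form s : all (leq 1) s -> size (binary_form s) = sumn s.
Proof.
elim: s => //= m s IH /andP[m0 s0].
by rewrite /binary_form /= size_cat size_nseq -/(binary_form s) IH// -addSn prednK.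
Qed.

(** Knowing the path up to time t is knowing the first [x t] bits: complete boxes given by the gaps,
    then a box of which a single ball is seen. *)
Lemma renewal_pathP w x t : infinitely_many_ones w -> x 0%N = 1%N ->
  (forall i, (i < t)%N -> (x i < x i.+1)%N) ->
  (forall i, (i <= t)%N -> renewal i w = x i) <->
  mkseq (fun j => xi j.+1 w) (x t) = binary_form (rcons (rev (gaps x t)) 1).
Proof.
move=> inf x0; elim: t => [|t IH] h.
  rewrite x0; split=> [_|_ i]; first by rewrite /mkseq /= xi1.
  by rewrite leqn0 => /eqP ->; rewrite x0.
have ht i : (i < t)%N -> (x i < x i.+1)%N by move=> it; apply: h; exact: ltnW.
have xt := h t (ltnSn t).
rewrite [gaps x t.+1]/= rev_cons binary_form_rcons ?subn_gt0//.
set m := (x t.+1 - x t)%N; have m0 : (0 < m)%N by rewrite subn_gt0.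
have xtm : x t.+1 = (x t + m)%N by rewrite subnKC// ltnW.
have -> : mkseq (fun j => xi j.+1 w) (x t.+1) =
    mkseq (fun j => xi j.+1 w) (x t) ++ mkseq (fun j => xi (x t + j).+1 w) m.
  rewrite xtm /mkseq iotaD map_cat add0n; congr (_ ++ _).
  by rewrite -{1}[x t]addn0 iotaDl -map_comp.
have szE : size (mkseq (fun j => xi j.+1 w) (x t)) = size (binary_form (rcons (rev (gaps x t)) 1)).
  rewrite size_mkseq size_binary_form.
    by rewrite sumn_rcons sumn_rev addn1 sumn_gaps.
  by rewrite all_rcons/= all_rev gaps_pos.
have catE : (mkseq (fun j => xi j.+1 w) (x t) ++ mkseq (fun j => xi (x t + j).+1 w) m =
    binary_form (rcons (rev (gaps x t)) 1) ++ rcons (nseq m.-1 false) true) <->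
    (mkseq (fun j => xi j.+1 w) (x t) = binary_form (rcons (rev (gaps x t)) 1) /\
     mkseq (fun j => xi (x t + j).+1 w) m = rcons (nseq m.-1 false) true).
  split=> [/eqP|[-> ->]//]; rewrite eqseq_cat// => /andP[/eqP -> /eqP ->] //.
rewrite catE -IH//.
have tailE : mkseq (fun j => xi (x t + j).+1 w) m = rcons (nseq m.-1 false) true <->
    next_one w (x t) = x t.+1.
  rewrite next_oneP//; split=> [e|[_ x1 x2]].
    have nthE j : (j < m)%N -> xi (x t + j).+1 w = (j == m.-1).
      move=> jm; have := congr1 (fun b => nth false b j) e; rewrite nth_mkseq// => ->.
      have jm1 : (j <= m.-1)%N by lia.
      by rewrite nth_rcons size_nseq nth_nseq; case: ltngtP jm1.
    split=> //.
      rewrite xtm -(prednK m0) addnS nthE ?eqxx//.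
      by rewrite prednK.
    move=> j /andP[tj jt]; have [i ij] : exists i, j = (x t + i).+1.
      by exists (j - x t).-1; rewrite -addnS prednK ?subn_gt0// subnKC// ltnW.
    by rewrite ij nthE; [apply/eqP|]; move: jt; rewrite ij xtm; lia.
  apply: (@eq_from_nth _ false); first by rewrite size_mkseq size_rcons size_nseq prednK.
  move=> j; rewrite size_mkseq => jm; rewrite nth_mkseq// nth_rcons size_nseq nth_nseq.
  case: ltngtP => [jm'|jm'|jm'].
  - by apply/negbTE/x2; rewrite xtm; lia.
  - lia.
  - by rewrite (_ : (x t + j).+1 = x t.+1) ?x1// xtm; lia.
rewrite tailE; split=> [hi|[hi e] i].
  split; first by move=> i it; apply: hi; exact: leqW.
  by rewrite -(hi t)// -(hi t.+1).
rewrite leq_eqVlt => /orP[/eqP ->|]; last by rewrite ltnS; exact: hi.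
by rewrite -e -(hi t).
Qed.

End renewal_chain.

Section binomial_differences.
Variable R : realType.

(** In terms of moments: x^i = x^i ((1 - x) + x)^j. *)
Lemma sum_bin_diff (f : nat -> R) j i :
  \sum_(m < j.+1) 'C(j, m)%:R * diff m f (i + (j - m))%N = f i.
Proof.
elim: j i => [|j IH] i; first by rewrite big_ord1 bin0 mul1r addn0.
rewrite big_ord_recl /= bin0 mul1r subn0.
under eq_bigr => m _ do rewrite /bump/= add1n binS natrD mulrDl subSS.
rewrite big_split/= addrA.
have -> : diff 0 f (i + j.+1)%N + \sum_(m < j.+1) 'C(j, m.+1)%:R * diff m.+1 f (i + (j - m))%N =
    \sum_(m < j.+1) 'C(j, m)%:R * diff m f (i + (j - m)).+1.
  rewrite [in LHS]big_ord_recr/= bin_small// mul0r addr0 [in RHS]big_ord_recl/=.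
  rewrite bin0 mul1r subn0 addnS; congr (_ + _).
  apply: eq_bigr => m _; rewrite /bump/= add1n; congr (_ * _).
  have mj := ltn_ord m.
  by rewrite (_ : (i + (j - m.+1)).+1 = (i + (j - m))%N)//; lia.
rewrite -big_split/= -[RHS](IH i); apply: eq_bigr => m _.
by rewrite -mulrDr; congr (_ * _); rewrite /= addrC subrK.
Qed.

End binomial_differences.

(** Decodes a reversed binary form; bits and boxes are both read from right to left. *)
Fixpoint boxes (b : seq bool) : seq nat :=
  if b is x :: b' then
    if x then 1%N :: boxes b' else if boxes b' is m :: rs then m.+1 :: rs else [::]
  else [::].

Lemma boxes_nseq k b : boxes (nseq k false ++ true :: b) = k.+1 :: boxes b.
Proof. by elim: k => //= k ->. Qed.

Lemma boxes_binary_form s : all (leq 1) s -> boxes (rev (binary_form s)) = rev s.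
Proof.
elim/last_ind: s => // s m IH; rewrite all_rcons => /andP[m0 s0].
rewrite /binary_form map_rcons flatten_rcons rev_cat rev_cons rev_nseq cat_rcons.
by rewrite boxes_nseq IH// prednK// rev_rcons.
Qed.

Lemma boxes_rcons b : exists m rs,
  [/\ boxes (rcons b true) = m :: rs, all (leq 1) (m :: rs) & sumn (m :: rs) = (size b).+1].
Proof.
elim: b => [|x b [m [rs [bE /= /andP[m0 rs0] sE]]]]; first by exists 1%N, [::].
case: x => /=; rewrite bE.
  by exists 1%N, (m :: rs); rewrite /= m0 rs0 sE.
by exists m.+1, rs; rewrite /= rs0 addSn sE.
Qed.

Lemma boxes_zeros N b m rs : boxes (rcons b true) = m :: rs ->
  boxes (rcons (nseq N false ++ b) true) = (N + m)%N :: rs.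
Proof. by move=> bE; elim: N => //= N ->. Qed.

(** * The chain attached to a nonnegative delayed law *)

Section markov_chain_of_law.
Variables (d : measure_display) (T : measurableType d) (R : realType)
  (P0 : probability T R) (f : T -> R).
Hypotheses (mf : measurable_fun setT f) (f01 : forall w, 0 < f w <= 1).
Let a k := \int[P0]_w f w ^+ k.
Hypothesis law_ge0 : forall m rs, all (leq 1) (m :: rs) -> 0 <= delayed_law a (m :: rs).

Local Notation U := (uniform_prob (@ltr01 R) : probability (measurableTypeR R) R).

Let bf : bounded_measurable f.
Proof. by apply: bmf01 => // w; case/andP: (f01 w) => /ltW ->. Qed.

Let a_gt0 k : 0 < a k.
Proof.
by apply: bmf_int_gt0 => [|w]; [exact: bmfX|rewrite exprn_gt0//; case/andP: (f01 w)].
Qed.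

Let a0 : a 0 = 1.
Proof.
rewrite /a -[RHS]/(fine 1%:E) -(probability_setT P0) -bmf_int_indic//.
by congr Rintegral; apply/funext => w; rewrite expr0 indicT.
Qed.

Lemma regen_law_ge0 rs : all (leq 1) rs -> 0 <= regen_law a rs.
Proof.
move=> rs0; have := @law_ge0 1 rs rs0.
by rewrite delayed_law1 pmulr_rge0.
Qed.

(** Every state is reachable, so that each row of the transition matrix can be read off a path of
    positive probability. If all jumps out of j + 1 balls had weight 0, the binomial expansion of
    Phi(0) = 0 would reduce to Phi(j+1) > 0. *)
Lemma regen_law_positive j : exists rs,
  [/\ all (leq 1) rs, sumn rs = j & 0 < regen_law a rs].
Proof.
elim/ltn_ind: j => -[|j] IH; first by exists [::].
pose Phi k := k%:R * a k.
have : \sum_(m < j.+2) 'C(j.+1, m)%:R * diff m Phi (0 + (j.+1 - m))%N = 0.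
  by rewrite sum_bin_diff /Phi mul0r.
rewrite big_ord_recl bin0 mul1r [diff _ _ _]/= add0n subn0.
have [/existsP[m hm]|/existsPn h] := boolP
    [exists m : 'I_j.+1, jump_weight a (j.+1 - m.+1) m.+1 != 0]; last first.
  rewrite big1 ?addr0 => [/eqP|m _]; first by rewrite /Phi mulf_eq0 (gt_eqF (a_gt0 _)) orbF pnatr_eq0.
  have := h m; rewrite negbK /jump_weight oppr_eq0 => /eqP h'.
  by rewrite lift0 add0n h' mulr0.
move=> _; have mj := ltn_ord m.
have [|rs [rs0 rsj rs_gt0]] := IH (j.+1 - m.+1)%N; first by lia.
exists (m.+1 :: rs); split=> //=; first by rewrite rsj; lia.
have h0 : 0 <= regen_law a (m.+1 :: rs) by apply: regen_law_ge0.
rewrite lt_neqAle h0 andbT eq_sym /= rsj !mulf_neq0 ?invr_eq0 ?mulf_neq0//.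
- by rewrite pnatr_eq0 -lt0n bin_gt0 leq_addl.
- by rewrite gt_eqF.
- by rewrite gt_eqF.
Qed.

(** The first bit is always 1; it is left out of the history and restored by [rcons]. *)
Let p b := delayed_law a (boxes (rcons b true)).

Let p_ge0 b : 0 <= p b.
Proof. by rewrite /p; have [m [rs [-> mrs _]]] := boxes_rcons b; exact: law_ge0. Qed.

Let p_nil : p [::] = 1.
Proof. by rewrite /p /= addn0 bin0 mulr1 mul1r a0. Qed.

Let p_split b : p (true :: b) + p (false :: b) = p b.
Proof.
rewrite /p /=; have [m [rs [-> /= /andP[m0 _] _]]] := boxes_rcons b.
by rewrite -[X in X + _ = _](@delayed_law_step _ a m rs)// subrK.
Qed.

(** The last box cannot grow forever. Bounding binom(j + k, j) f^j by (1 + f)^(j + k) leaves at most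
    2^j (1 - f^2)^k, which tends to 0 because f > 0. *)
Lemma zeros_cvg0 m rs : (0 < m)%N ->
  delayed_law a ((N + m)%N :: rs) @[N --> \oo] --> 0.
Proof.
move=> m0; set j := sumn rs.
pose g N w := 2 ^+ j * (1 - f w ^+ 2) ^+ (N + m.-1).
have fw w : 0 <= 1 - f w ^+ 2 < 1.
  have /andP[h1 h2] := f01 w; rewrite subr_ge0 exprn_ile1 ?(ltW h1)//=.
  by rewrite ltrBlDr ltrDl exprn_gt0.
have bg N : bounded_measurable (g N).
  by apply: bmfZ; apply: bmfX; apply: bmfB; [exact: bmf_cst|exact: bmfX].
have lawE N : delayed_law a ((N + m)%N :: rs) =
    (\int[P0]_w ('C(j + (N + m.-1), j)%:R * (f w ^+ j * (1 - f w) ^+ (N + m.-1)))) * regen_law a rs.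
  rewrite bmf_intZ; last by apply: bmfM; apply: bmfX => //; apply: bmfB => //; exact: bmf_cst.
  by rewrite moment_diff//= -/j -(prednK m0) addnS.
have c0 : \int[P0]_w g N w @[N --> \oo] --> 0.
  have -> : (0 : R) = \int[P0]_w (cst 0 w : R) by rewrite Rintegral_cst// mul0r.
  apply: (@bmf_int_cvg _ _ _ P0 _ _ (2 ^+ j)) => //.
  - by move=> N; case: (bg N).
  - move=> N w; have /andP[h1 h2] := fw w.
    rewrite ger0_norm ?mulr_ge0 ?exprn_ge0// ler_piMr ?exprn_ge0// exprn_ile1// ltW//.
  - apply: aeW => w; rewrite /g -(mulr0 (2 ^+ j)); apply: cvgMr.
    have /andP[h1 h2] := fw w.
    have -> : (fun N => (1 - f w ^+ 2) ^+ (N + m.-1)) =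
        (fun N => (1 - f w ^+ 2) ^+ N * (1 - f w ^+ 2) ^+ m.-1).
      by apply/funext => N; rewrite exprD.
    rewrite -(mul0r ((1 - f w ^+ 2) ^+ m.-1)); apply: cvgMl.
    by apply: cvg_expr; rewrite ger0_norm.
have -> : (fun N => delayed_law a ((N + m)%N :: rs)) =
    (fun N => (\int[P0]_w ('C(j + (N + m.-1), j)%:R * (f w ^+ j * (1 - f w) ^+ (N + m.-1)))) * regen_law a rs).
  by apply/funext.
rewrite -(mul0r (regen_law a rs)); apply: cvgMl.
apply: (@squeeze_cvgr _ _ _ _ (cst 0) (fun N => \int[P0]_w g N w)) => //; last exact: cvg_cst.
apply: nearW => N /=; apply/andP; split.
  apply: Rintegral_ge0 => w _; have /andP[h1 h2] := f01 w.
  by rewrite !mulr_ge0// exprn_ge0// ?subr_ge0// ltW.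
apply: bmf_int_le => // [|w].
  by apply: bmfZ; apply: bmfM; apply: bmfX => //; apply: bmfB => //; exact: bmf_cst.
have /andP[h1 h2] := f01 w; set k := (N + m.-1)%N.
have h3 : 'C(j + k, j)%:R * f w ^+ j <= (1 + f w) ^+ (j + k).
  rewrite exprDn (bigD1 (inord j))//= inordK ?ltnS ?leq_addr//.
  rewrite expr1n mul1r mulr_natl lerDl sumr_ge0// => i _.
  by rewrite expr1n mul1r mulrn_wge0// exprn_ge0// ltW.
rewrite mulrA; apply: (le_trans (ler_wpM2r _ h3)); first by rewrite exprn_ge0// subr_ge0.
rewrite exprD -mulrA -exprMn /g -/k.
have -> : (1 + f w) * (1 - f w) = 1 - f w ^+ 2 by ring.
apply: ler_wpM2r; first by rewrite exprn_ge0//; case/andP: (fw w).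
by apply: lerXn2r; rewrite ?nnegrE//; lra.
Qed.

Lemma ae_eq_probability d' (T' : measurableType d') (P : probability T' R) (A B : set T') :
  measurable A -> measurable B -> {ae P, forall w, A w <-> B w} -> P A = P B.
Proof.
move=> mA mB AB; rewrite -(@fineK _ (P A)) ?fin_num_measure// -(@fineK _ (P B)) ?fin_num_measure//.
congr EFin; rewrite -!bmf_int_indic//; apply: bmf_int_ae; [exact: bmf_indic|exact: bmf_indic|].
apply: filterS AB => w AB; rewrite !indicE; congr (_ %:R); congr nat_of_bool.
by apply/idP/idP; rewrite !inE => /AB.
Qed.

Lemma chain_of_law : exists Q : nat -> {RV U >-> nat}, increasing_markov_chain Q /\
  forall n s, (0 < n)%N -> compositions n s ->
    U [set w | xi_bits (fun t => Q t) w n = binary_form s] = (delayed_law a (rev s))%:E.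
Proof.
have [B [mB PB]] := random_bits p_ge0 p_nil p_split.
(* The bit 1 is always set, so the random bit 0 is the bit 2 of the string; the index 0 is not a
   position. *)
pose xi j x := if j is j'.+2 then B j' x else true.
have xi1 w : xi 1 w by [].
have mxi j : measurable [set w | xi j w].
  case: j => [|[|j]] /=; last exact: mB.
    by rewrite (_ : [set _ | _] = setT)//; apply/seteqP; split.
  by rewrite (_ : [set _ | _] = setT)//; apply/seteqP; split.
have bitsE n w : mkseq (fun j => xi j.+1 w) n.+1 = true :: mkseq (B^~ w) n.
  by rewrite /mkseq /= -[1%N]addn0 iotaDl -map_comp.
have bits_law n s : (0 < n)%N -> compositions n s ->
    measurable [set w | mkseq (fun j => xi j.+1 w) n = binary_form s] /\
    U [set w | mkseq (fun j => xi j.+1 w) n = binary_form s] = (delayed_law a (rev s))%:E.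
  case: n => // n _ [s0 sn].
  have [b' bE] : exists b', binary_form s = true :: b'.
    by case: s s0 sn => // m s /= _ _; exists (nseq m.-1 false ++ binary_form s).
  have szb : size (rev b') = n.
    apply: succn_inj; rewrite size_rev -sn -(size_binary_form s0) bE//.
  have -> : [set w | mkseq (fun j => xi j.+1 w) n.+1 = binary_form s] =
      [set x | mkseq (B^~ x) (size (rev b')) = rev (rev b')].
    apply/seteqP; split=> w; rewrite /= bitsE bE szb revK; first by case.
    by move=> ->.
  have [h1 h2] := PB (rev b'); split=> //; rewrite h2; congr EFin.
  by rewrite /p -rev_cons -bE boxes_binary_form.
have ae_inf : {ae U, forall w, infinitely_many_ones xi w}.
  (* The event that the history [b] is followed by zeros only; there are countably many of them. *)
  pose F b := \bigcap_N [set w | mkseq (B^~ w) (size (nseq N false ++ b)) = rev (nseq N false ++ b)].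
  have F0 b : {ae U, forall w, ~ F b w}.
    have mF : measurable (F b) by apply: bigcap_measurableType => N _; case: (PB (nseq N false ++ b)).
    exists (F b); split=> //; last by move=> w /= /contrapT.
    have [m [rs [bE /= /andP[m0 _] _]]] := boxes_rcons b.
    have UF : U (F b) \is a fin_num by rewrite fin_num_measure.
    have h N : fine (U (F b)) <= delayed_law a ((N + m)%N :: rs).
      have [mN UN] := PB (nseq N false ++ b).
      rewrite -(boxes_zeros N bE) -lee_fin (fineK UF) -UN; apply: le_measure; rewrite ?inE//.
      by move=> w; apply.
    have := seq_cvg_ge (zeros_cvg0 rs m0) h => h0.
    rewrite -(fineK UF); congr EFin; apply/eqP; rewrite eq_le h0/=.
    by rewrite fine_ge0.
  have : {ae U, forall w, forall k, ~ F (odflt [::] (unpickle k)) w}.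
    by apply: ae_foralln => k; exact: F0.
  apply: filterS => w h q; apply: contrapT => nex.
  apply: (h (pickle (rev (mkseq (B^~ w) q)))); rewrite pickleK /= => N _ /=.
  rewrite size_cat size_nseq size_rev size_mkseq rev_cat revK rev_nseq addnC /mkseq iotaD map_cat.
  congr (_ ++ _); apply: (@eq_from_nth _ false); first by rewrite size_map size_iota size_nseq.
  move=> i; rewrite size_map size_iota => iN.
  rewrite (nth_map 0%N) ?size_iota// nth_iota// nth_nseq iN add0n.
  by apply/negP => Bi; apply: nex; exists (q + i).+2; rewrite /= Bi; lia.
have mQ t : measurable_fun setT (renewal xi t : measurableTypeR R -> nat).
  move=> _ A _; rewrite setTI (_ : _ @^-1` A = \bigcup_(k in A) [set w | renewal xi t w = k]).
    by apply: bigcup_measurable => k _; exact: renewal_measurable.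
  apply/seteqP; split=> w /= => [Aw|[k Ak e]]; first by exists (renewal xi t w).
  by rewrite /preimage /= e.
pose Q t : {RV U >-> nat} := mfun_Sub (mem_set (mQ t)).
have QE t w : Q t w = renewal xi t w by [].
have mpath (t : nat) (x : nat -> nat) : measurable [set w | forall i, (i <= t)%N -> Q i w = x i].
  rewrite (_ : [set w | _] = \bigcap_(i in [set i | (i <= t)%N]) [set w | renewal xi i w = x i]) //.
  by apply: bigcap_measurableType => i _; exact: renewal_measurable.
exists Q; split; last first.
  move=> n s n0 ns; have [m1 <-] := bits_law n s n0 ns.
  apply: ae_eq_probability => //.
    rewrite (_ : [set w | _] = [set w | forall i : 'I_n,
      (exists t, Q t w = i.+1) <-> nth false (binary_form s) i]).
      have sm : sigma_algebra setT (@measurable _ (measurableTypeR R)) by exact: sigma_algebra_measurable.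
      apply: (sigma_forall sm) => i; apply: (sigma_iff sm); last exact: (sigma_const sm).
      by apply: (sigma_exists sm) => t; exact: renewal_measurable.
    have szb : size (binary_form s) = n by case: ns => s0 sn; rewrite size_binary_form.
    apply/seteqP; split=> w /= h.
      move=> i; rewrite -h nth_mkseq//; split; first by move/asboolP.
      by move/asboolP.
    apply: (@eq_from_nth _ false); first by rewrite size_mkseq szb.
    move=> i; rewrite size_mkseq => ni; rewrite nth_mkseq//.
    by apply/asboolP/idP => [/(h (Ordinal ni))|/(h (Ordinal ni))].
  apply: filterS ae_inf => w inf.
  suff /= -> : xi_bits (fun t => Q t) w n = mkseq (fun j => xi j.+1 w) n by [].
  apply: eq_map => j; apply/asboolP/idP; first by move/(renewal_hits xi1 inf (ltn0Sn j)).
  by move/(renewal_hits xi1 inf (ltn0Sn j)).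
(* The ratio of the probabilities of a path and of its extension: by [path_law], everything but the
   last jump from j0 + 1 cancels. *)
pose q i j : R := if i is j0.+1 then
    if (i < j)%N then 'C(j0 + (j - i), j - i)%:R * jump_weight a j0 (j - i) / (j0 + (j - i))%:R / a j0
    else 0 else 0.
pose valid x t := x 0%N = 1%N /\ forall i, (i < t)%N -> (x i < x i.+1)%N.
have path_law x t : valid x t ->
    U [set w | forall i, (i <= t)%N -> Q i w = x i] =
    (a (sumn (gaps x t)) * regen_law a (gaps x t))%:E.
  move=> [x0 xt]; rewrite -delayed_law1.
  have g0 : all (leq 1) (gaps x t) by exact: gaps_pos.
  have gs : sumn (rcons (rev (gaps x t)) 1) = x t.
    by rewrite sumn_rcons sumn_rev addn1 sumn_gaps.
  have [|| m1 U1] := bits_law (x t) (rcons (rev (gaps x t)) 1).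
  - by rewrite -(sumn_gaps x0 xt).
  - by split=> //; rewrite all_rcons/= all_rev.
  rewrite rev_rcons revK in U1; rewrite -U1.
  apply: ae_eq_probability => //; apply: filterS ae_inf => w inf.
  exact: renewal_pathP.
have path_invalid x t : ~ valid x t -> U [set w | forall i, (i <= t)%N -> Q i w = x i] = 0%E.
  move=> nv; rewrite (_ : [set w | _] = set0) ?measure0//.
  apply/seteqP; split=> // w /= h; apply: nv; split; first by rewrite -(h 0%N).
  by move=> i it; rewrite -(h i) ?(ltnW it)// -(h i.+1)//; exact: renewal_lt.
have transition (t : nat) (x : nat -> nat) :
    (U [set w | forall i, (i <= t.+1)%N -> Q i w = x i] =
     U [set w | forall i, (i <= t)%N -> Q i w = x i] * (q (x t) (x t.+1))%:E)%E.
  have [[x0 xt]|nv] := pselect (valid x t); last first.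
    rewrite !path_invalid ?mul0e// => -[x0 h]; apply: nv; split=> // i it.
    by apply: h; exact: ltnW.
  have xtE := sumn_gaps x0 xt.
  have [lt|ge] := ltnP (x t) (x t.+1); last first.
    rewrite path_invalid; last by move=> [_ /(_ t (ltnSn t))]; rewrite ltnNge ge.
    by rewrite /q -xtE xtE ltnNge ge/= mule0.
  rewrite !path_law//; last first.
    by split=> // i; rewrite ltnS leq_eqVlt => /orP[/eqP -> //|]; exact: xt.
  rewrite -EFinM; congr EFin; rewrite /q -xtE xtE lt [gaps x t.+1]/= [sumn (_ :: _)]/= [regen_law a (_ :: _)]/=.
  move: (x t.+1 - x t)%N (subn_gt0 (x t) (x t.+1)) => m; rewrite lt => m0.
  set j := sumn _; rewrite [(m + j)%N]addnC; field.
  have jm0 : j%:R + m%:R != 0 :> R by rewrite -natrD pnatr_eq0 -lt0n addn_gt0 m0 orbT.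
  by rewrite jm0 !gt_eqF.
split; [by []|by move=> t w; exact: renewal_lt|].
exists q => // i i0.
have [rs [rs0 rsi rs_gt0]] := regen_law_positive i.-1.
have [x [x0 xlt gx]] := gaps_path rs0; rewrite rsi prednK// => xrs.
have x_valid : valid x (size rs) by [].
(* A path of positive probability that ends in i. Splitting it by the next state gives the sign and
   the total mass of the row i. *)
pose A := [set w | forall i, (i <= size rs)%N -> Q i w = x i].
have UA : U A = (a i.-1 * regen_law a rs)%:E by rewrite path_law// gx rsi.
pose pr := a i.-1 * regen_law a rs.
have pr0 : 0 < pr by rewrite mulr_gt0.
pose Aj j := A `&` [set w | Q (size rs).+1 w = j].
have mAj j : measurable (Aj j) by apply: measurableI; [exact: mpath|exact: renewal_measurable].
have UAj j : U (Aj j) = (pr * q i j)%:E.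
  pose x' k := if (k <= size rs)%N then x k else j.
  have := transition (size rs) x'.
  rewrite /x' leqnn ltnn xrs EFinM -UA => h; rewrite -[RHS]/(U A * (q i j)%:E)%E.
  have -> : U A = U [set w | forall k, (k <= size rs)%N -> Q k w = (if (k <= size rs)%N then x k else j)].
    by congr (U _); apply/seteqP; split=> w /= hw k krs; have := hw k krs; rewrite krs.
  rewrite -h; congr (U _); apply/seteqP; split=> w /=.
    move=> [hA hj] k; rewrite leq_eqVlt => /orP[/eqP ->|]; first by rewrite ltnn.
    by rewrite ltnS => krs; rewrite krs; exact: hA.
  move=> hw; split=> [k krs|]; last by have := hw _ (leqnn _); rewrite ltnn.
  by have := hw k (leqW krs); rewrite krs.
split=> [j|j ji|].
- have : (0 <= U (Aj j))%E by exact: measure_ge0.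
  by rewrite UAj lee_fin pmulr_rge0.
- by rewrite /q; case: (i) ji => // i' ji; rewrite ltnNge ji.
have : (U (\bigcup_j Aj j) = \sum_(j <oo) U (Aj j))%E.
  apply/esym/cvg_lim => //; apply: measure_sigma_additive => //; apply/trivIsetP => k l _ _ kl.
  by apply/seteqP; split=> // w [[_ /= e1] [_ /= e2]]; rewrite -e1 -e2 eqxx in kl.
have -> : \bigcup_j Aj j = A.
  apply/seteqP; split=> [w [j _ []]//|w Aw].
  by exists (Q (size rs).+1 w).
rewrite (eq_eseriesr (g := fun j => (pr%:E * (q i j)%:E)%E)) => [|j _]; last by rewrite UAj EFinM.
have q_ge0 j : 0 <= q i j.
  have : (0 <= U (Aj j))%E by exact: measure_ge0.
  by rewrite UAj lee_fin pmulr_rge0.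
rewrite nneseriesZl//; last by move=> j _; rewrite lee_fin.
rewrite UA -/pr => h.
have : (pr^-1%:E * pr%:E = pr^-1%:E * (pr%:E * \sum_(j <oo) (q i j)%:E))%E by rewrite -h.
by rewrite muleA -EFinM mulVf ?gt_eqF// mul1e => <-.
Qed.

End markov_chain_of_law.

Lemma regenerative_self_similar_markov (R : realType) (C : nat -> seq nat -> R)
    (d : measure_display) (Om : measurableType d) (P : probability Om R) (Z W : Om -> set R) :
  composition_structure C -> associated_set P C Z -> regenerative_stationary_delay P W ->
  (forall w, Z w = exp_neg (W w)) -> self_similar_markov C.
Proof.
move=> [hC _] [cZ _ _ _ [U [U_unif UZ CU]]] [dr [nu [X [Y [Ysub [mfin c0] XY [X0 Xlaw] WE]]]]] ZE.
pose a k := \int[P]_w expR (- X w) ^+ k.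
have CE n s : (0 < n)%N -> compositions n s -> C n s = delayed_law a (rev s).
  move=> n0 ns; apply: EFin_inj; rewrite CU//.
  exact: (sampling_law Ysub mfin c0 XY X0 Xlaw WE ZE cZ U_unif UZ).
have mf : measurable_fun setT (fun w => expR (- X w)).
  by apply: measurableT_comp => //; apply: measurableT_comp.
have f01 w : 0 < expR (- X w) <= 1 by rewrite expR_gt0 -[leRHS]expR0 ler_expR oppr_le0 X0.
(* The delayed law is nonnegative because it is the law of a composition. *)
have law_ge0 m rs : all (leq 1) (m :: rs) -> 0 <= delayed_law a (m :: rs).
  move=> mrs; have n0 : (0 < sumn (m :: rs))%N by case/andP: mrs => m0 _; rewrite addn_gt0 m0.
  have := hC _ n0 => -[/(_ (rev (m :: rs))) C0 _ _]; move: C0.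
  rewrite CE ?revK//; split; last by rewrite sumn_rev.
  by rewrite all_rev.
have [Q [Qchain Qlaw]] := chain_of_law mf f01 law_ge0.
exists _, (measurableTypeR R), (uniform_prob (@ltr01 R) : probability (measurableTypeR R) R), Q.
by split=> // n s n0 ns; rewrite CE// Qlaw.
Qed.

(** * The Levy measure of a moment sequence *)

Section log_series.
Variable R : realType.

Let log_remainder n : exists F : R -> R, (forall y : R, F y =
    ln y + \sum_(m < n) ((1 - y) ^+ m.+1 / m.+1%:R)) /\
  forall y : R, 0 < y -> is_derive y (1 : R) F (y^-1 - \sum_(m < n) (1 - y) ^+ m).
Proof.
elim: n => [|n [F [FE dF]]].
  exists (@ln R); split=> y; first by rewrite big_ord0 addr0.
  by move=> y0; rewrite big_ord0 subr0; exact: is_derive1_ln.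
exists (F + n.+1%:R^-1 \*: ((cst 1 - id) ^+ n.+1)); split=> y.
  rewrite big_ord_recr addrA -FE /=; congr (_ + _).
  by rewrite [LHS]/(_ *: _) exprfctE [RHS]mulrC.
move=> y0; have h := dF y y0.
have h1 : is_derive y (1 : R) (cst 1 - id : R -> R) (0 - 1) by apply: is_deriveB.
have h2 := is_deriveX n.+1 h1; have h3 := is_deriveZ (n.+1%:R^-1) h2.
apply: (is_derive_eq (is_deriveD h h3)).
rewrite big_ord_recr /= opprD addrA; congr (_ + _).
rewrite /GRing.scale/= sub0r mulrN1 mulrN mulrA mulVf ?pnatr_eq0// mul1r.
by congr (- (_ ^+ _)).
Qed.

(** The function F of [log_remainder] vanishes at 1 and has derivative (1 - y)^n / y; the mean value
    theorem on [x, 1] bounds the remainder by x^-1 (1 - x)^n. *)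
Lemma cvg_log_series (x : R) : 0 < x < 1 ->
  \sum_(m < n) ((1 - x) ^+ m / m.+1%:R) @[n --> \oo] --> - ln x / (1 - x).
Proof.
move=> /andP[x0 x1]; have u0 : 0 < 1 - x by rewrite subr_gt0.
have bound n : - ln x / (1 - x) - x^-1 * (1 - x) ^+ n <=
    \sum_(m < n) ((1 - x) ^+ m / m.+1%:R) <= - ln x / (1 - x).
  have [F [FE dF]] := log_remainder n.
  have [||c /[1!in_itv]/= /andP[xc c1]] := @MVT R F (fun y => y^-1 - \sum_(m < n) (1 - y) ^+ m) x 1 x1.
  - by move=> y; rewrite in_itv/= => /andP[xy _]; apply: dF; exact: lt_trans xy.
  - apply: derivable_within_continuous => y; rewrite in_itv/= => /andP[xy _].
    by apply: ex_derive; apply: dF; exact: lt_le_trans xy.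
  have c0 : 0 < c by exact: lt_trans xc.
  have gs : \sum_(m < n) (1 - c) ^+ m = c^-1 * (1 - (1 - c) ^+ n).
    have := subrX1 (1 - c) n; rewrite (_ : 1 - c - 1 = - c); last by ring.
    move=> e; have -> : 1 - (1 - c) ^+ n = c * \sum_(m < n) (1 - c) ^+ m.
      by rewrite -[LHS]opprB e; ring.
    by rewrite mulKf// gt_eqF.
  rewrite gs !FE ln1 add0r big1 => [|m _]; last by rewrite subrr expr0n mul0r.
  rewrite sub0r.
  have -> : \sum_(m < n) ((1 - x) ^+ m.+1 / m.+1%:R) =
      (1 - x) * \sum_(m < n) ((1 - x) ^+ m / m.+1%:R).
    by rewrite mulr_sumr; apply: eq_bigr => m _; rewrite exprS mulrA.
  set S := \sum_(m < n) _; rewrite (_ : c^-1 - c^-1 * _ = c^-1 * (1 - c) ^+ n); last by ring.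
  move=> e; have SE : - ln x = (1 - x) * (S + c^-1 * (1 - c) ^+ n).
    by rewrite mulrDr [(1 - x) * (c^-1 * _)]mulrC -e; ring.
  rewrite SE [_ * (S + _)]mulrC mulfK ?gt_eqF//.
  have h0 : 0 <= c^-1 * (1 - c) ^+ n.
    by rewrite mulr_ge0 ?invr_ge0 ?(ltW c0)// exprn_ge0// subr_ge0 ltW.
  have h1 : c^-1 * (1 - c) ^+ n <= x^-1 * (1 - x) ^+ n.
    apply: ler_pM; rewrite ?invr_ge0 ?exprn_ge0 ?subr_ge0 ?(ltW c0) ?(ltW c1)//.
      by rewrite lef_pV2// ltW.
    by apply: lerXn2r; rewrite ?nnegrE ?subr_ge0 ?(ltW c1) ?(ltW x1)// lerB// ltW.
  lra.
apply: (squeeze_cvgr (f := fun n => - ln x / (1 - x) - x^-1 * (1 - x) ^+ n)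
  (h := fun=> - ln x / (1 - x))); last exact: cvg_cst.
  by near=> n; exact: bound.
rewrite -[X in _ --> X]subr0; apply: cvgB; first exact: cvg_cst.
rewrite -(mulr0 x^-1); apply: cvgMr; apply: cvg_expr.
by rewrite ger0_norm ?(ltW u0)//; lra.
Unshelve. all: by end_near. Qed.

End log_series.

Section more_differences.
Variable R : realType.
Implicit Types f g : nat -> R.

Lemma diff_succ f m j : diff m.+1 f j = diff m (fun k => f k - f k.+1) j.
Proof. by elim: m j => //= m IH j; rewrite -!IH. Qed.

Lemma diff_shift f m j : diff m (fun k => f k.+1) j = diff m f j.+1.
Proof. by elim: m j => //= m IH j; rewrite !IH. Qed.

Lemma diffB f g m j : diff m (fun k => f k - g k) j = diff m f j - diff m g j.
Proof. by elim: m j => //= m IH j; rewrite !IH; ring. Qed.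

Lemma diff_cst (c : R) m j : 0 <= c -> 0 <= diff m (fun=> c) j.
Proof.
by case: m => //= m _; have -> : diff m (fun=> c) j = diff m (fun=> c) j.+1;
  [rewrite -diff_shift|rewrite subrr].
Qed.

Lemma diff_exp (y : R) m j : diff m (fun k => y ^+ k) j = y ^+ j * (1 - y) ^+ m.
Proof.
by elim: m j => [|m IH] j /=; [rewrite expr0 mulr1|rewrite !IH !exprS; ring].
Qed.

Lemma diff_int d (T : measurableType d) (mu : {finite_measure set T -> \bar R})
    (f : nat -> T -> R) m j : (forall k, bounded_measurable (f k)) ->
  bounded_measurable (fun w => diff m (f ^~ w) j) /\
  diff m (fun k => \int[mu]_w f k w) j = \int[mu]_w diff m (f ^~ w) j.
Proof.
move=> bf; elim: m j => [|m IH] j //=; have [h1 e1] := IH j; have [h2 e2] := IH j.+1.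
by split; [exact: bmfB|rewrite e1 e2 bmf_intB].
Qed.

End more_differences.

Lemma Rintegral_law (R : realType) d1 (T1 : measurableType d1)
    d2 (T2 : measurableType d2) (P1 : probability T1 R) (P2 : probability T2 R)
    (X1 : T1 -> R) (X2 : T2 -> R) (g : R -> R) :
  measurable_fun setT X1 -> measurable_fun setT X2 ->
  measurable_fun setT g -> (forall x, 0 <= g x) ->
  (forall B, measurable B -> P1 (X1 @^-1` B) = P2 (X2 @^-1` B)) ->
  \int[P1]_w g (X1 w) = \int[P2]_w g (X2 w).
Proof.
move=> m1 m2 mg g0 e; rewrite /Rintegral; congr fine.
pose V1 : {RV P1 >-> R} := mfun_Sub (mem_set m1).
pose V2 : {RV P2 >-> R} := mfun_Sub (mem_set m2).
transitivity (\int[distribution P1 V1]_x (g x)%:E)%E.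
  by rewrite ge0_integral_distribution//; exact/measurable_EFinP.
transitivity (\int[distribution P2 V2]_x (g x)%:E)%E.
  by apply: eq_measure_integral => A mA _; exact: e.
by rewrite ge0_integral_distribution//; exact/measurable_EFinP.
Qed.

(** * Drift and jumps read off the variable M *)

Section levy_of_moments.
Context d (Om : measurableType d) (R : realType) (P : probability Om R).
Variables (M : Om -> R) (psi0 : R).
Hypotheses (mM : measurable_fun setT M) (M01 : forall w, 0 <= M w <= 1).
Hypothesis psi0_gt0 : 0 < psi0.
Hypothesis log_moments : \sum_(m < n) (psi0 * \int[P]_w (1 - M w) ^+ m / m.+1%:R)
  @[n --> \oo] --> (1 : R).

Let bM : bounded_measurable M. Proof. exact: bmf01. Qed.

Let D : set R := `]0, +oo[%classic.

Let mlevel (B : set R) : measurable B -> measurable [set w | B (M w)].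
Proof. by move=> mB; rewrite -[X in measurable X]setTI; exact: mM. Qed.

Let inner := [set w | (`]0, 1[%classic : set R) (M w)].

Let minner : measurable inner. Proof. by apply: mlevel; exact: measurable_itv. Qed.

Let innerE w : inner w <-> 0 < M w < 1.
Proof. by rewrite /inner /= in_itv. Qed.

(** Phi(k) = psi0 E (1 + M + ... + M^(k-1)) = E psi0 (1 - M^k) / (1 - M). So the jumps are - ln M,
    weighted by [jump_density], and the event M = 1, where the ratio is psi0 k, gives the drift. *)
Definition jump_size w : measurableTypeR R := - ln (M w).

Let mL : measurable_fun setT jump_size.
Proof.
by apply: measurableT_comp => //; apply: measurableT_comp => //; exact: measurable_ln.
Qed.

Let L_ge0 w : 0 <= jump_size w.
Proof. by rewrite oppr_ge0 ln_le0//; case/andP: (M01 w). Qed.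

Let D_L w : D (jump_size w) <-> inner w.
Proof.
rewrite innerE /D /= in_itv/= andbT /jump_size oppr_gt0; have /andP[h0 h1] := M01 w.
split=> [l0|m01]; last exact: ln_lt0.
have m0 : 0 < M w.
  by rewrite lt0r h0 andbT; apply/eqP => e; rewrite e ln0// ltxx in l0.
rewrite m0 lt_neqAle h1 andbT; apply/eqP => e; by rewrite e ln1 ltxx in l0.
Qed.

(* [psi0 / (1 - M)] where [0 < M < 1], and 0 elsewhere. *)
Definition jump_density w : R := \1_inner w * (psi0 * expR (- ln (1 - M w))).

Let mg : measurable_fun setT jump_density.
Proof.
apply: measurable_funM; first exact: measurable_indic.
apply: measurable_funM => //; apply: measurableT_comp => //.
apply: measurableT_comp => //; apply: measurableT_comp; first exact: measurable_ln.
exact: measurable_funB.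
Qed.

Let g0 w : 0 <= jump_density w.
Proof. by rewrite mulr_ge0 ?mulr_ge0 ?expR_ge0 ?(ltW psi0_gt0)// indicE. Qed.

Let gE w : inner w -> jump_density w = psi0 / (1 - M w).
Proof.
move=> iw; rewrite /jump_density indicE mem_set// mul1r expRN lnK// posrE subr_gt0.
by move/innerE : iw => /andP[].
Qed.

Let g_out w : ~ inner w -> jump_density w = 0.
Proof. by move=> iw; rewrite /jump_density indicE memNset// mul0r. Qed.

Let dens := density_measure P mg g0.

Definition jump_measure (A : set (measurableTypeR R)) : \bar R := dens (jump_size @^-1` A).

Let jm0 : jump_measure set0 = 0%E.
Proof. by rewrite /jump_measure preimage_set0 /dens measure0. Qed.

Let jm_ge0 A : (0 <= jump_measure A)%E.
Proof. exact: measure_ge0. Qed.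

Let mpre A : measurable A -> measurable (jump_size @^-1` A).
Proof. by move=> mA; rewrite -[X in measurable X]setTI; exact: mL. Qed.

Let jm_sigma : semi_sigma_additive jump_measure.
Proof.
move=> F mF tF mUF; rewrite /jump_measure preimage_bigcup.
apply: measure_semi_sigma_additive.
- by move=> n; exact: mpre.
- apply/trivIsetP => /= i j _ _ ij; rewrite -preimage_setI.
  by move/trivIsetP : tF => /(_ _ _ _ _ ij) ->//; rewrite preimage_set0.
- by rewrite -preimage_bigcup; exact: mpre.
Qed.

HB.instance Definition _ := isMeasure.Build _ _ _ jump_measure jm0 jm_ge0 jm_sigma.

Let nu : {measure set (measurableTypeR R) -> \bar R} := jump_measure.

Let mD : measurable (D : set (measurableTypeR R)). Proof. exact: measurable_itv. Qed.

Let integral_jump (h : R -> \bar R) : measurable_fun setT h -> (forall y, 0 <= h y)%E ->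
  (\int[nu]_(y in D) h y = \int[P]_w (h (jump_size w) * (jump_density w)%:E))%E.
Proof.
move=> mh h0; rewrite integral_mkcond.
have mhD : measurable_fun setT (h \_ D).
  by apply/(measurable_restrictT _ _).1 => //; exact: measurable_funTS.
have hD0 y : (0 <= (h \_ D) y)%E by rewrite patchE; case: ifP.
transitivity (\int[dens]_w (h \_ D) (jump_size w))%E.
  have := @ge0_integral_pushforward _ _ _ _ _ _ mL dens setT (h \_ D) measurableT mhD.
  by rewrite preimage_setT => <-.
rewrite ge0_integral_density//; last exact: measurableT_comp mhD mL.
apply: eq_integral => w _; rewrite patchE; case: ifPn => // /negP wD.
by rewrite g_out ?mule0// => /D_L /mem_set.
Qed.

Let A1 := [set w | ([set 1] : set R) (M w)].
Let mA1 : measurable A1. Proof. exact: mlevel. Qed.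
Let A0 := [set w | ([set 0] : set R) (M w)].
Let mA0 : measurable A0. Proof. exact: mlevel. Qed.

Definition jump_drift : R := psi0 * fine (P A1).

Let bpow n : bounded_measurable (fun w => (1 - M w) ^+ n).
Proof. by apply: bmfX; apply: bmfB => //; exact: bmf_cst. Qed.

Let term_ge0 w m : 0 <= (1 - M w) ^+ m / m.+1%:R.
Proof. by rewrite divr_ge0// exprn_ge0// subr_ge0; case/andP: (M01 w). Qed.

Let partial n w := \sum_(m < n) ((1 - M w) ^+ m / m.+1%:R).

Let partial_nd w : nondecreasing_seq (partial ^~ w).
Proof. by apply/nondecreasing_seqP => n; rewrite /partial big_ord_recr lerDl. Qed.

Let bpartial n : bounded_measurable (partial n).
Proof.
apply: bmf_sum => m; under eq_fun do rewrite mulrC.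
exact: bmfZ.
Qed.

Let int_partial n : \int[P]_w (psi0 * partial n w) =
  \sum_(m < n) (psi0 * \int[P]_w (1 - M w) ^+ m / m.+1%:R).
Proof.
rewrite bmf_intZ// bmf_int_sum => [|m]; last first.
  by under eq_fun do rewrite mulrC; exact: bmfZ.
rewrite mulr_sumr; apply: eq_bigr => m _.
under [in LHS]eq_Rintegral do rewrite mulrC.
by rewrite bmf_intZ// mulrCA mulrC.
Qed.

Let int_partial_le n : \int[P]_w (psi0 * partial n w) <= 1.
Proof.
have -> : (1 : R) = lim (\int[P]_w (psi0 * partial n w) @[n --> \oo]).
  apply/esym/cvg_lim => //; under eq_fun do rewrite int_partial; exact: log_moments.
apply: nondecreasing_cvgn_le; last first.
  by apply/cvg_ex; exists 1; under eq_fun do rewrite int_partial; exact: log_moments.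
apply/nondecreasing_seqP => k; apply: bmf_int_le; [exact: bmfZ|exact: bmfZ|move=> w].
by apply: ler_wpM2l; [exact: ltW|apply: partial_nd].
Qed.

(** An atom of M at 0 would be an infinite jump; its contribution psi0 P(M = 0) / (m + 1) alone
    would make the logarithmic moments diverge like the harmonic series. *)
Let A0_null : P A0 = 0%E.
Proof.
apply/eqP; rewrite eq_le measure_ge0 andbT leNgt; apply/negP => p0.
have fp : P A0 \is a fin_num by exact: fin_num_measure.
have p0' : 0 < psi0 * fine (P A0) by rewrite mulr_gt0// fine_gt0// p0 ltey_eq fp.
have hb n : series harmonic n <= (psi0 * fine (P A0))^-1.
  rewrite -[leRHS]div1r ler_pdivlMr// mulrC -mulrA -(bmf_int_indic P mA0).
  apply: le_trans (int_partial_le n); rewrite bmf_intZ// ler_pM2l//.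
  rewrite mulrC -bmf_intZ; last exact: bmf_indic.
  apply: bmf_int_le => // [|w]; first by apply: bmfZ; exact: bmf_indic.
  rewrite indicE; case: (boolP (w \in A0)) => [/set_mem wA|_]; last first.
    by rewrite mulr0 sumr_ge0// => m _; exact: term_ge0.
  rewrite mulr1 /series/= /partial big_mkord le_eqVlt (_ : M w = 0)//; apply/orP; left.
  by apply/eqP; apply: eq_bigr => m _; rewrite subr0 expr1n div1r.
apply: (@dvg_harmonic R); apply: nondecreasing_is_cvgn.
  by apply/nondecreasing_seqP => n; rewrite /series/= big_nat_recr//= lerDl invr_ge0.
by exists (psi0 * fine (P A0))^-1 => _ [n _ <-].
Qed.

(** Monotone convergence in [log_moments]: the partial sums increase to psi0 (- ln M) / (1 - M), the
    jump size times its density, where 0 < M < 1, and stay equal to psi0 from the first term on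
    where M = 1. *)
Let mean_drift : (levy_mean nu + (jump_drift)%:E = 1)%E.
Proof.
pose f w := jump_size w * jump_density w + psi0 * \1_A1 w.
(* The indicator removes the null event M = 0, where the partial sums diverge. *)
pose gg n w := (\1_(~` A0) w * (psi0 * partial n w))%:E.
have bgg n : bounded_measurable (fun w => \1_(~` A0) w * (psi0 * partial n w)).
  by apply: bmfM; [apply: bmf_indic; exact: measurableC|exact: bmfZ].
have gg_cvg w : gg n w @[n --> \oo] --> (f w)%:E.
  apply: EFin_cvg; rewrite /f; have /andP[h0 h1] := M01 w.
  have [e0|n0] := eqVneq (M w) 0.
    rewrite g_out; last by rewrite innerE e0 ltxx.
    rewrite mulr0 add0r [\1_A1 w]indicE memNset ?mulr0; last first.
      by rewrite /A1/= e0 => /esym/eqP; rewrite oner_eq0.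
    under eq_fun do rewrite indicE memNset ?mul0r//.
    exact: cvg_cst.
  have -> : (fun n => \1_(~` A0) w * (psi0 * partial n w)) = (fun n => psi0 * partial n w).
    by apply/funext => n; rewrite indicE mem_set ?mul1r//; exact/eqP.
  have [e1|n1] := eqVneq (M w) 1.
    rewrite g_out ?mulr0 ?add0r; last by rewrite innerE e1 ltxx andbF.
    rewrite indicE mem_set//; apply: cvgMr; rewrite /partial e1.
    have part1 n : (0 < n)%N -> \sum_(m < n) ((1 - 1) ^+ m / m.+1%:R) = 1 :> R.
      case: n => // n _; rewrite big_ord_recl big1 => [|m _].
        by rewrite expr0 divr1 addr0.
      by rewrite subrr expr0n mul0r.
    apply: cvg_near_cst; near=> n; rewrite part1//; near: n.
    exact: nbhs_infty_gt.
  have iw : inner w by rewrite innerE lt0r n0 h0 lt_neqAle n1 h1.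
  rewrite gE// indicE memNset ?mulr0 ?addr0; last by move=> /= e; rewrite e eqxx in n1.
  rewrite mulrCA; apply: cvgMr; apply: cvg_log_series; exact/innerE.
have ggn n : (\int[P]_w gg n w = (\int[P]_w (psi0 * partial n w))%:E)%E.
  rewrite bmf_integralE//; congr EFin; apply: bmf_int_ae => //; first exact: bmfZ.
  exists A0; split=> // w /=; apply: contra_notP => wA.
  by rewrite indicE mem_set ?mul1r.
have := @cvg_monotone_convergence _ _ _ P setT measurableT gg.
move=> /(_ (fun n => (measurable_EFinP _ _).2 (bgg n).1)).
have gg0 n w : setT w -> (0 <= gg n w)%E.
  move=> _; rewrite lee_fin mulr_ge0// ?indicE// mulr_ge0 ?(ltW psi0_gt0)//.
  by rewrite sumr_ge0// => m _; exact: term_ge0.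
move=> /(_ gg0); have gg_nd w : setT w -> nondecreasing_seq (gg ^~ w).
  move=> _ n m nm; rewrite lee_fin ler_wpM2l// ?indicE// ler_wpM2l ?(ltW psi0_gt0)//.
  exact: partial_nd.
move=> /(_ gg_nd); rewrite (_ : (fun n => _) = (fun n => (\int[P]_w (psi0 * partial n w))%:E)); last first.
  by apply/funext => n; exact: ggn.
have -> : (\int[P]_w (limn (gg ^~ w)) = \int[P]_w (f w)%:E)%E.
  by apply: eq_integral => w _; apply/cvg_lim.
move=> /eseq_cvg_unique /(_ (EFin_cvg _)) h.
rewrite -(h 1); last by under eq_fun do rewrite int_partial.
rewrite /f; under eq_integral do rewrite EFinD.
rewrite ge0_integralD//; last 4 first.
- by move=> w _; rewrite lee_fin mulr_ge0.
- by apply/measurable_EFinP; apply: measurable_funM.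
- by move=> w _; rewrite lee_fin mulr_ge0 ?(ltW psi0_gt0)// indicE.
- by apply/measurable_EFinP; apply: measurable_funM => //; exact: measurable_indic.
congr (_ + _)%E; last first.
  by rewrite bmf_integralE ?bmf_intZ ?bmf_int_indic//; [exact: bmf_indic|apply: bmfZ; exact: bmf_indic].
rewrite /levy_mean (_ : (\int[nu]_(y in _) _ = \int[nu]_(y in D) (Num.max 0 y)%:E)%E); last first.
  by apply: eq_integral => y; rewrite inE /D /= in_itv/= andbT => y0; rewrite max_r// ltW.
rewrite integral_jump.
- by apply: eq_integral => w _; rewrite max_r.
- by apply/measurable_EFinP; exact: measurable_maxr.
- by move=> y; rewrite lee_fin le_max lexx.
Unshelve. all: by end_near. Qed.

(* The Laplace exponent at [l] is the mean of psi0 (1 - M^l) / (1 - M), to be read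
   as psi0 l where M = 1. *)
Definition jump_kernel l w : R := (1 - expR (l * ln (M w))) * jump_density w +
  psi0 * l * \1_A1 w.

Let bern (x : R) n : 0 <= x <= 1 -> 1 - x ^+ n <= n%:R * (1 - x).
Proof.
move=> /andP[x0 x1]; have := @bernoulli_ineq R (x - 1) n.
rewrite lerBrDl addrN => /(_ x0); rewrite (_ : 1 + (x - 1) = x); last by ring.
lra.
Qed.

(** With N an integer above l, Bernoulli's inequality gives 1 - M^l <= 1 - M^N <= N (1 - M), which
    compensates the density. *)
Let kernel_bound l w : 0 <= l ->
  0 <= (1 - expR (l * ln (M w))) * jump_density w <= psi0 * (Num.truncn l).+1%:R.
Proof.
move=> l0; have l1 : expR (l * ln (M w)) <= 1.
  by rewrite -[leRHS]expR0 ler_expR mulr_ge0_le0// ln_le0//; case/andP: (M01 w).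
rewrite mulr_ge0 ?subr_ge0//=.
have [iw|/g_out ->] := pselect (inner w); last first.
  by rewrite mulr0 mulr_ge0// ltW.
have /innerE/andP[m0 m1] := iw; rewrite gE//.
rewrite mulrC -mulrA ler_pM2l// mulrC ler_pdivrMr ?subr_gt0//.
apply: le_trans (bern _ (M01 w)).
rewrite lerB// -[X in X ^+ _](lnK (x := M w)) ?posrE// -expRM_natl ler_expR.
by apply: ler_wnM2r; [rewrite ln_le0// ltW|rewrite ltW// truncnS_gt].
Qed.

Let bker l : 0 <= l -> bounded_measurable (fun w => (1 - expR (l * ln (M w))) * jump_density w).
Proof.
move=> l0; split; last first.
  exists (psi0 * (Num.truncn l).+1%:R) => w.
  by have /andP[h0 h1] := kernel_bound w l0; rewrite ger0_norm.
apply: measurable_funM => //; apply: measurable_funB => //; apply: measurableT_comp => //.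
by apply: measurable_funM => //; apply: measurableT_comp => //; exact: measurable_ln.
Qed.

Let bkernel l : 0 <= l -> bounded_measurable (jump_kernel l).
Proof. by move=> l0; apply: bmfD; [exact: bker|apply: bmfZ; exact: bmf_indic]. Qed.

Let laplaceE l : 0 <= l -> laplace_exponent jump_drift nu l = \int[P]_w jump_kernel l w.
Proof.
move=> l0; rewrite /jump_kernel bmf_intD; [|exact: bker|by apply: bmfZ; exact: bmf_indic].
rewrite bmf_intZ ?bmf_int_indic//; last exact: bmf_indic.
rewrite /laplace_exponent addrC; congr (_ + _); last by rewrite /jump_drift; ring.
rewrite /Rintegral; congr fine.
transitivity (\int[nu]_(y in D) (1 - expR (- (l * Num.max 0 y)))%:E)%E.
  by apply: eq_integral => y; rewrite inE /D /= in_itv/= andbT => y0; rewrite max_r// ltW.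
rewrite integral_jump.
- by apply: eq_integral => w _; rewrite max_r// -EFinM /jump_size mulrN opprK.
- apply/measurable_EFinP; apply: measurable_funB => //; apply: measurableT_comp => //.
  by apply: measurableT_comp => //; apply: measurable_funM => //; exact: measurable_maxr.
- move=> y; rewrite lee_fin subr_ge0 -[leRHS]expR0 ler_expR oppr_le0 mulr_ge0//.
  by rewrite le_max lexx.
Qed.

Let laplace_nat k : laplace_exponent jump_drift nu k%:R =
  \sum_(i < k) (psi0 * \int[P]_w M w ^+ i).
Proof.
rewrite laplaceE//.
have -> : \sum_(i < k) (psi0 * \int[P]_w M w ^+ i) =
    \int[P]_w (\sum_(i < k) (psi0 * M w ^+ i)).
  by rewrite bmf_int_sum => [|i]; [apply: eq_bigr => i _; rewrite bmf_intZ//; exact: bmfX|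
    apply: bmfZ; exact: bmfX].
apply: bmf_int_ae; [exact: bkernel|by apply: bmf_sum => i; apply: bmfZ; exact: bmfX|].
exists A0; split=> // w /=; apply: contra_notP => wA; have /andP[h0 h1] := M01 w.
have m0 : 0 < M w by rewrite lt0r h0 andbT; apply/eqP.
rewrite /jump_kernel expRM_natl lnK//; have [iw|niw] := pselect (inner w).
  rewrite gE// indicE memNset ?mulr0 ?addr0; last first.
    by move=> /= e; move: iw => /innerE; rewrite e ltxx andbF.
  have u0 : 1 - M w != 0 by rewrite gt_eqF// subr_gt0; move/innerE : iw => /andP[].
  rewrite -mulr_sumr mulrC -mulrA; congr (_ * _); apply: (canLR (mulKf u0)).
  by have := subrX1 (M w) k => e; rewrite -[LHS]opprB e; ring.
rewrite g_out// mulr0 add0r; have e1 : M w = 1.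
  by apply/eqP; rewrite eq_le h1 leNgt; apply/negP => m1; apply: niw; apply/innerE; rewrite m0.
rewrite indicE mem_set// mulr1 e1; under eq_bigr do rewrite expr1n mulr1.
by rewrite sumr_const card_ord mulr_natr.
Qed.

(** Under the integral and with y = M^r, the first difference in k is minus a nonnegative multiple
    of y^k, minus a nonnegative constant; the further differences of both are nonnegative. *)
Let laplace_alternating r m j : 0 <= r ->
  diff m.+1 (fun k => laplace_exponent jump_drift nu (k%:R * r)) j <= 0.
Proof.
move=> r0; have kr k : 0 <= k%:R * r :> R by rewrite mulr_ge0.
rewrite (eq_diff _ _ (fun k => laplaceE (kr k))).
have [_ ->] := diff_int P m.+1 j (fun k => bkernel (kr k)).
rewrite -oppr_ge0 -mulN1r -bmf_intZ; last by case: (diff_int P m.+1 j (fun k => bkernel (kr k))).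
apply: Rintegral_ge0 => w _; rewrite mulN1r oppr_ge0 diff_succ.
set y := expR (r * ln (M w)); have y01 : 0 <= y <= 1.
  rewrite expR_ge0 -[leRHS]expR0 ler_expR mulr_ge0_le0// ln_le0//.
  by case/andP: (M01 w).
rewrite (@eq_diff _ _ (fun k => - jump_density w * (1 - y) * y ^+ k - psi0 * r * \1_A1 w)).
  rewrite (diffB (fun k => - jump_density w * (1 - y) * y ^+ k) (fun=> psi0 * r * \1_A1 w)).
  rewrite (diffZ _ (fun k => y ^+ k)) (diff_exp y) subr_le0; apply: (@le_trans _ _ 0); last first.
    by apply: diff_cst; rewrite mulr_ge0 ?mulr_ge0 ?(ltW psi0_gt0)// indicE.
  have /andP[y0 y1] := y01; rewrite 2!mulNr oppr_le0.
  by apply: mulr_ge0; apply: mulr_ge0; rewrite ?exprn_ge0 ?subr_ge0.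
move=> k; rewrite /jump_kernel -!mulrA !expRM_natl -/y exprS -natr1; ring.
Qed.

Let cvg_laplace (l_ : nat -> R) l B : (forall n, 0 <= l_ n <= B) -> l_ n @[n --> \oo] --> l ->
  laplace_exponent jump_drift nu (l_ n) @[n --> \oo] --> laplace_exponent jump_drift nu l.
Proof.
move=> l_B cl; have l_0 n : 0 <= l_ n by case/andP: (l_B n).
have l0 : 0 <= l by apply: (seq_cvg_ge cl).
rewrite laplaceE//; under eq_fun do rewrite laplaceE//.
apply: (@bmf_int_cvg _ _ _ P (fun n => jump_kernel (l_ n)) _ (psi0 * (Num.truncn B).+1%:R + psi0 * B)).
- by move=> n; case: (bkernel (l_0 n)).
- by case: (bkernel l0).
- move=> n w; have /andP[_ lB] := l_B n; have /andP[k0 k1] := kernel_bound w (l_0 n).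
  have i01 : 0 <= (\1_A1 w : R) <= 1 by rewrite indicE; case: (_ \in _); rewrite /= ?lexx ?ler01.
  have /andP[i0 i1] := i01.
  have p1 : 0 <= psi0 * l_ n * \1_A1 w by rewrite mulr_ge0 ?mulr_ge0 ?(ltW psi0_gt0).
  rewrite ger0_norm ?addr_ge0// lerD//.
    apply: (le_trans k1); rewrite ler_pM2l// ler_nat ltnS.
    by rewrite le_truncn.
  by rewrite -mulrA ler_pM2l// -[leRHS]mulr1 ler_pM.
- apply: aeW => w; rewrite /jump_kernel; apply: cvgD.
    apply: cvgMl; apply: cvgB; first exact: cvg_cst.
    by apply: continuous_cvg; [exact: continuous_expR|exact: cvgMl].
  by apply: cvgMl; exact: cvgMr.
Qed.

Let laplace0 : laplace_exponent jump_drift nu 0 = 0.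
Proof.
rewrite laplaceE// /jump_kernel (_ : (fun w => _) = fun=> 0).
  by rewrite Rintegral_cst// mul0r.
by apply/funext => w; rewrite mul0r expR0 subrr mul0r mulr0 mul0r addr0.
Qed.

Lemma levy_of_moments : exists (dr : R) (nu : {measure set (measurableTypeR R) -> \bar R}),
  [/\ 0 <= dr, levy_measure nu, (levy_mean nu < +oo)%E,
      dr + fine (levy_mean nu) = 1 &
      [/\ (forall k, laplace_exponent dr nu k%:R = \sum_(i < k) (psi0 * \int[P]_w M w ^+ i)),
      (forall r m j, 0 <= r -> diff m.+1 (fun k => laplace_exponent dr nu (k%:R * r)) j <= 0),
      (forall (l_ : nat -> R) l B, (forall n, 0 <= l_ n <= B) -> l_ n @[n --> \oo] --> l ->
        laplace_exponent dr nu (l_ n) @[n --> \oo] --> laplace_exponent dr nu l) &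
      laplace_exponent dr nu 0 = 0]].
Proof.
have mean_ge0 : (0 <= levy_mean nu)%E.
  by apply: integral_ge0 => y; rewrite /= in_itv/= andbT lee_fin => /ltW.
have mean_fin : (levy_mean nu < +oo)%E.
  have : (levy_mean nu + jump_drift%:E < +oo)%E by rewrite mean_drift ltry.
  apply: le_lt_trans.
  by rewrite leeDl// lee_fin mulr_ge0 ?(ltW psi0_gt0)// fine_ge0.
exists jump_drift, nu; split=> //.
- by rewrite mulr_ge0 ?(ltW psi0_gt0)// fine_ge0.
- split.
    rewrite -[LHS]/(\int[P]_(w in jump_size @^-1` `]-oo, 0%R]%classic) (jump_density w)%:E)%E.
    rewrite integral0_eq// => w /=; rewrite in_itv/= => L0; rewrite g_out// => /D_L.
    by rewrite /D /= in_itv/= andbT ltNge L0.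
  apply: le_lt_trans mean_fin; apply: ge0_le_integral => //.
  - by move=> y; rewrite /= in_itv/= andbT lee_fin le_min ler01 => /ltW.
  - by apply/measurable_EFinP; apply: measurable_funTS; exact: measurable_minr.
  - by move=> y _; rewrite lee_fin ge_min lexx orbT.
- have := mean_drift; rewrite -(@fineK _ (levy_mean nu)) ?ge0_fin_numE//.
  by rewrite -EFinD addrC => -[].
Qed.

End levy_of_moments.

Section rational_approximation.
Variable R : realType.
Implicit Types (r s : R) (n : nat).

Definition frac (p : nat * nat) : R := p.1%:R / p.2.+1%:R.

Lemma frac_ge0 p : 0 <= frac p. Proof. exact: divr_ge0. Qed.

(** Strictly above r and within 1 / (n + 1) of it, and monotone in r: approximation from the right
    suits right limits. *)
Definition upper n r : nat * nat := ((Num.truncn (r * n.+1%:R)).+1, n).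

Lemma upper_gt n r : 0 <= r -> r < frac (upper n r).
Proof. by move=> r0; rewrite /frac/= ltr_pdivlMr// truncnS_gt. Qed.

Lemma upper_le n r : 0 <= r -> frac (upper n r) <= r + n.+1%:R^-1.
Proof.
move=> r0; rewrite /frac/= ler_pdivrMr// mulrDl mulVf// -natr1 lerD2r.
by rewrite truncn_le// mulr_ge0.
Qed.

Lemma le_upper n r s : r <= s -> frac (upper n r) <= frac (upper n s).
Proof. by move=> rs; rewrite /frac/= ler_pM2r ?invr_gt0// ler_nat ltnS le_truncn// ler_pM2r. Qed.

Lemma cvg_upper r : 0 <= r -> frac (upper n r) @[n --> \oo] --> r.
Proof.
move=> r0; apply: (squeeze_cvgr (f := fun=> r) (h := fun n => r + n.+1%:R^-1)).
- by near=> n; rewrite ltW ?upper_gt//= upper_le.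
- exact: cvg_cst.
- by rewrite -[X in _ --> X]addr0; apply: cvgD; [exact: cvg_cst|exact: cvg_harmonic].
Unshelve. all: by end_near. Qed.

End rational_approximation.

Lemma iter_diff_size (R : realType) (I : eqType) (f : nat -> R) (B A : seq I) :
  iter_diff B (fun s => f (size s)) A = diff (size B) f (size A).
Proof. by elim: B f => //= i B IH f; rewrite (IH (fun k => f k - f k.+1)) -diff_succ. Qed.

(** * From integer moments to real exponents *)

Section laplace_extension.
Variables (R : realType) (phi : R -> R).
Hypothesis phi0 : phi 0 = 0.
Hypothesis phi_alternating : forall r m j, 0 <= r ->
  diff m.+1 (fun k => phi (k%:R * r)) j <= 0.
Hypothesis cvg_phi : forall (l_ : nat -> R) l B, (forall n, 0 <= l_ n <= B) ->
  l_ n @[n --> \oo] --> l -> phi (l_ n) @[n --> \oo] --> phi l.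
Context d (Om : measurableType d) (P : probability Om R).
Variables (x : Om -> R) (t : R).
Hypotheses (mx : measurable_fun setT x) (x01 : forall w, 0 <= x w <= 1) (t0 : 0 <= t).
Hypothesis x_moments : forall k, \int[P]_w x w ^+ k = expR (- (t * phi k%:R)).

Local Notation U := (uniform_prob (@ltr01 R) : probability (measurableTypeR R) R).

(* [u] to the power [l]; the indicator is needed because [ln 0 = 0]. *)
Definition pow_pos (l u : R) : R := \1_(`]0, +oo[%classic : set R) u * expR (l * ln u).

Let pow_pos0 l : pow_pos l 0 = 0.
Proof. by rewrite /pow_pos indicE memNset ?mul0r// /= in_itv/= ltxx. Qed.

Let pow_posE l u : 0 < u -> pow_pos l u = expR (l * ln u).
Proof. by move=> u0; rewrite /pow_pos indicE mem_set ?mul1r//= in_itv/= u0. Qed.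

Let mpow l : measurable_fun setT (pow_pos l).
Proof.
have mpos : measurable (`]0, +oo[%classic : set R) by exact: measurable_itv.
apply: measurable_funM; first exact: measurable_indic.
apply: measurableT_comp => //.
exact: measurable_funM.
Qed.

Let pow_ge0 l u : 0 <= pow_pos l u.
Proof. by rewrite mulr_ge0 ?expR_ge0// indicE. Qed.

Let pow_le1 l u : 0 <= l -> u <= 1 -> pow_pos l u <= 1.
Proof.
move=> l0 u1; rewrite -[leRHS]mulr1 ler_pM ?expR_ge0 ?indicE//.
  by case: (_ \in _).
by rewrite -[leRHS]expR0 ler_expR mulr_ge0_le0// ln_le0.
Qed.

(** For r = 1 / n this plays the part of an n-th root of x: its n-th power has the moments of x,
    hence its law. Thus rational powers of x have the expected means. *)
Lemma scaled_moment_problem r : 0 <= r -> exists z : measurableTypeR R -> R,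
  [/\ measurable_fun setT z, (forall w, 0 <= z w <= 1) &
    forall k, \int[U]_w z w ^+ k = expR (- (t * phi (k%:R * r)))].
Proof.
move=> r0; pose Psi (s : seq unit) := t * phi ((size s)%:R * r).
have [||M [mM [M01 Mk]]] := @moment_problem R unit (fun s => expR (- Psi s)).
- apply: positive_table_exp; first by move=> s s' /perm_size; rewrite /Psi => ->.
  move=> i B A; rewrite (iter_diff_size (fun k => t * phi (k%:R * r))) diffZ.
  by rewrite mulr_ge0_le0//; exact: phi_alternating.
- by rewrite /Psi/= mul0r phi0 mulr0 oppr0 expR0.
exists (M tt); split=> // k; have := Mk (nseq k tt); rewrite /Psi size_nseq => <-.
congr Rintegral; apply/funext => w.
by elim: k => [|k IH]; rewrite ?big_nil// /= big_cons -IH exprS.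
Qed.

Let bx : bounded_measurable x. Proof. exact: bmf01. Qed.

Let bpowx l : 0 <= l -> bounded_measurable (fun w => pow_pos l (x w)).
Proof.
move=> l0; apply: bmf01; first exact: measurableT_comp (mpow l) mx.
by move=> w; rewrite pow_ge0 pow_le1//; case/andP: (x01 w).
Qed.

Let rational_moment p : (0 < p.1)%N ->
  \int[P]_w pow_pos (frac R p) (x w) = expR (- (t * phi (frac R p))).
Proof.
case: p => p r /= p0; rewrite /frac/=.
have r0 : 0 <= r.+1%:R^-1 :> R by rewrite invr_ge0.
have [z [mz z01 zk]] := scaled_moment_problem r0.
have z01' w : 0 <= z w ^+ r.+1 <= 1.
  have /andP[h0 h1] := z01 w; by rewrite exprn_ge0//= exprn_ile1.
have mzr : measurable_fun setT (fun w => z w ^+ r.+1) by exact: measurable_funX.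
rewrite (@Rintegral_law R _ _ _ _ P U x (fun w => z w ^+ r.+1) _ mx mzr (mpow _) (@pow_ge0 _)).
  rewrite -zk; congr Rintegral; apply/funext => w; have /andP[h0 h1] := z01 w.
  have [e|zn] := eqVneq (z w) 0.
    by rewrite e !expr0n pow_pos0 eqn0Ngt p0.
  have zp : 0 < z w by rewrite lt0r zn h0.
  rewrite pow_posE ?exprn_gt0// lnXn// -[ln _ *+ _]mulr_natl mulrA divfK ?pnatr_eq0//.
  by rewrite expRM_natl lnK.
apply: moments_distribution => // k; rewrite x_moments.
rewrite (_ : (fun w => _) = (fun w => z w ^+ (r.+1 * k))); last by apply/funext => w; rewrite exprM.
by rewrite zk natrM mulrAC mulfV ?pnatr_eq0// mul1r.
Qed.

Let x0 := [set w | ([set 0] : set R) (x w)].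

Let mx0 : measurable x0.
Proof. by rewrite -[X in measurable X]setTI; exact: mx. Qed.

(** The moment of order 1 / (n + 1) is at most 1 - P(x = 0), and it tends to exp(- t phi(0)) = 1. *)
Lemma moments_positive : P x0 = 0%E.
Proof.
have le n : expR (- (t * phi (frac R (1%N, n)))) <= 1 - fine (P x0).
  rewrite -rational_moment// -(bmf_int_indic P mx0) -[X in _ <= X - _](_ : \int[P]_w (cst 1 w) = 1); last first.
    by rewrite Rintegral_cst// mul1r; exact: (congr1 fine (probability_setT P)).
  rewrite -bmf_intB; [|exact: bmf_cst|exact: bmf_indic].
  apply: bmf_int_le; first by apply: bpowx; exact: frac_ge0.
    by apply: bmfB; [exact: bmf_cst|exact: bmf_indic].
  move=> w /=; rewrite indicE; case: (boolP (w \in x0)) => [/set_mem xw|_].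
    by rewrite (_ : x w = 0)// pow_pos0 subrr.
  by rewrite subr0 pow_le1 ?frac_ge0//; case/andP: (x01 w).
have c1 : expR (- (t * phi (frac R (1%N, n)))) @[n --> \oo] --> (1 : R).
  rewrite -expR0 -oppr0 -(mulr0 t) -phi0; apply: continuous_cvg; first exact: continuous_expR.
  apply: cvgN; apply: cvgMr; apply: (@cvg_phi _ _ 1) => [n|].
    by rewrite frac_ge0 /frac/= ler_pdivrMr// mul1r ler_nat.
  rewrite /frac/=; under eq_fun do rewrite mul1r; exact: cvg_harmonic.
have h1 : 1 <= 1 - fine (P x0) := seq_cvg_le c1 le.
have h : fine (P x0) <= 0 by lra.
apply/eqP; rewrite eq_le measure_ge0 andbT -(@fineK _ (P x0)) ?lee_fin//.
exact: fin_num_measure.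
Qed.

(** Rational exponents tending to l, and dominated convergence; where x > 0, [expR (l * ln x)] is
    the power. *)
Lemma moments_laplace l : 0 <= l ->
  \int[P]_w expR (l * ln (x w)) = expR (- (t * phi l)).
Proof.
rewrite le_eqVlt => /predU1P[<-|l0].
  rewrite phi0 mulr0 oppr0 expR0 (_ : (fun w => _) = cst 1).
    by rewrite Rintegral_cst// mul1r; exact: (congr1 fine (probability_setT P)).
  by apply/funext => w; rewrite mul0r expR0.
have lw := ltW l0; pose l_ n := frac R (upper n l).
have cl : l_ n @[n --> \oo] --> l by exact: cvg_upper.
have ln1 n : 0 <= l_ n <= l + 1.
  rewrite frac_ge0/= (le_trans (upper_le n lw))// lerD2l invf_le1// ler1n//.
transitivity (\int[P]_w pow_pos l (x w)).
  apply: bmf_int_ae; last 2 first.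
  - exact: bpowx.
  - exists x0; split=> //; first exact: moments_positive.
    move=> w /=; apply: contra_notP => xw; rewrite pow_posE// lt0r; case/andP: (x01 w) => -> _.
    by rewrite andbT; exact/eqP.
  apply: bmf01.
    apply: measurableT_comp => //; apply: measurable_funM => //.
    by apply: measurableT_comp => //; exact: measurable_ln.
  move=> w; rewrite expR_ge0 -[leRHS]expR0 ler_expR mulr_ge0_le0// ln_le0//.
  by case/andP: (x01 w).
apply: (seq_cvg_unique (u := fun n => \int[P]_w pow_pos (l_ n) (x w))).
  apply: (@bmf_int_cvg _ _ _ P _ _ 1).
  - by move=> n; case: (@bpowx (l_ n)) => //; exact: frac_ge0.
  - by case: (bpowx lw).
  - move=> n w; rewrite ger0_norm// pow_le1 ?frac_ge0//; by case/andP: (x01 w).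
  - apply: aeW => w; rewrite /pow_pos; apply: cvgMr.
    by apply: continuous_cvg; [exact: continuous_expR|exact: cvgMl].
under eq_fun do rewrite rational_moment//.
apply: continuous_cvg; first exact: continuous_expR.
by apply: cvgN; apply: cvgMr; exact: cvg_phi cl.
Qed.

End laplace_extension.

Section table_constructions.
Variable R : realType.
Implicit Types I J : eqType.

(** An index that [f] discards stands for the constant variable 1, so its factor 1 - x annihilates
    the mixed moment. *)
Lemma iter_diff_pmap I J (f : J -> option I) (a : seq I -> R) B A :
  iter_diff B (fun s => a (pmap f s)) A =
  if all (fun j => f j != None) B then iter_diff (pmap f B) a (pmap f A) else 0.
Proof.
elim: B a => //= j B IH a; case fj : (f j) => [i|] /=.
  by rewrite -(IH (fun s => a s - a (i :: s))).
rewrite (@eq_iter_diff _ _ B _ (fun=> 0 * 0)) => [|s]; last by rewrite subrr mul0r.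
by rewrite (iter_diffZ B 0 (fun=> 0)) mul0r.
Qed.

Lemma positive_table_pmap I J (f : J -> option I) (a : seq I -> R) :
  positive_table a -> positive_table (fun s => a (pmap f s)).
Proof.
move=> [sa pa]; split=> [s s' ss'|B A _].
  by apply: sa; apply: perm_pmap.
by rewrite iter_diff_pmap; case: ifP => // _; exact: pa.
Qed.

Lemma down_closedT I : down_closed (fun _ : seq I => True).
Proof. by []. Qed.

Lemma positive_table_moments I d (T : measurableType d)
    (P : probability T R) (f : T -> R) : measurable_fun setT f ->
  (forall w, 0 <= f w <= 1) -> positive_table (fun s : seq I => \int[P]_w f w ^+ size s).
Proof.
move=> mf f01; have bf := bmf01 mf f01.
split=> [s s' /perm_size ->//|B A _].
rewrite (iter_diff_size (fun k => \int[P]_w f w ^+ k)) -moment_diff//.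
apply: Rintegral_ge0 => w _; have /andP[h0 h1] := f01 w.
by rewrite mulr_ge0// exprn_ge0// subr_ge0.
Qed.

(** The product over all j, cut at the largest index present: beyond it the counts are 0 and the
    factors will be 1. *)
Definition independent_law (c : nat -> nat -> R) (s : seq nat) : R :=
  \prod_(j < (\max_(i <- s) i).+1) c j (count_mem (j : nat) s).

Section independent_law.
Variable c : nat -> nat -> R.
Hypothesis c0 : forall j, c j 0%N = 1.

Lemma independent_lawE N s : (\max_(i <- s) i < N)%N ->
  independent_law c s = \prod_(j < N) c j (count_mem (j : nat) s).
Proof.
move=> sN; rewrite /independent_law.
rewrite (big_ord_widen_cond N xpredT (fun j => c j (count_mem j s)) sN)/=.
rewrite [LHS]big_mkcond/=; apply: eq_bigr => j _; case: ltnP => // sj.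
rewrite (_ : count_mem _ _ = 0%N) ?c0//; apply/count_memPn; apply/negP => js.
by have := @leq_bigmax_seq _ s xpredT id j js isT; rewrite leqNgt sj.
Qed.

Lemma independent_law_cat s s' : (forall j, j \in s -> j \notin s') ->
  independent_law c (s ++ s') = independent_law c s * independent_law c s'.
Proof.
move=> ss'; pose N := (maxn (\max_(i <- s) i) (\max_(i <- s') i)).+1.
rewrite !(@independent_lawE N) ?ltnS ?leq_maxl ?leq_maxr//; last by rewrite big_cat.
rewrite -big_split/=; apply: eq_bigr => j _; rewrite count_cat.
have [/ss'/count_memPn ->|/count_memPn ->] := boolP (nat_of_ord j \in s).
  by rewrite addn0 c0 mulr1.
by rewrite add0n c0 mul1r.
Qed.

Lemma independent_law_nseq k j : independent_law c (nseq k j) = c j k.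
Proof.
rewrite (@independent_lawE j.+1); last first.
  by rewrite ltnS; apply/bigmax_leqP_seq => i; rewrite mem_nseq => /andP[_ /eqP ->].
rewrite big_ord_recr/= big1 ?mul1r => [|i _].
  by rewrite count_nseq /= eqxx mul1n.
by rewrite count_nseq /= gtn_eqF ?mul0n// ltn_ord.
Qed.

Lemma independent_law_positive :
  (forall j, positive_table (fun s : seq unit => c j (size s))) ->
  positive_table (independent_law c).
Proof.
move=> pc.
have pN N : positive_table (fun s : seq nat => \prod_(j < N) c j (count_mem (j : nat) s)).
  elim: N => [|N IH].
    under eq_fun do rewrite big_ord0; exact: positive_on1.
  under eq_fun do rewrite big_ord_recr/=.
  apply: positive_onM => //.
  have := @positive_table_pmap unit nat (fun i => if i == N then Some tt else None) _ (pc N).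
  congr positive_on; apply/funext => s; congr (c N _).
  by rewrite size_pmap; apply: eq_count => i /=; case: (i == N).
apply: positive_on_cvg pN _ => s; apply: cvg_near_cst; near=> N.
rewrite (@independent_lawE N)//; near: N; exact: nbhs_infty_gt.
Unshelve. all: by end_near. Qed.

End independent_law.

End table_constructions.

(** * Construction of a stationary regenerative set *)

Section increments_table.
Variables (R : realType) (Phi : nat -> R).
Hypothesis Phi0 : Phi 0%N = 0.
Hypothesis Phi_alternating : forall m j, diff m.+1 Phi j <= 0.

Local Notation I := ((nat * nat) * (nat * nat))%type.
Local Notation leb := (@lebesgue_measure R).
Implicit Types (i : I) (s : seq I) (t : measurableTypeR R).

Definition time_itv i : set (measurableTypeR R) := `]frac R i.1, frac R i.2]%classic.

Definition in_itv_bool i t : bool := frac R i.1 < t <= frac R i.2.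

Definition cover_count s t : nat := count (in_itv_bool ^~ t) s.

Lemma time_itvE i t : time_itv i t <-> in_itv_bool i t.
Proof. by rewrite /time_itv /= in_itv. Qed.

Let mitv i : measurable (time_itv i). Proof. exact: measurable_itv. Qed.

Let mu_fin (N : nat) : (leb `[0%R, N%:R]%classic < +oo)%E.
Proof. by rewrite (lebesgue_measure_itv `[0%R, N%:R]) /=; case: ifP => _; rewrite -?EFinB ltry. Qed.

Let mitvN N : measurable (`[0%R, N%:R]%classic : set (measurableTypeR R)).
Proof. exact: measurable_itv. Qed.

Let mu N := mfrestr (mitvN N) (mu_fin N).

Let count_cons i s t (f : nat -> R) : f (cover_count (i :: s) t) =
  \1_(time_itv i) t * f (cover_count s t).+1 + \1_(~` time_itv i) t * f (cover_count s t).
Proof.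
rewrite /cover_count /= -/(cover_count s t).
case: (boolP (in_itv_bool i t)) => it.
  have h : time_itv i t by exact/time_itvE.
  by rewrite !indicE in_setC mem_set//= mul1r mul0r addr0.
have h : ~ time_itv i t by move/time_itvE; exact/negP.
by rewrite !indicE in_setC memNset//= mul0r mul1r add0r.
Qed.

Let bcount (f : nat -> R) s : bounded_measurable (fun t => f (cover_count s t)).
Proof.
elim: s f => [|i s IH] f.
  by rewrite (_ : (fun t => _) = fun=> f 0%N)//; exact: bmf_cst.
rewrite (_ : (fun t => _) = (fun t => \1_(time_itv i) t * f (cover_count s t).+1 +
    \1_(~` time_itv i) t * f (cover_count s t))); last by apply/funext => t; exact: count_cons.
apply: bmfD; apply: bmfM; [exact: bmf_indic| |apply: bmf_indic; exact: measurableC|exact: IH].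
exact: (IH (fun k => f k.+1)).
Qed.

(** The integrand is a step function: splitting D along the intervals of [s] reduces the claim to
    the masses of subsets of D. *)
Let int_agree (m1 m2 : {finite_measure set (measurableTypeR R) -> \bar R}) s :
  forall (f : nat -> R) D, measurable D ->
  (forall A, measurable A -> A `<=` D -> m1 A = m2 A) ->
  \int[m1]_t (\1_D t * f (cover_count s t)) = \int[m2]_t (\1_D t * f (cover_count s t)).
Proof.
elim: s => [|i s IH] f D mD agree.
  have e (m : {finite_measure set (measurableTypeR R) -> \bar R}) :
      \int[m]_t (\1_D t * f 0%N) = f 0%N * fine (m D).
    under eq_Rintegral do rewrite mulrC.
    by rewrite bmf_intZ ?bmf_int_indic//; exact: bmf_indic.
  by transitivity (f 0%N * fine (m1 D)); [exact: e|rewrite agree//; exact/esym/e].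
have split_D : (fun t => \1_D t * f (cover_count (i :: s) t)) = (fun t =>
    \1_(D `&` time_itv i) t * f (cover_count s t).+1 +
    \1_(D `&` ~` time_itv i) t * f (cover_count s t)).
  by apply/funext => t; rewrite count_cons !indicI /=; ring.
have mDi : measurable (D `&` time_itv i) by exact: measurableI.
have mDc : measurable (D `&` ~` time_itv i) by apply: measurableI => //; exact: measurableC.
have b1 : bounded_measurable (fun t => \1_(D `&` time_itv i) t * f (cover_count s t).+1).
  by apply: bmfM; [exact: bmf_indic|exact: (bcount (fun k => f k.+1))].
have b2 : bounded_measurable (fun t => \1_(D `&` ~` time_itv i) t * f (cover_count s t)).
  by apply: bmfM; [exact: bmf_indic|exact: bcount].
rewrite split_D (bmf_intD m1 b1 b2) (bmf_intD m2 b1 b2).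
congr (_ + _).
  apply: (IH (fun k => f k.+1)) => // A mA AD; apply: agree => //.
  by move=> x /AD[].
apply: IH => // A mA AD; apply: agree => //.
by move=> x /AD[].
Qed.

(** Stationary independent increments force the mixed moment of the factors exp(- (Y_q - Y_p)) to be
    exp(- Psi): at time t, the factors whose interval covers t act together, with exponent
    Phi(number of them). Lebesgue measure is cut at N to be finite; beyond the horizon N does not
    matter. *)
Let Psi N s := \int[mu N]_t Phi (cover_count s t).

Definition horizon s : nat := \sum_(i <- s) i.2.1.

Let horizon_le s i : i \in s -> frac R i.2 <= (horizon s)%:R.
Proof.
move=> si; rewrite /horizon (big_rem i)//= natrD.
rewrite (@le_trans _ _ i.2.1%:R)//; last by rewrite lerDl.
by rewrite /frac ler_pdivrMr// ler_peMr// ler1n.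
Qed.

Let count_out N s t : (horizon s <= N)%N -> ~~ (0 <= t <= N%:R) -> cover_count s t = 0%N.
Proof.
move=> sN tN; apply/eqP; rewrite -leqn0 leqNgt -has_count; apply/hasPn => i si.
apply/negP => /andP[h1 h2]; move/negP: tN; apply; apply/andP; split.
  by rewrite ltW// (le_lt_trans (frac_ge0 _ _) h1).
apply: (le_trans h2); apply: (le_trans (horizon_le si)).
by rewrite ler_nat.
Qed.

Let Psi_stable N N' s : (horizon s <= N <= N')%N -> Psi N s = Psi N' s.
Proof.
move=> /andP[sN NN']; pose D : set (measurableTypeR R) := `[0%R, N%:R]%classic.
have e : (fun t => Phi (cover_count s t)) = (fun t => \1_D t * Phi (cover_count s t)).
  apply/funext => t; rewrite indicE; case: (boolP (t \in D)) => tD; first by rewrite mul1r.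
  rewrite mul0r (count_out sN) ?Phi0//; apply: contraNN tD => tN.
  by rewrite inE /D /= in_itv.
rewrite /Psi e; apply: int_agree => [|A mA AD]; first exact: mitvN.
change (leb (A `&` `[0%R, N%:R]%classic) = leb (A `&` `[0%R, N'%:R]%classic)).
congr (leb _); rewrite !setIidl//.
apply: (subset_trans AD) => t; rewrite /D /= !in_itv/= => /andP[-> h].
by rewrite (le_trans h)// ler_nat.
Qed.

Let iter_diff_int N B (f : seq I -> measurableTypeR R -> R) A :
  (forall s, bounded_measurable (f s)) ->
  bounded_measurable (fun t => iter_diff B (f ^~ t) A) /\
  iter_diff B (fun s => \int[mu N]_t f s t) A = \int[mu N]_t iter_diff B (f ^~ t) A.
Proof.
elim: B f => [|i B IH] f bf //=.
have [|h e] := IH (fun s t => f s t - f (i :: s) t); first by move=> s; exact: bmfB.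
split=> //; rewrite -e; apply: eq_iter_diff => s.
by rewrite bmf_intB.
Qed.

Definition increments_law s : R := expR (- Psi (horizon s) s).

Let lawE N s : (horizon s <= N)%N -> increments_law s = expR (- Psi N s).
Proof. by move=> sN; rewrite /increments_law (@Psi_stable _ N)// leqnn. Qed.

(** By [positive_table_exp] only the alternation of Psi is at stake, and it holds under the
    integral: at a fixed t, Phi(cover count) is the table of Phi at sizes, restricted to the
    intervals that cover t. *)
Lemma increments_law_positive : positive_table increments_law.
Proof.
apply: (@positive_on_cvg _ _ _ (fun N s => expR (- Psi N s))) => [N|s]; last first.
  apply: cvg_near_cst; near=> N; rewrite (lawE (N := N))//; near: N.
  exact: nbhs_infty_ge.
apply: positive_table_exp => [s s' ss'|i B A].
  by congr Rintegral; apply/funext => t; congr Phi; exact: (permP ss').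
have [b ->] := @iter_diff_int N (i :: B) (fun s t => Phi (cover_count s t)) A (bcount Phi).
rewrite -oppr_ge0 -mulN1r -bmf_intZ//; apply: Rintegral_ge0 => t _; rewrite mulN1r oppr_ge0.
pose f (j : I) := if in_itv_bool j t then Some tt else None.
rewrite (@eq_iter_diff _ _ _ _ (fun s => Phi (size (pmap f s)))) => [|s]; last first.
  by congr Phi; rewrite size_pmap; apply: eq_count => j; rewrite /f /=; case: ifP.
have := iter_diff_pmap f (fun s : seq unit => Phi (size s)) (i :: B) A.
rewrite (iter_diff_size Phi); move=> ->; case: ifP => // /= /andP[fi _].
by case: (f i) fi => // u _; exact: Phi_alternating.
Unshelve. all: by end_near. Qed.

Lemma eq_increments_law s s' : (forall t, cover_count s t = cover_count s' t) ->
  increments_law s = increments_law s'.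
Proof.
move=> ss'; rewrite !(@lawE (horizon s + horizon s')) ?leq_addr ?leq_addl//.
by congr (expR (- Rintegral _ _ _)); apply/funext => t; rewrite ss'.
Qed.

Lemma increments_law_cat s s' :
  (forall t, cover_count s t = 0%N \/ cover_count s' t = 0%N) ->
  increments_law (s ++ s') = increments_law s * increments_law s'.
Proof.
move=> dis; have hc : horizon (s ++ s') = (horizon s + horizon s')%N by rewrite /horizon big_cat.
rewrite !(@lawE (horizon s + horizon s')) ?hc ?leq_addr ?leq_addl//.
rewrite -expRD -opprD /Psi -bmf_intD; [|exact: bcount|exact: bcount].
congr (expR (- Rintegral _ _ _)); apply/funext => t.
by rewrite /cover_count count_cat -!/(cover_count _ _); case: (dis t) => ->;
  rewrite ?addn0 Phi0 ?addr0 ?add0r.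
Qed.

Lemma increments_law_nseq k i : frac R i.1 <= frac R i.2 ->
  increments_law (nseq k i) = expR (- ((frac R i.2 - frac R i.1) * Phi k)).
Proof.
move=> i12; rewrite (@lawE (horizon (i :: nseq k i))); last first.
  by rewrite /horizon big_cons leq_addl.
congr (expR (- _)); rewrite /Psi.
rewrite (_ : (fun t => _) = (fun t => Phi k * \1_(time_itv i) t)); last first.
  apply/funext => t; rewrite /cover_count count_nseq indicE.
  case: (boolP (in_itv_bool i t)) => it; first by rewrite mem_set ?mul1n ?mulr1//; exact/time_itvE.
  by rewrite memNset ?mul0n ?Phi0 ?mulr0// => /time_itvE; exact/negP.
rewrite bmf_intZ; last exact: bmf_indic.
rewrite bmf_int_indic// mulrC; congr (_ * _).
set H := horizon _; change (fine (leb (time_itv i `&` `[0%R, H%:R]%classic)) = frac R i.2 - frac R i.1).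
rewrite setIidl.
  rewrite (lebesgue_measure_itv `]frac R i.1, frac R i.2]) /= lte_fin; case: ltP => //= h.
  by apply/esym/eqP; rewrite subr_eq0 eq_le h.
move=> t; rewrite /time_itv /= !in_itv/= => /andP[h1 h2].
rewrite (le_trans (frac_ge0 R i.1) (ltW h1))/= (le_trans h2)//.
by apply: (@horizon_le (i :: nseq k i)); rewrite mem_head.
Qed.

End increments_table.

Section almost_everywhere.
Context d (T : measurableType d) (R : realType) (P : probability T R).

Lemma ae_of_square (f : T -> R) : bounded_measurable f -> \int[P]_w (f w ^+ 2) = 0 ->
  {ae P, forall w, f w = 0}.
Proof.
move=> bf f0; have bf2 : bounded_measurable (fun w => f w ^+ 2) by exact: bmfX.
have /ae_eq_integral_abs h : measurable_fun setT (EFin \o (fun w => f w ^+ 2)).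
  by apply/measurable_EFinP; case: bf2.
have : (\int[P]_(x in setT) `|(EFin \o (fun w => f w ^+ 2)%R) x| = 0)%E.
  rewrite (eq_integral (EFin \o (fun w => f w ^+ 2)%R)) => [|w _]; last first.
    by rewrite /= ger0_norm// sqr_ge0.
  by have := bmf_integralE P bf2; rewrite f0.
move=> /(h P measurableT); apply: filterS => w /= /(_ I) [] /eqP.
by rewrite sqrf_eq0 => /eqP.
Qed.

Lemma ae_forall_countable (K : countType) (Q : K -> T -> Prop) :
  (forall k, {ae P, forall w, Q k w}) -> {ae P, forall w, forall k, Q k w}.
Proof.
move=> aeQ.
have : {ae P, forall w, forall n, if unpickle n is Some k then Q k w else True}.
  apply: ae_foralln => n; case: (unpickle n) => [k|]; first exact: aeQ.
  exact: aeW.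
by apply: filterS => w h k; have := h (pickle k); rewrite pickleK.
Qed.

End almost_everywhere.

Lemma sigma_RV_comp (R : realType) (T : Type) (f : T -> R) (h : R -> R) :
  measurable_fun setT h -> sigma_RV (fun w => h (f w)) `<=` sigma_RV f.
Proof.
move=> mh _ [B mB <-]; exists (h @^-1` B); last by rewrite !setTI.
by rewrite -[X in measurable X]setTI; exact: mh.
Qed.

(** * The process, from rational to real times *)

Section stationary_process.
Variables (R : realType) (phi : R -> R) (c : nat -> nat -> R).
Hypothesis phi0 : phi 0 = 0.
Hypothesis phi_alternating : forall r m j, 0 <= r ->
  diff m.+1 (fun k => phi (k%:R * r)) j <= 0.
Hypothesis cvg_phi : forall (l_ : nat -> R) l B, (forall n, 0 <= l_ n <= B) ->
  l_ n @[n --> \oo] --> l -> phi (l_ n) @[n --> \oo] --> phi l.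
Hypothesis c0 : forall j, c j 0%N = 1.
Hypothesis c_positive : forall j, positive_table (fun s : seq unit => c j (size s)).

Let Phi k := phi k%:R.

Let Phi0 : Phi 0%N = 0. Proof. exact: phi0. Qed.

Let Phi_alternating m j : diff m.+1 Phi j <= 0.
Proof.
have := @phi_alternating 1 m j ler01.
by rewrite (@eq_diff _ _ Phi) => // k; rewrite mulr1.
Qed.

Local Notation Q := (nat * nat)%type.
Local Notation idx := ((Q * Q) + nat)%type.

Definition get_itv (v : idx) : option (Q * Q) := if v is inl i then Some i else None.
Definition get_nat (v : idx) : option nat := if v is inr j then Some j else None.

(* Moments of the variables exp(- (Y_q - Y_p)), for the index [inl (p, q)], and of
   independent variables with moments [c j], for the index [inr j]. *)
Definition process_law (s : seq idx) : R :=
  increments_law Phi (pmap get_itv s) * independent_law c (pmap get_nat s).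

Let ind0 : independent_law c [::] = 1.
Proof. exact: etrans (independent_law_nseq c0 0 0) (c0 0). Qed.

Let law_itv s : process_law (map inl s) = increments_law Phi s.
Proof.
rewrite /process_law (_ : pmap get_nat _ = [::]); last by elim: s.
rewrite (_ : pmap get_itv _ = s); last by elim: s => //= i s ->.
by rewrite ind0 mulr1.
Qed.

Let law_nat s : process_law (map inr s) = independent_law c s.
Proof.
rewrite /process_law (_ : pmap get_itv _ = [::]); last by elim: s.
rewrite (_ : pmap get_nat _ = s); last by elim: s => //= i s ->.
have i00 : frac R (0, 0)%N <= frac R (0, 0)%N by [].
rewrite (increments_law_nseq Phi0 0 (i := ((0, 0), (0, 0))%N) i00).
by rewrite Phi0 mulr0 oppr0 expR0 mul1r.
Qed.

Lemma process_law_positive : positive_table process_law.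
Proof.
have h1 : positive_table (fun s : seq idx => increments_law Phi (pmap get_itv s)) :=
  positive_table_pmap get_itv (increments_law_positive Phi0 Phi_alternating).
have h2 : positive_table (fun s : seq idx => independent_law c (pmap get_nat s)) :=
  positive_table_pmap get_nat (independent_law_positive c0 c_positive).
exact: (positive_onM (down_closedT idx) h1 h2).
Qed.

Lemma process_law_nil : process_law [::] = 1.
Proof. exact: etrans (law_nat [::]) ind0. Qed.

Lemma process_law_cat s s' :
  (forall t : measurableTypeR R,
     cover_count (pmap get_itv s) t = 0%N \/ cover_count (pmap get_itv s') t = 0%N) ->
  (forall j, j \in pmap get_nat s -> j \notin pmap get_nat s') ->
  process_law (s ++ s') = process_law s * process_law s'.
Proof.
move=> h1 h2; rewrite /process_law !pmap_cat increments_law_cat// independent_law_cat//.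
exact: mulrACA.
Qed.

Context d (Om : measurableType d) (P : probability Om R).
Variable M : idx -> Om -> R.
Hypotheses (mM : forall v, measurable_fun setT (M v)) (M01 : forall v w, 0 <= M v w <= 1).
Hypothesis MP : forall s, \int[P]_w (\prod_(v <- s) M v w) = process_law s.

Let x p q w := M (inl (p, q)) w.

Let bM v : bounded_measurable (M v). Proof. exact: bmf01. Qed.

Let prod_nseq (v : idx) k w : \prod_(u <- nseq k v) M u w = M v w ^+ k.
Proof. by elim: k => [|k IH]; rewrite ?big_nil// /= big_cons IH exprS. Qed.

Let x_moment p q k : frac R p <= frac R q ->
  \int[P]_w x p q w ^+ k = expR (- ((frac R q - frac R p) * Phi k)).
Proof.
move=> pq; rewrite -(increments_law_nseq Phi0 k (i := (p, q)) pq) -law_itv map_nseq -MP.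
by under [RHS]eq_Rintegral do rewrite prod_nseq.
Qed.

Let z_moment j k : \int[P]_w M (inr j) w ^+ k = c j k.
Proof.
rewrite -(independent_law_nseq c0) -law_nat map_nseq -MP.
by under [RHS]eq_Rintegral do rewrite prod_nseq.
Qed.

(** The square of the difference has mean 0: since ]p, r] is the disjoint union of ]p, q] and ]q,
    r], the three terms of the expanded square have the same cover counts, hence the same mean, with
    coefficients 1, -2, 1. *)
Let x_multiplicative p q r : frac R p <= frac R q -> frac R q <= frac R r ->
  {ae P, forall w, x p r w = x p q w * x q r w}.
Proof.
move=> pq qr.
have bp : bounded_measurable (fun w => x p q w * x q r w).
  exact: bmfM (bM (inl (p, q))) (bM (inl (q, r))).
have : {ae P, forall w, x p r w - x p q w * x q r w = 0}; last first.
  by apply: filterS => w /eqP; rewrite subr_eq0 => /eqP.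
apply: ae_of_square; first exact: bmfB (bM (inl (p, r))) bp.
pose l1 : seq (Q * Q) := [:: (p, r); (p, r)].
pose l2 : seq (Q * Q) := [:: (p, r); (p, q); (q, r)].
pose l3 : seq (Q * Q) := [:: (p, q); (q, r); (p, q); (q, r)].
have split_itv (t : measurableTypeR R) : nat_of_bool (frac R p < t <= frac R r) =
    (nat_of_bool (frac R p < t <= frac R q)%R + nat_of_bool (frac R q < t <= frac R r)%R)%N.
  case: (leP t (frac R q)) => tq /=; first by rewrite (le_trans tq qr) addn0.
  by rewrite (le_lt_trans pq tq).
have e2 : increments_law Phi l2 = increments_law Phi l1.
  apply: (eq_increments_law Phi0) => t; rewrite /cover_count /= /in_itv_bool /=.
  by rewrite split_itv; lia.
have e3 : increments_law Phi l3 = increments_law Phi l1.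
  apply: (eq_increments_law Phi0) => t; rewrite /cover_count /= /in_itv_bool /=.
  by rewrite split_itv; lia.
have E (l : seq (Q * Q)) : \int[P]_w (\prod_(i <- l) M (inl i) w) = increments_law Phi l.
  by rewrite -law_itv -MP; under [RHS]eq_Rintegral do rewrite big_map.
have bprod (l : seq (Q * Q)) : bounded_measurable (fun w => \prod_(i <- l) M (inl i) w).
  by apply: bmf_prod.
rewrite (_ : (fun w => _) = (fun w => \prod_(i <- l1) M (inl i) w +
    (-2) * \prod_(i <- l2) M (inl i) w + \prod_(i <- l3) M (inl i) w)); last first.
  by apply/funext => w; rewrite !big_cons !big_nil /x; ring.
have b1 := bprod l1; have b2 := bmfZ (-2) (bprod l2).
rewrite (bmf_intD P (bmfD b1 b2) (bprod l3)) (bmf_intD P b1 b2) (bmf_intZ P _ (bprod l2)) !E e2 e3.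
by move: (increments_law _ _) => v; ring.
Qed.

Let x_positive p q : frac R p <= frac R q -> {ae P, forall w, 0 < x p q w}.
Proof.
move=> pq; have h0 : 0 <= frac R q - frac R p by rewrite subr_ge0.
have := moments_positive phi0 phi_alternating cvg_phi (mM (inl (p, q))) (M01 (inl (p, q)))
  h0 (fun k => x_moment k pq).
move=> e; exists [set w | ([set 0] : set R) (x p q w)]; split=> //.
  by rewrite -[X in measurable X]setTI; exact: mM.
move=> w /=; apply: contra_notP => xw; rewrite lt0r; case/andP: (M01 (inl (p, q)) w) => -> _.
by rewrite andbT; exact/eqP.
Qed.

Definition regular_path w := forall k : Q * Q * Q,
  frac R k.1.1 <= frac R k.1.2 -> frac R k.1.2 <= frac R k.2 ->
  x k.1.1 k.2 w = x k.1.1 k.1.2 w * x k.1.2 k.2 w /\ 0 < x k.1.1 k.1.2 w.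

Let ae_regular : {ae P, forall w, regular_path w}.
Proof.
apply: ae_forall_countable => -[[p q] r] /=.
have [pq|/negP pq] := boolP (frac R p <= frac R q); last by apply: aeW.
have [qr|/negP qr] := boolP (frac R q <= frac R r); last by apply: aeW.
by apply: filterS2 (x_multiplicative pq qr) (x_positive pq).
Qed.

Let sm : sigma_algebra setT (@measurable _ Om).
Proof. exact: sigma_algebra_measurable. Qed.

Let m_regular : measurable [set w | regular_path w].
Proof.
apply: (sigma_forall sm) => -[[p q] r] /=.
apply: (sigma_imply sm); first exact: (sigma_const sm).
apply: (sigma_imply sm); first exact: (sigma_const sm).
apply: (sigma_and sm).
  have mf : measurable_fun setT (fun w => x p r w - x p q w * x q r w).
    exact: measurable_funB (mM (inl (p, r)))
      (measurable_funM (mM (inl (p, q))) (mM (inl (q, r)))).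
  rewrite (_ : [set w | _] = (fun w => x p r w - x p q w * x q r w) @^-1` [set 0]).
    by rewrite -[X in measurable X]setTI; exact: mf.
  apply/seteqP; split=> w /=; first by move=> ->; rewrite subrr.
  by move=> /eqP; rewrite subr_eq0 => /eqP.
rewrite (_ : [set w | _] = x p q @^-1` `]0, +oo[%classic).
  by rewrite -[X in measurable X]setTI; apply: mM => //; exact: measurable_itv.
by apply/seteqP; split=> w /=; rewrite in_itv/= andbT.
Qed.

Let o : Q := (0, 0)%N.
Let frac0 : frac R o = 0. Proof. by rewrite /frac mul0r. Qed.
Let frac_o q : frac R o <= frac R q. Proof. by rewrite frac0 frac_ge0. Qed.

(* [survival t / survival 0] will be exp(- Y_t): right limits at [t] of the
   multiplicative functional [x o], which is only defined on fractions. *)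
Definition survival (t : R) w := sup [set x o q w | q in [set q | t < frac R q]].

Let upperS t : exists q, t < frac R q.
Proof.
exists ((Num.truncn t).+1, 0)%N; rewrite /frac/= divr1; exact: truncnS_gt.
Qed.

Let surv_nonempty t w : [set x o q w | q in [set q | t < frac R q]] !=set0.
Proof. by have [q tq] := upperS t; exists (x o q w), q. Qed.

Let surv_ub t w : ubound [set x o q w | q in [set q | t < frac R q]] 1.
Proof. by move=> _ [q _ <-]; case/andP: (M01 (inl (o, q)) w). Qed.

Let surv_ge t q w : t < frac R q -> x o q w <= survival t w.
Proof. by move=> tq; apply: ub_le_sup; [exists 1; exact: surv_ub|exists q]. Qed.

Let surv_le t w b : (forall q, t < frac R q -> x o q w <= b) -> survival t w <= b.
Proof. by move=> h; apply: ge_sup => // _ [q tq <-]; exact: h. Qed.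

Let surv_gt t w b : b < survival t w -> exists2 q, t < frac R q & b < x o q w.
Proof.
by move=> /sup_gt => /(_ (surv_nonempty t w))[_ [q tq <-] h]; exists q.
Qed.

Let surv_ge0 t w : 0 <= survival t w.
Proof.
have [q tq] := upperS t; apply: le_trans (surv_ge w tq).
by case/andP: (M01 (inl (o, q)) w).
Qed.

Let surv_le1 t w : survival t w <= 1.
Proof. by apply: surv_le => q _; case/andP: (M01 (inl (o, q)) w). Qed.

Let surv_ni s t w : s <= t -> survival t w <= survival s w.
Proof. by move=> st; apply: surv_le => q tq; apply: surv_ge; exact: le_lt_trans tq. Qed.

Let m_surv t : measurable_fun setT (survival t).
Proof.
move=> _ B mB; rewrite setTI; apply: (preimage_sigma_algebra sm) mB => b.
rewrite (_ : [set w | _] = [set w | exists q, t < frac R q /\ b < x o q w]).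
  apply: (sigma_exists sm) => q; apply: (sigma_and sm); first exact: (sigma_const sm).
  rewrite (_ : [set w | _] = x o q @^-1` `]b, +oo[%classic).
    by rewrite -[X in measurable X]setTI; apply: mM => //; exact: measurable_itv.
  by apply/seteqP; split=> w /=; rewrite in_itv/= andbT.
apply/seteqP; split=> w /=; first by move=> /surv_gt[q tq bq]; exists q.
by move=> [q [tq bq]]; apply: lt_le_trans bq (surv_ge w tq).
Qed.

Section regular.
Variable w : Om.
Hypothesis rw : regular_path w.

Let xE p q r : frac R p <= frac R q -> frac R q <= frac R r ->
  x p r w = x p q w * x q r w.
Proof. by move=> pq qr; case: (@rw (p, q, r) pq qr). Qed.

Let x_gt0 p q : frac R p <= frac R q -> 0 < x p q w.
Proof. by move=> pq; case: (@rw (p, q, q) pq (lexx _)). Qed.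

Let x_ni q r : frac R q <= frac R r -> x o r w <= x o q w.
Proof.
move=> qr; rewrite (xE (frac_o q) qr) ger_pMr; first by case/andP: (M01 (inl (q, r)) w).
exact: x_gt0.
Qed.

Lemma surv_gt0 t : 0 < survival t w.
Proof. by have [q tq] := upperS t; apply: lt_le_trans (surv_ge w tq); exact: x_gt0. Qed.

Lemma cvg_surv t : 0 <= t -> x o (upper n t) w @[n --> \oo] --> survival t w.
Proof.
move=> t0; apply/cvgrPdist_le => e e0.
have /surv_gt[q tq xq] : survival t w - e < survival t w by rewrite gtrBl.
have : \forall n \near \oo, frac R (upper n t) < frac R q.
  by apply: (cvgr_lt t) => //; exact: cvg_upper.
apply: filterS => n nq; have h1 := surv_ge w (upper_gt n t0).
have h2 := x_ni (ltW nq); rewrite ger0_norm ?subr_ge0//; lra.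
Qed.

Lemma surv_right t : 0 <= t -> survival s w @[s --> t^'+] --> survival t w.
Proof.
move=> t0; apply/cvgrPdist_le => e e0.
have /surv_gt[q tq xq] : survival t w - e < survival t w by rewrite gtrBl.
near=> s; have st : t <= s by [].
have sq : s < frac R q by near: s; exact: nbhs_right_lt.
have h1 := surv_ni w st; have h2 := surv_ge w sq.
rewrite ger0_norm ?subr_ge0//; lra.
Unshelve. all: by end_near. Qed.

Lemma cvg_increment s t : 0 <= s <= t ->
  x (upper n s) (upper n t) w @[n --> \oo] --> survival t w / survival s w.
Proof.
move=> /andP[s0 st]; have t0 := le_trans s0 st.
rewrite (_ : (fun n => _) = (fun n => x o (upper n t) w / x o (upper n s) w)).
  by apply: cvgM; [exact: cvg_surv|apply: cvgV; [rewrite gt_eqF// surv_gt0|exact: cvg_surv]].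
apply/funext => n; rewrite (xE (frac_o (upper n s)) (le_upper n st)) mulrC mulKf//.
by rewrite gt_eqF// x_gt0.
Qed.

End regular.

(** Off the almost sure event of regularity the path is constantly 0, so that monotonicity and right
    continuity hold at every sample point, as a subordinator requires. *)
Definition levy_path (t : R) w : R :=
  if pselect (regular_path w) then ln (survival 0 w) - ln (survival t w) else 0.

Lemma measurable_levy_path t : measurable_fun setT (levy_path t).
Proof.
rewrite (_ : levy_path t = (fun w => \1_[set w | regular_path w] w *
    (ln (survival 0 w) - ln (survival t w)))).
  apply: measurable_funM; first exact: measurable_indic.
  exact: measurable_funB (measurableT_comp (@measurable_ln R) (m_surv 0))
    (measurableT_comp (@measurable_ln R) (m_surv t)).
apply/funext => w; rewrite /levy_path indicE; case: pselect => h.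
  by rewrite mem_set// mul1r.
by rewrite memNset// mul0r.
Qed.

Lemma levy_path0 w : levy_path 0 w = 0.
Proof. by rewrite /levy_path; case: pselect => // ?; rewrite subrr. Qed.

Lemma levy_path_nd w s t : s <= t -> levy_path s w <= levy_path t w.
Proof.
move=> st; rewrite /levy_path; case: pselect => // rw.
by rewrite lerD2l lerN2 ler_ln ?posrE ?surv_gt0// surv_ni.
Qed.

Lemma levy_path_right w t : 0 <= t -> levy_path s w @[s --> t^'+] --> levy_path t w.
Proof.
move=> t0; rewrite /levy_path; case: pselect => rw; last exact: cvg_cst.
apply: cvgB; first exact: cvg_cst.
apply: continuous_cvg; first exact/continuous_ln/surv_gt0.
exact: surv_right.
Qed.

Definition increment (st : R * R) w := expR (- (levy_path st.2 w - levy_path st.1 w)).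

Let incrementE st w : regular_path w ->
  increment st w = survival st.2 w / survival st.1 w.
Proof.
move=> rw; rewrite /increment /levy_path; case: pselect => // ?.
rewrite /= (_ : - (_ - _) = ln (survival st.2 w) - ln (survival st.1 w)); last by ring.
rewrite -ln_div ?posrE ?surv_gt0//.
by rewrite lnK// posrE divr_gt0// surv_gt0.
Qed.

Let m_increment st : measurable_fun setT (increment st).
Proof.
apply: measurableT_comp => //; apply: measurableT_comp => //.
by apply: measurable_funB; exact: measurable_levy_path.
Qed.

Let increment01 (st : R * R) w : st.1 <= st.2 -> 0 <= increment st w <= 1.
Proof.
move=> h; rewrite expR_ge0 -[leRHS]expR0 ler_expR oppr_le0 subr_ge0.
exact: levy_path_nd.
Qed.

(** Pairs of real times, in contrast to [idx]; [approx] replaces them by fractions from the right,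
    whose mixed moments are known. *)
Definition variable_index := ({st : R * R | 0 <= st.1 <= st.2} + nat)%type.

Definition variable (v : variable_index) w : R :=
  match v with inl st => increment (sval st) w | inr j => M (inr j) w end.

Definition approx n (v : variable_index) : idx :=
  match v with
  | inl st => inl (upper n (sval st).1, upper n (sval st).2)
  | inr j => inr j
  end.

Lemma measurable_variable v : measurable_fun setT (variable v).
Proof. by case: v => [st|j]; [exact: m_increment|exact: mM]. Qed.

Lemma variable01 v w : 0 <= variable v w <= 1.
Proof. by case: v => [[st h]|j] //=; apply: increment01; case/andP: h. Qed.

Lemma cvg_variables l : process_law (map (approx n) l) @[n --> \oo] -->
  \int[P]_w (\prod_(v <- l) variable v w).
Proof.
under eq_fun do rewrite -MP.
apply: (@bmf_int_cvg _ _ _ P _ _ 1).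
- by move=> n; case: (@bmf_prod _ _ R _ (map (approx n) l) xpredT M bM).
- have bv v : bounded_measurable (variable v).
    by apply: bmf01; [exact: measurable_variable|exact: variable01].
  by case: (bmf_prod l xpredT bv).
- move=> n w; have : 0 <= \prod_(v <- map (approx n) l) M v w <= 1.
    elim: (map _ _) => [|v s IH]; first by rewrite big_nil ler01 lexx.
    rewrite big_cons; have /andP[h1 h2] := IH; have /andP[h3 h4] := M01 v w.
    by rewrite mulr_ge0//= mulr_ile1.
  by move=> /andP[h1 h2]; rewrite ger0_norm.
- apply: filterS ae_regular => w rw; elim: l => [|v l IH].
    by under eq_fun do rewrite /= big_nil; rewrite big_nil; exact: cvg_cst.
  rewrite big_cons; under eq_fun do rewrite /= big_cons.
  apply: cvgM => //; case: v => [[[s t] /= st]|j] /=; last exact: cvg_cst.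
  by rewrite incrementE//; exact: cvg_increment.
Qed.

(** The mixed moments factorize along the fractions, hence in the limit, and factorized moments
    imply independence. *)
Lemma variables_independent (K1 K2 : Type) (f : K1 -> variable_index) (g : K2 -> variable_index) :
  (forall n s t, process_law (map (approx n) (map f s ++ map g t)) =
     process_law (map (approx n) (map f s)) * process_law (map (approx n) (map g t))) ->
  independent_classes P <<s \bigcup_k sigma_RV (variable (f k)) >>
    <<s \bigcup_k sigma_RV (variable (g k)) >>.
Proof.
move=> fg; apply: moments_independence; try by move=> *; exact: measurable_variable.
- by move=> *; exact: variable01.
- by move=> *; exact: variable01.
move=> s t; have e K (h : K -> variable_index) l :
    (fun w => \prod_(k <- l) variable (h k) w) = (fun w => \prod_(v <- map h l) variable v w).
  by apply/funext => w; rewrite big_map.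
have -> : (fun w => \prod_(i <- s) variable (f i) w * \prod_(j <- t) variable (g j) w) =
    (fun w => \prod_(v <- map f s ++ map g t) variable v w).
  by apply/funext => w; rewrite big_cat !big_map.
rewrite (e _ f s) (e _ g t).
apply: (seq_cvg_unique (@cvg_variables (map f s ++ map g t))); under eq_fun do rewrite fg.
by apply: cvgM; exact: cvg_variables.
Qed.

Lemma increment_moment_laplace s t k : 0 <= s <= t ->
  \int[P]_w increment (s, t) w ^+ k = expR (- ((t - s) * phi k%:R)).
Proof.
move=> st; pose v : variable_index := inl (exist (fun st : R * R => 0 <= st.1 <= st.2) (s, t) st).
have := @cvg_variables (nseq k v).
have -> : (fun w => \prod_(u <- nseq k v) variable u w) = (fun w => increment (s, t) w ^+ k).
  by apply/funext => w; elim: k => [|k IH]; rewrite ?big_nil// /= big_cons IH exprS.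
move=> /seq_cvg_unique; apply; have /andP[s0 st'] := st.
rewrite (_ : (fun n => _) = (fun n => expR (- ((frac R (upper n t) - frac R (upper n s)) * Phi k)))).
  apply: continuous_cvg; first exact: continuous_expR.
  by apply: cvgN; apply: cvgMl; apply: cvgB; apply: cvg_upper => //; exact: le_trans st'.
apply/funext => n.
have -> : map (approx n) (nseq k v) = map inl (nseq k (upper n s, upper n t)).
  by elim: k => //= k ->.
by rewrite law_itv increments_law_nseq//; exact: le_upper.
Qed.

(** The table only gives the integer moments of exp(- Y_t); [moments_laplace] passes to real
    exponents. *)
Lemma levy_path_laplace t l : 0 <= t -> 0 <= l ->
  \int[P]_w expR (- (l * levy_path t w)) = expR (- (t * phi l)).
Proof.
move=> t0 l0; have h2 : (0 : R) <= 0 <= t by apply/andP; split.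
rewrite -(moments_laplace (P := P) phi0 phi_alternating cvg_phi (m_increment (0, t))
  (fun w => increment01 w (t0 : (0, t).1 <= (0, t).2)) t0 _ l0) => [|k].
  congr Rintegral; apply/funext => w.
  by rewrite /increment/= expRK levy_path0 subr0 mulrN.
by rewrite (increment_moment_laplace k h2) subr0.
Qed.

Lemma levy_path_stationary s t A : 0 <= s -> 0 <= t -> measurable A ->
  P [set w | A (levy_path (s + t) w - levy_path s w)] = P [set w | A (levy_path t w)].
Proof.
move=> s0 t0 mA; pose h (u : R) := - ln u.
have mh : measurable (h @^-1` A).
  rewrite -[X in measurable X]setTI.
  by apply: (measurableT_comp _ (@measurable_ln R)) => //; exact: measurable_oppr.
have st : s <= s + t by rewrite lerDl.
have := moments_distribution (m_increment (s, s + t)) (m_increment (0, t))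
  (fun w => increment01 w (st : (s, s + t).1 <= (s, s + t).2))
  (fun w => increment01 w (t0 : (0, t).1 <= (0, t).2)) _ mh.
have -> : increment (s, s + t) @^-1` (h @^-1` A) =
    [set w | A (levy_path (s + t) w - levy_path s w)].
  by apply/seteqP; split=> w /=; rewrite /h /increment expRK opprK.
have -> : increment (0, t) @^-1` (h @^-1` A) = [set w | A (levy_path t w)].
  by apply/seteqP; split=> w /=; rewrite /h /increment expRK opprK/= levy_path0 subr0.
have h1 : 0 <= s <= s + t by rewrite s0.
have h2 : (0 : R) <= 0 <= t by apply/andP; split.
apply=> k; rewrite (increment_moment_laplace k h1) (increment_moment_laplace k h2).
by rewrite subr0 addrAC subrr add0r.
Qed.

Lemma process_independent s t : 0 <= s -> 0 <= t ->
  independent_classes P (sigma_process `[0, s]%classic levy_path)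
    (sigma_RV (fun w => levy_path (s + t) w - levy_path s w)).
Proof.
move=> s0 t0; pose K1 := {r : R | 0 <= r <= s}.
pose f (r : K1) : variable_index :=
  inl (exist (fun st : R * R => 0 <= st.1 <= st.2) (0, sval r)
    (introT andP (conj (lexx 0) (proj1 (elimT andP (svalP r)))))).
have st : 0 <= (s, s + t).1 <= (s, s + t).2 by rewrite /= s0 lerDl.
pose g (_ : unit) : variable_index := inl (exist (fun st : R * R => 0 <= st.1 <= st.2) (s, s + t) st).
have mln : measurable_fun setT (fun u : R => - ln u).
  by apply: measurableT_comp => //; exact: measurable_ln.
have ind : independent_classes P <<s \bigcup_k sigma_RV (variable (f k)) >>
    <<s \bigcup_k sigma_RV (variable (g k)) >>.
  apply: variables_independent => n l l'; rewrite map_cat; apply: process_law_cat => [u|j].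
    (* A time up to the fraction that approximates s is covered by no increment after s, a later one
       by no interval from 0 to some r <= s. *)
    have [us|su] := leP u (frac R (upper n s)).
      right; elim: l' => //= _ l' IH; rewrite /cover_count/= -/(cover_count _ _) IH addn0.
      by rewrite /in_itv_bool/= ltNge us.
    left; elim: l => //= r l IH; rewrite /cover_count/= -/(cover_count _ _) IH addn0.
    have h : frac R (upper n (sval r)) < u.
      by apply: le_lt_trans su; apply: le_upper; case/andP: (svalP r).
    by rewrite /in_itv_bool/= [u <= _]leNgt h andbF.
  by rewrite (_ : pmap get_nat _ = [::])//; elim: l.
move=> A B hA hB; apply: ind.
  move: A hA; apply: smallest_sub; first exact: smallest_sigma_algebra.
  move=> A [r /= rs]; rewrite in_itv/= in rs; move=> hA; apply: sub_sigma_algebra.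
  exists (exist (fun r : R => 0 <= r <= s) r rs) => //=.
  apply: (sigma_RV_comp mln (f := increment (0, r))); move: hA; congr (sigma_RV _ _).
  by apply/funext => w; rewrite /increment expRK opprK levy_path0 subr0.
apply: sub_sigma_algebra; exists tt => //=.
apply: (sigma_RV_comp mln (f := increment (s, s + t))); move: hB; congr (sigma_RV _ _).
by apply/funext => w; rewrite /increment expRK opprK.
Qed.

(* The variable [inr 0] yields the delay and the variables [inr i.+1] the sample
   points, so [None] is the source of everything [Z] depends on. *)
Definition source (v : variable_index) : option nat :=
  if v is inr j.+1 then Some j else None.

Lemma source_independent (u : option nat) :
  independent_classes P
    <<s \bigcup_(k : {v | source v = u}) sigma_RV (variable (sval k)) >>
    <<s \bigcup_(k : {v | source v <> u}) sigma_RV (variable (sval k)) >>.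
Proof.
apply: variables_independent => n l l'; rewrite map_cat; apply: process_law_cat => [t|j].
  case: u l l' => [i|] l l'.
    by left; rewrite (_ : pmap _ _ = [::])//; elim: l => //= -[[st|j] /= h] l IH.
  by right; rewrite (_ : pmap _ _ = [::])//; elim: l' => //= -[[st|j] /= h] l' IH.
have srcv (Q' : variable_index -> Prop) (K : seq {v | Q' v}) :
    j \in pmap get_nat (map (approx n) (map sval K)) -> Q' (inr j).
  elim: K => //= -[[st|i] /= h] K IH //.
  by rewrite inE => /predU1P[->|/IH].
by move=> /srcv h; apply/negP => /srcv; apply.
Qed.

Lemma source_variable_moment j k : \int[P]_w M (inr j) w ^+ k = c j k.
Proof. exact: z_moment. Qed.

End stationary_process.

Section delayed_range.
Context d (Om : measurableType d) (R : realType) (P : probability Om R).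
Variables (X : Om -> R) (Y : R -> Om -> R).
Hypotheses (X_ge0 : forall w, 0 <= X w) (Y0 : forall w, Y 0 w = 0).
Hypothesis Y_nd : forall w (s t : R), s <= t -> Y s w <= Y t w.
Hypothesis Y_right : forall w (t : R), 0 <= t -> Y s w @[s --> t^'+] --> Y t w.

Definition delayed_range w := closure [set X w + Y t w | t in `[0, +oo[%classic].

Definition delayed_set w := exp_neg (delayed_range w).

Let Y_ge0 t w : 0 <= t -> 0 <= Y t w.
Proof. by move=> t0; rewrite -(Y0 w); exact: Y_nd. Qed.

Let range_lt w x b : delayed_range w x -> x < b -> exists2 t, 0 <= t & X w + Y t w < b.
Proof.
move=> Wx xb; have : nbhs x [set y | y < b].
  by apply: open_nbhs_nbhs; split => //; exact: open_lt.
by move=> /Wx[_ [[t /= t0 <-] h]]; exists t => //; move: t0; rewrite in_itv/= andbT.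
Qed.

Let range_ge w x : delayed_range w x -> X w <= x.
Proof.
move=> Wx; rewrite leNgt; apply/negP => /(range_lt Wx)[t t0].
by rewrite gtrDl ltNge Y_ge0.
Qed.

Let range_ge0 w x : delayed_range w x -> 0 <= x.
Proof. by move=> /range_ge; exact: le_trans. Qed.

Let range_path w t : 0 <= t -> delayed_range w (X w + Y t w).
Proof. by move=> t0; apply: subset_closure; exists t => //=; rewrite in_itv/= t0. Qed.

Lemma delayed_set01 w : delayed_set w `<=` `[0, 1]%classic.
Proof.
move=> z [->|[x /range_ge0 x0 <-]] /=; rewrite in_itv/= ?lexx ?ler01//.
by rewrite expR_ge0 -[leRHS]expR0 ler_expR oppr_le0.
Qed.

Let delayed_set_closed w : closed (delayed_set w).
Proof.
have cW : open (~` delayed_range w) by apply: closed_openC; exact: closed_closure.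
rewrite -openC openE => z nz; have z0 : z != 0 by apply/eqP => e; apply: nz; left.
have [zn|zp|/eqP] := ltgtP z 0; last by rewrite (negbTE z0).
  have : nbhs z [set y | y < 0].
    by apply: open_nbhs_nbhs; split => //; exact: open_lt.
  apply: filterS => y /= y0 /delayed_set01; rewrite /= in_itv/= => /andP[].
  by rewrite leNgt y0.
have cl : - ln y @[y --> z] --> - ln z by apply: cvgN; exact: continuous_ln.
have nW : (~` delayed_range w) (- ln z).
  by move=> Wz; apply: nz; right; exists (- ln z) => //; rewrite opprK lnK.
have h1 : \forall y \near z, (~` delayed_range w) (- ln y).
  by apply: cl; exact: open_nbhs_nbhs.
have h2 : \forall y \near z, 0 < y.
  by apply: open_nbhs_nbhs; split => //; exact: open_gt.
apply: filterS2 h1 h2 => y nWy y0 [e|[x Wx e]]; first by rewrite e ltxx in y0.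
by apply: nWy; rewrite -e expRK opprK.
Qed.

(** By right continuity, an open set that meets the closed range contains a point taken at a
    rational time; hence hitting events are countable unions. *)
Let hitsE G w : open G -> hits delayed_set G w <->
  G 0 \/ exists q : nat * nat, G (expR (- (X w + Y (frac R q) w))).
Proof.
move=> oG; split=> [[z [[->|[x Wx <-]] Gz]]|[G0|[q Gq]]].
- by left.
- right; have : \forall y \near x, G (expR (- y)).
    have c : expR (- y) @[y --> x] --> expR (- x).
      by apply: continuous_cvg; [exact: continuous_expR|exact: cvgN].
    by apply: c; exact: open_nbhs_nbhs.
  move=> /Wx[_ [[t /= t0 <-] Gt]]; rewrite in_itv/= andbT in t0.
  have c : expR (- (X w + Y s w)) @[s --> t^'+] --> expR (- (X w + Y t w)).
    apply: continuous_cvg; first exact: continuous_expR.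
    by apply: cvgN; apply: cvgD; [exact: cvg_cst|exact: Y_right].
  have : \forall s \near t^'+, G (expR (- (X w + Y s w))).
    by apply: c; exact: open_nbhs_nbhs.
  move=> /(cvg_upper t0)[N _ hN]; exists (upper N t).
  by apply: hN => //=; exact: upper_gt.
- by exists 0; split=> //; left.
- exists (expR (- (X w + Y (frac R q) w))); split=> //; right.
  by exists (X w + Y (frac R q) w) => //; apply: range_path; exact: frac_ge0.
Qed.

Lemma delayed_set_hits (S : set (set Om)) G : sigma_algebra setT S -> open G ->
  (forall q : nat * nat, S [set w | G (expR (- (X w + Y (frac R q) w)))]) ->
  S (hits delayed_set G).
Proof.
move=> sS oG SG.
rewrite (_ : hits _ _ = [set w | G 0 \/ exists q : nat * nat, G (expR (- (X w + Y (frac R q) w)))]).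
  by apply: (sigma_or sS); [exact: (sigma_const sS)|exact: (sigma_exists sS)].
by apply/seteqP; split=> w /(hitsE w oG).
Qed.

Lemma delayed_set_random : measurable_fun setT X -> (forall t, measurable_fun setT (Y t)) ->
  random_closed_set delayed_set.
Proof.
move=> mX mY; split=> [w|G oG]; first exact: delayed_set_closed.
apply: delayed_set_hits => // [|q]; first exact: sigma_algebra_measurable.
have mf : measurable_fun setT (fun w => expR (- (X w + Y (frac R q) w))).
  by apply: measurableT_comp => //; apply: measurableT_comp => //; exact: measurable_funD.
by rewrite -[X in measurable X]setTI; apply: mf => //; exact: open_measurable.
Qed.

(** If 1 is in the set then X = 0, and the points exp(- Y_(1/(n+1))), which are less than 1,
    accumulate at 1 by right continuity. *)
Lemma delayed_set_not_isolated w : (X w = 0 -> forall n, 0 < Y n.+1%:R^-1 w) ->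
  ~ isolated (delayed_set w) (1 : R).
Proof.
move=> h; rewrite /isolated => -[/set_mem Z1 [V V1 VZ]].
case: Z1 => [/eqP|[x Wx e]]; first by rewrite oner_eq0.
have x0 : x = 0 by apply: oppr_inj; apply: expR_inj; rewrite e oppr0 expR0.
have Xw : X w = 0 by apply/eqP; rewrite eq_le X_ge0 andbT -x0 range_ge.
have {}h := h Xw.
have c : expR (- (X w + Y s w)) @[s --> (0 : R)^'+] --> expR (- (X w + Y 0 w)).
  apply: continuous_cvg; first exact: continuous_expR.
  by apply: cvgN; apply: cvgD; [exact: cvg_cst|exact: Y_right].
have : \forall s \near (0 : R)^'+, V (expR (- (X w + Y s w))) .
  by apply: c; rewrite Xw Y0 addr0 oppr0 expR0.
move=> /(@cvg_harmonic R)[N _ hN].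
have n0 : (0 : R) < N.+1%:R^-1 by rewrite invr_gt0.
have : (V `&` delayed_set w) (expR (- (X w + Y N.+1%:R^-1 w))).
  split; first by apply: (hN N) => //=.
  by right; exists (X w + Y N.+1%:R^-1 w) => //; apply: range_path; exact: ltW.
rewrite VZ /= Xw add0r -[RHS]expR0 => /expR_inj /eqP; rewrite oppr_eq0 => /eqP e0.
by have := h N; rewrite e0 ltxx.
Qed.

End delayed_range.

(** Induction on the list of indices: the events of all other indices, and so their intersection,
    lie in [S i]. *)
Lemma mutually_independent_of_complements (R : realType) d (Om : measurableType d)
    (P : probability Om R) (I : eqType) (F : I -> set (set Om)) (S : I -> set (set Om)) :
  (forall i, sigma_algebra setT (S i)) ->
  (forall i, independent_classes P (F i) (S i)) ->
  (forall i j, i != j -> F j `<=` S i) -> mutually_independent P F.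
Proof.
move=> sS FS sub s E; elim: s => [|i s IH] us EF.
  rewrite big_nil -[RHS](probability_setT P); congr (P _).
  by apply/seteqP; split=> // w _ j.
have -> : \bigcap_(j in [set` i :: s]) E j = E i `&` \bigcap_(j in [set` s]) E j.
  apply/seteqP; split=> [w h|w [h1 h2] j /=].
    split=> [|j js]; first by apply: h; rewrite /= mem_head.
    by apply: h; rewrite /= inE js orbT.
  by rewrite inE => /predU1P[->//|js]; exact: h2.
have /andP[si us'] := us.
rewrite big_cons -IH//; last by move=> j js; apply: EF; rewrite inE js orbT.
apply: (FS i); first by apply: EF; rewrite mem_head.
have {IH us us'} : forall j, j \in s -> S i (E j).
  move=> j js; apply: (sub i j).
    by apply: contraNneq si => ->.
  by apply: EF; rewrite inE js orbT.
elim: s {si EF} => [|j s IH] h.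
  rewrite (_ : \bigcap_(j in _) _ = setT); first exact: sigma_algebra_setT.
  by apply/seteqP; split=> // w _ j.
rewrite (_ : \bigcap_(k in [set` j :: s]) E k = E j `&` \bigcap_(k in [set` s]) E k).
  apply: sigma_algebra_setI => //; first by apply: h; rewrite mem_head.
  by apply: IH => k ks; apply: h; rewrite inE ks orbT.
apply/seteqP; split=> [w h'|w [h1 h2] k /=].
  split=> [|k ks]; first by apply: h'; rewrite /= mem_head.
  by apply: h'; rewrite /= inE ks orbT.
by rewrite inE => /predU1P[->//|ks]; exact: h2.
Qed.

Section delay_probability.
Variables (R : realType) (dr : R) (nu : {measure set (measurableTypeR R) -> \bar R}).
Hypotheses (dr_ge0 : 0 <= dr) (nu_levy : levy_measure nu)
  (mean_fin : (levy_mean nu < +oo)%E) (c_gt0 : 0 < dr + fine (levy_mean nu)).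

Let total : delay_measure dr_ge0 nu_levy c_gt0 setT = 1%E.
Proof. exact: delay_measure_setT. Qed.

HB.instance Definition _ :=
  Measure_isProbability.Build _ _ R (delay_measure dr_ge0 nu_levy c_gt0) total.

Lemma delay_probability : exists PX : probability (measurableTypeR R) R,
  forall A, PX A = delay_measure dr_ge0 nu_levy c_gt0 A.
Proof. by exists (delay_measure dr_ge0 nu_levy c_gt0). Qed.

End delay_probability.

(** * The stationary regenerative set together with its sample *)

Section assembly.
Variables (R : realType) (dr : R) (nu : {measure set (measurableTypeR R) -> \bar R}).
Hypotheses (dr_ge0 : 0 <= dr) (nu_levy : levy_measure nu)
  (mean_fin : (levy_mean nu < +oo)%E) (c_gt0 : 0 < dr + fine (levy_mean nu)).
Let phi := laplace_exponent dr nu.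
Hypothesis phi0 : phi 0 = 0.
Hypothesis phi_alternating : forall r m j, 0 <= r ->
  diff m.+1 (fun k => phi (k%:R * r)) j <= 0.
Hypothesis cvg_phi : forall (l_ : nat -> R) l B, (forall n, 0 <= l_ n <= B) ->
  l_ n @[n --> \oo] --> l -> phi (l_ n) @[n --> \oo] --> phi l.

Local Notation U := (uniform_prob (@ltr01 R) : probability (measurableTypeR R) R).
Local Notation idx := (((nat * nat) * (nat * nat)) + nat)%type.

Variable PX : probability (measurableTypeR R) R.
Hypothesis PXE : forall A, PX A = delay_measure dr_ge0 nu_levy c_gt0 A.

(** [fX] and [fU] encode the delay and the sample points in [0, 1] for the moment problem; the
    truncations act only on null sets. *)
Let fX (x : measurableTypeR R) : R := expR (- Num.max 0 x).
Let fU (x : measurableTypeR R) : R := Num.max 0 (Num.min x 1).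

Let mfX : measurable_fun setT fX.
Proof.
apply: measurableT_comp => //; apply: measurableT_comp => //; exact: measurable_maxr.
Qed.

Let mfU : measurable_fun setT fU.
Proof. by apply: measurable_maxr => //; exact: measurable_minr. Qed.

Let fX01 x : 0 <= fX x <= 1.
Proof. by rewrite expR_ge0 -[leRHS]expR0 ler_expR oppr_le0 le_max lexx. Qed.

Let fU01 x : 0 <= fU x <= 1.
Proof. by rewrite le_max lexx/= ge_max ler01 ge_min lexx orbT. Qed.

Definition source_moment (j k : nat) : R :=
  if j is 0%N then \int[PX]_x fX x ^+ k else \int[U]_x fU x ^+ k.

Lemma source_moment0 j : source_moment j 0 = 1.
Proof.
by case: j => [|j]; rewrite /source_moment; under eq_Rintegral do rewrite expr0;
  rewrite -[LHS]/(\int[_]_x cst 1 x) Rintegral_cst// mul1r;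
  [exact: (congr1 fine (probability_setT PX))|exact: (congr1 fine (probability_setT U))].
Qed.

Lemma source_moment_positive j : positive_table (fun s : seq unit => source_moment j (size s)).
Proof. by case: j => [|j]; exact: positive_table_moments. Qed.

Variable M : idx -> measurableTypeR R -> R.
Hypotheses (mM : forall v, measurable_fun setT (M v)) (M01 : forall v w, 0 <= M v w <= 1).
Hypothesis MP : forall s, \int[U]_w (\prod_(v <- s) M v w) = process_law phi source_moment s.

Let Y := levy_path M.
Let var := variable M.

Let mY t : measurable_fun setT (Y t). Proof. exact: measurable_levy_path. Qed.

Let hX (u : R) : R := \1_(`]0, +oo[%classic : set R) u * - ln u.

Let mhX : measurable_fun setT hX.
Proof.
have mpos : measurable (`]0, +oo[%classic : set R) by exact: measurable_itv.
apply: measurable_funM; first exact: measurable_indic.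
by apply: measurableT_comp => //; exact: measurable_ln.
Qed.

Let hX_pos u : 0 < u -> hX u = - ln u.
Proof. by move=> u0; rewrite /hX indicE mem_set ?mul1r//= in_itv/= u0. Qed.

Let hX_ge0 u : u <= 1 -> 0 <= hX u.
Proof.
by move=> u1; rewrite mulr_ge0 ?indicE// oppr_ge0 ln_le0.
Qed.

Let X w := hX (M (inr 0%N) w).

Let mX : measurable_fun setT X. Proof. exact: measurableT_comp mhX (mM _). Qed.

Let X_ge0 w : 0 <= X w.
Proof. by apply: hX_ge0; case/andP: (M01 (inr 0%N) w). Qed.

Let M_moment j k : \int[U]_w M (inr j) w ^+ k = source_moment j k.
Proof. exact: (source_variable_moment phi0 source_moment0 MP). Qed.

Let M_law_X B : measurable B -> U (M (inr 0%N) @^-1` B) = PX (fX @^-1` B).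
Proof. by apply: moments_distribution => // k; rewrite M_moment. Qed.

Let M_law_U i B : measurable B -> U (M (inr i.+1) @^-1` B) = U (fU @^-1` B).
Proof. by apply: moments_distribution => // k; rewrite M_moment. Qed.

Let PX_negative : PX `]-oo, 0%R[%classic = 0%E.
Proof.
rewrite PXE delay_measureE; last exact: measurable_itv.
rewrite (_ : `]-oo, 0%R[%classic `&` _ = set0); last first.
  by apply/seteqP; split=> // x [] /=; rewrite !in_itv/= andbT ltNge => /negP.
by rewrite integral_set0 mule0 add0e diracE memNset ?mule0// /= in_itv/= ltxx.
Qed.

Let X_law A : measurable A -> U (X @^-1` A) = delay_measure dr_ge0 nu_levy c_gt0 A.
Proof.
move=> mA; have mhA : measurable (hX @^-1` A) by rewrite -[X in measurable X]setTI; exact: mhX.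
rewrite -PXE -[LHS]/(U (M (inr 0%N) @^-1` (hX @^-1` A))) M_law_X//.
apply: ae_eq_probability => //.
  by rewrite -[X in measurable X]setTI; exact: mfX.
exists `]-oo, 0%R[%classic; split; [exact: measurable_itv|exact: PX_negative|].
move=> x /=; rewrite in_itv/=; apply: contra_notP => /negP; rewrite -leNgt => x0.
by rewrite hX_pos ?expR_gt0// expRK opprK max_r.
Qed.

Let U_law i A : measurable A -> U (M (inr i.+1) @^-1` A) = U A.
Proof.
move=> mA; have mfA : measurable (fU @^-1` A).
  by rewrite -[X in measurable X]setTI; exact: mfU.
rewrite M_law_U//; apply: (etrans (uniform_probE mfA)).
apply: (etrans _ (esym (uniform_probE mA))).
congr (lebesgue_measure _); apply/seteqP; split=> x [h /[dup] x01];
  rewrite /= in_itv/= => /andP[x0 x1]; split=> //; move: h; rewrite /= /fU.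
  by rewrite min_l// max_r.
by rewrite min_l// max_r.
Qed.

Let S (o : option nat) : set (set (measurableTypeR R)) :=
  <<s \bigcup_(k : {v | source v = o}) sigma_RV (var (sval k)) >>.
Let S' (o : option nat) : set (set (measurableTypeR R)) :=
  <<s \bigcup_(k : {v | source v <> o}) sigma_RV (var (sval k)) >>.

Let SS' o : independent_classes U (S o) (S' o).
Proof. exact: (source_independent phi0 phi_alternating cvg_phi source_moment0 mM M01 MP). Qed.

Let sS (G : set (set (measurableTypeR R))) : sigma_algebra setT <<s G >>.
Proof. exact: smallest_sigma_algebra. Qed.

Let S_sub_S' o o' : o != o' -> S o' `<=` S' o.
Proof.
move=> oo'; apply: smallest_sub; first exact: sS.
move=> A [[v vo'] _ hA].
have vo : source v <> o by rewrite vo' => e; rewrite e eqxx in oo'.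
by apply: sub_sigma_algebra; exists (exist (fun v => source v <> o) v vo).
Qed.

Let var_S (v : variable_index R) : sigma_RV (var v) `<=` S (source v).
Proof.
move=> A hA; apply: sub_sigma_algebra.
by exists (exist (fun u => source u = source v) v erefl).
Qed.

Let index_of (t : R) (t0 : 0 <= t) : variable_index R :=
  inl (exist (fun st : R * R => 0 <= st.1 <= st.2) (0, t) (introT andP (conj (lexx 0) t0))).

Let mln : measurable_fun setT (fun u : R => - ln u).
Proof. by apply: measurableT_comp => //; exact: measurable_ln. Qed.

Let Y_var t (t0 : 0 <= t) : Y t = (fun w => - ln (var (index_of t0) w)).
Proof. by apply/funext => w; rewrite /= /increment expRK opprK/= levy_path0 subr0. Qed.

Let XY_independent : independent_classes U (sigma_RV X) (sigma_process `[0, +oo[%classic Y).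
Proof.
pose f (_ : unit) : variable_index R := inr 0%N.
pose g (t : {t : R | 0 <= t}) : variable_index R := index_of (svalP t).
have ind : independent_classes U <<s \bigcup_k sigma_RV (var (f k)) >>
    <<s \bigcup_k sigma_RV (var (g k)) >>.
  apply: (variables_independent phi0 phi_alternating cvg_phi source_moment0 mM M01 MP) => n l l'; rewrite map_cat; apply: (process_law_cat phi0 source_moment0).
    by move=> t; left; rewrite (_ : pmap _ _ = [::])//; elim: l.
  by move=> j _; rewrite (_ : pmap get_nat _ = [::])//; elim: l'.
move=> A B hA hB; apply: ind.
  apply: sub_sigma_algebra; exists tt => //.
  exact: (sigma_RV_comp mhX (f := M (inr 0%N))).
move: B hB; apply: smallest_sub; first exact: sS.
move=> B [t /=]; rewrite in_itv/= andbT => t0 hB.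
apply: sub_sigma_algebra; exists (exist (fun t : R => 0 <= t) t t0) => //.
rewrite (Y_var t0) in hB.
exact: (sigma_RV_comp mln (f := var (index_of t0))).
Qed.

Let Z := delayed_set X Y.

Let Y0 w : Y 0 w = 0. Proof. exact: levy_path0. Qed.

Let Y_nd w s t : s <= t -> Y s w <= Y t w. Proof. exact: levy_path_nd. Qed.

Let Y_right w t : 0 <= t -> Y s w @[s --> t^'+] --> Y t w.
Proof. exact: levy_path_right. Qed.

Let Z_sigma : sigma_set Z `<=` S None.
Proof.
apply: smallest_sub; first exact: sS.
move=> _ [G oG <-].
apply: delayed_set_hits => // [|q]; first exact: sS.
pose gens := \bigcup_(k : {v | source v = None}) sigma_RV (var (sval k)).
pose T := g_sigma_algebraType gens.
have mvar (v : variable_index R) : source v = None -> measurable_fun setT (var v : T -> R).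
  move=> vn _ B mB; rewrite setTI; apply: sub_sigma_algebra.
  exists (exist (fun v => source v = None) v vn) => //; exists B => //.
  by rewrite setTI.
have mXT : measurable_fun setT (X : T -> R).
  exact: (measurableT_comp mhX (mvar (inr 0%N) erefl)).
have mYT : measurable_fun setT (Y (frac R q) : T -> R).
  rewrite (Y_var (frac_ge0 R q)).
  exact: (measurableT_comp mln (mvar (index_of (frac_ge0 R q)) erefl)).
have mf : measurable_fun setT (fun w : T => expR (- (X w + Y (frac R q) w))).
  by apply: measurableT_comp => //; apply: measurableT_comp => //; exact: measurable_funD.
have := mf measurableT G (open_measurable oG); rewrite setTI; exact.
Qed.

Let pX : {RV U >-> R} := mfun_Sub (mem_set mX).
Let pY t : {RV U >-> R} := mfun_Sub (mem_set (mY t)).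
Let pV i : {RV U >-> R} := mfun_Sub (mem_set (mM (inr i.+1))).

Let Y_subordinator : subordinator dr nu pY.
Proof.
split=> //.
- by move=> w s t _; exact: levy_path_nd.
- exact: (process_independent phi0 phi_alternating cvg_phi source_moment0 mM M01 MP).
- exact: (levy_path_stationary phi0 phi_alternating cvg_phi source_moment0 mM M01 MP).
- move=> t l t0 l0; rewrite unlock.
  rewrite -(levy_path_laplace phi0 phi_alternating cvg_phi source_moment0 mM M01 MP t0 l0).
  rewrite -bmf_integralE//; apply: bmf01.
    apply: measurableT_comp => //; apply: measurableT_comp => //.
    exact: measurable_funM (measurable_cst _) (mY t).
  move=> w; rewrite expR_ge0 -[leRHS]expR0 ler_expR oppr_le0 mulr_ge0//.
  by rewrite -(levy_path0 M w); exact: levy_path_nd.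
Qed.

Let mutual : mutually_independent U
  (fun o : option nat => if o is Some i then sigma_RV (pV i) else sigma_set Z).
Proof.
have sub o : (if o is Some i then sigma_RV (pV i) else sigma_set Z) `<=` S o.
  case: o => [i|]; last exact: Z_sigma.
  exact: (@var_S (inr i.+1)).
apply: (mutually_independent_of_complements (S := S')).
- by move=> o; exact: sS.
- by move=> o A B hA hB; apply: SS'; [exact: (sub o)|exact: hB].
- by move=> o o' oo'; exact: subset_trans (sub o') (S_sub_S' oo').
Qed.

(** This keeps 1 from being isolated. Without drift the delay has no atom at 0. With drift dr > 0,
    P(Y_t = 0) <= E exp(- k Y_t) <= exp(- k t dr) for every k, so Y_t > 0 almost surely. *)
Let first_jump : {ae U, forall w, X w = 0 -> forall n, 0 < Y n.+1%:R^-1 w}.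
Proof.
have [dr0|dr_neq0] := eqVneq dr 0.
  exists [set w | X w \in [set 0]]; split.
  - rewrite (_ : [set w | _] = X @^-1` [set 0]).
      by rewrite -[X in measurable X]setTI; exact: mX.
    by apply/seteqP; split=> w /=; rewrite inE.
  - rewrite (_ : [set w | _] = X @^-1` [set 0]); last by apply/seteqP; split=> w /=; rewrite inE.
    rewrite X_law// delay_measureE// dr0 mul0r mul0e adde0.
    rewrite (_ : [set 0] `&` _ = [set 0]) ?integral_set1 ?mule0//.
    by apply/seteqP; split=> [x []//|x /= ->]; split=> //=; rewrite in_itv/= lexx.
  - by move=> w /=; rewrite inE /= => h; apply: contrapT => X0; apply: h.
have dr_gt0 : 0 < dr by rewrite lt0r dr_neq0.
have ae_n n : {ae U, forall w, 0 < Y n.+1%:R^-1 w}.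
  have t0 : 0 < n.+1%:R^-1 :> R by rewrite invr_gt0.
  set t := n.+1%:R^-1 in t0 *.
  have mA : measurable [set w | ([set 0] : set R) (Y t w)].
    by rewrite -[X in measurable X]setTI; exact: mY.
  have Yt0 w : 0 <= Y t w by rewrite -(levy_path0 M w); apply: levy_path_nd => //; exact: ltW.
  exists [set w | ([set 0] : set R) (Y t w)]; split=> //; last first.
    by move=> w /=; apply: contra_notP => Yn; rewrite lt0r Yt0 andbT; exact/eqP.
  have le k : fine (U [set w | ([set 0] : set R) (Y t w)]) <= expR (- (t * dr)) ^+ k.
    apply: (@le_trans _ _ (expR (- (t * phi k%:R)))); last first.
      rewrite -expRM_natl ler_expR mulrN lerN2 mulrCA ler_pM2l// /phi /laplace_exponent mulrC.
      rewrite lerDl; apply: Rintegral_ge0 => y /=; rewrite in_itv/= andbT => y0.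
      by rewrite subr_ge0 -[leRHS]expR0 ler_expR oppr_le0 mulr_ge0// ltW.
    rewrite -(levy_path_laplace phi0 phi_alternating cvg_phi source_moment0 mM M01 MP (ltW t0))//.
    rewrite -bmf_int_indic//; apply: bmf_int_le; first exact: bmf_indic.
      apply: bmf01.
        apply: measurableT_comp => //; apply: measurableT_comp => //.
        exact: measurable_funM (measurable_cst _) (mY t).
      by move=> w; rewrite expR_ge0 -[leRHS]expR0 ler_expR oppr_le0 mulr_ge0.
    move=> w; rewrite indicE; case: (boolP (_ \in _)) => [/set_mem/= e|_]; last exact: expR_ge0.
    by rewrite [levy_path _ _ _]e mulr0 oppr0 expR0.
  have q1 : `|expR (- (t * dr))| < 1.
    by rewrite ger0_norm ?expR_ge0// -[ltRHS]expR0 ltr_expR oppr_lt0 mulr_gt0.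
  have := seq_cvg_ge (cvg_expr q1) le => h.
  apply/eqP; rewrite eq_le measure_ge0 andbT -(@fineK _ (U _)) ?lee_fin//.
  exact: fin_num_measure.
by apply: filterS (ae_foralln ae_n) => w h _ n; exact: h.
Qed.

Lemma stationary_regenerative : exists (X : {RV U >-> R}) (Z W : measurableTypeR R -> set R),
  [/\ regenerative_stationary_delay U W,
    (forall w, Z w = exp_neg (W w)),
    [/\ random_closed_set Z, (forall w, Z w `<=` `[0, 1]%classic), (forall w, Z w 0) &
      {ae U, forall w, ~ isolated (Z w) (1 : R)}],
    (forall w, 0 <= X w) /\ (forall k, phi k%:R =
      (dr + fine (levy_mean nu)) * (k%:R * \int[U]_w expR (- X w) ^+ k)) &
    exists V : nat -> {RV U >-> R}, [/\
      forall i A, measurable A -> distribution U (V i) A = U A,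
      mutually_independent U
        (fun o : option nat => if o is Some i then sigma_RV (V i) else sigma_set Z) &
      forall n s, (0 < n)%N -> compositions n s ->
        U [set w | sampled_composition (Z w) n (fun i => V i w) s] =
        (delayed_law (fun k => \int[U]_w expR (- X w) ^+ k) (rev s))%:E]].
Proof.
pose W w := delayed_range X Y w.
have XL A : measurable A -> distribution U pX A =
   (((dr + fine (levy_mean nu))^-1)%:E *
     (\int[lebesgue_measure]_(y in A `&` `[0%R, +oo[%classic) nu `[y, +oo[%classic) +
   (dr / (dr + fine (levy_mean nu)))%:E * \d_(0%R : R) A)%E.
  by move=> mA; rewrite -delay_measureE//; exact: X_law.
have cZ : random_closed_set Z.
  exact: delayed_set_random.
have WE w : W w = closure [set pX w + pY t w | t in `[0, +oo[%classic] by [].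
have ZE w : Z w = exp_neg (W w) by [].
exists pX, Z, W; split=> //.
- exists dr, nu, pX, pY; split.
  + exact: Y_subordinator.
  + by [].
  + exact: XY_independent.
  + by split.
  + exact: WE.
- split; first exact: cZ.
  + by move=> w; exact: delayed_set01.
  + by move=> w; left.
  + by apply: filterS first_jump => w h; exact: delayed_set_not_isolated.
- split=> [|k]; first exact: X_ge0.
  exact: (delay_momentE (X := pX) Y_subordinator mean_fin c_gt0 X_ge0 XL).
exists pV; split; [exact: U_law|exact: mutual|move=> n s n0 ns].
exact: (sampling_law (X := pX) (U := pV) Y_subordinator mean_fin c_gt0 XY_independent X_ge0 XL WE ZE cZ U_law mutual).
Qed.

End assembly.

(** * The moments of a chain *)

From mathcomp Require Import finmap.
Section deletions.
Variable R : realType.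
Implicit Types (g : seq nat -> R) (s : seq nat).

Definition drop_ball m s := if m == 1%N then s else m.-1 :: s.

Lemma delete_ball_cat s1 s2 j : delete_ball (s1 ++ s2) j =
  if (j < sumn s1)%N then delete_ball s1 j ++ s2 else s1 ++ delete_ball s2 (j - sumn s1).
Proof.
elim: s1 j => [|m s1 IH] j /=; first by rewrite subn0.
have [jm|mj] := ltnP j m.
  by rewrite (leq_trans jm (leq_addr _ _)); case: ifP.
rewrite IH ltn_subLR// subnDA; by case: ifP.
Qed.

Lemma sum_delete_cat g s1 s2 :
  \sum_(0 <= j < sumn (s1 ++ s2)) g (delete_ball (s1 ++ s2) j) =
  \sum_(0 <= j < sumn s1) g (delete_ball s1 j ++ s2) +
  \sum_(0 <= j < sumn s2) g (s1 ++ delete_ball s2 j).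
Proof.
rewrite sumn_cat (@big_cat_nat _ _ _ (sumn s1) 0 (sumn s1 + sumn s2)) ?leq_addr//=; congr (_ + _).
  by apply: eq_big_nat => j /andP[_ js]; rewrite delete_ball_cat js.
rewrite -{1}[sumn s1]add0n big_addn addKn; apply: eq_big_nat => j _.
by rewrite delete_ball_cat ltnNge leq_addl/= addnK.
Qed.

Lemma sum_delete1 g m : \sum_(0 <= j < sumn [:: m]) g (delete_ball [:: m] j) =
  m%:R * g (drop_ball m [::]).
Proof.
rewrite /= addn0 (eq_big_nat _ _ (F2 := fun=> g (drop_ball m [::]))).
  by rewrite sumr_const_nat subn0 mulr_natl.
by move=> j /andP[_ ->].
Qed.

Lemma sum_delete_cons g m s : \sum_(0 <= j < sumn (m :: s)) g (delete_ball (m :: s) j) =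
  m%:R * g (drop_ball m s) + \sum_(0 <= j < sumn s) g (m :: delete_ball s j).
Proof.
have := sum_delete_cat g [:: m] s => /= ->; congr (_ + _).
have := sum_delete1 (fun l => g (l ++ s)) m => ->; congr (_ * g _).
by rewrite /drop_ball; case: ifP.
Qed.

(** Reversing the boxes only permutes the balls among which the deleted one is chosen. *)
Lemma sum_delete_rev g s : \sum_(0 <= j < sumn s) g (rev (delete_ball s j)) =
  \sum_(0 <= j < sumn s) g (delete_ball (rev s) j).
Proof.
elim: s g => [|m s IH] g; first by rewrite !big_nil.
rewrite (sum_delete_cons (fun l => g (rev l))) rev_cons -cats1.
have -> : sumn (m :: s) = sumn (rev s ++ [:: m]) by rewrite sumn_cat sumn_rev /= addn0 addnC.
rewrite sum_delete_cat sumn_rev addrC.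
congr (_ + _).
  under eq_bigr do rewrite rev_cons -cats1.
  exact: (IH (fun l => g (l ++ [:: m]))).
rewrite (sum_delete1 (fun l => g (rev s ++ l))); congr (_ * g _).
by rewrite /drop_ball; case: ifP => _; rewrite ?cats0// rev_cons cats1.
Qed.

Lemma delete_ball_comp n s j : compositions n.+1 s -> (j < n.+1)%N ->
  compositions n (delete_ball s j).
Proof.
move=> [s0 sn]; rewrite -sn => js.
suff [h1 h2] : all (leq 1) (delete_ball s j) /\ (sumn (delete_ball s j)).+1 = sumn s.
  by split=> //; apply: succn_inj; rewrite h2.
elim: s j s0 js {sn} => // m s IH j /= /andP[m0 s0] js.
have [jm|mj] := ltnP j m.
  case: eqVneq => [->//|m1]; rewrite /= s0; split; first by lia.
  by rewrite -addSn prednK.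
have [|h1 h2] := IH (j - m)%N s0; first by rewrite ltn_subLR.
by rewrite /= m0 h1 -addnS h2.
Qed.

(** Boxes being listed from right to left, these test for a box that has just been opened and, for
    [ends2], for the size m of the box completed before it: a visit of the chain and the jump that
    led to it. *)
Definition ends1 s : R := (head 0%N s == 1%N)%:R.
Definition ends2 m s : R := ((head 0%N s == 1%N) && (head 0%N (behead s) == m))%:R.

Lemma sum_delete_ends1 x l : (0 < x)%N ->
  \sum_(0 <= j < sumn (x :: l)) ends1 (delete_ball (x :: l) j) =
  (sumn l)%:R * ends1 (x :: l) + ends2 1 (x :: l) + 2 * (x == 2%N)%:R.
Proof.
move=> x0; rewrite sum_delete_cons.
have -> : \sum_(0 <= j < sumn l) ends1 (x :: delete_ball l j) = (sumn l)%:R * ends1 (x :: l).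
  by rewrite /ends1 /= sumr_const_nat subn0 mulr_natl.
rewrite addrC -addrA; congr (_ + _).
case: x x0 => // -[|[|x]] _; rewrite /ends1 /ends2 /drop_ball /=.
- by rewrite mul1r mulr0 addr0.
- by rewrite add0r.
- by rewrite !mulr0 addr0.
Qed.

(** The four terms: a ball left of the two last boxes; a ball of the previous box, of size m + 1; a
    ball of a last box of size 2; one of two singletons at the right end, next to a box of size
    m. *)
Lemma sum_delete_ends2 m x y l : (0 < m)%N -> (0 < x)%N -> (0 < y)%N ->
  \sum_(0 <= j < sumn (x :: y :: l)) ends2 m (delete_ball (x :: y :: l) j) =
  (sumn l)%:R * ends2 m (x :: y :: l) + m.+1%:R * ends2 m.+1 (x :: y :: l) +
  2 * ((x == 2%N) && (y == m))%:R + 2 * [&& x == 1%N, y == 1%N & head 0%N l == m]%:R.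
Proof.
move=> m0 x0 y0; rewrite sum_delete_cons (sum_delete_cons (fun l => ends2 m (x :: l))).
have -> : \sum_(0 <= j < sumn l) ends2 m [:: x, y & delete_ball l j] =
    (sumn l)%:R * ends2 m (x :: y :: l).
  by rewrite /ends2 /= sumr_const_nat subn0 mulr_natl.
case: m m0 => // m _.
case: x x0 => // -[|[|x]] _; rewrite /ends2 /drop_ball /=.
- case: y y0 => // -[|y] _ /=.
    by case: m => [|m]; rewrite ?eqxx /=; ring.
  rewrite !eqSS; have [->|_] := eqVneq y m; rewrite /= ?mulr0n ?mulr1n; by ring.
- by ring.
- by ring.
Qed.

End deletions.

Lemma binary_form_boxes b : binary_form (rev (boxes (rcons b true))) = rev (rcons b true).
Proof.
elim: b => // x b IH; have [m [rs [bE /= /andP[m0 _] _]]] := boxes_rcons b.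
move: IH; rewrite /= bE; case: x; rewrite /= !rev_cons => IH.
  by rewrite -IH /binary_form !map_rcons !flatten_rcons /= cats1.
rewrite -IH /binary_form !map_rcons !flatten_rcons rcons_cat; congr (_ ++ _).
by case: m m0 {bE IH} => // m _; congr (_ :: _); elim: m => //= m <-.
Qed.

(** * Sampling consistency determines the law of the chain *)

Section markov_law.
Context d (Om : measurableType d) (R : realType) (P : probability Om R).
Variables (Q : nat -> {RV P >-> nat}) (q : nat -> nat -> R) (C : nat -> seq nat -> R).
Hypotheses (Q0 : forall w, Q 0%N w = 1%N) (Q_lt : forall t w, (Q t w < Q t.+1 w)%N).
Hypothesis q_trans : increasing_transition q.
Hypothesis Q_markov : forall (t : nat) (x : nat -> nat),
  (P [set w | forall i, (i <= t.+1)%N -> Q i w = x i] =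
   P [set w | forall i, (i <= t)%N -> Q i w = x i] * (q (x t) (x t.+1))%:E)%E.
Hypothesis hC : composition_structure C.
Hypothesis C_law : forall n s, (0 < n)%N -> compositions n s ->
  (C n s)%:E = P [set w | xi_bits (fun t => Q t) w n = binary_form s].

Let xi j w : bool := `[< exists t, Q t w = j >].

Let xi1 w : xi 1 w. Proof. by apply/asboolP; exists 0%N. Qed.

Let mQ t j : measurable [set w | Q t w = j].
Proof.
have := @measurable_funPT _ _ _ _ (Q t) measurableT [set j] I.
by rewrite setTI.
Qed.

Let mxi j : measurable [set w | xi j w].
Proof.
have sm : sigma_algebra setT (@measurable _ Om) by exact: sigma_algebra_measurable.
rewrite (_ : [set w | _] = [set w | exists t, Q t w = j]).
  by apply: (sigma_exists sm) => t; exact: mQ.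
by apply/seteqP; split=> w /= /asboolP.
Qed.

Let Q_mono w t u : (t <= u)%N -> (Q t w <= Q u w)%N.
Proof.
move=> /subnK <-; elim: (u - t)%N => // k IH; rewrite addSn.
exact: leq_trans IH (ltnW (Q_lt _ _)).
Qed.

Let Q_ge w t : (t < Q t w)%N.
Proof. by elim: t => [|t IH]; [rewrite Q0|apply: leq_ltn_trans IH (Q_lt _ _)]. Qed.

Let xi_inf w : infinitely_many_ones xi w.
Proof. by move=> k; exists (Q k w); rewrite Q_ge; apply/asboolP; exists k. Qed.

Let renewalE t w : renewal xi t w = Q t w.
Proof.
elim: t => [|t IH]; first by rewrite Q0.
rewrite /renewal iterS -/(renewal xi t w) IH.
apply/(next_oneP _ _ (xi_inf w)); split; [exact: Q_lt|by apply/asboolP; exists t.+1|].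
move=> j /andP[h1 h2]; apply/negP => /asboolP[u uj].
have [ut|tu] := leqP u t.
  by have := Q_mono w ut; rewrite uj leqNgt h1.
by have := Q_mono w tu; rewrite uj leqNgt h2.
Qed.

Definition last_boxes n w := boxes (rev (xi_bits (fun t => Q t) w n)).

Let rk := last_boxes.

Let bits_rcons n w : exists b, size b = n /\ rev (xi_bits (fun t => Q t) w n.+1) = rcons b true.
Proof.
exists (rev (mkseq (fun j => xi j.+2 w) n)); rewrite size_rev size_mkseq; split=> //.
rewrite -rev_cons; congr rev; rewrite /xi_bits /mkseq /= -/(xi 1 w) xi1.
by rewrite -[1%N]addn0 iotaDl -map_comp.
Qed.

Let bitsS n w : rev (xi_bits (fun t => Q t) w n.+1) =
  xi n.+1 w :: rev (xi_bits (fun t => Q t) w n).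
Proof. by rewrite /xi_bits /mkseq -[in LHS]addn1 iotaD map_cat rev_cat. Qed.

(** The effect of one more ball at the right end, which couples all compositions of the chain on one
    space. *)
Let rkS n w : rk n.+1 w = if xi n.+1 w then 1%N :: rk n w else
  if rk n w is m :: rs then m.+1 :: rs else [::].
Proof. by rewrite /rk /last_boxes bitsS. Qed.

Let rk_cons n w : exists m rs, [/\ rk n.+1 w = m :: rs, all (leq 1) (m :: rs) & sumn (m :: rs) = n.+1].
Proof.
have [b [sb bE]] := bits_rcons n w.
by rewrite /rk /last_boxes bE -sb; exact: boxes_rcons.
Qed.

Let rk_comp n w : compositions n.+1 (rev (rk n.+1 w)).
Proof.
by have [m [rs [-> h1 h2]]] := rk_cons n w; split; rewrite ?all_rev ?sumn_rev.
Qed.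

Let rk_bits n w s : compositions n.+1 s ->
  rk n.+1 w = rev s <-> xi_bits (fun t => Q t) w n.+1 = binary_form s.
Proof.
move=> [s0 sn]; rewrite /rk /last_boxes; have [b [sb bE]] := bits_rcons n w.
split=> [|->]; last exact: boxes_binary_form.
rewrite bE => e; rewrite -(revK (xi_bits _ _ _)) bE -binary_form_boxes e revK//.
Qed.

Let mbits n b : measurable [set w | xi_bits (fun t => Q t) w n = b].
Proof.
have [sb|sb] := eqVneq (size b) n; last first.
  rewrite (_ : [set w | _] = set0)//; apply/seteqP; split=> // w /= h.
  by rewrite -h size_mkseq eqxx in sb.
have sm : sigma_algebra setT (@measurable _ Om) by exact: sigma_algebra_measurable.
rewrite (_ : [set w | _] = [set w | forall i : 'I_n, xi i.+1 w <-> nth false b i]).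
  apply: (sigma_forall sm) => i; apply: (sigma_iff sm); first exact: mxi.
  exact: (sigma_const sm).
apply/seteqP; split=> w /= h; first by move=> i; rewrite -h nth_mkseq.
apply: (@eq_from_nth _ false); first by rewrite size_mkseq sb.
move=> i; rewrite size_mkseq => ni; rewrite nth_mkseq//.
by apply/idP/idP => /(h (Ordinal ni)).
Qed.

Let bmf_rk n (g : seq nat -> R) : bounded_measurable (fun w => g (rk n w)).
Proof.
have -> : (fun w => g (rk n w)) = (fun w => \sum_(b : n.-tuple bool)
    g (boxes (rev b)) * \1_[set w | xi_bits (fun t => Q t) w n = b] w).
  apply/funext => w; have szb : size (xi_bits (fun t => Q t) w n) == n by rewrite size_mkseq.
  rewrite (bigD1 (Tuple szb))//= indicE mem_set// mulr1 big1 ?addr0// => b bw.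
  rewrite indicE memNset ?mulr0// => /= e; move/eqP: bw; apply.
  by apply: val_inj; rewrite /= e.
by apply: bmf_sum => b; apply: bmfZ; apply: bmf_indic; exact: mbits.
Qed.

Let finite_comps n : finite_set (compositions n).
Proof.
apply: (@sub_finite_set _ _ ((fun b : n.-tuple bool => rev (boxes (rev b))) @` setT)).
  move=> s [s0 sn]; have szb : size (binary_form s) == n by rewrite size_binary_form// sn.
  by exists (Tuple szb) => //=; rewrite boxes_binary_form// revK.
exact: finite_image.
Qed.

Let cs n : {fset seq nat} := fset_set (compositions n).

Let mem_cs n (s : seq nat) : s \in cs n <-> compositions n s.
Proof. by rewrite in_fset_set//; split=> [/set_mem|/mem_set]. Qed.

Let expectation n (g : seq nat -> R) :
  \int[P]_w g (rk n.+1 w) = \sum_(s <- cs n.+1) C n.+1 s * g (rev s).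
Proof.
have -> : (fun w => g (rk n.+1 w)) = (fun w => \sum_(s <- cs n.+1)
    (if pselect (compositions n.+1 s) is left _ then
      g (rev s) * \1_[set w | xi_bits (fun t => Q t) w n.+1 = binary_form s] w else 0)).
  apply/funext => w; have mc : rev (rk n.+1 w) \in cs n.+1 by apply/mem_cs.
  rewrite (bigD1_seq _ mc (fset_uniq _))/=; case: pselect => [c|/(_ (rk_comp n w))//].
  rewrite indicE mem_set/=; last by apply/rk_bits; rewrite ?revK.
  rewrite revK mulr1 big1 ?addr0// => s sw; case: pselect => // cs'.
  rewrite indicE memNset ?mulr0//= => /(rk_bits _ cs') e.
  by rewrite e revK eqxx in sw.
rewrite bmf_int_sum => [|s]; last first.
  by case: pselect => _; [apply: bmfZ; apply: bmf_indic; exact: mbits|exact: bmf_cst].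
rewrite big_seq [RHS]big_seq; apply: eq_bigr => s /mem_cs ns.
case: pselect => // _; rewrite bmf_intZ; last by apply: bmf_indic; exact: mbits.
rewrite bmf_int_indic; last exact: mbits.
rewrite mulrC; congr (_ * _); exact: (congr1 fine (esym (C_law (ltn0Sn n) ns))).
Qed.

(** Sampling consistency tested on functions of the reversed composition; deleting a uniform ball
    commutes with reversal. *)
Let consistency n (g : seq nat -> R) : (0 < n)%N ->
  n.+1%:R * \int[P]_w g (rk n w) =
  \int[P]_w (\sum_(0 <= j < n.+1) g (delete_ball (rk n.+1 w) j)).
Proof.
case: n => // n _.
rewrite (expectation n.+1 (fun l => \sum_(0 <= j < n.+2) g (delete_ball l j))) expectation.
rewrite big_seq (eq_bigr (fun mu => \sum_(s <- cs n.+2) C n.+2 s *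
    ((\sum_(j < n.+2) (delete_ball s j == mu)%:R / n.+2%:R) * g (rev mu)))); last first.
  move=> mu /mem_cs cmu; rewrite (hC.2 n.+1 mu)// fsbig_finite//= mulr_suml.
  by apply: eq_bigr => s _; rewrite mulrA.
rewrite -big_seq exchange_big/= mulr_sumr big_seq [RHS]big_seq; apply: eq_bigr => s /mem_cs cs_s.
rewrite -mulr_sumr mulrCA; congr (_ * _).
have sn : sumn s = n.+2 by case: cs_s.
rewrite -[in RHS]sn -sum_delete_rev sn big_mkord.
under eq_bigr do rewrite mulr_suml.
rewrite exchange_big/= mulr_sumr; apply: eq_bigr => j _.
have dj : delete_ball s j \in cs n.+1 by apply/mem_cs; exact: delete_ball_comp.
rewrite (bigD1_seq _ dj (fset_uniq _))/= eqxx big1 ?addr0.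
  by rewrite (_ : true%:R = 1)// div1r mulrA mulfV ?mul1r// pnatr_eq0.
by move=> mu /negbTE hmu; rewrite eq_sym hmu mul0r mul0r.
Qed.

Let h n := \int[P]_w ends1 R (rk n w).
Let G n m := \int[P]_w ends2 R m (rk n.+1 w).

(** Uniform deletion meets right consistency: by [rkS], a last box of size 2 among n + 1 balls is a
    last box of size 1 among n balls to which a ball has been added without opening a box. This
    closes the system of equations. *)
Let G1 n : (0 < n)%N -> G n 1 = n%:R * h n.+1 - (n%:R - 1) * h n.
Proof.
move=> n0; have := consistency (@ends1 R) n0.
have -> : (fun w => \sum_(0 <= j < n.+1) ends1 R (delete_ball (rk n.+1 w) j)) =
   (fun w => n%:R * ends1 R (rk n.+1 w) + 2 * ends1 R (rk n w) - ends2 R 1 (rk n.+1 w)).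
  apply/funext => w; case: n n0 => // n _.
  have [m [rs [rE /andP[m0 rs0] rs_n]]] := rk_cons n w.
  have := rkS n.+1 w; rewrite rE; case: (xi _ w) => rE'.
    rewrite rE' -rs_n -[X in \sum_(0 <= j < X) _]add1n -[(1 + _)%N]/(sumn (1%N :: m :: rs)).
    rewrite sum_delete_ends1// /ends1 /ends2 /=; case: (m == 1%N) => /=; ring.
  rewrite rE' -rs_n -[(sumn (m :: rs)).+1]/(sumn (m.+1 :: rs)) sum_delete_ends1//.
  by case: m m0 {rE rs_n rE'} => // m _; rewrite /ends1 /ends2 /= ?eqSS natrD; ring.
rewrite bmf_intB; [|by apply: bmfD; apply: bmfZ; exact: bmf_rk|exact: bmf_rk].
rewrite bmf_intD; [|by apply: bmfZ; exact: bmf_rk|by apply: bmfZ; exact: bmf_rk].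
rewrite !bmf_intZ; [|exact: bmf_rk|exact: bmf_rk].
rewrite -/(h n) -/(h n.+1) -/(G n 1) -natr1; lra.
Qed.

Let GS n m : (0 < m)%N -> (m <= n)%N ->
  n%:R * G n m = (n.+1%:R - m%:R) * G n.+1 m + m.+1%:R * G n.+1 m.+1.
Proof.
move=> m0 mn; have := consistency (@ends2 R m) (ltn0Sn n).
have -> : (fun w => \sum_(0 <= j < n.+2) ends2 R m (delete_ball (rk n.+2 w) j)) =
   (fun w => (n.+1%:R - m%:R) * ends2 R m (rk n.+2 w) + m.+1%:R * ends2 R m.+1 (rk n.+2 w) +
      2 * ends2 R m (rk n.+1 w)).
  apply/funext => w.
  have [x [l [rE /andP[x0 l0] sn]]] := rk_cons n w.
  have := rkS n.+1 w; rewrite rE; case: (xi _ w) => rE'.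
    rewrite rE' -sn -[X in \sum_(0 <= j < X) _]add1n -[(1 + _)%N]/(sumn (1%N :: x :: l)).
    rewrite sum_delete_ends2// /ends2 /= natrD.
    by have [->|_] := eqVneq x m; rewrite /= ?mulr1n ?mulr0n; ring.
  rewrite rE' -sn -[(sumn (x :: l)).+1]/(sumn (x.+1 :: l)).
  case: l l0 sn rE rE' => [|y l] l0 sn rE rE'.
    rewrite sum_delete_cons big_nil addr0 /ends2 /drop_ball/=.
    by case: x x0 {sn rE rE'} => // x _ /=; case: m m0 {mn} => // m _; rewrite ?andbF/=; ring.
  have /andP[y0 _] := l0; rewrite sum_delete_ends2// /ends2 /= !eqSS.
  by case: x x0 {sn rE rE'} => // x _; rewrite /= ?eqSS; ring.
rewrite bmf_intD; [|by apply: bmfD; apply: bmfZ; exact: bmf_rk|by apply: bmfZ; exact: bmf_rk].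
rewrite bmf_intD; [|by apply: bmfZ; exact: bmf_rk|by apply: bmfZ; exact: bmf_rk].
rewrite !bmf_intZ; [|exact: bmf_rk|exact: bmf_rk|exact: bmf_rk].
rewrite -/(G n m) -/(G n.+1 m) -/(G n.+1 m.+1) -[n.+2%:R]natr1 -[n.+1%:R]natr1; lra.
Qed.

Let a k := h k.+1.

(** Induction on m: [GS] computes the value at m + 1 from values at m, as do the differences of Phi
    multiplied by binomial coefficients. *)
Let G_jump n m : (0 < m)%N -> (m <= n)%N ->
  n%:R * G n m = 'C(n, m)%:R * jump_weight a (n - m) m.
Proof.
elim: m n => // -[|m] IH n _ mn.
  case: n mn => // n _; rewrite G1// bin1 subn1 /jump_weight /= /a opprB -natr1.
  by ring.
case: n mn => // n; rewrite ltnS => mn.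
have n0 : n.+1%:R != 0 :> R by rewrite pnatr_eq0.
have m0 : m.+2%:R != 0 :> R by rewrite pnatr_eq0.
have h1 := IH n isT mn.
have h2 := IH n.+1 isT (leqW mn).
have h3 := GS (ltn0Sn m) mn.
have b1 : 'C(n.+1, m.+2)%:R * m.+2%:R = n.+1%:R * 'C(n, m.+1)%:R :> R.
  by rewrite -!natrM mulnC -mul_bin_diag.
have b2 : 'C(n.+1, m.+1)%:R * (n.+1%:R - m.+1%:R) = n.+1%:R * 'C(n, m.+1)%:R :> R.
  rewrite -natrB ?(leqW mn)// -!natrM mulnC; congr (_%:R).
  by rewrite -(mul_bin_down n.+1 m.+1).
have JS : jump_weight a (n.+1 - m.+2) m.+2 =
    jump_weight a (n - m.+1) m.+1 - jump_weight a (n.+1 - m.+1) m.+1.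
  by rewrite subSS /jump_weight /= -(subSn mn) opprB opprK addrC.
apply: (mulfI m0); rewrite JS; apply: (mulIf n0); 
rewrite [RHS](_ : _ = ('C(n.+1, m.+2)%:R * m.+2%:R) * n.+1%:R * (jump_weight a (n - m.+1) m.+1 - jump_weight a (n.+1 - m.+1) m.+1)); last by ring.
rewrite b1 [LHS](_ : _ = n.+1%:R * n.+1%:R * (n%:R * G n m.+1 - (n.+1%:R - m.+1%:R) * G n.+1 m.+1)); last by rewrite h3; ring.
rewrite h1 mulrBr [X in _ - X](_ : _ = n.+1%:R * ((n.+1%:R - m.+1%:R) * (n.+1%:R * G n.+1 m.+1))); last by ring.
rewrite h2 (_ : (n.+1%:R - m.+1%:R) * ('C(n.+1, m.+1)%:R * jump_weight a (n.+1 - m.+1) m.+1) = n.+1%:R * 'C(n, m.+1)%:R * jump_weight a (n.+1 - m.+1) m.+1); last by rewrite -b2; ring.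
by ring.
Qed.

Let G_ge0 n m : 0 <= G n m.
Proof. by apply: Rintegral_ge0 => w _; rewrite /ends2. Qed.

Let h_ge0 n : 0 <= h n.
Proof. by apply: Rintegral_ge0 => w _; rewrite /ends1. Qed.

(** The alternation of signs required by Hausdorff's theorem: by [G_jump] the weight is a
    probability up to a positive factor. *)
Lemma jump_ge0 j m : (0 < m)%N -> 0 <= jump_weight a j m.
Proof.
move=> m0; have := @G_jump (j + m)%N m m0 (leq_addl _ _).
rewrite addnK => e.
have c0 : 0 < 'C(j + m, m)%:R :> R by rewrite ltr0n bin_gt0 leq_addl.
by rewrite -(pmulr_rge0 _ c0) -e mulr_ge0.
Qed.

Let mrk n l : measurable [set w | rk n w = l].
Proof.
have e : [set w | rk n w = l] = (fun w => ((rk n w == l)%:R : R)) @^-1` [set 1].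
  apply/seteqP; split=> w /=; first by move=> ->; rewrite eqxx.
  by case: eqP => // _ /esym/eqP; rewrite oner_eq0.
have [mf _] := bmf_rk n (fun l' => (l' == l)%:R).
by rewrite e -[X in measurable X]setTI; exact: mf.
Qed.

Let prefix_expectation n j pre : (sumn pre + j = n.+1)%N ->
  \int[P]_w ((prefix pre (rk n.+1 w))%:R : R) =
  \sum_(s <- cs j) fine (P [set w | rk n.+1 w = pre ++ rev s]).
Proof.
move=> pj.
have -> : (fun w => ((prefix pre (rk n.+1 w))%:R : R)) =
    (fun w => \sum_(s <- cs j) \1_[set w | rk n.+1 w = pre ++ rev s] w).
  apply/funext => w; have [m [l [rE l0 ln]]] := rk_cons n w.
  case: prefixP => [[l' lE]|np]; last first.
    rewrite big1// => s _; rewrite indicE memNset//= => e; apply: np.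
    by exists (rev s).
  have mc : rev l' \in cs j.
    apply/mem_cs; split.
      by move: l0; rewrite -rE lE all_cat all_rev => /andP[].
    by apply/(@addnI (sumn pre)); rewrite pj sumn_rev -sumn_cat -lE rE.
  rewrite (bigD1_seq _ mc (fset_uniq _))/= indicE mem_set/= ?revK// big1 ?addr0// => s sl.
  rewrite indicE memNset//= lE => /eqP; rewrite eqseq_cat// eqxx/= => /eqP e.
  by rewrite e revK eqxx in sl.
rewrite bmf_int_sum => [|s]; last exact: bmf_indic.
by apply: eq_bigr => s _; rewrite bmf_int_indic.
Qed.

Let path_event rs x w : all (leq 1) rs -> x 0%N = 1%N ->
  (forall i, (i < size rs)%N -> (x i < x i.+1)%N) -> gaps x (size rs) = rs ->
  rk (sumn rs).+1 w = 1%N :: rs <-> (forall i, (i <= size rs)%N -> Q i w = x i).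
Proof.
move=> rs0 x0 x_lt gx; have xt := sumn_gaps x0 x_lt; rewrite gx in xt.
have := renewal_pathP xi1 (xi_inf w) x0 x_lt; rewrite gx -xt => e.
have cr : compositions (sumn rs).+1 (rcons (rev rs) 1%N).
  by split; rewrite ?all_rcons ?all_rev// -cats1 sumn_cat sumn_rev /= addn0 addn1.
have := rk_bits w cr; rewrite rev_rcons revK => ->.
split=> [/e hi i /hi|hi]; first by rewrite renewalE.
by apply/e => i ih; rewrite renewalE; exact: hi.
Qed.

Let T_cons m rs : all (leq 1) (m :: rs) ->
  (P [set w | rk (sumn (m :: rs)).+1 w = [:: 1, m & rs]%N] =
   P [set w | rk (sumn rs).+1 w = 1%N :: rs] * (q (sumn rs).+1 (sumn rs + m).+1)%:E)%E.
Proof.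
move=> rs0; have [x [x0 x_lt gx xt]] := gaps_path rs0.
move: (gx) => /= -[xm gx']; have rs1 : all (leq 1) rs by case/andP: rs0.
have x_lt' i : (i < size rs)%N -> (x i < x i.+1)%N by move=> ir; apply: x_lt => /=; exact: leqW.
have xt' : x (size rs) = (sumn rs).+1 by rewrite -(sumn_gaps x0 x_lt') gx'.
have -> : [set w | rk (sumn (m :: rs)).+1 w = [:: 1, m & rs]%N] =
    [set w | forall i, (i <= (size rs).+1)%N -> Q i w = x i].
  by apply/seteqP; split=> w /= /(path_event w rs0 x0 x_lt gx).
have -> : [set w | rk (sumn rs).+1 w = 1%N :: rs] =
    [set w | forall i, (i <= size rs)%N -> Q i w = x i].
  by apply/seteqP; split=> w /= /(path_event w rs1 x0 x_lt' gx').
by rewrite Q_markov xt' (xt : x (size rs).+1 = _) /= addnC.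
Qed.

(** The Markov property summed over all pasts that lead to the state j + 1. *)
Let G_transition j m : (0 < m)%N -> G (j + m) m = a j * q j.+1 (j + m).+1.
Proof.
move=> m0; have e1 : a j = \sum_(s <- cs j) fine (P [set w | rk j.+1 w = 1%N :: rev s]).
  rewrite -(@prefix_expectation j j [:: 1%N])//; congr (Rintegral _ _ _).
  by apply/funext => w; rewrite /ends1; case: (rk _ w) => //= y l; rewrite eq_sym prefix0s andbT.
have -> : G (j + m) m =
    \sum_(s <- cs j) fine (P [set w | rk (j + m).+1 w = [:: 1, m & rev s]%N]).
  rewrite -(@prefix_expectation (j + m) j [:: 1; m]%N); last by rewrite /= addn0 add1n addSn addnC.
  congr (Rintegral _ _ _); apply/funext => w; rewrite /ends2.
  case: (rk _ w) => //= y [|z l] /=; first by case: m m0 => // m _; rewrite !andbF.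
  by rewrite prefix0s andbT ![_ == y]eq_sym [m == _]eq_sym.
rewrite e1 mulr_suml big_seq [RHS]big_seq; apply: eq_bigr => s /mem_cs[s0 sj].
have := @T_cons m (rev s); rewrite /= m0 all_rev sumn_rev sj addnC => -> //.
by rewrite fineM//; apply: fin_num_measure; exact: mrk.
Qed.

Let a0 : a 0 = 1.
Proof.
rewrite /a /h (_ : (fun w => _) = (fun=> 1)) ?Rintegral_cst//=.
  by rewrite mul1r probability_setT.
apply/funext => w; rewrite /ends1; have [m [rs [-> /= /andP[m0 _]]]] := rk_cons 0 w.
by case: m m0 => // -[|m] _ //=; rewrite addSn.
Qed.

Let G_diag m : (0 < m)%N -> q 1 m.+1 = jump_weight a 0 m / m%:R.
Proof.
move=> m0; have := G_jump m0 (leqnn m); rewrite subnn binn mul1r => <-.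
have := @G_transition 0 m m0; rewrite a0 add0n mul1r => <-.
by rewrite mulrC mulKf// pnatr_eq0 -lt0n.
Qed.

(** The first row of the transition matrix has sum 1: the first increment of the chain is finite. *)
Lemma jump_series : \sum_(m < n) (jump_weight a 0 m.+1 / m.+1%:R) @[n --> \oo] --> (1 : R).
Proof.
have [q_ge0 q_le q_sum] := q_trans (ltn0Sn 0).
have cq : (\sum_(0 <= j < n) (q 1 j)%:E)%E @[n --> \oo] --> 1%E.
  by rewrite -q_sum; apply: is_cvg_nneseries => n _ _; rewrite lee_fin.
have {}cq : \sum_(0 <= j < n) q 1 j @[n --> \oo] --> (1 : R).
  apply: (@cvg_trans _ (fine \o (fun n => \sum_(0 <= j < n) (q 1 j)%:E)%E @ \oo)).
    by apply: near_eq_cvg; near=> n; rewrite /= sumEFin.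
  exact: fine_cvg.
(* The terms [q 1 0] and [q 1 1] vanish. *)
rewrite -(cvg_shiftn 2) in cq; move: cq; apply: cvg_trans; apply: near_eq_cvg; near=> n.
rewrite /= addn2 big_nat_recl// big_nat_recl// !q_le// !add0r big_mkord; apply: eq_bigr => i _.
by rewrite G_diag.
Unshelve. all: by end_near. Qed.

(** If some moment vanishes, [G1] brings this down to a_1 = 0. The increments of Phi are nonnegative
    and at most Phi(1) = 0, so Phi = 0, and the first row would have sum 0. *)
Lemma moment_gt0 k : 0 < a k.
Proof.
rewrite lt0r h_ge0 andbT; apply/negP => /eqP ak.
have a1 : a 1 = 0.
  case: k ak => [|k]; first by rewrite a0 => /eqP; rewrite oner_eq0.
  elim: k => // k IH akS; apply: IH; have := G1 (ltn0Sn k.+1).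
  rewrite -/(a k.+2) -/(a k.+1) akS mulr0 add0r => e; have := G_ge0 k.+2 1; rewrite e.
  have k0 : 0 < k.+1%:R :> R by [].
  rewrite -[k.+2%:R]natr1 addrK oppr_ge0 pmulr_rle0// => ale.
  by apply/eqP; rewrite eq_le ale h_ge0.
have jdec j : jump_weight a j 1 <= jump_weight a 0 1.
  elim: j => // j; apply: le_trans; have := @jump_ge0 j 2 isT.
  by rewrite /jump_weight/=; lra.
have j0 : jump_weight a 0 1 = 0 by rewrite /jump_weight/= a1 mulr0 mul0r subrr oppr0.
have an j : j%:R * a j = 0.
  elim: j => [|j IH]; first by rewrite mul0r.
  have h1 := jdec j; have h2 := @jump_ge0 j 1 isT; rewrite j0 in h1.
  by move: h1 h2; rewrite /jump_weight/= IH; lra.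
have jz m : jump_weight a 0 m = 0.
  rewrite /jump_weight (@eq_diff _ _ (fun k => 0 * 1)) => [|i]; last by rewrite an mul0r.
  by rewrite diffZ mul0r oppr0.
have c0 : \sum_(m < n) (jump_weight a 0 m.+1 / m.+1%:R) @[n --> \oo] --> (0 : R).
  rewrite (_ : (fun n => _) = fun=> 0); first exact: cvg_cst.
  by apply/funext => n; rewrite big1// => i _; rewrite jz mul0r.
by have /eqP := seq_cvg_unique jump_series c0; rewrite oner_eq0.
Qed.

Let T_regen rs : all (leq 1) rs ->
  P [set w | rk (sumn rs).+1 w = 1%N :: rs] = (a (sumn rs) * regen_law a rs)%:E.
Proof.
elim: rs => [_|m rs IH rs0].
  rewrite /= a0 mulr1 (_ : [set w | _] = setT) ?probability_setT//.
  apply/seteqP; split=> // w _ /=; have [m [rs [-> /= /andP[m0 rs0] h1]]] := rk_cons 0 w.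
  case: rs rs0 h1 => [|x rs] /=; first by rewrite addn0 => _ ->.
  by case/andP => x0 _ h1; exfalso; lia.
rewrite T_cons// IH; last by case/andP: rs0.
have m0 : (0 < m)%N by case/andP: rs0.
have := G_jump m0 (leq_addl (sumn rs) m); rewrite addnK G_transition// => e.
rewrite -EFinM; congr EFin; rewrite /= [(m + _)%N]addnC.
have aj : a (sumn rs + m) != 0 by rewrite gt_eqF// moment_gt0.
have jm : (sumn rs + m)%:R != 0 :> R by rewrite pnatr_eq0; lia.
rewrite -e; field; by rewrite aj addrC -natrD addnC.
Qed.

(** Induction on m: a last box of size m + 1 is one of size m, minus the event that the next ball
    opens a box; [delayed_law] obeys the same rule. *)
Let rk_law n m l : all (leq 1) (m :: l) -> sumn (m :: l) = n.+1 ->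
  P [set w | rk n.+1 w = m :: l] = (delayed_law a (m :: l))%:E.
Proof.
case: m => // m; elim: m n => [|m IH] n l0.
  by rewrite -[sumn _]/(1 + sumn l)%N add1n => -[<-]; rewrite T_regen// delayed_law1.
rewrite -[sumn _]/(m.+2 + sumn l)%N addSn => -[sn]; case: n sn => // n sn.
have T1 : P [set w | rk n.+2 w = [:: 1, m.+1 & l]%N] = (delayed_law a [:: 1, m.+1 & l]%N)%:E.
  by rewrite delayed_law1 -(@T_regen (m.+1 :: l))// [sumn _]sn.
have -> : [set w | rk n.+2 w = m.+2 :: l] =
    [set w | rk n.+1 w = m.+1 :: l] `\` [set w | rk n.+2 w = [:: 1, m.+1 & l]%N].
  apply/seteqP; split=> w /=; rewrite (rkS n.+1); case: (xi _ w).
  - by [].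
  - by case: (rk n.+1 w) => // y l' [-> ->].
  - by move=> [-> /(_ erefl)].
  - by move=> [-> _].
rewrite measureD; [|exact: mrk|exact: mrk|by apply: le_lt_trans (probability_le1 _ _) (ltry _); exact: mrk].
rewrite (setIidr (A := [set w | rk n.+1 w = m.+1 :: l])); last first.
  move=> w /=; rewrite (rkS n.+1); case: (xi _ w); first by case=> ->.
  by have [y [rs [-> /= /andP[y0 _] _]]] := rk_cons n w; case: y y0.
transitivity ((delayed_law a (m.+1 :: l))%:E - (delayed_law a [:: 1, m.+1 & l]%N)%:E)%E.
  by congr (_ - _)%E; [exact: IH|exact: T1].
rewrite -EFinB -(@delayed_law_step _ a m.+1 l)//; last exact: moment_gt0.
by congr EFin; ring.
Qed.

Lemma law_of_chain n s : (0 < n)%N -> compositions n s -> C n s = delayed_law a (rev s).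
Proof.
case: n => // n _ cs'; apply: EFin_inj; rewrite C_law//.
rewrite (_ : [set w | _] = [set w | rk n.+1 w = rev s]); last first.
  by apply/seteqP; split=> w /= /(rk_bits w cs').
have [s0 sn] := cs'; have : all (leq 1) (rev s) by rewrite all_rev.
have : sumn (rev s) = n.+1 by rewrite sumn_rev.
by case: (rev s) => // m l e l0; rewrite rk_law.
Qed.

Lemma chain_law_moments : exists a : nat -> R,
  [/\ a 0%N = 1, (forall k, 0 < a k),
      (forall j m, (0 < m)%N -> 0 <= jump_weight a j m),
      \sum_(m < n) (jump_weight a 0 m.+1 / m.+1%:R) @[n --> \oo] --> (1 : R) &
      forall n s, (0 < n)%N -> compositions n s -> C n s = delayed_law a (rev s)].
Proof.
exists a; split; [exact: a0|exact: moment_gt0|exact: jump_ge0|exact: jump_series|].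
exact: law_of_chain.
Qed.

End markov_law.

Lemma self_similar_markov_moments (R : realType) (C : nat -> seq nat -> R) :
  composition_structure C -> self_similar_markov C -> exists a : nat -> R,
  [/\ a 0%N = 1, (forall k, 0 < a k),
      (forall j m, (0 < m)%N -> 0 <= jump_weight a j m),
      \sum_(m < n) (jump_weight a 0 m.+1 / m.+1%:R) @[n --> \oo] --> (1 : R) &
      forall n s, (0 < n)%N -> compositions n s -> C n s = delayed_law a (rev s)].
Proof.
move=> hC [d [Om [P [Q [[Q0 Q_lt [q q_trans Q_markov]] C_law]]]]].
exact: chain_law_moments Q0 Q_lt q_trans Q_markov hC C_law.
Qed.

(** * From the chain to the set *)

Section forward.
Variables (R : realType) (C : nat -> seq nat -> R).
Local Notation U := (uniform_prob (@ltr01 R) : probability (measurableTypeR R) R).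

Lemma unit_moment_problem (f : nat -> R) : f 0%N = 1 -> (forall m j, 0 <= diff m f j) ->
  exists z : measurableTypeR R -> R, [/\ measurable_fun setT z,
    (forall w, 0 <= z w <= 1) & forall k, \int[U]_w z w ^+ k = f k].
Proof.
move=> f0 fd; have [||M [mM [M01 Mk]]] := @moment_problem R unit (fun s => f (size s)) => //.
  split=> [s s' /perm_size ->//|B A _]; by rewrite (iter_diff_size f).
exists (M tt); split=> // k; have := Mk (nseq k tt); rewrite size_nseq => <-.
congr Rintegral; apply/funext => w.
by elim: k => [|k IH]; rewrite ?big_nil// /= big_cons -IH exprS.
Qed.

Lemma diff_jump_weight (a : nat -> R) m j :
  diff m (fun n => jump_weight a n 1) j = jump_weight a j m.+1.
Proof.
rewrite /jump_weight diff_succ -[RHS]mulN1r -diffZ.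
by apply: eq_diff => n; rewrite mulN1r.
Qed.

Lemma markov_stationary_regenerative :
  composition_structure C -> self_similar_markov C ->
  exists (d : measure_display) (Om : measurableType d) (P : probability Om R)
         (Z W : Om -> set R),
    associated_set P C Z /\
    regenerative_stationary_delay P W /\
    (forall w : Om, Z w = exp_neg (W w)).
Proof.
move=> hC hM; have [a [a0 a_gt0 jump_ge0 series CE]] := self_similar_markov_moments hC hM.
(* The increments Phi(n + 1) - Phi(n). Divided by the first one, which is a_1, they are the moments
   of a variable z by Hausdorff's theorem. *)
pose psi n := jump_weight a n 1; pose psi0 := psi 0%N.
have psiE n : psi n = n.+1%:R * a n.+1 - n%:R * a n by rewrite /psi /jump_weight /= opprB.
have psi0_gt0 : 0 < psi0 by rewrite /psi0 psiE mul1r mul0r subr0.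
have psi0_neq0 : psi0 != 0 by rewrite gt_eqF.
have [||z [mz z01 zk]] := @unit_moment_problem (fun k => psi0^-1 * psi k).
- by rewrite mulVf.
- move=> m j; rewrite diffZ diff_jump_weight mulr_ge0 ?invr_ge0 ?(ltW psi0_gt0)//.
  exact: jump_ge0.
have bz : bounded_measurable z by exact: bmf01.
(* This turns the row sum of the chain into the logarithmic moments of z, hence into d + m = 1. *)
have zm m : psi0 * \int[U]_w (1 - z w) ^+ m = jump_weight a 0 m.+1.
  have := moment_diff U 0 m bz.
  rewrite (_ : (fun w => _) = (fun w => (1 - z w) ^+ m)) => [->|]; last first.
    by apply/funext => w; rewrite expr0 mul1r.
  rewrite (eq_diff _ _ zk) diffZ diff_jump_weight mulrA mulfV ?mul1r//.
have [|dr [nu [dr_ge0 nu_levy mean_fin c1 [phi_nat phi_alt cvg_phi phi0]]]] :=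
    @levy_of_moments _ _ R U z psi0 mz z01 psi0_gt0.
  by under eq_fun do under eq_bigr do rewrite zm.
have c_gt0 : 0 < dr + fine (levy_mean nu) by rewrite c1.
have phiE k : laplace_exponent dr nu k%:R = k%:R * a k.
  rewrite phi_nat; elim: k => [|k IH]; first by rewrite big_ord0 mul0r.
  by rewrite big_ord_recr IH /= zk mulrA mulfV// mul1r psiE; ring.
have [PX PXE] := delay_probability dr_ge0 nu_levy mean_fin c_gt0.
have pos := process_law_positive phi0 phi_alt (source_moment0 PX) (@source_moment_positive R PX).
have [M [mM [M01 MP]]] := moment_problem pos (process_law_nil phi0 (source_moment0 PX)).
have [X [Z [W [WP ZE [cZ Z01 Z0 Z_iso] [X_ge0 Xk] [V [V_unif V_indep V_law]]]]]] :=
  stationary_regenerative mean_fin phi0 phi_alt cvg_phi PXE mM M01 MP.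
(* With d + m = 1, both sequences are Phi(k) / k for k > 0, and 1 at k = 0. *)
have aE : (fun k => \int[U]_w expR (- X w) ^+ k) = a.
  apply/funext => -[|k].
    under eq_Rintegral do rewrite expr0.
    rewrite -[LHS]/(\int[U]_w cst 1 w) Rintegral_cst// mul1r a0.
    exact: (congr1 fine (probability_setT U)).
  have := Xk k.+1; rewrite phiE c1 mul1r => /mulfI e; apply/esym/e.
  by rewrite pnatr_eq0.
exists _, (measurableTypeR R), U, Z, W; split; last by split.
split=> //; exists V; split=> // n s n0 ns.
by rewrite V_law// aE CE.
Qed.

End forward.

Theorem theorem10 (R : realType) (C : nat -> seq nat -> R)
    (hC : composition_structure C) :
  self_similar_markov C <->
  exists (d : measure_display) (Om : measurableType d) (P : probability Om R)
         (Z W : Om -> set R),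
    associated_set P C Z /\
    regenerative_stationary_delay P W /\
    (forall w : Om, Z w = exp_neg (W w)).
Proof.
split; first exact: markov_stationary_regenerative.
by move=> [d [Om [P [Z [W [CZ [WP ZE]]]]]]]; exact: regenerative_self_similar_markov hC CZ WP ZE.
Qed.
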